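(* Let $d_\gamma(m_R,b_R)=c\big(b_R\log\frac{b_R}{m_R}+(1-b_R)\log\frac{1-b_R}{1-m_R}\big)$ for a fixed constant $c>0$ (the gamma scan statistic). There is an algorithm that, given the input below and $\epsilon>0$, computes an additive $\epsilon$-approximation to the maximum of $d_\gamma(m_R,b_R)$ over all admissible axis-parallel rectangles $R$ in time $O(\frac{1}{\epsilon}n^2\log^2 n)$. For the prospective version (maximum over admissible space-time regions $R\times[t^*,\infty)$), such an approximation can be computed in time $O(\frac{1}{\epsilon}n^3\log^2 n)$.
   Context: Input: a set $P$ of $n$ points in the plane, with measurement $m:P\to\mathbb{R}$ and baseline $b:P\to\mathbb{R}$ satisfying $m(p),b(p)=\Theta(1)$ for all $p$. Let $M=\sum_{p\in P}m(p)$, $B=\sum_{p\in P}b(p)$, and for a region $R$, $m_R=\sum_{p\in P\cap R}m(p)/M$ and $b_R=\sum_{p\in P\cap R}b(p)/B$. For a fixed constant $C>0$, a region $R$ is admissible (contains at least a constant measure) if $(m_R,b_R)\in[C/n,1-C/n]^2$. OPT is the maximum of the discrepancy $d(m_R,b_R)$ over admissible axis-parallel rectangles. In the prospective version each point $p$ additionally has a timestamp $t(p)$, regions are $R\times[t^*,\infty)$ with $R$ an axis-parallel rectangle and $t^*\in\mathbb{R}$, sums range over points in $R$ with $t(p)\ge t^*$, and OPT is maximized over admissible such regions. An additive $\epsilon$-approximation is a value $V$ with $V\le\mathrm{OPT}\le V+\epsilon$. *)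

(* Defs.v *)
From Stdlib Require Import Reals List Arith ClassicalEpsilon.
Open Scope R_scope.

(* Cost model: a real-RAM with unit-cost arithmetic and natural log.   *)
(* Memory is an infinite array of reals, directly addressed by         *)
(* instruction operands and indirectly addressed through cells that    *)
(* hold natural numbers.  Every executed instruction costs one step.   *)

Inductive instr : Type :=
| IConst (d k : nat)
| IAdd (d a b : nat)
| ISub (d a b : nat)
| IMul (d a b : nat)
| IDiv (d a b : nat)
| ILn  (d a : nat)
| ILoad (d a : nat)
| IStore (a s : nat)
| IJlt (a b l : nat)
| IJmp (l : nat)
| IHalt.

Definition program := list instr.

Record state := mkState { pc : nat; mem : nat -> R }.

Definition upd (m : nat -> R) (a : nat) (v : R) : nat -> R :=
  fun j => if Nat.eqb j a then v else m j.

(* Deterministic one-step transition relation (stuck on faults). *)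
Inductive step (P : program) : state -> state -> Prop :=
| StConst pc m d k : nth_error P pc = Some (IConst d k) ->
    step P (mkState pc m) (mkState (S pc) (upd m d (INR k)))
| StAdd pc m d a b : nth_error P pc = Some (IAdd d a b) ->
    step P (mkState pc m) (mkState (S pc) (upd m d (m a + m b)))
| StSub pc m d a b : nth_error P pc = Some (ISub d a b) ->
    step P (mkState pc m) (mkState (S pc) (upd m d (m a - m b)))
| StMul pc m d a b : nth_error P pc = Some (IMul d a b) ->
    step P (mkState pc m) (mkState (S pc) (upd m d (m a * m b)))
| StDiv pc m d a b : nth_error P pc = Some (IDiv d a b) -> m b <> 0 ->
    step P (mkState pc m) (mkState (S pc) (upd m d (m a / m b)))
| StLn pc m d a : nth_error P pc = Some (ILn d a) -> 0 < m a ->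
    step P (mkState pc m) (mkState (S pc) (upd m d (ln (m a))))
| StLoad pc m d a j : nth_error P pc = Some (ILoad d a) -> m a = INR j ->
    step P (mkState pc m) (mkState (S pc) (upd m d (m j)))
| StStore pc m a s j : nth_error P pc = Some (IStore a s) -> m a = INR j ->
    step P (mkState pc m) (mkState (S pc) (upd m j (m s)))
| StJltT pc m a b l : nth_error P pc = Some (IJlt a b l) -> m a < m b ->
    step P (mkState pc m) (mkState l m)
| StJltF pc m a b l : nth_error P pc = Some (IJlt a b l) -> ~ m a < m b ->
    step P (mkState pc m) (mkState (S pc) m)
| StJmp pc m l : nth_error P pc = Some (IJmp l) ->
    step P (mkState pc m) (mkState l m).

Inductive exec (P : program) : state -> nat -> R -> Prop :=
| ExHalt pc m : nth_error P pc = Some IHalt -> exec P (mkState pc m) 1 (m 0%nat)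
| ExStep s s' k out : step P s s' -> exec P s' k out -> exec P s (S k) out.

Fixpoint sumR (n : nat) (f : nat -> R) : R :=
  match n with O => 0 | S k => sumR k f + f k end.

Record rect := mkRect { rx1 : R; rx2 : R; ry1 : R; ry2 : R }.

Definition in_rect (Q : rect) (x y : R) : Prop :=
  rx1 Q <= x <= rx2 Q /\ ry1 Q <= y <= ry2 Q.

Definition d_gamma (c mR bR : R) : R :=
  c * (bR * ln (bR / mR) + (1 - bR) * ln ((1 - bR) / (1 - mR))).

Definition frac (n : nat) (w : nat -> R) (inR : nat -> Prop) : R :=
  sumR n (fun i => if excluded_middle_informative (inR i) then w i else 0)
  / sumR n w.

Definition admissible (n : nat) (C mR bR : R) : Prop :=
  C / INR n <= mR <= 1 - C / INR n /\ C / INR n <= bR <= 1 - C / INR n.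

Definition in_static (x y : nat -> R) (Q : rect) : nat -> Prop :=
  fun i => in_rect Q (x i) (y i).

Definition adm_rect (n : nat) (C : R) (x y m b : nat -> R) (Q : rect) : Prop :=
  admissible n C (frac n m (in_static x y Q)) (frac n b (in_static x y Q)).

Definition val_rect (n : nat) (c : R) (x y m b : nat -> R) (Q : rect) : R :=
  d_gamma c (frac n m (in_static x y Q)) (frac n b (in_static x y Q)).

Definition is_opt_rect (n : nat) (c C : R) (x y m b : nat -> R) (OPT : R) : Prop :=
  (exists Q, adm_rect n C x y m b Q /\ val_rect n c x y m b Q = OPT) /\
  (forall Q, adm_rect n C x y m b Q -> val_rect n c x y m b Q <= OPT).

Definition in_prosp (x y t : nat -> R) (Q : rect) (ts : R) : nat -> Prop :=
  fun i => in_rect Q (x i) (y i) /\ ts <= t i.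

Definition adm_prosp (n : nat) (C : R) (x y t m b : nat -> R) (Q : rect) (ts : R)
  : Prop :=
  admissible n C (frac n m (in_prosp x y t Q ts)) (frac n b (in_prosp x y t Q ts)).

Definition val_prosp (n : nat) (c : R) (x y t m b : nat -> R) (Q : rect) (ts : R)
  : R :=
  d_gamma c (frac n m (in_prosp x y t Q ts)) (frac n b (in_prosp x y t Q ts)).

Definition is_opt_prosp (n : nat) (c C : R) (x y t m b : nat -> R) (OPT : R)
  : Prop :=
  (exists Q ts, adm_prosp n C x y t m b Q ts /\ val_prosp n c x y t m b Q ts = OPT) /\
  (forall Q ts, adm_prosp n C x y t m b Q ts -> val_prosp n c x y t m b Q ts <= OPT).

(* cell 0 = n, 1 = eps, 2 = c, 3 = C; point i occupies cells            *)
(* 4+5i .. 4+5i+4 holding x, y, m, b, t (t = 0 in the static version).  *)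
Definition input_mem (n : nat) (eps c C : R) (x y m b t : nat -> R) : nat -> R :=
  fun j =>
    match j with
    | 0%nat => INR n
    | 1%nat => eps
    | 2%nat => c
    | 3%nat => C
    | S (S (S (S k))) =>
        if Nat.ltb k (5 * n) then
          match Nat.modulo k 5 with
          | 0%nat => x (Nat.div k 5)
          | 1%nat => y (Nat.div k 5)
          | 2%nat => m (Nat.div k 5)
          | 3%nat => b (Nat.div k 5)
          | _ => t (Nat.div k 5)
          end
        else 0
    end.

Definition init_state (n : nat) (eps c C : R) (x y m b t : nat -> R) : state :=
  mkState 0 (input_mem n eps c C x y m b t).

Definition valid_input (n : nat) (lo hi : R) (x y m b : nat -> R) : Prop :=
  (forall i j, (i < n)%nat -> (j < n)%nat -> i <> j -> (x i, y i) <> (x j, y j)) /\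
  (forall i, (i < n)%nat -> lo <= m i <= hi /\ lo <= b i <= hi).

(* Main.v *)
(* By convexity, the gamma statistic is the supremum over slopes [r], [g] of the planes
   [c (b (1 + ln r) - r m + (1 - b) (1 + ln g) - g (1 - m))], attained at [r = b / m] and
   [g = (1 - b) / (1 - m)].  The bounds on the weights keep both slopes in a fixed
   interval, where a slope error [h] costs [O(h^2)], so a grid of [O(1 / eps)] slope pairs
   suffices.

   For a fixed plane the objective is additive over the points.  For every lower side [a]
   (a y-class) and time threshold, the points above [a] are inserted by increasing y into
   a segment tree over the x-ranks whose root yields the best x-interval.  Having at
   least [k0] points inside and outside, for a constant [k0], guarantees admissibility:
   the nodes carry max-plus matrices of an automaton counting the chosen points up to
   [k0], and a strip is used only if it misses [k0] points.  Planes lie below the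
   statistic, so the values found never exceed the optimum.

   Two families escape the tree and are evaluated exactly.  Regions with fewer than [k0]
   points have value at most [D / n], hence matter only if [eps n < D], which pays for
   enumerating them naively; strips missing fewer than [k0] points number [O(1)] per
   time threshold.  The static problem is the prospective one with a single threshold.

   The algorithm is written in a small imperative language of total programs whose
   running time is read off the loop nesting, and compiled to the RAM. *)
Require Import Defs.
From Stdlib Require Import Reals List Arith Lia Lra ClassicalEpsilon FunctionalExtensionality Bool ZArith FinFun.
Open Scope R_scope.

(** The machine has no rounding and no infinity, and both absences shape the program. Rounding up is
    done by counting, affordable because the rounded number is [O(1 / eps)]; minus infinity becomes
    [- 3 G c], low enough that a forbidden choice in the tree yields a nonpositive value.
    Nonpositive values are harmless because the search starts from 0, a lower bound for the optimum
    of a nonnegative statistic.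

    A plane may be large on an inadmissible region, and reporting that value could overshoot the
    optimum. This is why the tree has to count points and cannot merely maximise a sum.

    Three constants depend on [c], [C], [lo], [hi] alone: [k0 >= C hi / lo] makes [k0] points carry
    a share of at least [C / n]; [G >= (hi / lo)^2] bounds the quotient of the two shares of a set;
    [D >= 2 c G k0 hi / lo] bounds [n] times the statistic of an admissible region with fewer than
    [k0] points.

    Coordinates are used only through their ranks, so ties matter: a strip handled by the tree may
    start or end only between two classes of equal ordinates. *)

Inductive nexp : Type :=
| NC (k : nat)
| NG (a : nat) (i : nexp)
| NAdd (e1 e2 : nexp)
| NMul (e1 e2 : nexp)
| NSub (e1 e2 : nexp).

Inductive rexp : Type :=
| RG (a : nat) (i : nexp)
| RN (e : nexp)
| RAdd (e1 e2 : rexp)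
| RSub (e1 e2 : rexp)
| RMul (e1 e2 : rexp)
| RDiv (e1 e2 : rexp)
| RLn (e : rexp).

Inductive cond : Type :=
| CN (e1 e2 : nexp)
| CR (e1 e2 : rexp).

(** [Ceil] is a primitive because the machine can only round by counting; its cost is therefore the
    number produced. The number of iterations of [For] is read on entry from entry 0 of array
    [w]. *)
Inductive cmd : Type :=
| Skip
| SetN (a : nat) (i e : nexp)
| SetR (a : nat) (i : nexp) (e : rexp)
| Seq (c1 c2 : cmd)
| If (b : cond) (c1 c2 : cmd)
| For (v w : nat) (c : cmd)
| Ceil (v a : nat).

Record st := mkSt { na : nat -> nat -> nat; ra : nat -> nat -> R }.

Definition upd2 {A : Type} (f : nat -> nat -> A) (a i : nat) (v : A) : nat -> nat -> A :=
  fun a' i' => if Nat.eqb a' a && Nat.eqb i' i then v else f a' i'.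

Definition setn (a i v : nat) (s : st) : st := mkSt (upd2 (na s) a i v) (ra s).
Definition setr (a i : nat) (v : R) (s : st) : st := mkSt (na s) (upd2 (ra s) a i v).

Fixpoint evN (e : nexp) (s : st) : nat :=
  match e with
  | NC k => k
  | NG a i => na s a (evN i s)
  | NAdd e1 e2 => evN e1 s + evN e2 s
  | NMul e1 e2 => evN e1 s * evN e2 s
  | NSub e1 e2 => evN e1 s - evN e2 s
  end.

Fixpoint evR (e : rexp) (s : st) : R :=
  match e with
  | RG a i => ra s a (evN i s)
  | RN e => INR (evN e s)
  | RAdd e1 e2 => evR e1 s + evR e2 s
  | RSub e1 e2 => evR e1 s - evR e2 s
  | RMul e1 e2 => evR e1 s * evR e2 s
  | RDiv e1 e2 => evR e1 s / evR e2 s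
  | RLn e => ln (evR e s)
  end.

Definition Rltb (x y : R) : bool := if Rlt_dec x y then true else false.

Definition evC (b : cond) (s : st) : bool :=
  match b with
  | CN e1 e2 => Nat.ltb (evN e1 s) (evN e2 s)
  | CR e1 e2 => Rltb (evR e1 s) (evR e2 s)
  end.

Fixpoint niter {A : Type} (n : nat) (f : A -> A) (x : A) : A :=
  match n with O => x | S k => niter k f (f x) end.

Fixpoint niter_cost {A : Type} (n : nat) (f : A -> A) (g : A -> nat) (x : A) : nat :=
  match n with O => 0 | S k => g x + niter_cost k f g (f x) end.

Definition incr (v : nat) (s : st) : st := setn v 0 (S (na s v 0%nat)) s.

Fixpoint run (c : cmd) (s : st) : st :=
  match c with
  | Skip => s
  | SetN a i e => setn a (evN i s) (evN e s) s
  | SetR a i e => setr a (evN i s) (evR e s) s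
  | Seq c1 c2 => run c2 (run c1 s)
  | If b c1 c2 => if evC b s then run c1 s else run c2 s
  | For v w c => niter (na s w 0%nat) (fun s => incr v (run c s)) (setn v 0 0 s)
  | Ceil v a => setn v 0 (Z.to_nat (up (ra s a 0%nat))) s
  end.

Fixpoint cost (c : cmd) (s : st) : nat :=
  match c with
  | Skip => 0
  | SetN _ _ _ | SetR _ _ _ => 1
  | Seq c1 c2 => cost c1 s + cost c2 (run c1 s)
  | If b c1 c2 => S (if evC b s then cost c1 s else cost c2 s)
  | For v w c => 1 + niter_cost (na s w 0%nat) (fun s => incr v (run c s))
                       (fun s => S (cost c s)) (setn v 0 0 s)
  | Ceil v a => 1 + Z.to_nat (up (ra s a 0%nat))
  end.

(** * Written arrays and loop limits *)

Fixpoint nmods (c : cmd) : list nat :=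
  match c with
  | SetN a _ _ => a :: nil
  | Seq c1 c2 | If _ c1 c2 => nmods c1 ++ nmods c2
  | For v _ c => v :: nmods c
  | Ceil v _ => v :: nil
  | _ => nil
  end.

Fixpoint rmods (c : cmd) : list nat :=
  match c with
  | SetR a _ _ => a :: nil
  | Seq c1 c2 | If _ c1 c2 => rmods c1 ++ rmods c2
  | For _ _ c => rmods c
  | _ => nil
  end.

Fixpoint limits (c : cmd) : list nat :=
  match c with
  | Seq c1 c2 | If _ c1 c2 => limits c1 ++ limits c2
  | For _ w c => w :: limits c
  | _ => nil
  end.

Definition memb (l : list nat) (a : nat) : bool := existsb (Nat.eqb a) l.

Lemma memb_app l1 l2 a : memb (l1 ++ l2) a = memb l1 a || memb l2 a.
Proof. apply existsb_app. Qed.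

Lemma upd2_other_arr {A} (f : nat -> nat -> A) a i v a' :
  Nat.eqb a' a = false -> upd2 f a i v a' = f a'.
Proof. intros H. apply functional_extensionality; intros i'. unfold upd2. now rewrite H. Qed.

Lemma niter_inv {A} (I : A -> Prop) n f (x : A) :
  (forall x, I x -> I (f x)) -> I x -> I (niter n f x).
Proof. intros Hf. revert x. induction n as [|n IH]; simpl; auto. Qed.

(** Frame rule. Its side condition is decided by computation, so even large commands are framed by
    [reflexivity]. *)
Lemma run_na c s a : memb (nmods c) a = false -> na (run c s) a = na s a.
Proof.
  revert s; induction c; intros s H; simpl in *; auto.
  - rewrite orb_false_r in H. now apply upd2_other_arr.
  - rewrite memb_app in H. apply orb_false_iff in H. destruct H.
    rewrite IHc2, IHc1; auto.
  - rewrite memb_app in H. apply orb_false_iff in H. destruct H. destruct (evC b s); auto.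
  - apply orb_false_iff in H. destruct H as [H1 H2].
    apply (niter_inv (fun s' => na s' a = na s a)).
    + intros x Hx. simpl. rewrite upd2_other_arr; auto. rewrite IHc; auto.
    + simpl. now apply upd2_other_arr.
  - rewrite orb_false_r in H. now apply upd2_other_arr.
Qed.

Lemma run_ra c s a : memb (rmods c) a = false -> ra (run c s) a = ra s a.
Proof.
  revert s; induction c; intros s H; simpl in *; auto.
  - rewrite orb_false_r in H. now apply upd2_other_arr.
  - rewrite memb_app in H. apply orb_false_iff in H. destruct H.
    rewrite IHc2, IHc1; auto.
  - rewrite memb_app in H. apply orb_false_iff in H. destruct H. destruct (evC b s); auto.
  - apply (niter_inv (fun s' => ra s' a = ra s a)); auto.
    intros x Hx. simpl. rewrite IHc; auto.
Qed.

(** * Static bounds on the cost from bounds on the loop limits *)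

Fixpoint cost_bound (c : cmd) (L : nat -> nat) : nat :=
  match c with
  | Skip => 0
  | SetN _ _ _ | SetR _ _ _ => 1
  | Seq c1 c2 => cost_bound c1 L + cost_bound c2 L
  | If _ c1 c2 => 1 + cost_bound c1 L + cost_bound c2 L
  | For _ w c => 1 + L w * (1 + cost_bound c L)
  | Ceil _ _ => 0
  end.

Fixpoint no_ceil (c : cmd) : bool :=
  match c with
  | Seq c1 c2 | If _ c1 c2 => no_ceil c1 && no_ceil c2
  | For _ _ c => no_ceil c
  | Ceil _ _ => false
  | _ => true
  end.

Definition fixed_limits (c : cmd) : bool :=
  forallb (fun w => negb (memb (nmods c) w)) (limits c).

(** The list [ms] stands for the arrays written by the whole enclosing command. A loop limit must
    survive everything that runs before its loop, also outside the subcommand at hand, so [ms] stays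
    fixed while the command shrinks in the induction. *)
Lemma cost_le_aux c (L : nat -> nat) : no_ceil c = true ->
  forall ms s, (forall a, memb ms a = false -> memb (nmods c) a = false) ->
  (forall w, In w (limits c) -> memb ms w = false) ->
  (forall w, In w (limits c) -> (na s w 0 <= L w)%nat) ->
  (cost c s <= cost_bound c L)%nat.
Proof.
  intros Hc. induction c; intros ms s Hms Hlim HL; simpl in *; auto.
  - apply andb_true_iff in Hc. destruct Hc as [Hc1 Hc2].
    assert (Hs : forall a, memb ms a = false ->
              memb (nmods c1) a = false /\ memb (nmods c2) a = false).
    { intros a Ha. specialize (Hms a Ha). rewrite memb_app in Hms.
      now apply orb_false_iff in Hms. }
    apply Nat.add_le_mono.
    + apply IHc1 with ms; auto.
      * intros a Ha. now apply Hs.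
      * intros; apply Hlim; apply in_or_app; auto.
      * intros; apply HL; apply in_or_app; auto.
    + apply IHc2 with ms; auto.
      * intros a Ha. now apply Hs.
      * intros; apply Hlim; apply in_or_app; auto.
      * intros w Hw. rewrite run_na.
        -- apply HL; apply in_or_app; auto.
        -- apply Hs. apply Hlim; apply in_or_app; auto.
  - apply andb_true_iff in Hc. destruct Hc as [Hc1 Hc2].
    assert (Hs : forall a, memb ms a = false ->
              memb (nmods c1) a = false /\ memb (nmods c2) a = false).
    { intros a Ha. specialize (Hms a Ha). rewrite memb_app in Hms.
      now apply orb_false_iff in Hms. }
    destruct (evC b s).
    + apply le_n_S. eapply Nat.le_trans; [|apply Nat.le_add_r].
      apply IHc1 with ms; auto.
      * intros a Ha. now apply Hs.
      * intros; apply Hlim; apply in_or_app; auto.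
      * intros; apply HL; apply in_or_app; auto.
    + apply le_n_S. eapply Nat.le_trans; [|rewrite Nat.add_comm; apply Nat.le_add_r].
      apply IHc2 with ms; auto.
      * intros a Ha. now apply Hs.
      * intros; apply Hlim; apply in_or_app; auto.
      * intros; apply HL; apply in_or_app; auto.
  - apply le_n_S.
    assert (Hs : forall a, memb ms a = false ->
              Nat.eqb a v = false /\ memb (nmods c) a = false).
    { intros a Ha. specialize (Hms a Ha). now apply orb_false_iff in Hms. }
    apply Nat.le_trans with (na s w 0 * S (cost_bound c L))%nat;
      [|apply Nat.mul_le_mono_r; apply HL; auto].
    assert (HL' : forall u, In u (limits c) -> (na (setn v 0 0 s) u 0 <= L u)%nat).
    { intros u Hu. simpl. rewrite upd2_other_arr; [apply HL; auto|].
      apply Hs. apply Hlim; auto. }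
    revert HL'. generalize (setn v 0 0 s). generalize (na s w 0%nat).
    induction n as [|n IHn]; intros x Hx; simpl; [apply Nat.le_0_l|].
    apply le_n_S. apply Nat.add_le_mono.
    + apply IHc with ms; auto. intros a Ha; now apply Hs.
    + apply IHn. intros u Hu. simpl. rewrite upd2_other_arr.
      * rewrite run_na; [apply Hx; auto|]. apply Hs. apply Hlim; auto.
      * apply Hs. apply Hlim; auto.
  - discriminate.
Qed.

Lemma cost_le c (L : nat -> nat) s : no_ceil c = true -> fixed_limits c = true ->
  (forall w, In w (limits c) -> (na s w 0 <= L w)%nat) ->
  (cost c s <= cost_bound c L)%nat.
Proof.
  intros Hc Hf HL. apply cost_le_aux with (nmods c); auto.
  intros w Hw. unfold fixed_limits in Hf. rewrite forallb_forall in Hf.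
  specialize (Hf w Hw). now apply negb_true_iff in Hf.
Qed.

(** * Compilation to the real RAM *)

(* Cell 0 holds the base address [base] of the virtual store, cells below [TL]
   are temporaries, and the virtual cells [na a i] and [ra a i] live at
   [base + FW * i + 2 a] and [base + FW * i + 2 a + 1] for [a < AW]. *)
Definition AW : nat := 64.
Definition FW : nat := 128.
Definition TL : nat := 30.

Arguments FW : simpl never.
Arguments TL : simpl never.
Arguments AW : simpl never.

Definition addr_code (d col : nat) : list instr :=
  IConst (S d) FW :: IMul d d (S d) :: IConst (S d) col :: IAdd d d (S d)
  :: IAdd d d 0 :: nil.

(** Jump targets are absolute, so a fragment with jumps is generated for its own start address [q].
    The comparison reproduces truncated subtraction. *)
Definition nsub_code (d q : nat) : list instr :=
  IJlt d (S d) (q + 3) :: ISub d d (S d) :: IJmp (q + 4) :: IConst d 0 :: nil.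

(** Dividing by 0 would block the machine. The two comparisons detect this case and deliver 0, which
    is the value of [x / 0] in Rocq; the logarithm below is made total in the same way. *)
Definition div_code (d q : nat) : list instr :=
  IConst (S (S d)) 0 :: IJlt (S d) (S (S d)) (q + 5) :: IJlt (S (S d)) (S d) (q + 5)
  :: IConst d 0 :: IJmp (q + 6) :: IDiv d d (S d) :: nil.

Definition ln_code (d q : nat) : list instr :=
  IConst (S d) 0 :: IJlt (S d) d (q + 4) :: IConst d 0 :: IJmp (q + 5) :: ILn d d :: nil.

Fixpoint compN (e : nexp) (d p : nat) : list instr :=
  match e with
  | NC k => IConst d k :: nil
  | NG a i => compN i d p ++ addr_code d (2 * a) ++ ILoad d d :: nil
  | NAdd e1 e2 =>
      let l1 := compN e1 d p in
      let l2 := compN e2 (S d) (p + length l1) in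
      l1 ++ l2 ++ IAdd d d (S d) :: nil
  | NMul e1 e2 =>
      let l1 := compN e1 d p in
      let l2 := compN e2 (S d) (p + length l1) in
      l1 ++ l2 ++ IMul d d (S d) :: nil
  | NSub e1 e2 =>
      let l1 := compN e1 d p in
      let l2 := compN e2 (S d) (p + length l1) in
      let q := (p + length l1 + length l2)%nat in
      l1 ++ l2 ++ nsub_code d q
  end.

Fixpoint compR (e : rexp) (d p : nat) : list instr :=
  match e with
  | RG a i => compN i d p ++ addr_code d (S (2 * a)) ++ ILoad d d :: nil
  | RN e => compN e d p
  | RAdd e1 e2 =>
      let l1 := compR e1 d p in
      let l2 := compR e2 (S d) (p + length l1) in
      l1 ++ l2 ++ IAdd d d (S d) :: nil
  | RSub e1 e2 =>
      let l1 := compR e1 d p in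
      let l2 := compR e2 (S d) (p + length l1) in
      l1 ++ l2 ++ ISub d d (S d) :: nil
  | RMul e1 e2 =>
      let l1 := compR e1 d p in
      let l2 := compR e2 (S d) (p + length l1) in
      l1 ++ l2 ++ IMul d d (S d) :: nil
  | RDiv e1 e2 =>
      let l1 := compR e1 d p in
      let l2 := compR e2 (S d) (p + length l1) in
      let q := (p + length l1 + length l2)%nat in
      l1 ++ l2 ++ div_code d q
  | RLn e =>
      let l1 := compR e d p in
      let q := (p + length l1)%nat in
      l1 ++ ln_code d q
  end.

(** An exclusive bound on the temporaries touched when the value is delivered in cell [d]. Comparing
    it with [TL] keeps evaluation away from the virtual store. *)
Fixpoint needN (e : nexp) (d : nat) : nat :=
  match e with
  | NC _ => S d
  | NG a i => Nat.max (d + 2) (needN i d)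
  | NAdd e1 e2 | NMul e1 e2 | NSub e1 e2 =>
      Nat.max (d + 3) (Nat.max (needN e1 d) (needN e2 (S d)))
  end.

Fixpoint needR (e : rexp) (d : nat) : nat :=
  match e with
  | RG a i => Nat.max (d + 2) (needN i d)
  | RN e => needN e d
  | RAdd e1 e2 | RSub e1 e2 | RMul e1 e2 | RDiv e1 e2 =>
      Nat.max (d + 3) (Nat.max (needR e1 d) (needR e2 (S d)))
  | RLn e => Nat.max (d + 2) (needR e d)
  end.

Fixpoint arrN (e : nexp) : bool :=
  match e with
  | NC _ => true
  | NG a i => Nat.ltb a AW && arrN i
  | NAdd e1 e2 | NMul e1 e2 | NSub e1 e2 => arrN e1 && arrN e2
  end.

Fixpoint arrR (e : rexp) : bool :=
  match e with
  | RG a i => Nat.ltb a AW && arrN i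
  | RN e => arrN e
  | RAdd e1 e2 | RSub e1 e2 | RMul e1 e2 | RDiv e1 e2 => arrR e1 && arrR e2
  | RLn e => arrR e
  end.

Definition okN (e : nexp) (d : nat) : bool := arrN e && Nat.leb (needN e d) TL.
Definition okR (e : rexp) (d : nat) : bool := arrR e && Nat.leb (needR e d) TL.

Definition comp_setn (a : nat) (i e : nexp) (p : nat) : list instr :=
  let l1 := compN i 1 p in
  let l2 := compN e 2 (p + length l1 + 5) in
  l1 ++ addr_code 1 (2 * a) ++ l2 ++ IStore 1 2 :: nil.

Definition comp_setr (a : nat) (i : nexp) (e : rexp) (p : nat) : list instr :=
  let l1 := compN i 1 p in
  let l2 := compR e 2 (p + length l1 + 5) in
  l1 ++ addr_code 1 (S (2 * a)) ++ l2 ++ IStore 1 2 :: nil.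

Definition comp_test (b : cond) (p l : nat) : list instr :=
  match b with
  | CN e1 e2 =>
      let l1 := compN e1 1 p in
      let l2 := compN e2 2 (p + length l1) in
      l1 ++ l2 ++ IJlt 1 2 l :: nil
  | CR e1 e2 =>
      let l1 := compR e1 1 p in
      let l2 := compR e2 2 (p + length l1) in
      l1 ++ l2 ++ IJlt 1 2 l :: nil
  end.

Notation var a := (NG a (NC 0)).
Notation rvar a := (RG a (NC 0)).

(** The layout is measured with the dummy target 0, since the length of a test does not depend on
    where it jumps. *)
Definition comp_loop (b : cond) (body : nat -> list instr) (p : nat) : list instr :=
  let lt := length (comp_test b p 0) in
  let lb := body (p + lt + 1)%nat in
  comp_test b p (p + lt + 1) ++ IJmp (p + lt + 1 + length lb + 1) :: lb
    ++ IJmp p :: nil.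

Definition comp_incr (v p : nat) : list instr :=
  comp_setn v (NC 0) (NAdd (var v) (NC 1)) p.

Fixpoint compC (c : cmd) (p : nat) : list instr :=
  match c with
  | Skip => nil
  | SetN a i e => comp_setn a i e p
  | SetR a i e => comp_setr a i e p
  | Seq c1 c2 =>
      let l1 := compC c1 p in l1 ++ compC c2 (p + length l1)
  | If b c1 c2 =>
      let q := (p + length (comp_test b p 0))%nat in
      let l2 := compC c2 q in
      let r := (q + length l2 + 1)%nat in
      let l1 := compC c1 r in
      comp_test b p r ++ l2 ++ IJmp (r + length l1) :: l1
  | For v w c =>
      let l0 := comp_setn v (NC 0) (NC 0) p in
      l0 ++ comp_loop (CN (var v) (var w))
              (fun q => let l1 := compC c q in l1 ++ comp_incr v (q + length l1))
              (p + length l0)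
  | Ceil v a =>
      let l0 := comp_setn v (NC 0) (NC 0) p in
      let q := (p + length l0)%nat in
      let b := CR (rvar a) (RN (var v)) in
      let r := (q + length (comp_test b q 0))%nat in
      let l1 := comp_incr v r in
      l0 ++ comp_test b q (r + length l1 + 1) ++ l1 ++ IJmp q :: nil
  end.

Definition okB (b : cond) : bool :=
  match b with
  | CN e1 e2 => okN e1 1 && okN e2 2
  | CR e1 e2 => okR e1 1 && okR e2 2
  end.

(** The compiled loop rereads counter and limit at every test, whereas [run] fixes the number of
    iterations on entry. Forbidding the body to write either array makes the two agree. *)
Fixpoint okC (c : cmd) : bool :=
  match c with
  | Skip => true
  | SetN a i e => Nat.ltb a AW && okN i 1 && okN e 2
  | SetR a i e => Nat.ltb a AW && okN i 1 && okR e 2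
  | Seq c1 c2 => okC c1 && okC c2
  | If b c1 c2 => okB b && okC c1 && okC c2
  | For v w c => Nat.ltb v AW && Nat.ltb w AW && negb (Nat.eqb v w)
                 && negb (memb (nmods c) v) && negb (memb (nmods c) w) && okC c
  | Ceil v a => Nat.ltb v AW && Nat.ltb a AW
  end.

(** * Correctness of the compiled code *)

Inductive steps (P : program) : state -> nat -> state -> Prop :=
| steps_0 s : steps P s 0 s
| steps_S s s' s'' k : step P s s' -> steps P s' k s'' -> steps P s (S k) s''.

Lemma steps_trans P s1 k1 s2 k2 s3 :
  steps P s1 k1 s2 -> steps P s2 k2 s3 -> steps P s1 (k1 + k2) s3.
Proof. induction 1; intros; simpl; auto. econstructor; eauto. Qed.

Lemma steps_exec P s1 k1 s2 k2 v :
  steps P s1 k1 s2 -> exec P s2 k2 v -> exec P s1 (k1 + k2) v.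
Proof. induction 1; intros; simpl; auto. econstructor; eauto. Qed.

Definition codeat (P : program) (p : nat) (l : list instr) : Prop :=
  forall i x, nth_error l i = Some x -> nth_error P (p + i) = Some x.

Lemma codeat_app P p l1 l2 :
  codeat P p (l1 ++ l2) -> codeat P p l1 /\ codeat P (p + length l1) l2.
Proof.
  intros H. split; intros i x Hx.
  - apply H. rewrite nth_error_app1; auto. apply nth_error_Some. congruence.
  - rewrite <- Nat.add_assoc. apply H. rewrite nth_error_app2 by lia.
    now replace (length l1 + i - length l1)%nat with i by lia.
Qed.

Lemma codeat_cons P p x l :
  codeat P p (x :: l) -> nth_error P p = Some x /\ codeat P (S p) l.
Proof.
  intros H. split.
  - replace p with (p + 0)%nat by lia. now apply H.
  - intros i y Hy. replace (S p + i)%nat with (p + S i)%nat by lia. now apply H.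
Qed.

Lemma fetch P p l i x pc :
  codeat P p l -> nth_error l i = Some x -> pc = (p + i)%nat -> nth_error P pc = Some x.
Proof. intros H Hx ->. now apply H. Qed.

Definition rel (base : nat) (s : st) (m : nat -> R) : Prop :=
  m 0%nat = INR base /\
  (forall a i, (a < AW)%nat -> m (base + FW * i + 2 * a)%nat = INR (na s a i)) /\
  (forall a i, (a < AW)%nat -> m (base + FW * i + S (2 * a))%nat = ra s a i).

(** Evaluation at depth [d] may disturb only the temporaries from [d] up to [TL]; operands parked
    below [d], the base address in cell 0 and the virtual store survive. *)
Definition same_outside (d : nat) (m m' : nat -> R) : Prop :=
  forall j, (j < d)%nat \/ (TL <= j)%nat -> m' j = m j.

Lemma rel_same base s m m' d : (1 <= d)%nat -> (TL <= base)%nat ->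
  rel base s m -> same_outside d m m' -> rel base s m'.
Proof.
  intros Hd Hb (H0 & H1 & H2) H. repeat split.
  - rewrite H by lia. auto.
  - intros. rewrite H by (right; lia). auto.
  - intros. rewrite H by (right; lia). auto.
Qed.

Lemma same_trans d d' m m' m'' : (d <= d')%nat ->
  same_outside d m m' -> same_outside d' m' m'' -> same_outside d m m''.
Proof. intros Hd H1 H2 j Hj. rewrite H2 by lia. apply H1; lia. Qed.

Lemma same_upd d j v m : (d <= j < TL)%nat -> same_outside d m (upd m j v).
Proof. intros Hj i Hi. unfold upd. destruct (Nat.eqb_spec i j); [lia|auto]. Qed.

Lemma same_upd_r d j v m m' : (d <= j < TL)%nat ->
  same_outside d m m' -> same_outside d m (upd m' j v).
Proof. intros Hj H. apply (same_trans d d _ _ _ (le_n d) H). now apply same_upd. Qed.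

Lemma upd_eq m j v : upd m j v j = v.
Proof. unfold upd. now rewrite Nat.eqb_refl. Qed.

Lemma upd_neq m j v i : i <> j -> upd m j v i = m i.
Proof. intros H. unfold upd. destruct (Nat.eqb_spec i j); congruence. Qed.

Ltac one H i :=
  eapply steps_S; [ econstructor; eapply (fetch _ _ _ i _ _ H); [reflexivity | lia] | ].
Ltac upds := repeat (first [rewrite upd_eq | rewrite upd_neq by lia]).

Lemma addr_ok P p d col base m k :
  codeat P p (addr_code d col) -> (1 <= d)%nat -> (S d < TL)%nat ->
  m 0%nat = INR base -> m d = INR k ->
  exists m', steps P (mkState p m) 5 (mkState (p + 5) m') /\
    m' d = INR (base + FW * k + col) /\ same_outside d m m'.
Proof.
  intros H Hd HT H0 Hk.
  eexists. split.
  - one H 0%nat. one H 1%nat. one H 2%nat. one H 3%nat. one H 4%nat.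
    replace (p + 5)%nat with (S (S (S (S (S p))))) by lia. apply steps_0.
  - split.
    + upds. rewrite H0, Hk, !plus_INR, mult_INR. ring.
    + repeat (apply same_upd_r; [lia|]). intros j Hj; reflexivity.
Qed.

(** Code for expressions only jumps forward, so no instruction runs twice and the code length bounds
    the number of steps. *)
Definition computes P base s p (l : list instr) (d : nat) (v : R) : Prop :=
  forall m, rel base s m -> exists k m',
    steps P (mkState p m) k (mkState (p + length l) m') /\
    (k <= length l)%nat /\ m' d = v /\ same_outside d m m'.

Definition finishes P p (l : list instr) (d : nat) (v1 v2 v : R) : Prop :=
  forall m, m d = v1 -> m (S d) = v2 -> exists k m',
    steps P (mkState p m) k (mkState (p + length l) m') /\
    (k <= length l)%nat /\ m' d = v /\ same_outside d m m'.

Lemma computes_app P base s p l1 l2 d v1 v : (1 <= d)%nat -> (TL <= base)%nat ->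
  computes P base s p l1 d v1 ->
  (forall m, rel base s m -> m d = v1 -> exists k m',
    steps P (mkState (p + length l1) m) k (mkState (p + length l1 + length l2) m') /\
    (k <= length l2)%nat /\ m' d = v /\ same_outside d m m') ->
  computes P base s p (l1 ++ l2) d v.
Proof.
  intros Hd HB H1 H2 m Hr.
  destruct (H1 m Hr) as (k1 & m1 & S1 & K1 & V1 & F1).
  destruct (H2 m1 (rel_same _ _ _ _ _ Hd HB Hr F1) V1) as (k2 & m2 & S2 & K2 & V2 & F2).
  exists (k1 + k2)%nat, m2. rewrite length_app, Nat.add_assoc.
  split; [|split; [lia|split; auto]].
  - eapply steps_trans; eauto.
  - now apply (same_trans d d _ m1).
Qed.

Lemma computes_bin P base s p l1 l2 l3 d v1 v2 v : (1 <= d)%nat -> (TL <= base)%nat ->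
  computes P base s p l1 d v1 -> computes P base s (p + length l1) l2 (S d) v2 ->
  finishes P (p + length l1 + length l2) l3 d v1 v2 v ->
  computes P base s p (l1 ++ l2 ++ l3) d v.
Proof.
  intros Hd HB H1 H2 H3. apply computes_app with v1; auto.
  intros m Hr V1. destruct (H2 m Hr) as (k2 & m2 & S2 & K2 & V2 & F2).
  destruct (H3 m2) as (k3 & m3 & S3 & K3 & V3 & F3); auto.
  { rewrite F2 by (left; apply Nat.lt_succ_diag_r). exact V1. }
  exists (k2 + k3)%nat, m3. rewrite length_app, Nat.add_assoc.
  split; [|split; [lia|split; auto]].
  - eapply steps_trans; eauto.
  - intros j Hj. rewrite F3 by exact Hj. apply F2. destruct Hj; auto.
Qed.

Lemma finishes_arith P p op d v1 v2 :
  codeat P p (op :: nil) -> (S d < TL)%nat ->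
  forall v, (forall m, m d = v1 -> m (S d) = v2 ->
    step P (mkState p m) (mkState (S p) (upd m d v))) ->
  finishes P p (op :: nil) d v1 v2 v.
Proof.
  intros H HT v Hop m H1 H2. exists 1%nat, (upd m d v).
  split; [|split; [auto|split; [apply upd_eq|apply same_upd; lia]]].
  eapply steps_S; [apply Hop; auto|]. simpl. rewrite Nat.add_comm. apply steps_0.
Qed.

Lemma finishes_add P p d v1 v2 : codeat P p (IAdd d d (S d) :: nil) -> (S d < TL)%nat ->
  finishes P p (IAdd d d (S d) :: nil) d v1 v2 (v1 + v2).
Proof.
  intros H HT. apply finishes_arith; auto.
  intros m <- <-. apply StAdd. apply (codeat_cons _ _ _ _ H).
Qed.

Lemma finishes_sub P p d v1 v2 : codeat P p (ISub d d (S d) :: nil) -> (S d < TL)%nat ->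
  finishes P p (ISub d d (S d) :: nil) d v1 v2 (v1 - v2).
Proof.
  intros H HT. apply finishes_arith; auto.
  intros m <- <-. apply StSub. apply (codeat_cons _ _ _ _ H).
Qed.

Lemma finishes_mul P p d v1 v2 : codeat P p (IMul d d (S d) :: nil) -> (S d < TL)%nat ->
  finishes P p (IMul d d (S d) :: nil) d v1 v2 (v1 * v2).
Proof.
  intros H HT. apply finishes_arith; auto.
  intros m <- <-. apply StMul. apply (codeat_cons _ _ _ _ H).
Qed.

Lemma finishes_nsub P q d a b : codeat P q (nsub_code d q) -> (S d < TL)%nat ->
  finishes P q (nsub_code d q) d (INR a) (INR b) (INR (a - b)).
Proof.
  intros H HT m H1 H2.
  destruct (Nat.lt_ge_cases a b) as [Hlt|Hge].
  - exists 2%nat. eexists. split; [|split; [simpl; auto|split]].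
    + eapply steps_S; [eapply StJltT; [eapply (fetch _ _ _ 0 _ _ H); [reflexivity|lia]|]|].
      { rewrite H1, H2. now apply lt_INR. }
      one H 3%nat. simpl. rewrite (Nat.add_succ_r q 3). apply steps_0.
    + rewrite upd_eq. now replace (a - b)%nat with 0%nat by lia.
    + apply same_upd; lia.
  - exists 3%nat. eexists. split; [|split; [simpl; auto|split]].
    + eapply steps_S; [eapply StJltF; [eapply (fetch _ _ _ 0 _ _ H); [reflexivity|lia]|]|].
      { rewrite H1, H2. apply Rle_not_lt. now apply le_INR. }
      one H 1%nat. one H 2%nat. apply steps_0.
    + rewrite upd_eq, H1, H2, minus_INR; auto.
    + apply same_upd; lia.
Qed.

Lemma finishes_div P q d x y : codeat P q (div_code d q) -> (S (S d) < TL)%nat ->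
  finishes P q (div_code d q) d x y (x / y).
Proof.
  intros H HT m H1 H2.
  assert (F : forall v, same_outside d m (upd (upd m (S (S d)) (INR 0)) d v)).
  { intros v. do 2 (apply same_upd_r; [lia|]). intros j Hj; reflexivity. }
  destruct (Rtotal_order y 0) as [Hlt|[Heq|Hgt]].
  - exists 3%nat. eexists. split; [|split; [simpl; lia|split; [|apply F]]].
    + one H 0%nat.
      eapply steps_S; [eapply StJltT; [eapply (fetch _ _ _ 1 _ _ H); [reflexivity|lia]|]|].
      { upds. rewrite H2. simpl. lra. }
      eapply steps_S; [eapply StDiv; [eapply (fetch _ _ _ 5 _ _ H); [reflexivity|lia]|]|].
      { upds. rewrite H2. lra. }
      simpl. rewrite (Nat.add_succ_r q 5). apply steps_0.
    + upds. now rewrite H1, H2.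
  - exists 5%nat. eexists. split; [|split; [simpl; lia|split; [|apply F]]].
    + one H 0%nat.
      eapply steps_S; [eapply StJltF; [eapply (fetch _ _ _ 1 _ _ H); [reflexivity|lia]|]|].
      { upds. rewrite H2. simpl. lra. }
      eapply steps_S; [eapply StJltF; [eapply (fetch _ _ _ 2 _ _ H); [reflexivity|lia]|]|].
      { upds. rewrite H2. simpl. lra. }
      one H 3%nat. one H 4%nat. apply steps_0.
    + rewrite upd_eq, Heq. unfold Rdiv. now rewrite Rinv_0, Rmult_0_r.
  - exists 4%nat. eexists. split; [|split; [simpl; lia|split; [|apply F]]].
    + one H 0%nat.
      eapply steps_S; [eapply StJltF; [eapply (fetch _ _ _ 1 _ _ H); [reflexivity|lia]|]|].
      { upds. rewrite H2. simpl. lra. }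
      eapply steps_S; [eapply StJltT; [eapply (fetch _ _ _ 2 _ _ H); [reflexivity|lia]|]|].
      { upds. rewrite H2. simpl. lra. }
      eapply steps_S; [eapply StDiv; [eapply (fetch _ _ _ 5 _ _ H); [reflexivity|lia]|]|].
      { upds. rewrite H2. lra. }
      simpl. rewrite (Nat.add_succ_r q 5). apply steps_0.
    + upds. now rewrite H1, H2.
Qed.

Lemma ln_nonpos x : x <= 0 -> ln x = 0.
Proof. intros H. unfold ln. destruct (Rlt_dec 0 x); [exfalso; lra|reflexivity]. Qed.

Lemma ln_code_ok P q d x m : codeat P q (ln_code d q) -> (S d < TL)%nat -> m d = x ->
  exists k m', steps P (mkState q m) k (mkState (q + length (ln_code d q)) m') /\
    (k <= length (ln_code d q))%nat /\ m' d = ln x /\ same_outside d m m'.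
Proof.
  intros H HT H1.
  assert (F : forall v, same_outside d m (upd (upd m (S d) (INR 0)) d v)).
  { intros v. do 2 (apply same_upd_r; [lia|]). intros j Hj; reflexivity. }
  destruct (Rlt_le_dec 0 x) as [Hlt|Hle].
  - exists 3%nat. eexists. split; [|split; [simpl; lia|split; [|apply F]]].
    + one H 0%nat.
      eapply steps_S; [eapply StJltT; [eapply (fetch _ _ _ 1 _ _ H); [reflexivity|lia]|]|].
      { upds. rewrite H1. simpl. lra. }
      eapply steps_S; [eapply StLn; [eapply (fetch _ _ _ 4 _ _ H); [reflexivity|lia]|]|].
      { upds. rewrite H1. lra. }
      simpl. rewrite (Nat.add_succ_r q 4). apply steps_0.
    + upds. now rewrite H1.
  - exists 4%nat. eexists. split; [|split; [simpl; lia|split; [|apply F]]].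
    + one H 0%nat.
      eapply steps_S; [eapply StJltF; [eapply (fetch _ _ _ 1 _ _ H); [reflexivity|lia]|]|].
      { upds. rewrite H1. simpl. lra. }
      one H 2%nat. one H 3%nat. apply steps_0.
    + rewrite upd_eq. now rewrite (ln_nonpos _ Hle).
Qed.

Lemma compN_ok P base s e : forall d p,
  codeat P p (compN e d p) -> (1 <= d)%nat -> (TL <= base)%nat -> arrN e = true ->
  (needN e d <= TL)%nat -> computes P base s p (compN e d p) d (INR (evN e s)).
Proof.
  induction e as [k|a i IH|e1 IH1 e2 IH2|e1 IH1 e2 IH2|e1 IH1 e2 IH2];
    intros d p H Hd HB HA HN; cbn [compN evN arrN needN] in *.
  - intros m Hr. exists 1%nat. eexists. split; [|split; [auto|split]].
    + one H 0%nat. simpl. rewrite Nat.add_comm. apply steps_0.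
    + apply upd_eq.
    + apply same_upd; lia.
  - apply andb_true_iff in HA. destruct HA as [Ha HA]. apply Nat.ltb_lt in Ha.
    apply codeat_app in H. destruct H as [Hi H].
    eapply computes_app; [auto|auto|apply IH; auto; lia|].
    intros m (R0 & RN & _) V1. apply codeat_app in H. destruct H as [Hc H].
    destruct (addr_ok _ _ _ _ base _ _ Hc Hd ltac:(lia) R0 V1) as (m2 & S2 & V2 & F2).
    exists 6%nat. eexists. split; [|split; [auto|split]].
    + eapply (steps_trans _ _ 5 _ 1); [exact S2|].
      eapply steps_S; [eapply StLoad; [eapply (fetch _ _ _ 0 _ _ H); [reflexivity|]|exact V2]|].
      { rewrite Nat.add_0_r. reflexivity. }
      simpl. rewrite (Nat.add_succ_r _ 5). apply steps_0.
    + rewrite upd_eq, F2 by lia. apply RN; auto.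
    + apply same_upd_r; auto. lia.
  - apply andb_true_iff in HA. destruct HA as [HA1 HA2].
    apply codeat_app in H. destruct H as [Ha H].
    apply codeat_app in H. destruct H as [Hb H].
    rewrite plus_INR. eapply computes_bin;
      [auto|auto|apply IH1; auto; lia|apply IH2; auto; lia|apply finishes_add; auto; lia].
  - apply andb_true_iff in HA. destruct HA as [HA1 HA2].
    apply codeat_app in H. destruct H as [Ha H].
    apply codeat_app in H. destruct H as [Hb H].
    rewrite mult_INR. eapply computes_bin;
      [auto|auto|apply IH1; auto; lia|apply IH2; auto; lia|apply finishes_mul; auto; lia].
  - apply andb_true_iff in HA. destruct HA as [HA1 HA2].
    apply codeat_app in H. destruct H as [Ha H].
    apply codeat_app in H. destruct H as [Hb H].
    eapply computes_bin;
      [auto|auto|apply IH1; auto; lia|apply IH2; auto; lia|apply finishes_nsub; auto; lia].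
Qed.

Lemma compR_ok P base s e : forall d p,
  codeat P p (compR e d p) -> (1 <= d)%nat -> (TL <= base)%nat -> arrR e = true ->
  (needR e d <= TL)%nat -> computes P base s p (compR e d p) d (evR e s).
Proof.
  induction e as [a i|e|e1 IH1 e2 IH2|e1 IH1 e2 IH2|e1 IH1 e2 IH2|e1 IH1 e2 IH2|e IH];
    intros d p H Hd HB HA HN; cbn [compR evR arrR needR] in *.
  - apply andb_true_iff in HA. destruct HA as [Ha HA]. apply Nat.ltb_lt in Ha.
    apply codeat_app in H. destruct H as [Hi H].
    eapply computes_app; [auto|auto|apply compN_ok; auto; lia|].
    intros m (R0 & _ & RR) V1. apply codeat_app in H. destruct H as [Hc H].
    destruct (addr_ok _ _ _ _ base _ _ Hc Hd ltac:(lia) R0 V1) as (m2 & S2 & V2 & F2).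
    exists 6%nat. eexists. split; [|split; [auto|split]].
    + eapply (steps_trans _ _ 5 _ 1); [exact S2|].
      eapply steps_S; [eapply StLoad; [eapply (fetch _ _ _ 0 _ _ H); [reflexivity|]|exact V2]|].
      { rewrite Nat.add_0_r. reflexivity. }
      simpl. rewrite (Nat.add_succ_r _ 5). apply steps_0.
    + rewrite upd_eq, F2 by lia. apply RR; auto.
    + apply same_upd_r; auto. lia.
  - apply compN_ok; auto.
  - apply andb_true_iff in HA. destruct HA as [HA1 HA2].
    apply codeat_app in H. destruct H as [Ha H].
    apply codeat_app in H. destruct H as [Hb H].
    eapply computes_bin;
      [auto|auto|apply IH1; auto; lia|apply IH2; auto; lia|apply finishes_add; auto; lia].
  - apply andb_true_iff in HA. destruct HA as [HA1 HA2].
    apply codeat_app in H. destruct H as [Ha H].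
    apply codeat_app in H. destruct H as [Hb H].
    eapply computes_bin;
      [auto|auto|apply IH1; auto; lia|apply IH2; auto; lia|apply finishes_sub; auto; lia].
  - apply andb_true_iff in HA. destruct HA as [HA1 HA2].
    apply codeat_app in H. destruct H as [Ha H].
    apply codeat_app in H. destruct H as [Hb H].
    eapply computes_bin;
      [auto|auto|apply IH1; auto; lia|apply IH2; auto; lia|apply finishes_mul; auto; lia].
  - apply andb_true_iff in HA. destruct HA as [HA1 HA2].
    apply codeat_app in H. destruct H as [Ha H].
    apply codeat_app in H. destruct H as [Hb H].
    eapply computes_bin;
      [auto|auto|apply IH1; auto; lia|apply IH2; auto; lia|apply finishes_div; auto; lia].
  - apply codeat_app in H. destruct H as [Ha H].
    eapply computes_app; [auto|auto|apply IH; auto; lia|].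
    intros m Hr V1. apply ln_code_ok; auto; lia.
Qed.

Lemma cell_inj base i i' c c' : (c < FW)%nat -> (c' < FW)%nat ->
  (base + FW * i + c = base + FW * i' + c')%nat -> i = i' /\ c = c'.
Proof. unfold FW. lia. Qed.

Lemma upd_upd2_even (m : nat -> R) f a i v base a' i' : (a < AW)%nat -> (a' < AW)%nat ->
  m (base + FW * i' + 2 * a')%nat = INR (f a' i') ->
  upd m (base + FW * i + 2 * a) (INR v) (base + FW * i' + 2 * a')%nat
  = INR (upd2 f a i v a' i').
Proof.
  intros Ha Ha' H. unfold upd, upd2. unfold AW in *.
  destruct (Nat.eqb_spec (base + FW * i' + 2 * a') (base + FW * i + 2 * a)) as [E|E].
  - apply cell_inj in E; try (unfold FW; lia). destruct E as [-> E].
    replace a' with a by lia. now rewrite !Nat.eqb_refl.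
  - destruct (Nat.eqb_spec a' a) as [->|Na]; [|exact H].
    destruct (Nat.eqb_spec i' i) as [->|Ni]; [congruence|exact H].
Qed.

Lemma upd_upd2_odd (m : nat -> R) f a i v base a' i' : (a < AW)%nat -> (a' < AW)%nat ->
  m (base + FW * i' + S (2 * a'))%nat = f a' i' ->
  upd m (base + FW * i + S (2 * a)) v (base + FW * i' + S (2 * a'))%nat
  = upd2 f a i v a' i'.
Proof.
  intros Ha Ha' H. unfold upd, upd2. unfold AW in *.
  destruct (Nat.eqb_spec (base + FW * i' + S (2 * a')) (base + FW * i + S (2 * a))) as [E|E].
  - apply cell_inj in E; try (unfold FW; lia). destruct E as [-> E].
    replace a' with a by lia. now rewrite !Nat.eqb_refl.
  - destruct (Nat.eqb_spec a' a) as [->|Na]; [|exact H].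
    destruct (Nat.eqb_spec i' i) as [->|Ni]; [congruence|exact H].
Qed.

Lemma rel_setn base s m a i v : (a < AW)%nat -> (TL <= base)%nat -> rel base s m ->
  rel base (setn a i v s) (upd m (base + FW * i + 2 * a) (INR v)).
Proof.
  intros Ha HB (R0 & RN & RR). split; [|split].
  - rewrite upd_neq by (unfold TL in HB; lia). exact R0.
  - intros a' i' Ha'. apply upd_upd2_even; auto.
  - intros a' i' Ha'. cbn [na ra setn setr]. rewrite upd_neq; auto. unfold AW in *.
    intros E. apply cell_inj in E; unfold FW; lia.
Qed.

Lemma rel_setr base s m a i v : (a < AW)%nat -> (TL <= base)%nat -> rel base s m ->
  rel base (setr a i v s) (upd m (base + FW * i + S (2 * a)) v).
Proof.
  intros Ha HB (R0 & RN & RR). split; [|split].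
  - rewrite upd_neq by (unfold TL in HB; lia). exact R0.
  - intros a' i' Ha'. cbn [na ra setn setr]. rewrite upd_neq; auto. unfold AW in *.
    intros E. apply cell_inj in E; unfold FW; lia.
  - intros a' i' Ha'. apply upd_upd2_odd; auto.
Qed.

Lemma okN_spec e d : okN e d = true -> arrN e = true /\ (needN e d <= TL)%nat.
Proof. unfold okN. intros H. apply andb_true_iff in H. now rewrite Nat.leb_le in H. Qed.

Lemma okR_spec e d : okR e d = true -> arrR e = true /\ (needR e d <= TL)%nat.
Proof. unfold okR. intros H. apply andb_true_iff in H. now rewrite Nat.leb_le in H. Qed.

Definition runs P base (p q : nat) (s s' : st) (K : nat) : Prop :=
  forall m, rel base s m -> exists k m',
    steps P (mkState p m) k (mkState q m') /\ (k <= K)%nat /\ rel base s' m'.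

Lemma runs_trans P base p q r s s' s'' K K' :
  runs P base p q s s' K -> runs P base q r s' s'' K' -> runs P base p r s s'' (K + K').
Proof.
  intros H1 H2 m Hr. destruct (H1 m Hr) as (k1 & m1 & S1 & K1 & R1).
  destruct (H2 m1 R1) as (k2 & m2 & S2 & K2 & R2).
  exists (k1 + k2)%nat, m2. split; [eapply steps_trans; eauto|split; [lia|auto]].
Qed.

Lemma runs_weaken P base p q s s' K K' : (K <= K')%nat ->
  runs P base p q s s' K -> runs P base p q s s' K'.
Proof.
  intros HK H m Hr. destruct (H m Hr) as (k & m' & HS & Hk & HR).
  exists k, m'. split; auto. split; auto. lia.
Qed.

Lemma runs_jmp P base p q s : nth_error P p = Some (IJmp q) -> runs P base p q s s 1.
Proof.
  intros H m Hr. exists 1%nat, m. split; [|auto].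
  eapply steps_S; [eapply StJmp; exact H|apply steps_0].
Qed.

Lemma comp_setn_ok P base s a i e p : codeat P p (comp_setn a i e p) ->
  (TL <= base)%nat -> (a < AW)%nat -> okN i 1 = true -> okN e 2 = true ->
  runs P base p (p + length (comp_setn a i e p)) s (setn a (evN i s) (evN e s) s)
    (length (comp_setn a i e p)).
Proof.
  unfold comp_setn. intros H HB Ha Hi He m Hr.
  apply okN_spec in Hi. apply okN_spec in He. destruct Hi as [Ai Ni], He as [Ae Ne].
  apply codeat_app in H. destruct H as [H1 H].
  apply codeat_app in H. destruct H as [H2 H].
  apply codeat_app in H. destruct H as [H3 H].
  change (length (addr_code 1 (2 * a))) with 5%nat in *.
  destruct (compN_ok P base s i 1 p H1 (le_n 1) HB Ai Ni m Hr) as (k1 & m1 & S1 & K1 & V1 & F1).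
  assert (R1 := rel_same _ _ _ _ _ (le_n 1) HB Hr F1).
  destruct (addr_ok _ _ 1 _ base _ _ H2 (le_n 1) ltac:(unfold TL; lia) (proj1 R1) V1)
    as (m2 & S2 & V2 & F2).
  assert (R2 := rel_same _ _ _ _ _ (le_n 1) HB R1 F2).
  destruct (compN_ok P base s e 2 _ H3 ltac:(auto) HB Ae Ne m2 R2) as (k3 & m3 & S3 & K3 & V3 & F3).
  assert (R3 := rel_same _ _ _ _ 2 ltac:(auto) HB R2 F3).
  exists (k1 + (5 + (k3 + 1)))%nat. eexists. split; [|split].
  - eapply steps_trans; [exact S1|]. eapply steps_trans; [exact S2|].
    eapply steps_trans; [exact S3|].
    eapply steps_S; [eapply StStore; [exact (proj1 (codeat_cons _ _ _ _ H))|]|].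
    { rewrite F3 by auto. exact V2. }
    rewrite V3, !length_app. simpl length.
    match goal with |- steps _ (mkState ?x _) _ (mkState ?y _) => replace y with x by lia end.
    apply steps_0.
  - rewrite !length_app. simpl length. lia.
  - apply rel_setn; auto.
Qed.

Lemma comp_setr_ok P base s a i e p : codeat P p (comp_setr a i e p) ->
  (TL <= base)%nat -> (a < AW)%nat -> okN i 1 = true -> okR e 2 = true ->
  runs P base p (p + length (comp_setr a i e p)) s (setr a (evN i s) (evR e s) s)
    (length (comp_setr a i e p)).
Proof.
  unfold comp_setr. intros H HB Ha Hi He m Hr.
  apply okN_spec in Hi. apply okR_spec in He. destruct Hi as [Ai Ni], He as [Ae Ne].
  apply codeat_app in H. destruct H as [H1 H].
  apply codeat_app in H. destruct H as [H2 H].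
  apply codeat_app in H. destruct H as [H3 H].
  change (length (addr_code 1 (S (2 * a)))) with 5%nat in *.
  destruct (compN_ok P base s i 1 p H1 (le_n 1) HB Ai Ni m Hr) as (k1 & m1 & S1 & K1 & V1 & F1).
  assert (R1 := rel_same _ _ _ _ _ (le_n 1) HB Hr F1).
  destruct (addr_ok _ _ 1 _ base _ _ H2 (le_n 1) ltac:(unfold TL; lia) (proj1 R1) V1)
    as (m2 & S2 & V2 & F2).
  assert (R2 := rel_same _ _ _ _ _ (le_n 1) HB R1 F2).
  destruct (compR_ok P base s e 2 _ H3 ltac:(auto) HB Ae Ne m2 R2) as (k3 & m3 & S3 & K3 & V3 & F3).
  assert (R3 := rel_same _ _ _ _ 2 ltac:(auto) HB R2 F3).
  exists (k1 + (5 + (k3 + 1)))%nat. eexists. split; [|split].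
  - eapply steps_trans; [exact S1|]. eapply steps_trans; [exact S2|].
    eapply steps_trans; [exact S3|].
    eapply steps_S; [eapply StStore; [exact (proj1 (codeat_cons _ _ _ _ H))|]|].
    { rewrite F3 by auto. exact V2. }
    rewrite V3, !length_app. simpl length.
    match goal with |- steps _ (mkState ?x _) _ (mkState ?y _) => replace y with x by lia end.
    apply steps_0.
  - rewrite !length_app. simpl length. lia.
  - apply rel_setr; auto.
Qed.

Lemma comp_test_length b p l l' : length (comp_test b p l) = length (comp_test b p l').
Proof. destruct b; simpl; rewrite !length_app; reflexivity. Qed.

Lemma comp_test_ok P base s b p l : codeat P p (comp_test b p l) ->
  (TL <= base)%nat -> okB b = true ->
  runs P base p (if evC b s then l else p + length (comp_test b p l))%nat s s
    (length (comp_test b p l)).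
Proof.
  intros H HB Hok m Hr.
  assert (HT : (2 < TL)%nat) by (unfold TL; lia).
  destruct b as [e1 e2|e1 e2]; simpl in *; apply andb_true_iff in Hok; destruct Hok as [O1 O2];
    apply codeat_app in H; destruct H as [H1 H];
    apply codeat_app in H; destruct H as [H2 H].
  - apply okN_spec in O1. apply okN_spec in O2. destruct O1 as [A1 N1], O2 as [A2 N2].
    destruct (compN_ok P base s e1 1 p H1 (le_n 1) HB A1 N1 m Hr) as (k1 & m1 & S1 & K1 & V1 & F1).
    assert (R1 := rel_same _ _ _ _ _ (le_n 1) HB Hr F1).
    destruct (compN_ok P base s e2 2 _ H2 ltac:(auto) HB A2 N2 m1 R1) as (k2 & m2 & S2 & K2 & V2 & F2).
    assert (R2 := rel_same _ _ _ _ 2 ltac:(auto) HB R1 F2).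
    exists (k1 + (k2 + 1))%nat, m2. split; [|split; [rewrite !length_app; simpl length; lia|exact R2]].
    eapply steps_trans; [exact S1|]. eapply steps_trans; [exact S2|].
    rewrite <- (F2 1%nat) in V1 by auto.
    apply codeat_cons in H. destruct H as [H _].
    destruct (Nat.ltb_spec (evN e1 s) (evN e2 s)) as [Hlt|Hge].
    + eapply steps_S; [eapply StJltT; [exact H|]|apply steps_0].
      rewrite V1, V2. now apply lt_INR.
    + eapply steps_S; [eapply StJltF; [exact H|]|].
      { rewrite V1, V2. apply Rle_not_lt. now apply le_INR. }
      rewrite !length_app. simpl length.
      match goal with |- steps _ (mkState ?x _) _ (mkState ?y _) => replace y with x by lia end.
      apply steps_0.
  - apply okR_spec in O1. apply okR_spec in O2. destruct O1 as [A1 N1], O2 as [A2 N2].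
    destruct (compR_ok P base s e1 1 p H1 (le_n 1) HB A1 N1 m Hr) as (k1 & m1 & S1 & K1 & V1 & F1).
    assert (R1 := rel_same _ _ _ _ _ (le_n 1) HB Hr F1).
    destruct (compR_ok P base s e2 2 _ H2 ltac:(auto) HB A2 N2 m1 R1) as (k2 & m2 & S2 & K2 & V2 & F2).
    assert (R2 := rel_same _ _ _ _ 2 ltac:(auto) HB R1 F2).
    exists (k1 + (k2 + 1))%nat, m2. split; [|split; [rewrite !length_app; simpl length; lia|exact R2]].
    eapply steps_trans; [exact S1|]. eapply steps_trans; [exact S2|].
    rewrite <- (F2 1%nat) in V1 by auto.
    apply codeat_cons in H. destruct H as [H _].
    unfold Rltb. destruct (Rlt_dec (evR e1 s) (evR e2 s)) as [Hlt|Hge].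
    + eapply steps_S; [eapply StJltT; [exact H|]|apply steps_0].
      now rewrite V1, V2.
    + eapply steps_S; [eapply StJltF; [exact H|]|].
      { now rewrite V1, V2. }
      rewrite !length_app. simpl length.
      match goal with |- steps _ (mkState ?x _) _ (mkState ?y _) => replace y with x by lia end.
      apply steps_0.
Qed.

(** The exit test of the counting loop behind [Ceil]: counting up from 0, the first [v] with
    [r < INR v] is [Z.to_nat (up r)], also when [r] is negative. *)
Lemma up_nonneg_spec r v : r < INR v <-> (Z.to_nat (up r) <= v)%nat.
Proof.
  destruct (archimed r) as [A1 A2]. rewrite INR_IZR_INZ. split; intros H.
  - assert (IZR (up r) < IZR (Z.of_nat v + 1)) by (rewrite plus_IZR; lra).
    apply lt_IZR in H0. lia.
  - apply Rlt_le_trans with (IZR (up r)); [lra|]. apply IZR_le. lia.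
Qed.

(** One unit of [cost] pays for [W] machine steps. Each unit covers one pass over pieces of the
    compiled text, whose whole length is at most [W]; in a loop, these pieces are the test, the
    increment and the jump back of one iteration. *)
Lemma compC_ok P base (HB : (TL <= base)%nat) W c : forall p s,
  codeat P p (compC c p) -> okC c = true -> (length (compC c p) <= W)%nat ->
  runs P base p (p + length (compC c p)) s (run c s) (W * cost c s).
Proof.
  assert (HAW : (0 < AW)%nat) by (unfold AW; lia).
  induction c as [|a i e|a i e|c1 IH1 c2 IH2|b c1 IH1 c2 IH2|v w c IH|v a];
    intros p s H Hok HW; cbn [compC okC run cost] in *.
  - intros m Hr. exists 0%nat, m. simpl. rewrite Nat.add_0_r. split; [apply steps_0|].
    split; [lia|auto].
  - apply andb_true_iff in Hok. destruct Hok as [Hok O3].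
    apply andb_true_iff in Hok. destruct Hok as [O1 O2]. apply Nat.ltb_lt in O1.
    eapply runs_weaken; [|apply comp_setn_ok; auto]. lia.
  - apply andb_true_iff in Hok. destruct Hok as [Hok O3].
    apply andb_true_iff in Hok. destruct Hok as [O1 O2]. apply Nat.ltb_lt in O1.
    eapply runs_weaken; [|apply comp_setr_ok; auto]. lia.
  - apply andb_true_iff in Hok. destruct Hok as [O1 O2].
    apply codeat_app in H. destruct H as [H1 H2].
    rewrite length_app in *. rewrite Nat.mul_add_distr_l, Nat.add_assoc.
    eapply runs_trans; [apply IH1; auto; lia|apply IH2; auto; lia].
  - apply andb_true_iff in Hok. destruct Hok as [Hok O3].
    apply andb_true_iff in Hok. destruct Hok as [O1 O2].
    set (q := (p + length (comp_test b p 0))%nat) in *.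
    set (l2 := compC c2 q) in *. set (r := (q + length l2 + 1)%nat) in *.
    apply codeat_app in H. destruct H as [H1 H].
    apply codeat_app in H. destruct H as [H2 H].
    rewrite (comp_test_length _ _ _ 0) in H2, H. fold q in H2, H.
    apply codeat_cons in H. destruct H as [H3 H4].
    replace (S (q + length l2)) with r in H4 by (unfold r; lia).
    rewrite !length_app, (comp_test_length _ _ _ 0) in *. simpl length in *.
    assert (HT := comp_test_ok P base s b p r H1 HB O1).
    rewrite (comp_test_length _ _ _ 0) in HT. fold q in HT.
    rewrite Nat.mul_succ_r.
    match goal with |- runs _ _ _ ?x _ _ _ => replace x with (r + length (compC c1 r))%nat
       by (unfold r, q; lia) end.
    destruct (evC b s).
    + eapply runs_weaken; [|eapply runs_trans; [exact HT|apply IH1; auto; lia]]. lia.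
    + eapply runs_weaken; [|eapply runs_trans; [exact HT|eapply runs_trans;
        [apply IH2; auto; unfold l2 in *; lia|apply runs_jmp; exact H3]]].
      lia.
  - apply andb_true_iff in Hok. destruct Hok as [Hok O6].
    apply andb_true_iff in Hok. destruct Hok as [Hok O5].
    apply andb_true_iff in Hok. destruct Hok as [Hok O4].
    apply andb_true_iff in Hok. destruct Hok as [Hok O3].
    apply andb_true_iff in Hok. destruct Hok as [O1 O2].
    apply Nat.ltb_lt in O1. apply Nat.ltb_lt in O2.
    apply negb_true_iff in O3. apply negb_true_iff in O4. apply negb_true_iff in O5.
    apply codeat_app in H. destruct H as [H0 H].
    set (l0 := comp_setn v (NC 0) (NC 0) p) in *.
    rewrite length_app in *. set (q := (p + length l0)%nat) in *.
    unfold comp_loop in H, HW |- *. set (b := CN (var v) (var w)) in *.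
    cbv zeta in H, HW |- *. set (lt := length (comp_test b q 0)) in *.
    set (r := (q + lt + 1)%nat) in *. set (l1 := compC c r) in *.
    set (l2 := comp_incr v (r + length l1)) in *.
    assert (Elt : forall l, length (comp_test b q l) = lt)
      by (intros; apply comp_test_length).
    apply codeat_app in H. destruct H as [H1 H]. rewrite Elt in H.
    apply codeat_cons in H. destruct H as [H2 H].
    replace (S (q + lt)) with r in H by (unfold r; lia).
    apply codeat_app in H. destruct H as [H H5].
    apply codeat_app in H. destruct H as [H3 H4].
    apply codeat_cons in H5. destruct H5 as [H5 _].
    rewrite length_app, Elt in HW |- *. cbn [length] in HW |- *.
    rewrite !length_app in HW |- *. cbn [length] in HW |- *. rewrite length_app in H2.
    match goal with |- runs _ _ _ ?x _ _ _ =>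
      replace x with (r + (length l1 + length l2) + 1)%nat by (unfold r, q; lia) end.
    assert (Hok1 : okN (NC 0) 1 = true) by reflexivity.
    assert (Hokv : okN (var v) 2 = true).
    { unfold okN. simpl. rewrite (proj2 (Nat.ltb_lt v AW) O1). reflexivity. }
    assert (Hb : okB b = true).
    { unfold b, okB, okN. simpl. rewrite (proj2 (Nat.ltb_lt v AW) O1), (proj2 (Nat.ltb_lt w AW) O2).
      reflexivity. }
    assert (Hi : okN (NAdd (var v) (NC 1)) 2 = true).
    { unfold okN. simpl. rewrite (proj2 (Nat.ltb_lt v AW) O1). reflexivity. }
    set (f := fun s0 : st => incr v (run c s0)).
    (* Induction on the iterations left; the counter plus this number equals the limit throughout,
       which decides the outcome of each test. *)
    assert (Hloop : forall n s, (na s v 0 + n = na s w 0)%nat ->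
      runs P base q (r + (length l1 + length l2) + 1) s (niter n f s)
        (W * niter_cost n f (fun s => S (cost c s)) s + (lt + 1))).
    { clear s. induction n as [|n IHn]; intros s Hn; cbn [niter niter_cost].
      - assert (HT := comp_test_ok P base s b q r H1 HB Hb).
        rewrite Elt in HT.
        replace (evC b s) with false in HT
          by (symmetry; unfold b; simpl; apply Nat.ltb_ge; lia).
        rewrite Nat.mul_0_r, Nat.add_0_l.
        eapply runs_trans; [exact HT|]. now apply runs_jmp.
      - assert (HT := comp_test_ok P base s b q r H1 HB Hb).
        rewrite Elt in HT.
        replace (evC b s) with true in HT
          by (symmetry; unfold b; simpl; apply Nat.ltb_lt; lia).
        assert (Hc := IH r s H3 O6 ltac:(fold l1; lia)). fold l1 in Hc.
        assert (Hinc := comp_setn_ok P base (run c s) v (NC 0) (NAdd (var v) (NC 1))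
                          (r + length l1) H4 HB O1 Hok1 Hi).
        change (comp_setn v (NC 0) (NAdd (var v) (NC 1)) (r + length l1)) with l2 in Hinc.
        simpl evN in Hinc. rewrite Nat.add_1_r in Hinc.
        assert (Hrest := IHn (f s)).
        assert (Hv : (na (f s) v 0 + n = na (f s) w 0)%nat).
        { unfold f, incr. simpl. unfold upd2. rewrite Nat.eqb_refl. simpl.
          rewrite (run_na c s v), (run_na c s w) by auto.
          rewrite Nat.eqb_sym, O3. simpl. lia. }
        specialize (Hrest Hv).
        assert (Hj := runs_jmp P base _ _ (f s) H5).
        rewrite length_app, Nat.add_assoc in Hj.
        eapply runs_weaken; [|eapply runs_trans; [exact HT|eapply runs_trans; [exact Hc|
          eapply runs_trans; [exact Hinc|eapply runs_trans; [exact Hj|exact Hrest]]]]].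
        nia. }
    assert (Hset := comp_setn_ok P base s v (NC 0) (NC 0) p H0 HB O1 Hok1 eq_refl).
    fold l0 q in Hset. simpl evN in Hset.
    eapply runs_weaken; [|eapply runs_trans; [exact Hset|apply Hloop]].
    + fold f. nia.
    + simpl. unfold upd2. rewrite !Nat.eqb_refl, (Nat.eqb_sym w v), O3. reflexivity.
  - apply andb_true_iff in Hok. destruct Hok as [O1 O2].
    apply Nat.ltb_lt in O1. apply Nat.ltb_lt in O2.
    apply codeat_app in H. destruct H as [H0 H].
    set (l0 := comp_setn v (NC 0) (NC 0) p) in *. set (q := (p + length l0)%nat) in *.
    set (b := CR (rvar a) (RN (var v))) in *.
    set (lt := length (comp_test b q 0)) in *.
    set (r := (q + lt)%nat) in *. set (l1 := comp_incr v r) in *.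
    assert (Elt : forall l, length (comp_test b q l) = lt)
      by (intros; apply comp_test_length).
    apply codeat_app in H. destruct H as [H1 H]. rewrite Elt in H. fold r in H.
    apply codeat_app in H. destruct H as [H2 H3].
    apply codeat_cons in H3. destruct H3 as [H3 _].
    rewrite !length_app, Elt in HW |- *. cbn [length] in HW |- *.
    match goal with |- runs _ _ _ ?x _ _ _ =>
      replace x with (r + length l1 + 1)%nat by (unfold r, q; lia) end.
    assert (Hok1 : okN (NC 0) 1 = true) by reflexivity.
    assert (Hb : okB b = true).
    { unfold b, okB, okR. simpl. rewrite (proj2 (Nat.ltb_lt v AW) O1), (proj2 (Nat.ltb_lt a AW) O2).
      reflexivity. }
    assert (Hi : okN (NAdd (var v) (NC 1)) 2 = true).
    { unfold okN. simpl. rewrite (proj2 (Nat.ltb_lt v AW) O1). reflexivity. }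
    assert (Eb : forall k, evC b (setn v 0 k s) = Rltb (ra s a 0%nat) (INR k)).
    { intros k. unfold b. simpl. unfold upd2. now rewrite Nat.eqb_refl. }
    set (N := Z.to_nat (up (ra s a 0%nat))).
    assert (Hloop : forall n k, (k + n = N)%nat ->
      runs P base q (r + length l1 + 1) (setn v 0 k s) (setn v 0 N s) (W * n + lt)).
    { induction n as [|n IHn]; intros k Hk;
        assert (HT := comp_test_ok P base (setn v 0 k s) b q _ H1 HB Hb);
        rewrite Elt in HT;
        rewrite Eb in HT; unfold Rltb in HT; destruct (Rlt_dec (ra s a 0%nat) (INR k)) as [Hd|Hd].
      - replace k with N in HT |- * by lia. rewrite Nat.mul_0_r. exact HT.
      - exfalso. apply Hd. apply up_nonneg_spec. fold N. lia.
      - exfalso. apply up_nonneg_spec in Hd. fold N in Hd. lia.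
      - fold r in HT.
        assert (Hinc := comp_setn_ok P base (setn v 0 k s) v (NC 0) (NAdd (var v) (NC 1))
                          r H2 HB O1 Hok1 Hi).
        change (comp_setn v (NC 0) (NAdd (var v) (NC 1)) r) with l1 in Hinc.
        simpl evN in Hinc. unfold upd2 at 1 in Hinc. rewrite Nat.eqb_refl in Hinc. simpl in Hinc.
        replace (setn v 0 (k + 1) (setn v 0 k s)) with (setn v 0 (S k) s) in Hinc.
        2:{ unfold setn. simpl. f_equal. apply functional_extensionality; intros x.
            apply functional_extensionality; intros y. unfold upd2.
            destruct (Nat.eqb x v && Nat.eqb y 0); auto. lia. }
        eapply runs_weaken; [|eapply runs_trans; [exact HT|eapply runs_trans; [exact Hinc|
          eapply runs_trans; [apply runs_jmp; exact H3|apply IHn; lia]]]].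
        change 16%nat with (length l1). nia. }
    assert (Hset := comp_setn_ok P base s v (NC 0) (NC 0) p H0 HB O1 Hok1 eq_refl).
    fold l0 q in Hset. simpl evN in Hset.
    eapply runs_weaken; [|eapply runs_trans; [exact Hset|apply (Hloop N 0%nat); lia]].
    fold N. nia.
Qed.

(** * Relocating the input *)

(* Offset in the virtual store of input cell [j >= 2]: column 13 holds [c], column 15
   holds [C], and coordinate [f] of point [i] is the virtual cell [ra f i]. *)
Definition off (j : nat) : nat :=
  if Nat.eqb j 2 then 13 else if Nat.eqb j 3 then 15
  else FW * ((j - 4) / 5) + 2 * ((j - 4) mod 5) + 1.

Lemma off_point i f : (f < 5)%nat -> off (4 + 5 * i + f) = (FW * i + 2 * f + 1)%nat.
Proof.
  intros Hf. unfold off.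
  destruct (Nat.eqb_spec (4 + 5 * i + f) 2); [lia|].
  destruct (Nat.eqb_spec (4 + 5 * i + f) 3); [lia|].
  replace (4 + 5 * i + f - 4)%nat with (f + i * 5)%nat by lia.
  rewrite Nat.div_add, Nat.Div0.mod_add, Nat.div_small, Nat.mod_small by lia. lia.
Qed.

Lemma off_cases j : (2 <= j)%nat ->
  (j = 2%nat /\ off j = 13%nat) \/ (j = 3%nat /\ off j = 15%nat) \/
  exists i f, (f < 5)%nat /\ j = (4 + 5 * i + f)%nat /\ off j = (FW * i + 2 * f + 1)%nat.
Proof.
  intros Hj. destruct (Nat.eq_dec j 2) as [->|N2]; [left; auto|].
  destruct (Nat.eq_dec j 3) as [->|N3]; [right; left; auto|].
  right; right. exists ((j - 4) / 5)%nat, ((j - 4) mod 5)%nat.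
  assert (Hm := Nat.mod_upper_bound (j - 4) 5 ltac:(lia)).
  assert (Hd := Nat.div_mod_eq (j - 4) 5).
  split; auto. split; [lia|].
  rewrite <- off_point by auto. f_equal. lia.
Qed.

Lemma off_inj j j' : (2 <= j)%nat -> (2 <= j')%nat -> off j = off j' -> j = j'.
Proof.
  intros H H' E.
  destruct (off_cases j H) as [[-> E1]|[[-> E1]|(i & f & Hf & -> & E1)]];
  destruct (off_cases j' H') as [[-> E2]|[[-> E2]|(i' & f' & Hf' & -> & E2)]];
  rewrite ?E1, ?E2 in E; unfold FW in E; lia.
Qed.

(** Odd offsets belong to real entries, so the copied input never hits an entry for naturals. Offset
    11 is reserved for [eps]. *)
Lemma off_odd j : (2 <= j)%nat -> (off j mod 2 = 1)%nat /\ off j <> 11%nat.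
Proof.
  intros H. destruct (off_cases j H) as [[-> E1]|[[-> E1]|(i & f & Hf & -> & E1)]];
    rewrite E1; [split; [reflexivity|lia]|split; [reflexivity|lia]|].
  unfold FW. split; [|lia].
  replace (128 * i + 2 * f + 1)%nat with (1 + (64 * i + f) * 2)%nat by lia.
  rewrite Nat.Div0.mod_add. reflexivity.
Qed.

Lemma off_pos j : (2 <= j)%nat -> (0 < off j)%nat.
Proof.
  intros H. destruct (off_odd j H) as [E _].
  destruct (off j) as [|o]; [discriminate|lia].
Qed.

(** Cell 1 is the only scratch cell at this point, so the base pointer itself travels to the
    destination and back. *)
Definition save_cell (j : nat) : list instr :=
  IConst 1 (off j) :: IAdd 0 0 1 :: IStore 0 j :: ISub 0 0 1 :: nil.

Fixpoint save_cells (j k : nat) : list instr :=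
  match k with O => nil | S k => save_cell j ++ save_cells (S j) k end.

Definition move_cell : list instr :=
  ILoad 6 4 :: IStore 5 6 :: IConst 7 1 :: IAdd 4 4 7 :: IConst 7 2 :: IAdd 5 5 7 :: nil.

Fixpoint move_cells (k : nat) : list instr :=
  match k with O => nil | S k => move_cell ++ move_cells k end.

(** Five doublings of cell 0 reach [32 n] with no scratch cell, none being free yet. The factor 32
    places the base beyond the input and beyond the cells below 34 that are saved before the loop;
    with 16 this would fail at [n = 2]. Parking [eps] at the base frees cell 1. *)
Definition grow_code : list instr :=
  IAdd 0 0 0 :: IAdd 0 0 0 :: IAdd 0 0 0 :: IAdd 0 0 0 :: IAdd 0 0 0 :: IStore 0 1 :: nil.

(** [eps] moves to its final offset 11 = 2 * 5 + 1, and [n], recovered as the base divided by 32,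
    takes its place. The copying loop will start at point 6: source 34 = 4 + 5 * 6, destination
    offset 769 = 128 * 6 + 1. *)
Definition mid_code : list instr :=
  ILoad 1 0 :: IConst 2 11 :: IAdd 2 2 0 :: IStore 2 1 :: IConst 2 32 :: IDiv 2 0 2
  :: IStore 0 2 :: IConst 3 6 :: IConst 4 34 :: IConst 5 769 :: IAdd 5 5 0 :: nil.

(** Five copies advance the destination by 10, and 118 more complete the stride 128 of a frame. The
    loop occupies 37 instructions. *)
Definition move_loop (p : nat) : list instr :=
  (IJlt 3 2 (p + 2) :: IJmp (p + 37) :: nil) ++ move_cells 5 ++
  (IConst 7 118 :: IAdd 5 5 7 :: IConst 7 1 :: IAdd 3 3 7 :: IJmp p :: nil).

(** The 32 cells from 2 to 33 include all temporaries still holding input and end exactly with point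
    5, so what remains starts at a point boundary. The loop sits at address 145 = 6 + 4 * 32 +
    11. *)
Definition prologue : list instr :=
  grow_code ++ save_cells 2 32 ++ mid_code ++ move_loop 145.

Section Relocation.
Variables (P : program) (n : nat) (inp : nat -> R).
Hypothesis Hn : (2 <= n)%nat.
Hypothesis inp_0 : inp 0%nat = INR n.
Hypothesis inp_far : forall j, (5 * n + 4 <= j)%nat -> inp j = 0.

Let base := (32 * n)%nat.

(* Input cells [2 <= j < q] have been copied to their virtual place and cells from
   [q] on are still intact. *)
Definition saved (q : nat) (m : nat -> R) : Prop :=
  m 0%nat = INR base /\
  (forall j, (q <= j < base)%nat -> m j = inp j) /\
  (forall j, (2 <= j)%nat -> m (base + off j)%nat = if Nat.ltb j q then inp j else 0) /\
  (forall o, (o <> 0)%nat -> (o <> 11)%nat -> (forall j, (2 <= j)%nat -> off j <> o) ->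
     m (base + o)%nat = 0).

Lemma saved_upd_low q m d v : (0 < d < q)%nat -> (d < base)%nat ->
  saved q m -> saved q (upd m d v).
Proof.
  intros Hd Hb (S0 & S1 & S2 & S3). repeat split.
  - rewrite upd_neq by lia. auto.
  - intros j Hj. rewrite upd_neq by lia. auto.
  - intros j Hj. rewrite upd_neq by lia. auto.
  - intros o Ho Ho' Hoff. rewrite upd_neq by lia. auto.
Qed.

Lemma saved_store q m m' : (2 <= q)%nat -> saved q m ->
  (forall j, (j < base)%nat -> m' j = m j) ->
  (forall o, m' (base + o)%nat = if Nat.eqb o (off q) then inp q else m (base + o)%nat) ->
  saved (S q) m'.
Proof.
  intros Hq (S0 & S1 & S2 & S3) HL HH. repeat split.
  - rewrite HL; auto. unfold base; lia.
  - intros j Hj. rewrite HL by lia. apply S1. lia.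
  - intros j Hj. rewrite HH. destruct (Nat.eqb_spec (off j) (off q)) as [E|E].
    + apply off_inj in E; auto. subst. now rewrite (proj2 (Nat.ltb_lt q (S q))) by lia.
    + rewrite S2 by auto. destruct (Nat.ltb_spec j q), (Nat.ltb_spec j (S q)); auto; try lia.
      assert (j = q) by lia. subst. congruence.
  - intros o Ho Ho' Hoff. rewrite HH. destruct (Nat.eqb_spec o (off q)) as [->|E].
    + exfalso. now apply (Hoff q).
    + apply S3; auto.
Qed.

Lemma saved_upd q m : (2 <= q)%nat -> saved q m ->
  saved (S q) (upd m (base + off q) (inp q)).
Proof.
  intros Hq HS. apply (saved_store q m); auto.
  - intros j Hj. apply upd_neq. lia.
  - intros o. unfold upd.
    destruct (Nat.eqb_spec (base + o) (base + off q)), (Nat.eqb_spec o (off q)); auto; lia.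
Qed.

Lemma inp_at_base q m j : saved q m -> (q <= j)%nat -> (2 <= j < 34)%nat -> m j = inp j.
Proof. intros (S0 & S1 & _) Hq Hj. apply S1. unfold base. lia. Qed.

Lemma save_cell_ok p q m : codeat P p (save_cell q) -> (2 <= q < 34)%nat -> saved q m ->
  exists m', steps P (mkState p m) 4 (mkState (p + 4) m') /\ saved (S q) m' /\
    m' base = m base.
Proof.
  intros H Hq HS. assert (Hb : (64 <= base)%nat) by (unfold base; lia).
  assert (Hinp := inp_at_base q m q HS (le_n q) Hq).
  assert (S0 := proj1 HS). assert (Ho := off_pos q ltac:(lia)).
  eexists. split; [|split].
  - one H 0%nat. one H 1%nat.
    eapply steps_S; [eapply (StStore _ _ _ _ _ (base + off q)); [eapply (fetch _ _ _ 2 _ _ H); [reflexivity|lia]|]|].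
    { upds. rewrite S0, plus_INR. ring. }
    one H 3%nat. replace (p + 4)%nat with (S (S (S (S p)))) by lia. apply steps_0.
  - apply (saved_store q (upd m 1 (INR (off q)))); [lia|apply saved_upd_low; auto; lia| |].
    + intros j Hj. unfold upd. destruct (Nat.eqb_spec j 0) as [->|N0].
      * destruct (Nat.eqb_spec 0 (base + off q)); [lia|].
        destruct (Nat.eqb_spec 1 (base + off q)); [lia|].
        simpl. ring.
      * destruct (Nat.eqb_spec j (base + off q)); [lia|].
        destruct (Nat.eqb_spec j 1); [auto|].
        destruct (Nat.eqb_spec j 0); [lia|auto].
    + intros o. unfold upd. destruct (Nat.eqb_spec (base + o) 0); [lia|].
      destruct (Nat.eqb_spec (base + o) (base + off q)), (Nat.eqb_spec o (off q)); try lia.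
      * destruct (Nat.eqb_spec q 0); [lia|]. destruct (Nat.eqb_spec q 1); [lia|auto].
      * destruct (Nat.eqb_spec (base + o) 0); [lia|auto].
  - upds. auto.
Qed.

Lemma save_cells_ok k : forall p q m, codeat P p (save_cells q k) ->
  (2 <= q)%nat -> (q + k <= 34)%nat -> saved q m ->
  exists m', steps P (mkState p m) (4 * k) (mkState (p + 4 * k) m') /\ saved (q + k) m' /\
    m' base = m base.
Proof.
  induction k as [|k IH]; intros p q m H Hq Hk HS; cbn [save_cells] in H.
  - exists m. replace (p + 4 * 0)%nat with p by lia. replace (q + 0)%nat with q by lia.
    split; [apply steps_0|auto].
  - apply codeat_app in H. destruct H as [H1 H2].
    destruct (save_cell_ok p q m H1 ltac:(lia) HS) as (m1 & T1 & HS1 & B1).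
    destruct (IH _ (S q) m1 H2 ltac:(lia) ltac:(lia) HS1) as (m2 & T2 & HS2 & B2).
    exists m2. replace (4 * S k)%nat with (4 + 4 * k)%nat by lia.
    replace (p + (4 + 4 * k))%nat with (p + 4 + 4 * k)%nat by lia.
    split; [eapply steps_trans; eauto|]. split; [|congruence].
    now replace (q + S k)%nat with (S q + k)%nat by lia.
Qed.

(* State of the copying loop: [m 4] points to the next source cell, [m 5] to its
   destination [base + d]. *)
Definition moving (i q d : nat) (m : nat -> R) : Prop :=
  saved q m /\ m base = INR n /\ m (base + 11)%nat = inp 1%nat /\
  m 2%nat = INR n /\ m 3%nat = INR i /\ m 4%nat = INR q /\ m 5%nat = INR (base + d).

Lemma move_cell_ok p i q m : codeat P p move_cell -> (34 <= q < 5 * n + 4)%nat ->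
  moving i q (off q) m ->
  exists m', steps P (mkState p m) 6 (mkState (p + 6) m') /\ moving i (S q) (off q + 2) m'.
Proof.
  intros H Hq (HS & Hbase & Heps & H2 & H3 & H4 & H5).
  assert (Hb : (64 <= base)%nat) by (unfold base; lia).
  assert (Hqb : (q < base)%nat) by (unfold base; lia).
  assert (Ho := off_pos q ltac:(lia)).
  assert (H11 := proj2 (off_odd q ltac:(lia))).
  assert (Hinp : m q = inp q) by (apply HS; lia).
  eexists. split.
  - eapply steps_S; [eapply (StLoad _ _ _ _ _ q); [eapply (fetch _ _ _ 0 _ _ H); [reflexivity|lia]|exact H4]|].
    eapply steps_S; [eapply (StStore _ _ _ _ _ (base + off q)); [eapply (fetch _ _ _ 1 _ _ H); [reflexivity|lia]|]|].
    { upds. exact H5. }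
    one H 2%nat. one H 3%nat. one H 4%nat. one H 5%nat.
    replace (p + 6)%nat with (S (S (S (S (S (S p)))))) by lia. apply steps_0.
  - split; [|repeat split; upds; auto].
    + repeat (apply saved_upd_low; [lia|lia|]).
      rewrite upd_eq, Hinp. apply saved_upd; [lia|]. apply saved_upd_low; auto; lia.
    + rewrite H4, (S_INR q). reflexivity.
    + rewrite H5, Nat.add_assoc, (plus_INR _ 2). reflexivity.
Qed.

Lemma move_cells_ok k : forall p i f m, codeat P p (move_cells k) -> (f + k <= 5)%nat ->
  (6 <= i < n)%nat -> moving i (4 + 5 * i + f) (FW * i + 2 * f + 1) m ->
  exists m', steps P (mkState p m) (6 * k) (mkState (p + 6 * k) m') /\
    moving i (4 + 5 * i + (f + k)) (FW * i + 2 * (f + k) + 1) m'.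
Proof.
  induction k as [|k IH]; intros p i f m H Hk Hi HM; cbn [move_cells] in H.
  - exists m. replace (p + 6 * 0)%nat with p by lia. rewrite Nat.add_0_r.
    split; [apply steps_0|auto].
  - apply codeat_app in H. destruct H as [H1 H2].
    rewrite <- off_point in HM by lia.
    destruct (move_cell_ok p i (4 + 5 * i + f) m H1 ltac:(lia) HM) as (m1 & T1 & HM1).
    rewrite off_point in HM1 by lia.
    destruct (IH _ i (S f) m1 H2 ltac:(lia) Hi) as (m2 & T2 & HM2).
    { replace (4 + 5 * i + S f)%nat with (S (4 + 5 * i + f)) by lia.
      replace (FW * i + 2 * S f + 1)%nat with (FW * i + 2 * f + 1 + 2)%nat by lia. exact HM1. }
    exists m2. replace (6 * S k)%nat with (6 + 6 * k)%nat by lia.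
    replace (p + (6 + 6 * k))%nat with (p + 6 + 6 * k)%nat by lia.
    split; [eapply steps_trans; eauto|].
    now replace (f + S k)%nat with (S f + k)%nat by lia.
Qed.

Lemma move_loop_ok p k : forall i m, codeat P p (move_loop p) -> (6 <= i)%nat ->
  (n <= i + k)%nat -> moving i (4 + 5 * i) (FW * i + 1) m ->
  exists j i' m', steps P (mkState p m) j (mkState (p + 37) m') /\ (j <= 36 * k + 2)%nat /\
    (n <= i')%nat /\ (6 <= i')%nat /\ moving i' (4 + 5 * i') (FW * i' + 1) m'.
Proof.
  assert (Hb : (64 <= base)%nat) by (unfold base; lia).
  induction k as [|k IH]; intros i m H Hi Hk HM; assert (HC := H);
    unfold move_loop in H; apply codeat_app in H; destruct H as [H1 H2];
    apply codeat_app in H2; destruct H2 as [H2 H3]; simpl length in H2, H3;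
    assert (HM' := HM); destruct HM' as (HS & Hbase & Heps & M2 & M3 & M4 & M5);
    destruct (Nat.lt_ge_cases i n) as [Hin|Hin]; [lia| | |].
  - exists 2%nat, i, m. split; [|split; [lia|auto]].
    eapply steps_S; [eapply StJltF; [eapply (fetch _ _ _ 0 _ _ H1); [reflexivity|lia]|]|].
    { rewrite M2, M3. apply Rle_not_lt. now apply le_INR. }
    one H1 1%nat. apply steps_0.
  - replace (4 + 5 * i)%nat with (4 + 5 * i + 0)%nat in HM by lia.
    replace (FW * i + 1)%nat with (FW * i + 2 * 0 + 1)%nat in HM by lia.
    destruct (move_cells_ok 5 _ i 0 m H2 ltac:(lia) ltac:(lia) HM) as (m1 & T1 & HM1).
    destruct HM1 as (HS1 & Hbase1 & Heps1 & N2 & N3 & N4 & N5).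
    edestruct (IH (S i)) as (j & i' & m' & T2 & Hj & Hi' & Hi6 & HM2); [exact HC|lia|lia| |].
    2:{ exists (1 + (6 * 5 + (5 + j)))%nat, i', m'. split; [|split; [lia|auto]].
        eapply (steps_trans _ _ 1).
        { eapply steps_S; [eapply StJltT; [eapply (fetch _ _ _ 0 _ _ H1); [reflexivity|lia]|]|apply steps_0].
          rewrite M2, M3. now apply lt_INR. }
        eapply steps_trans; [exact T1|].
        eapply (steps_trans _ _ 5); [|exact T2].
        one H3 0%nat. one H3 1%nat. one H3 2%nat. one H3 3%nat. one H3 4%nat. apply steps_0. }
    split; [|repeat split; upds; auto].
    + repeat (apply saved_upd_low; [lia|lia|]).
      now replace (4 + 5 * S i)%nat with (4 + 5 * i + (0 + 5))%nat by lia.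
    + rewrite N3, (S_INR i). reflexivity.
    + rewrite N4. f_equal. lia.
    + rewrite N5, <- plus_INR. f_equal. unfold FW. lia.
  - exists 2%nat, i, m. split; [|split; [lia|auto]].
    eapply steps_S; [eapply StJltF; [eapply (fetch _ _ _ 0 _ _ H1); [reflexivity|lia]|]|].
    { rewrite M2, M3. apply Rle_not_lt. now apply le_INR. }
    one H1 1%nat. apply steps_0.
Qed.

Definition relocated : st :=
  mkSt (fun a i => if Nat.eqb a 0 && Nat.eqb i 0 then n else 0%nat)
       (fun a i => if Nat.ltb a 5 then inp (4 + 5 * i + a)%nat
                   else if negb (Nat.eqb i 0) then 0
                   else if Nat.eqb a 5 then inp 1%nat
                   else if Nat.eqb a 6 then inp 2%nat
                   else if Nat.eqb a 7 then inp 3%nat else 0).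

Lemma relocated_rel i m : (n <= i)%nat -> (6 <= i)%nat -> saved (4 + 5 * i) m ->
  m base = INR n -> m (base + 11)%nat = inp 1%nat -> rel base relocated m.
Proof.
  intros Hi Hi6 (S0 & S1 & S2 & S3) Hbase Heps. repeat split; auto.
  - intros a k Ha. simpl na.
    destruct (Nat.eqb_spec a 0) as [->|Na]; destruct (Nat.eqb_spec k 0) as [->|Nk]; simpl andb; cbv iota.
    { replace (base + FW * 0 + 2 * 0)%nat with base by lia. exact Hbase. }
    all: rewrite <- Nat.add_assoc; apply S3; unfold FW; try lia.
    all: intros j Hj E; destruct (off_odd j Hj) as [E1 _]; rewrite E in E1;
      match type of E1 with (?x mod 2 = 1)%nat =>
        assert (E2 := Nat.div_mod_eq x 2); rewrite E1 in E2; lia end.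
  - intros a k Ha. simpl ra. unfold AW in Ha.
    destruct (Nat.ltb_spec a 5) as [H5|H5].
    { replace (base + FW * k + S (2 * a))%nat with (base + off (4 + 5 * k + a))%nat
        by (rewrite off_point by auto; lia).
      (* Frames past the copied points hold 0, in agreement with the zeros that follow the input. *)
      rewrite S2 by lia. destruct (Nat.ltb_spec (4 + 5 * k + a) (4 + 5 * i)); auto.
      symmetry. apply inp_far. lia. }
    assert (Hz : (k <> 0 \/ 8 <= a)%nat -> m (base + FW * k + S (2 * a))%nat = 0).
    { intros Hc. rewrite <- Nat.add_assoc. apply S3; unfold FW; try lia.
      intros j Hj E. destruct (off_cases j Hj) as [[-> E1]|[[-> E1]|(i' & f & Hf & -> & E1)]];
      rewrite E1 in E; unfold FW in E; lia. }
    destruct (Nat.eqb_spec k 0) as [->|Nk]; simpl negb; cbv iota; [|apply Hz; auto].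
    destruct (Nat.eqb_spec a 5) as [->|N5].
    { replace (base + FW * 0 + S (2 * 5))%nat with (base + 11)%nat by lia. exact Heps. }
    destruct (Nat.eqb_spec a 6) as [->|N6].
    { replace (base + FW * 0 + S (2 * 6))%nat with (base + off 2)%nat by (unfold off; simpl; lia).
      rewrite S2 by lia. now rewrite (proj2 (Nat.ltb_lt 2 (4 + 5 * i))) by lia. }
    destruct (Nat.eqb_spec a 7) as [->|N7].
    { replace (base + FW * 0 + S (2 * 7))%nat with (base + off 3)%nat by (unfold off; simpl; lia).
      rewrite S2 by lia. now rewrite (proj2 (Nat.ltb_lt 3 (4 + 5 * i))) by lia. }
    apply Hz. lia.
Qed.

Lemma prologue_ok : codeat P 0 prologue ->
  exists k m', steps P (mkState 0 inp) k (mkState (length prologue) m') /\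
    (k <= 36 * n + 147)%nat /\ rel base relocated m'.
Proof.
  intros H. assert (Hb : (64 <= base)%nat) by (unfold base; lia).
  unfold prologue in H. apply codeat_app in H. destruct H as [H1 H].
  apply codeat_app in H. destruct H as [H2 H].
  apply codeat_app in H. destruct H as [H3 H4].
  simpl length in H2, H3, H4.
  assert (T1 : exists m1, steps P (mkState 0 inp) 6 (mkState 6 m1) /\ saved 2 m1 /\
             m1 base = inp 1%nat).
  { eexists. split.
    - one H1 0%nat. one H1 1%nat. one H1 2%nat. one H1 3%nat. one H1 4%nat.
      eapply steps_S; [eapply (StStore _ _ _ _ _ base); [eapply (fetch _ _ _ 5 _ _ H1); [reflexivity|lia]|]|apply steps_0].
      rewrite !upd_eq, inp_0. unfold base. rewrite mult_INR. simpl. ring.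
    - split.
      + repeat split.
        * rewrite upd_neq by lia. rewrite !upd_eq, inp_0. unfold base. rewrite mult_INR.
          simpl. ring.
        * intros j Hj. upds. auto.
        * intros j Hj. assert (Ho := off_pos j Hj). upds.
          rewrite inp_far by (unfold base; lia).
          destruct (Nat.ltb_spec j 2); [lia|auto].
        * intros o Ho Ho' Hoff. upds. apply inp_far. unfold base; lia.
      + upds. auto. }
  destruct T1 as (m1 & T1 & SV1 & B1).
  destruct (save_cells_ok 32 _ 2 m1 H2 ltac:(lia) ltac:(lia) SV1) as (m2 & T2 & SV2 & B2).
  assert (T3 : exists m3, steps P (mkState 134 m2) 11 (mkState 145 m3) /\
             moving 6 34 (FW * 6 + 1) m3).
  { assert (S0 := proj1 SV2). eexists. split.
    - eapply steps_S; [eapply (StLoad _ _ _ _ _ base); [eapply (fetch _ _ _ 0 _ _ H3); [reflexivity|simpl; lia]|exact S0]|].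
      one H3 1%nat. one H3 2%nat.
      eapply steps_S; [eapply (StStore _ _ _ _ _ (base + 11)); [eapply (fetch _ _ _ 3 _ _ H3); [reflexivity|lia]|]|].
      { upds. rewrite S0, Nat.add_comm, plus_INR. simpl. ring. }
      one H3 4%nat.
      eapply steps_S; [eapply StDiv; [eapply (fetch _ _ _ 5 _ _ H3); [reflexivity|lia]|]|].
      { upds. apply not_0_INR. lia. }
      eapply steps_S; [eapply (StStore _ _ _ _ _ base); [eapply (fetch _ _ _ 6 _ _ H3); [reflexivity|lia]|]|].
      { upds. exact S0. }
      one H3 7%nat. one H3 8%nat. one H3 9%nat. one H3 10%nat. apply steps_0.
    - assert (Hdiv : INR base / INR 32 = INR n).
      { unfold base. rewrite mult_INR. field. apply not_0_INR. lia. }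
      split; [|repeat split; upds; auto].
      + destruct SV2 as (_ & U1 & U2 & U3). repeat split.
        * upds. exact S0.
        * intros j Hj. upds. apply U1. lia.
        * intros j Hj. assert (Ho := off_pos j Hj). destruct (off_odd j Hj) as [_ Ho'].
          upds. apply U2; auto.
        * intros o Ho Ho' Hoff. upds. apply U3; auto.
      + rewrite S0. exact Hdiv.
      + congruence.
      + rewrite S0. exact Hdiv.
      + rewrite S0, Nat.add_comm, plus_INR. reflexivity. }
  destruct T3 as (m3 & T3 & M3).
  destruct (move_loop_ok 145 n 6 m3 H4 ltac:(lia) ltac:(lia) M3) as (j & i & m4 & T4 & Hj & Hi & H6 & M4).
  exists (6 + (4 * 32 + (11 + j)))%nat, m4. split; [|split; [lia|]].
  - eapply steps_trans; [exact T1|]. eapply steps_trans; [exact T2|].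
    eapply steps_trans; [exact T3|]. exact T4.
  - destruct M4 as (SV & Hbase & Heps & _).
    eapply relocated_rel; eauto.
Qed.
End Relocation.

(** * From commands to machine programs *)

Lemma codeat_sub l1 l2 l3 : codeat (l1 ++ l2 ++ l3) (length l1) l2.
Proof.
  intros i x H. rewrite nth_error_app2 by lia.
  replace (length l1 + i - length l1)%nat with i by lia.
  rewrite nth_error_app1; auto. apply nth_error_Some. congruence.
Qed.

(** [W] depends on the program text alone, and the summand [n] pays for moving the input. At the end
    the result is added to a zero into cell 0, the machine having no plain move. *)
Lemma ram_of_cmd c o : okC c = true -> (o < AW)%nat ->
  exists (P : program) (W : nat), forall n inp, (2 <= n)%nat -> inp 0%nat = INR n ->
    (forall j, (5 * n + 4 <= j)%nat -> inp j = 0) ->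
    exists k, exec P (mkState 0 inp) k (ra (run c (relocated n inp)) o 0%nat) /\
      (k <= W * (n + cost c (relocated n inp) + 1))%nat.
Proof.
  intros Hok Ho.
  set (l1 := prologue). set (l2 := compC c (length l1)).
  set (q := (length l1 + length l2)%nat). set (l3 := compR (rvar o) 1 q).
  set (l4 := IConst 2 0 :: IAdd 0 1 2 :: IHalt :: nil).
  exists (l1 ++ l2 ++ l3 ++ l4), (200 + length l2 + length l3)%nat.
  set (P := l1 ++ l2 ++ l3 ++ l4).
  intros n inp Hn H0 Hfar.
  assert (HB : (TL <= 32 * n)%nat) by (unfold TL; lia).
  assert (C1 : codeat P 0 l1).
  { intros i x H. simpl. unfold P. rewrite nth_error_app1; auto. apply nth_error_Some. congruence. }
  assert (C2 : codeat P (length l1) l2) by apply codeat_sub.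
  assert (C3 : codeat P q l3).
  { unfold P, q. rewrite app_assoc, <- length_app. apply codeat_sub. }
  assert (C4 : codeat P (q + length l3) l4).
  { unfold P, q. rewrite <- !length_app.
    replace (l1 ++ l2 ++ l3 ++ l4) with ((((l1 ++ l2) ++ l3) ++ l4 ++ nil))
      by (rewrite app_nil_r, !app_assoc; reflexivity).
    apply codeat_sub. }
  destruct (prologue_ok P n inp Hn H0 Hfar C1) as (k1 & m1 & T1 & K1 & R1).
  destruct (compC_ok P (32 * n) HB (200 + length l2 + length l3) c (length l1)
              (relocated n inp) C2 Hok ltac:(fold l2; lia) m1 R1) as (k2 & m2 & T2 & K2 & R2).
  fold l2 q in T2.
  assert (HA : arrR (rvar o) = true).
  { simpl. rewrite (proj2 (Nat.ltb_lt o AW) Ho). reflexivity. }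
  destruct (compR_ok P (32 * n) (run c (relocated n inp)) (rvar o) 1 q C3 (le_n 1) HB HA
              ltac:(simpl; unfold TL; lia) m2 R2) as (k3 & m3 & T3 & K3 & V3 & F3).
  fold l3 in T3, K3.
  eexists. split.
  - eapply steps_exec; [exact T1|]. eapply steps_exec; [exact T2|].
    eapply steps_exec; [exact T3|].
    eapply ExStep; [apply StConst; eapply (fetch _ _ _ 0 _ _ C4); [reflexivity|lia]|].
    eapply ExStep; [apply StAdd; eapply (fetch _ _ _ 1 _ _ C4); [reflexivity|lia]|].
    match goal with |- exec _ (mkState ?pc ?mm) _ _ =>
      assert (E : ra (run c (relocated n inp)) o 0%nat = mm 0%nat) end.
    { rewrite upd_eq, upd_eq. rewrite upd_neq by lia. rewrite V3. simpl. ring. }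
    rewrite E. apply ExHalt. eapply (fetch _ _ _ 2 _ _ C4); [reflexivity|lia].
  - nia.
Qed.

(** * The program *)

Notation "c1 ;; c2" := (Seq c1 c2) (at level 61, right associativity).

(* Arrays 0-15 of naturals: n, number of time thresholds, k0, k0+1, k0+3, number and
   depth of the leaves, number of slopes, a lower bound
   for its square, n+1, n+2, x-ranks, y-ranks,
   points sorted by y, flags marking the first point of each y-class, parents.
   Arrays 0-9 of reals: x, y, m, b, t, eps, c, C, M, B. *)
Notation vn := (var 0). Notation vtn := (var 1). Notation vk := (var 2).
Notation vNN := (var 5). Notation vNp := (var 7). Notation vN1 := (var 8).
Notation RX e := (NG 11 e). Notation RY e := (NG 12 e). Notation YS e := (NG 13 e).
Notation VF e := (NG 14 e). Notation PAR e := (NG 15 e).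
Notation vbest := (rvar 10).

(** Reals 13 and 14 are the running sums of [m] and [b] over the current region. The four tests let
    exactly the admissible pairs through, so for [C > 0] the logarithms only meet positive
    arguments. *)
Definition eval_cmd : cmd :=
  SetR 15 (NC 0) (RDiv (rvar 13) (rvar 8)) ;;
  SetR 16 (NC 0) (RDiv (rvar 14) (rvar 9)) ;;
  SetR 17 (NC 0) (RDiv (rvar 7) (RN vn)) ;;
  If (CR (rvar 15) (rvar 17)) Skip
  (If (CR (RSub (RN (NC 1)) (rvar 17)) (rvar 15)) Skip
  (If (CR (rvar 16) (rvar 17)) Skip
  (If (CR (RSub (RN (NC 1)) (rvar 17)) (rvar 16)) Skip
  (SetR 18 (NC 0)
     (RMul (rvar 6)
        (RAdd (RMul (rvar 16) (RLn (RDiv (rvar 16) (rvar 15))))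
              (RMul (RSub (RN (NC 1)) (rvar 16))
                    (RLn (RDiv (RSub (RN (NC 1)) (rvar 16))
                               (RSub (RN (NC 1)) (rvar 15))))))) ;;
   If (CR vbest (rvar 18)) (SetR 10 (NC 0) (rvar 18)) Skip)))).

Definition clear_cmd : cmd :=
  For 22 0 (SetR 11 (var 22) (RN (NC 0)) ;; SetR 12 (var 22) (RN (NC 0)) ;;
            SetN 24 (var 22) (NC 0)).

Definition fill_cmd : cmd :=
  For 23 0 (
    If (CN (RY (var 23)) (var 20)) Skip
    (If (CN (var 21) (RY (var 23))) Skip
    (If (CR (RG 4 (var 23)) (rvar 19)) Skip
    (SetR 11 (RX (var 23)) (RAdd (RG 11 (RX (var 23))) (RG 2 (var 23))) ;;
     SetR 12 (RX (var 23)) (RAdd (RG 12 (RX (var 23))) (RG 3 (var 23))) ;;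
     SetN 24 (RX (var 23)) (NAdd (NG 24 (RX (var 23))) (NC 1)))))).

(** Filled from right to left. The table lets a scan jump over empty x-ranks, so that every advance
    takes in at least one point; entry [n] is a sentinel. *)
Definition next_cmd : cmd :=
  SetN 25 vn vn ;;
  For 22 0 (
    SetN 29 (NC 0) (NSub (NSub vn (NC 1)) (var 22)) ;;
    If (CN (NC 0) (NG 24 (var 29)))
      (SetN 25 (var 29) (var 29))
      (SetN 25 (var 29) (NG 25 (NAdd (var 29) (NC 1))))).

Definition advance_cmd : cmd :=
  eval_cmd ;;
  SetN 29 (NC 0) (NG 25 (var 28)) ;;
  If (CN (var 29) vn)
    (SetR 13 (NC 0) (RAdd (rvar 13) (RG 11 (var 29))) ;;
     SetR 14 (NC 0) (RAdd (rvar 14) (RG 12 (var 29))) ;;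
     SetN 28 (NC 0) (NAdd (var 29) (NC 1)))
    Skip.

(** After [lim] advances, every region with the current left rank and fewer than that many points
    has been evaluated. The limit is array 2, holding [k0], for the small regions, and array 9,
    holding [n + 1] and thus exceeding every count, for the wide strips. *)
Definition scan_cmd (lim : nat) : cmd :=
  For 26 0 (
    SetN 28 (NC 0) (var 26) ;;
    SetR 13 (NC 0) (RN (NC 0)) ;; SetR 14 (NC 0) (RN (NC 0)) ;;
    For 27 lim advance_cmd).

Definition walk_cmd (lim : nat) : cmd :=
  clear_cmd ;; fill_cmd ;; next_cmd ;; scan_cmd lim.

Definition small_cmd : cmd :=
  For 19 1 (SetR 19 (NC 0) (RG 4 (var 19)) ;; For 20 0 (For 21 0 (walk_cmd 2))).

(** A strip that misses fewer than [k0] points leaves fewer than [k0] sorted positions below it and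
    fewer than [k0] above it, whatever the threshold. Hence both margins run below [k0]. *)
Definition wide_cmd : cmd :=
  For 19 1 (SetR 19 (NC 0) (RG 4 (var 19)) ;;
    For 20 2 (For 41 2 (
      If (CN (var 41) vn)
        (SetN 21 (NC 0) (NSub (NSub vn (NC 1)) (var 41)) ;; walk_cmd 9) Skip))).

Definition tix (j p q : nexp) : nexp :=
  NAdd (NMul (NAdd (NMul j (var 4)) p) (var 4)) q.

(** Every entry receives the substitute for minus infinity kept in real 29 before the transitions of
    the automaton overwrite it. Arrays 2 and 3 supply the states [k0] and [k0 + 1]. *)
Definition leaf_cmd : cmd :=
  SetN 30 (NC 0) (NAdd vNN (var 39)) ;;
  For 31 4 (For 32 4 (SetR 21 (tix (var 30) (var 31) (var 32)) (rvar 29))) ;;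
  SetR 21 (tix (var 30) (var 3) (var 3)) (RN (NC 0)) ;;
  SetR 21 (tix (var 30) (var 3) (NC 0)) (RN (NC 0)) ;;
  SetR 21 (tix (var 30) (var 2) (NAdd (var 2) (NC 2))) (RN (NC 0)) ;;
  SetR 21 (tix (var 30) (NAdd (var 2) (NC 2)) (NAdd (var 2) (NC 2))) (RN (NC 0)) ;;
  For 31 3 (
    SetN 32 (NC 0) (NAdd (var 31) (NG 34 (var 39))) ;;
    If (CN vk (var 32)) (SetN 32 (NC 0) vk) Skip ;;
    SetR 21 (tix (var 30) (var 31) (var 32)) (RG 20 (var 39))).

Definition child_sum (r : nexp) : rexp :=
  RAdd (RG 21 (tix (NMul (NC 2) (var 30)) (var 31) r))
       (RG 21 (tix (NAdd (NMul (NC 2) (var 30)) (NC 1)) r (var 32))).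

(** A max-plus product of the two children. The running maximum starts from the candidate with
    middle state 0, which avoids a minus infinity. *)
Definition combine_cmd : cmd :=
  For 31 4 (For 32 4 (
    SetR 22 (NC 0) (child_sum (NC 0)) ;;
    For 33 4 (
      SetR 23 (NC 0) (child_sum (var 33)) ;;
      If (CR (rvar 22) (rvar 23)) (SetR 22 (NC 0) (rvar 23)) Skip) ;;
    SetR 21 (tix (var 30) (var 31) (var 32)) (rvar 22))).

Definition climb_cmd : cmd :=
  For 35 6 (SetN 30 (NC 0) (PAR (var 30)) ;; combine_cmd).

Definition reset_cmd : cmd :=
  For 39 5 (SetN 34 (var 39) (NC 0) ;; SetR 20 (var 39) (RN (NC 0)) ;; leaf_cmd) ;;
  For 35 5 (
    SetN 30 (NC 0) (NSub (NSub vNN (NC 1)) (var 35)) ;;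
    If (CN (NC 0) (var 30)) combine_cmd Skip).

Definition insert_cmd : cmd :=
  SetN 39 (NC 0) (NAdd (RX (var 40)) (NC 1)) ;;
  SetN 34 (var 39) (NAdd (NG 34 (var 39)) (NC 1)) ;;
  SetR 20 (var 39) (RAdd (RG 20 (var 39))
    (RSub (RMul (rvar 26) (RG 3 (var 40))) (RMul (rvar 27) (RG 2 (var 40))))) ;;
  leaf_cmd ;; climb_cmd.

(** The flag at the next position says that a y-class has just been completed; the count in array 38
    checks that the strip misses at least [k0] points. *)
Definition query_cmd : cmd :=
  If (CN (NC 0) (VF (NAdd (var 21) (NC 1))))
    (If (CN vn (NAdd (var 38) vk)) Skip
      (SetR 23 (NC 0) (RAdd (RG 21 (tix (NC 1) (var 3) (NAdd (var 2) (NC 2)))) (rvar 28)) ;;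
       If (CR vbest (rvar 23)) (SetR 10 (NC 0) (rvar 23)) Skip))
    Skip.

Definition visit_cmd : cmd :=
  If (CN (var 21) (var 20)) Skip
    (SetN 40 (NC 0) (YS (var 21)) ;;
     If (CR (RG 4 (var 40)) (rvar 19)) Skip
       (insert_cmd ;; SetN 38 (NC 0) (NAdd (var 38) (NC 1))) ;;
     query_cmd).

Definition sweep_cmd : cmd :=
  SetN 38 (NC 0) (NC 0) ;; reset_cmd ;; For 21 0 visit_cmd.

Definition slope (G : nat) (u : nat) : rexp :=
  RAdd (RDiv (RN (NC 1)) (RN (NC G)))
       (RDiv (RMul (RN (var u)) (RN (NC G))) (RN vNp)).

(** Collecting terms, the plane is [c (ln r - ln g) bR - c (r - g) mR + c (1 + ln g - g)]. Dividing
    the first two coefficients by [B] and [M] gives the weights per point in reals 26 and 27; the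
    constant term is real 28. *)
Definition planes_cmd (G : nat) : cmd :=
  For 36 7 (For 37 7 (
    SetR 24 (NC 0) (slope G 36) ;; SetR 25 (NC 0) (slope G 37) ;;
    SetR 26 (NC 0) (RDiv (RMul (rvar 6) (RSub (RLn (rvar 24)) (RLn (rvar 25)))) (rvar 9)) ;;
    SetR 27 (NC 0) (RDiv (RMul (rvar 6) (RSub (rvar 24) (rvar 25))) (rvar 8)) ;;
    SetR 28 (NC 0) (RMul (rvar 6) (RSub (RAdd (RN (NC 1)) (RLn (rvar 25))) (rvar 25))) ;;
    SetR 29 (NC 0) (RSub (RN (NC 0)) (RMul (rvar 6) (RN (NC (3 * G))))) ;;
    For 19 1 (SetR 19 (NC 0) (RG 4 (var 19)) ;;
      For 20 0 (If (CN (NC 0) (VF (var 20))) sweep_cmd Skip)))).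

Definition sizes_cmd (static : bool) (k0 : nat) : cmd :=
  SetN 1 (NC 0) (if static then NC 1 else vn) ;;
  SetN 2 (NC 0) (NC k0) ;; SetN 3 (NC 0) (NC (k0 + 1)) ;; SetN 4 (NC 0) (NC (k0 + 3)) ;;
  SetN 9 (NC 0) (NAdd vn (NC 1)) ;; SetN 10 (NC 0) (NAdd vn (NC 2)) ;;
  SetR 10 (NC 0) (RN (NC 0)).

Definition totals_cmd : cmd :=
  SetR 8 (NC 0) (RN (NC 0)) ;; SetR 9 (NC 0) (RN (NC 0)) ;;
  For 16 0 (SetR 8 (NC 0) (RAdd (rvar 8) (RG 2 (var 16))) ;;
            SetR 9 (NC 0) (RAdd (rvar 9) (RG 3 (var 16)))).

(** The time budget allows quadratic preparation, so ranks are obtained by plain counting. *)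
Definition rank_cmd (key dst : nat) : cmd :=
  For 16 0 (
    SetN 18 (NC 0) (NC 0) ;;
    For 17 0 (If (CR (RG key (var 17)) (RG key (var 16)))
                (SetN 18 (NC 0) (NAdd (var 18) (NC 1))) Skip) ;;
    SetN dst (var 16) (var 18)).

Definition sort_cmd : cmd :=
  For 16 0 (
    SetN 18 (NC 0) (RY (var 16)) ;;
    For 17 0 (
      If (CN (var 17) (var 16))
        (If (CN (RY (var 17)) (RY (var 16))) Skip
          (If (CN (RY (var 16)) (RY (var 17))) Skip
             (SetN 18 (NC 0) (NAdd (var 18) (NC 1)))))
        Skip) ;;
    SetN 13 (var 18) (var 16)).

Definition flags_cmd : cmd :=
  For 16 0 (If (CN (RY (YS (var 16))) (var 16))
              (SetN 14 (var 16) (NC 0)) (SetN 14 (var 16) (NC 1))) ;;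
  SetN 14 vn (NC 1).

(** At least [n + 2] leaves are required: one per x-rank and an idle one at each end, spent by the
    automaton on entering and on leaving the interval. The parent table stands in for integer
    halving. *)
Definition shape_cmd : cmd :=
  SetN 5 (NC 0) (NC 1) ;; SetN 6 (NC 0) (NC 0) ;;
  For 16 10 (If (CN vNN (var 10))
    (SetN 5 (NC 0) (NMul (NC 2) vNN) ;; SetN 6 (NC 0) (NAdd (var 6) (NC 1))) Skip) ;;
  For 16 5 (SetN 15 (NMul (NC 2) (var 16)) (var 16) ;;
            SetN 15 (NAdd (NMul (NC 2) (var 16)) (NC 1)) (var 16)).

(** With [N] values per slope the error is [c G^3 / N^2]; real 30 is what [N^2] must reach for an
    error of at most [eps]. *)
Definition target_cmd (G : nat) : cmd :=
  SetR 30 (NC 0) (RDiv (RMul (rvar 6) (RN (NC (G * G * G)))) (rvar 5)).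

(** A rounded square root by counting. The loop runs as often as the number under the root, which is
    again [O(1 / eps)]. *)
Definition slopes_cmd : cmd :=
  SetN 7 (NC 0) (NC 1) ;;
  For 16 8 (If (CN (NMul vNp vNp) vN1) (SetN 7 (NC 0) (NAdd vNp (NC 1))) Skip).

Definition prep_cmd (static : bool) (k0 : nat) : cmd :=
  sizes_cmd static k0 ;; totals_cmd ;; rank_cmd 0 11 ;; rank_cmd 1 12 ;;
  sort_cmd ;; flags_cmd ;; shape_cmd.

Definition search_cmd (G D : nat) : cmd :=
  If (CR (RMul (rvar 5) (RN vn)) (RN (NC D))) small_cmd Skip ;;
  wide_cmd ;; planes_cmd G.

Definition main_cmd (static : bool) (k0 G D : nat) : cmd :=
  prep_cmd static k0 ;; target_cmd G ;; Ceil 8 30 ;; slopes_cmd ;; search_cmd G D.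

Lemma main_ok static k0 G D : okC (main_cmd static k0 G D) = true.
Proof. destruct static; vm_compute; reflexivity. Qed.

(** * Finite sums and counts *)

Fixpoint nsum (n : nat) (f : nat -> nat) : nat :=
  match n with O => 0 | S k => nsum k f + f k end.

Definition count (n : nat) (S : nat -> bool) : nat := nsum n (fun i => if S i then 1 else 0)%nat.
Definition total (n : nat) (S : nat -> bool) (w : nat -> R) : R :=
  sumR n (fun i => if S i then w i else 0).

Lemma sumR_ext n f g : (forall i, (i < n)%nat -> f i = g i) -> sumR n f = sumR n g.
Proof. induction n as [|n IH]; intros H; simpl; auto. rewrite IH, H; auto. Qed.

Lemma sumR_plus n f g : sumR n (fun i => f i + g i) = sumR n f + sumR n g.
Proof. induction n as [|n IH]; simpl; [|rewrite IH]; ring. Qed.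

Lemma sumR_scal n a f : sumR n (fun i => a * f i) = a * sumR n f.
Proof. induction n as [|n IH]; simpl; [|rewrite IH]; ring. Qed.

Lemma sumR_le n f g : (forall i, (i < n)%nat -> f i <= g i) -> sumR n f <= sumR n g.
Proof.
  induction n as [|n IH]; intros H; simpl; [lra|].
  apply Rplus_le_compat; auto.
Qed.

Lemma sumR_0 n f : (forall i, (i < n)%nat -> f i = 0) -> sumR n f = 0.
Proof. induction n as [|n IH]; intros H; simpl; auto. rewrite IH, H; auto. ring. Qed.

Lemma sumR_single n j f : (j < n)%nat -> (forall i, (i < n)%nat -> i <> j -> f i = 0) ->
  sumR n f = f j.
Proof.
  induction n as [|n IH]; intros Hj H; [lia|]. simpl.
  destruct (Nat.eq_dec j n) as [->|N].
  - rewrite sumR_0; [ring|]. intros i Hi. apply H; lia.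
  - rewrite (H n), IH by (auto; lia). ring.
Qed.

Lemma sumR_nsum n f : INR (nsum n f) = sumR n (fun i => INR (f i)).
Proof. induction n as [|n IH]; simpl; auto. now rewrite plus_INR, IH. Qed.

Lemma INR_count n S : INR (count n S) = total n S (fun _ => 1).
Proof.
  unfold count, total. rewrite sumR_nsum. apply sumR_ext.
  intros i _. destruct (S i); reflexivity.
Qed.

Lemma total_ext n S S' w : (forall i, (i < n)%nat -> S i = S' i) -> total n S w = total n S' w.
Proof. intros H. apply sumR_ext. intros i Hi. now rewrite H. Qed.

Lemma count_ext n S S' : (forall i, (i < n)%nat -> S i = S' i) -> count n S = count n S'.
Proof. intros H. apply INR_eq. rewrite !INR_count. now apply total_ext. Qed.

Lemma total_le n S w w' : (forall i, (i < n)%nat -> S i = true -> w i <= w' i) ->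
  total n S w <= total n S w'.
Proof.
  intros H. apply sumR_le. intros i Hi. destruct (S i) eqn:E; [auto|lra].
Qed.

Lemma total_scal n S a w : total n S (fun i => a * w i) = a * total n S w.
Proof.
  unfold total. rewrite <- sumR_scal. apply sumR_ext. intros i _. destruct (S i); ring.
Qed.

Lemma total_split n S w : sumR n w = total n S w + total n (fun i => negb (S i)) w.
Proof.
  unfold total. rewrite <- sumR_plus. apply sumR_ext. intros i _. destruct (S i); simpl; ring.
Qed.

Lemma count_all n : count n (fun _ => true) = n.
Proof. unfold count. induction n as [|n IH]; simpl; lia. Qed.

Lemma count_le n S S' : (forall i, (i < n)%nat -> S i = true -> S' i = true) ->
  (count n S <= count n S')%nat.
Proof.
  unfold count. induction n as [|n IH]; intros H; simpl; auto.
  assert (H1 := IH ltac:(intros; apply H; auto)).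
  assert (H2 := H n ltac:(auto)).
  destruct (S n); [rewrite H2 by auto; lia|lia].
Qed.

Lemma count_lt n S S' p : (p < n)%nat -> S p = false -> S' p = true ->
  (forall i, (i < n)%nat -> S i = true -> S' i = true) -> (count n S < count n S')%nat.
Proof.
  unfold count. induction n as [|n IH]; intros Hp Hf Ht H; [lia|]. simpl.
  destruct (Nat.eq_dec p n) as [->|N].
  - rewrite Hf, Ht. assert (H1 := count_le n S S' ltac:(intros; apply H; auto)).
    unfold count in H1. lia.
  - assert (H1 := IH ltac:(lia) Hf Ht ltac:(intros; apply H; auto)).
    assert (H2 := H n ltac:(auto)).
    destruct (S n); [rewrite H2 by auto; lia|lia].
Qed.

Lemma count_bound n S : (count n S <= n)%nat.
Proof. rewrite <- (count_all n) at 2. apply count_le; auto. Qed.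

Lemma count_pos n S p : (p < n)%nat -> S p = true -> (0 < count n S)%nat.
Proof.
  intros Hp HS. apply Nat.le_lt_trans with (count n (fun _ => false)); [lia|].
  apply count_lt with p; auto. discriminate.
Qed.

Lemma count_compl n S : (count n S + count n (fun i => negb (S i)) = n)%nat.
Proof.
  apply INR_eq. rewrite plus_INR, !INR_count, <- total_split.
  rewrite <- (count_all n) at 2. rewrite INR_count. reflexivity.
Qed.

Lemma Rltb_true u v : Rltb u v = true <-> u < v.
Proof. unfold Rltb. destruct (Rlt_dec u v); split; auto; discriminate. Qed.

Lemma Rltb_false u v : Rltb u v = false <-> v <= u.
Proof.
  unfold Rltb. destruct (Rlt_dec u v); split; intros; auto; try discriminate.
  - exfalso; lra.
  - now apply Rnot_lt_le.
Qed.

Lemma Rltb_spec u v : BoolSpec (u < v) (v <= u) (Rltb u v).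
Proof.
  destruct (Rltb u v) eqn:E; constructor; [now apply Rltb_true|now apply Rltb_false].
Qed.

Ltac rcase H := match goal with |- context [Rltb ?u ?v] => destruct (Rltb_spec u v) as [H|H] end.

Lemma exists_min n (S : nat -> bool) (f : nat -> R) : (exists p, (p < n)%nat /\ S p = true) ->
  exists p, (p < n)%nat /\ S p = true /\ forall q, (q < n)%nat -> S q = true -> f p <= f q.
Proof.
  induction n as [|n IH]; intros (p & Hp & HS); [lia|].
  destruct (excluded_middle_informative (exists p, (p < n)%nat /\ S p = true)) as [He|He].
  - destruct (IH He) as (r & Hr & Sr & Hmin).
    destruct (S n) eqn:Sn.
    + destruct (Rle_dec (f r) (f n)) as [Hle|Hle].
      * exists r. split; [lia|split; auto]. intros q Hq Sq.
        destruct (Nat.eq_dec q n) as [->|]; auto. apply Hmin; auto; lia.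
      * exists n. split; [lia|split; auto]. intros q Hq Sq.
        destruct (Nat.eq_dec q n) as [->|]; [lra|].
        assert (f r <= f q) by (apply Hmin; auto; lia). lra.
    + exists r. split; [lia|split; auto]. intros q Hq Sq.
      destruct (Nat.eq_dec q n) as [->|]; [congruence|]. apply Hmin; auto; lia.
  - assert (p = n).
    { destruct (Nat.eq_dec p n); auto. exfalso. apply He. exists p. split; auto. lia. }
    subst p. exists n. split; [lia|split; auto]. intros q Hq Sq.
    destruct (Nat.eq_dec q n) as [->|]; [lra|]. exfalso. apply He. exists q. split; auto. lia.
Qed.

(** * Ranks *)

Section Ranks.
Variables (n : nat) (key : nat -> R).

Definition below (r : R) : nat := count n (fun q => Rltb (key q) r).
Definition upto (r : R) : nat := count n (fun q => negb (Rltb r (key q))).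
Definition rank (p : nat) : nat := below (key p).

Lemma below_le r r' : r <= r' -> (below r <= below r')%nat.
Proof. intros H. apply count_le. intros i _. rewrite !Rltb_true. lra. Qed.

Lemma upto_le_below r r' : r < r' -> (upto r <= below r')%nat.
Proof.
  intros H. apply count_le. intros i _. rewrite negb_true_iff, Rltb_true, Rltb_false. lra.
Qed.

Lemma upto_le r r' : r <= r' -> (upto r <= upto r')%nat.
Proof.
  intros H. apply count_le. intros i _. rewrite !negb_true_iff, !Rltb_false. lra.
Qed.

Lemma rank_lt_upto p : (p < n)%nat -> (rank p < upto (key p))%nat.
Proof.
  intros Hp. apply count_lt with p; auto.
  - apply Rltb_false. lra.
  - apply negb_true_iff, Rltb_false. lra.
  - intros i _. rewrite negb_true_iff, Rltb_true, Rltb_false. lra.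
Qed.

Lemma rank_bound p : (p < n)%nat -> (rank p < n)%nat.
Proof.
  intros Hp. apply Nat.lt_le_trans with (upto (key p)); [now apply rank_lt_upto|].
  apply count_bound.
Qed.

Lemma below_le_rank r p : (p < n)%nat -> (below r <= rank p)%nat <-> r <= key p.
Proof.
  intros Hp. split; intros H.
  - apply Rnot_lt_le. intros Hlt. assert (H1 := rank_lt_upto p Hp).
    assert (H2 := upto_le_below _ _ Hlt). lia.
  - now apply below_le.
Qed.

Lemma rank_lt_upto_iff r p : (p < n)%nat -> (rank p < upto r)%nat <-> key p <= r.
Proof.
  intros Hp. split; intros H.
  - apply Rnot_lt_le. intros Hlt. assert (H2 := upto_le_below _ _ Hlt). unfold rank in H. lia.
  - apply Nat.lt_le_trans with (upto (key p)); [now apply rank_lt_upto|now apply upto_le].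
Qed.

Lemma rank_le p q : (p < n)%nat -> (q < n)%nat -> (rank p <= rank q)%nat <-> key p <= key q.
Proof. intros Hp Hq. now apply below_le_rank. Qed.

(** The least and the greatest key occurring in the rank range serve as end points; they exist
    because the range is inhabited. *)
Lemma interval_of_ranks l1 l2 : (exists p, (p < n)%nat /\ (l1 <= rank p < l2)%nat) ->
  exists r1 r2, forall p, (p < n)%nat -> (r1 <= key p <= r2 <-> (l1 <= rank p < l2)%nat).
Proof.
  intros (p0 & Hp0 & H0).
  set (S := fun p => (Nat.leb l1 (rank p) && Nat.ltb (rank p) l2)%bool).
  assert (HS : forall p, S p = true <-> (l1 <= rank p < l2)%nat).
  { intros p. unfold S. rewrite andb_true_iff, Nat.leb_le, Nat.ltb_lt. tauto. }
  assert (He : exists p, (p < n)%nat /\ S p = true) by (exists p0; rewrite HS; auto).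
  destruct (exists_min n S key He) as (p1 & Hp1 & S1 & M1).
  destruct (exists_min n S (fun p => - key p) He) as (p2 & Hp2 & S2 & M2).
  exists (key p1), (key p2). intros p Hp. rewrite <- HS. split.
  - intros [A B]. apply HS. apply HS in S1. apply HS in S2.
    apply rank_le in A; auto. apply rank_le in B; auto. lia.
  - intros Sp. assert (A := M1 p Hp Sp). assert (B := M2 p Hp Sp). lra.
Qed.

(* Position of [p] in the ordering by rank, ties being broken by index. *)
Definition sort_pos (p : nat) : nat :=
  (rank p + count p (fun q => negb (Nat.ltb (rank q) (rank p)) && negb (Nat.ltb (rank p) (rank q))))%nat.

Lemma pos_ge_rank p : (rank p <= sort_pos p)%nat.
Proof. unfold sort_pos. lia. Qed.

Lemma count_app k l S : count (k + l) S = (count k S + count l (fun i => S (k + i)%nat))%nat.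
Proof.
  unfold count. induction l as [|l IH]; [rewrite Nat.add_0_r; simpl; lia|].
  rewrite Nat.add_succ_r. simpl. rewrite IH. lia.
Qed.

Lemma count_le_dim k l S : (k <= l)%nat -> (count k S <= count l S)%nat.
Proof.
  intros H. replace l with (k + (l - k))%nat by lia. rewrite count_app. lia.
Qed.

Lemma same_rank p q : (p < n)%nat -> (q < n)%nat ->
  (negb (Nat.ltb (rank q) (rank p)) && negb (Nat.ltb (rank p) (rank q)))%bool = true <->
  key p = key q.
Proof.
  intros Hp Hq. rewrite andb_true_iff, !negb_true_iff, !Nat.ltb_ge, !rank_le by auto.
  split; [lra|intros ->; lra].
Qed.

(** Only tied points of smaller index are added to the rank, and [p] itself is tied but not among
    them, so the position stays strictly below the end of its class. *)
Lemma pos_lt_upto p : (p < n)%nat -> (sort_pos p < upto (key p))%nat.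
Proof.
  intros Hp.
  set (E := fun q => (negb (Nat.ltb (rank q) (rank p)) && negb (Nat.ltb (rank p) (rank q)))%bool).
  assert (H1 : (count p E < count n E)%nat).
  { apply Nat.lt_le_trans with (count (S p) E); [|apply count_le_dim; lia].
    unfold count. simpl nsum. assert (E p = true) by (apply same_rank; auto).
    rewrite H. lia. }
  assert (H2 : (upto (key p) = rank p + count n E)%nat).
  { apply INR_eq. rewrite plus_INR. unfold upto, rank, below. rewrite !INR_count.
    unfold total. rewrite <- sumR_plus. apply sumR_ext. intros i Hi.
    assert (HE := same_rank p i Hp Hi). change (E i = true <-> key p = key i) in HE.
    destruct (Rtotal_order (key i) (key p)) as [H|[H|H]].
    - rewrite (proj2 (Rltb_true _ _) H), (proj2 (Rltb_false (key p) (key i))) by lra.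
      destruct (E i); [exfalso; assert (key p = key i) by (apply HE; auto); lra|simpl; ring].
    - rewrite (proj2 (Rltb_false (key i) (key p))), (proj2 (Rltb_false (key p) (key i))) by lra.
      rewrite (proj2 HE) by lra. simpl. ring.
    - rewrite (proj2 (Rltb_false (key i) (key p))), (proj2 (Rltb_true (key p) (key i))) by lra.
      destruct (E i); [exfalso; assert (key p = key i) by (apply HE; auto); lra|simpl; ring]. }
  unfold sort_pos. fold E. lia.
Qed.

Lemma pos_bound p : (p < n)%nat -> (sort_pos p < n)%nat.
Proof.
  intros Hp. apply Nat.lt_le_trans with (upto (key p)); [now apply pos_lt_upto|apply count_bound].
Qed.

Lemma pos_key_lt p q : (p < n)%nat -> (q < n)%nat -> key p < key q -> (sort_pos p < sort_pos q)%nat.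
Proof.
  intros Hp Hq H. apply Nat.lt_le_trans with (upto (key p)); [now apply pos_lt_upto|].
  apply Nat.le_trans with (rank q); [now apply upto_le_below|apply pos_ge_rank].
Qed.

Lemma pos_inj p q : (p < n)%nat -> (q < n)%nat -> sort_pos p = sort_pos q -> p = q.
Proof.
  assert (W : forall p q, (p < q < n)%nat -> sort_pos p <> sort_pos q).
  { clear p q. intros p q Hpq H.
    destruct (Rtotal_order (key p) (key q)) as [L|[E|L]].
    - apply pos_key_lt in L; lia.
    - assert (Er : rank p = rank q) by (unfold rank; now rewrite E).
      unfold sort_pos in H. rewrite Er in H.
      set (F := fun r => (negb (Nat.ltb (rank r) (rank q)) && negb (Nat.ltb (rank q) (rank r)))%bool) in *.
      assert (H1 : (count p F < count q F)%nat).
      { apply Nat.lt_le_trans with (count (S p) F); [|apply count_le_dim; lia].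
        unfold count. simpl nsum. assert (F p = true) by (apply same_rank; lra || lia).
        rewrite H0. lia. }
      lia.
    - apply pos_key_lt in L; lia. }
  intros Hp Hq H. destruct (Nat.lt_trichotomy p q) as [L|[E|L]]; auto.
  - exfalso. apply (W p q); auto.
  - exfalso. apply (W q p); auto.
Qed.

Lemma pos_surj i : (i < n)%nat -> exists p, (p < n)%nat /\ sort_pos p = i.
Proof.
  intros Hi. assert (HF : bFun n sort_pos) by (intros p Hp; now apply pos_bound).
  destruct (proj1 (bInjective_bSurjective HF)) with (y := i) as (p & Hp & Ep); eauto.
  intros p q Hp Hq. now apply pos_inj.
Qed.

(* [a] splits the sorted order between two classes of equal keys. *)
Definition cut (a : nat) : Prop :=
  forall p, (p < n)%nat -> sort_pos p = a -> (a <= rank p)%nat.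

Lemma cut_below r : cut (below r).
Proof.
  intros p Hp E. apply below_le_rank; auto. apply Rnot_lt_le. intros Hlt.
  assert (H1 := pos_lt_upto p Hp). assert (H2 := upto_le_below _ _ Hlt). lia.
Qed.

Lemma cut_upto r : cut (upto r).
Proof.
  intros p Hp E. destruct (Rle_lt_dec (key p) r) as [Hle|Hlt].
  - assert (H1 := pos_lt_upto p Hp). assert (H2 := upto_le _ _ Hle). lia.
  - now apply upto_le_below.
Qed.

(** At a boundary between classes the two orders agree. This is what turns a stretch of the
    insertion order into a strip of y-ranks. *)
Lemma cut_pos a p : cut a -> (a <= n)%nat -> (p < n)%nat ->
  ((a <= sort_pos p)%nat <-> (a <= rank p)%nat).
Proof.
  intros Hc Ha Hp. split; [|assert (H := pos_ge_rank p); lia].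
  intros H. assert (Hpos := pos_bound p Hp).
  destruct (pos_surj a ltac:(lia)) as (p0 & Hp0 & E0).
  assert (H0 := Hc p0 Hp0 E0).
  apply Nat.le_trans with (rank p0); auto. apply rank_le; auto.
  apply Rnot_lt_le. intros Hlt. apply pos_key_lt in Hlt; auto. lia.
Qed.

End Ranks.

(** * The gamma statistic and its tangent planes *)

Lemma ln_le_sub1 u : 0 < u -> ln u <= u - 1.
Proof.
  intros Hu. assert (H := exp_ineq1_le (ln u)). rewrite exp_ln in H by auto. lra.
Qed.

(** [ln u <= u - 1] at [u = r m / b]: a tangent plane lies below the convex function. *)
Lemma kl_lower m b r : 0 < m -> 0 < b -> 0 < r ->
  b * (1 + ln r) - r * m <= b * ln (b / m).
Proof.
  intros Hm Hb Hr.
  assert (H := ln_le_sub1 (r * m / b) ltac:(apply Rdiv_lt_0_compat; nra)).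
  unfold Rdiv in *. rewrite !ln_mult in * by (try apply Rinv_0_lt_compat; nra).
  rewrite !ln_Rinv in * by auto.
  assert (E : b * (r * m * / b - 1) = r * m - b) by (field; lra).
  assert (b * (ln r + ln m + - ln b) <= b * (r * m * / b - 1))
    by (apply Rmult_le_compat_l; lra).
  nra.
Qed.

(** The same inequality at [b / (m r)]. The error is quadratic because [b (b / (m r) - 1) = b - r m
    + (b / m - r)^2 m / r]. *)
Lemma kl_upper m b r : 0 < m -> 0 < b -> 0 < r ->
  b * ln (b / m) <= b * (1 + ln r) - r * m + (b / m - r) ^ 2 * m / r.
Proof.
  intros Hm Hb Hr.
  assert (H := ln_le_sub1 (b / (m * r)) ltac:(apply Rdiv_lt_0_compat; nra)).
  unfold Rdiv in H at 1.
  rewrite ln_mult, ln_Rinv, ln_mult in H by (try apply Rinv_0_lt_compat; nra).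
  unfold Rdiv at 1. rewrite ln_mult, ln_Rinv by (try apply Rinv_0_lt_compat; nra).
  assert (E : b * (1 + ln r) - r * m + (b / m - r) ^ 2 * m / r
              = b * ln r + b * (b / (m * r) - 1)) by (field; lra).
  rewrite E.
  assert (b * (ln b + - (ln m + ln r)) <= b * (b / (m * r) - 1))
    by (apply Rmult_le_compat_l; lra).
  nra.
Qed.

Definition plane (c r g mR bR : R) : R :=
  c * (bR * (1 + ln r) - r * mR + ((1 - bR) * (1 + ln g) - g * (1 - mR))).

Lemma plane_le c r g mR bR : 0 < c -> 0 < r -> 0 < g -> 0 < mR < 1 -> 0 < bR < 1 ->
  plane c r g mR bR <= d_gamma c mR bR.
Proof.
  intros Hc Hr Hg Hm Hb. unfold plane, d_gamma. apply Rmult_le_compat_l; [lra|].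
  apply Rplus_le_compat; apply kl_lower; lra.
Qed.

(** The plane with both slopes equal to 1 vanishes identically. *)
Lemma d_gamma_nonneg c mR bR : 0 < c -> 0 < mR < 1 -> 0 < bR < 1 -> 0 <= d_gamma c mR bR.
Proof.
  intros Hc Hm Hb. eapply Rle_trans; [|apply (plane_le c 1 1); lra].
  unfold plane. rewrite ln_1. right. ring.
Qed.

(** The two quadratic errors carry the factors [mR] and [1 - mR], which add up to 1; each slope is
    at least [/ G], whence the factor [G]. *)
Lemma d_gamma_le_plane c r g mR bR G h : 0 < c -> 0 < mR < 1 -> 0 < bR < 1 ->
  0 < G -> / G <= r -> / G <= g ->
  0 <= bR / mR - r <= h -> 0 <= (1 - bR) / (1 - mR) - g <= h ->
  d_gamma c mR bR <= plane c r g mR bR + c * (h ^ 2 * G).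
Proof.
  intros Hc Hm Hb HG Hr Hg H1 H2.
  assert (HG' : 0 < / G) by now apply Rinv_0_lt_compat.
  assert (W : forall u v z, 0 < z -> / G <= v -> 0 <= u <= h -> u ^ 2 * z / v <= h ^ 2 * G * z).
  { intros u v z Hz Hv Hu.
    assert (/ v <= G).
    { rewrite <- (Rinv_inv G). apply Rinv_le_contravar; lra. }
    assert (0 < / v) by (apply Rinv_0_lt_compat; lra).
    assert (u ^ 2 <= h ^ 2) by (apply pow_incr; lra).
    assert (0 <= u ^ 2) by apply pow2_ge_0.
    unfold Rdiv. replace (u ^ 2 * z * / v) with (u ^ 2 * / v * z) by ring.
    apply Rmult_le_compat_r; [lra|]. apply Rmult_le_compat; lra. }
  assert (U1 := kl_upper mR bR r ltac:(lra) ltac:(lra) ltac:(lra)).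
  assert (U2 := kl_upper (1 - mR) (1 - bR) g ltac:(lra) ltac:(lra) ltac:(lra)).
  assert (W1 := W _ r mR ltac:(lra) Hr H1).
  assert (W2 := W _ g (1 - mR) ltac:(lra) Hg H2).
  unfold d_gamma, plane. rewrite <- Rmult_plus_distr_l. apply Rmult_le_compat_l; [lra|].
  lra.
Qed.

Definition slope_val (G N u : nat) : R := 1 / INR G + INR u * INR G / INR N.

Lemma slope_val_bounds G N u : (1 <= G)%nat -> (u < N)%nat ->
  / INR G <= slope_val G N u <= / INR G + INR G.
Proof.
  intros HG Hu. unfold slope_val.
  assert (0 < INR G) by (apply lt_0_INR; lia).
  assert (0 < INR N) by (apply lt_0_INR; lia).
  assert (INR u <= INR N) by (apply le_INR; lia). assert (0 <= INR u) by apply pos_INR.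
  assert (0 <= INR u * INR G / INR N).
  { apply Rmult_le_pos; [nra|left; now apply Rinv_0_lt_compat]. }
  assert (INR u * INR G / INR N <= INR G).
  { apply Rmult_le_reg_r with (INR N); auto. unfold Rdiv. rewrite Rmult_assoc, Rinv_l by lra. nra. }
  lra.
Qed.

Lemma slope_val_close G N v : (1 <= G)%nat -> (1 <= N)%nat -> / INR G <= v <= INR G ->
  exists u, (u < N)%nat /\ 0 <= v - slope_val G N u <= INR G / INR N.
Proof.
  intros HG HN Hv.
  assert (G0 : 0 < INR G) by (apply lt_0_INR; lia).
  assert (N0 : 0 < INR N) by (apply lt_0_INR; lia).
  assert (0 < / INR G) by now apply Rinv_0_lt_compat.
  set (z := (v - / INR G) * INR N / INR G).
  assert (Hz : 0 <= z).
  { unfold z, Rdiv. apply Rmult_le_pos; [apply Rmult_le_pos; lra|lra]. }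
  assert (Ez : z * INR G / INR N = v - / INR G) by (unfold z; field; lra).
  destruct (archimed z) as [A1 A2].
  (* [up z] is the integer just above [z], so this is the floor of [z]: slopes are rounded down to
     the grid. *)
  set (u := (Z.to_nat (up z) - 1)%nat).
  assert (Hup : (1 <= up z)%Z).
  { assert (IZR 0 < IZR (up z)) by lra. apply lt_IZR in H0. lia. }
  assert (Eu : INR u = IZR (up z) - 1).
  { unfold u. rewrite minus_INR by lia. rewrite INR_IZR_INZ, Z2Nat.id by lia. reflexivity. }
  exists u. split.
  - apply INR_lt. apply Rle_lt_trans with z; [lra|].
    unfold z, Rdiv. apply Rmult_lt_reg_r with (INR G); auto.
    rewrite Rmult_assoc, Rinv_l, Rmult_1_r by lra. nra.
  - unfold slope_val.
    replace (v - (1 / INR G + INR u * INR G / INR N))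
      with ((z - INR u) * (INR G / INR N)).
    + assert (0 < INR G / INR N) by (apply Rdiv_lt_0_compat; auto).
      split; [apply Rmult_le_pos; lra|].
      rewrite <- (Rmult_1_l (INR G / INR N)) at 2. apply Rmult_le_compat_r; lra.
    + rewrite Rmult_minus_distr_r. unfold Rdiv in *. rewrite <- !Rmult_assoc, Ez. ring.
Qed.

(** * Regions *)

Section Regions.
Variables (n tn k0 G D : nat) (c C lo hi : R) (x y t m b : nat -> R).
Hypotheses (Hn : (2 <= n)%nat) (Hc : 0 < c) (HC : 0 < C) (Hlo : 0 < lo) (Hlh : lo <= hi).
Hypothesis Hm : forall i, (i < n)%nat -> lo <= m i <= hi.
Hypothesis Hb : forall i, (i < n)%nat -> lo <= b i <= hi.
Hypothesis Htn : forall p, (p < n)%nat -> exists q, (q < tn)%nat /\ t q = t p.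
Hypothesis Hk0 : C * hi <= INR k0 * lo.
Hypothesis HG : hi * hi <= INR G * (lo * lo).
Hypothesis HD : 2 * c * INR G * INR k0 * hi <= INR D * lo.

Notation rx := (rank n x).
Notation ry := (rank n y).

Definition box (q a b' l1 l2 p : nat) : bool :=
  (Nat.leb a (ry p) && Nat.ltb (ry p) b' && negb (Rltb (t p) (t q))
   && Nat.leb l1 (rx p) && Nat.ltb (rx p) l2)%bool.

Lemma box_true q a b' l1 l2 p : box q a b' l1 l2 p = true <->
  (a <= ry p < b')%nat /\ t q <= t p /\ (l1 <= rx p < l2)%nat.
Proof.
  unfold box. rewrite !andb_true_iff, !Nat.leb_le, !Nat.ltb_lt, negb_true_iff, Rltb_false.
  tauto.
Qed.

Definition mfrac (S : nat -> bool) : R := total n S m / sumR n m.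
Definition bfrac (S : nat -> bool) : R := total n S b / sumR n b.

Lemma frac_total w (I : nat -> Prop) S : (forall p, (p < n)%nat -> (I p <-> S p = true)) ->
  frac n w I = total n S w / sumR n w.
Proof.
  intros H. unfold frac. f_equal. apply sumR_ext. intros i Hi.
  destruct (excluded_middle_informative (I i)) as [HI|HI]; destruct (S i) eqn:E; auto.
  - apply H in HI; auto. congruence.
  - exfalso. apply HI. apply H; auto.
Qed.

(** A plane value is in general not a value of the statistic. Being at most the statistic of some
    admissible region is all that [V <= OPT] requires. *)
Definition attained (v : R) : Prop :=
  exists Q ts, adm_prosp n C x y t m b Q ts /\ v <= val_prosp n c x y t m b Q ts.

Definition region_of (S : nat -> bool) : Prop :=
  exists Q ts, forall p, (p < n)%nat -> (in_prosp x y t Q ts p <-> S p = true).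

Lemma box_region q a b' l1 l2 : (exists p, (p < n)%nat /\ box q a b' l1 l2 p = true) ->
  region_of (box q a b' l1 l2).
Proof.
  intros (p0 & Hp0 & H0). apply box_true in H0.
  destruct (interval_of_ranks n x l1 l2) as (x1 & x2 & HX); [exists p0; tauto|].
  destruct (interval_of_ranks n y a b') as (y1 & y2 & HY); [exists p0; tauto|].
  exists (mkRect x1 x2 y1 y2), (t q). intros p Hp. rewrite box_true.
  unfold in_prosp, in_rect; simpl. rewrite (HX p Hp), (HY p Hp). tauto.
Qed.

Lemma region_box Q ts : (exists p, (p < n)%nat /\ in_prosp x y t Q ts p) ->
  exists q a b' l1 l2, (q < tn)%nat /\ (a < b')%nat /\ (b' <= n)%nat /\ (l1 < l2)%nat /\
    (l2 <= n)%nat /\ cut n y a /\ cut n y b' /\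
    forall p, (p < n)%nat -> (in_prosp x y t Q ts p <-> box q a b' l1 l2 p = true).
Proof.
  intros (p0 & Hp0 & [HQ Ht0]).
  (* The threshold can be raised to the earliest timestamp that is not before [ts] without losing
     any point, so thresholds taken from the points suffice. *)
  destruct (exists_min n (fun p => negb (Rltb (t p) ts)) t) as (p1 & Hp1 & S1 & M1).
  { exists p0. rewrite negb_true_iff, Rltb_false. auto. }
  destruct (Htn p1 Hp1) as (q & Hq & Eq).
  rewrite negb_true_iff, Rltb_false in S1.
  assert (H : forall p, (p < n)%nat -> (in_prosp x y t Q ts p <->
     box q (below n y (ry1 Q)) (upto n y (ry2 Q)) (below n x (rx1 Q)) (upto n x (rx2 Q)) p = true)).
  { intros p Hp. rewrite box_true. unfold in_prosp, in_rect.
    rewrite !below_le_rank, !rank_lt_upto_iff by auto. rewrite Eq.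
    split; intros H; repeat split; try tauto.
    - apply M1; auto. rewrite negb_true_iff, Rltb_false. tauto.
    - lra. }
  exists q, (below n y (ry1 Q)), (upto n y (ry2 Q)), (below n x (rx1 Q)), (upto n x (rx2 Q)).
  assert (H0 := proj1 (H p0 Hp0) (conj HQ Ht0)). apply box_true in H0.
  split; [auto|]. split; [lia|]. split; [apply count_bound|]. split; [lia|].
  split; [apply count_bound|]. split; [apply cut_below|]. split; [apply cut_upto|]. exact H.
Qed.

Lemma total_bounds S w : (forall i, (i < n)%nat -> lo <= w i <= hi) ->
  lo * INR (count n S) <= total n S w <= hi * INR (count n S).
Proof.
  intros Hw. rewrite INR_count, <- !total_scal.
  split; apply total_le; intros i Hi _; specialize (Hw i Hi); lra.
Qed.

Lemma sum_bounds w : (forall i, (i < n)%nat -> lo <= w i <= hi) ->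
  lo * INR n <= sumR n w <= hi * INR n.
Proof.
  intros Hw. assert (H := total_bounds (fun _ => true) w Hw).
  rewrite count_all in H. exact H.
Qed.

Lemma INR_n_pos : 0 < INR n.
Proof. apply lt_0_INR; lia. Qed.

Lemma sum_pos w : (forall i, (i < n)%nat -> lo <= w i <= hi) -> 0 < sumR n w.
Proof. intros Hw. assert (H := sum_bounds w Hw). assert (H1 := INR_n_pos). nra. Qed.

Lemma share_bounds S w : (forall i, (i < n)%nat -> lo <= w i <= hi) ->
  lo * INR (count n S) / (hi * INR n) <= total n S w / sumR n w <= hi * INR (count n S) / (lo * INR n).
Proof.
  intros Hw. assert (HT := total_bounds S w Hw). assert (HS := sum_bounds w Hw).
  assert (Hp := INR_n_pos). assert (HC0 := pos_INR (count n S)).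
  assert (0 < lo * INR n) by nra.
  split; unfold Rdiv; (apply Rmult_le_compat; [| |lra|apply Rinv_le_contravar; lra]).
  - nra.
  - left. apply Rinv_0_lt_compat. nra.
  - nra.
  - left. apply Rinv_0_lt_compat. nra.
Qed.

(** Each share lies between [lo / hi] and [hi / lo] times the proportion of points in [S]; comparing
    the two extremes gives [(hi / lo)^2 <= G]. *)
Lemma share_ratio S w v : (forall i, (i < n)%nat -> lo <= w i <= hi) ->
  (forall i, (i < n)%nat -> lo <= v i <= hi) ->
  total n S w / sumR n w <= INR G * (total n S v / sumR n v).
Proof.
  intros Hw Hv. assert (H1 := share_bounds S w Hw). assert (H2 := share_bounds S v Hv).
  assert (Hp := INR_n_pos). assert (HC0 := pos_INR (count n S)).
  assert (HG0 := pos_INR G).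
  eapply Rle_trans; [apply H1|].
  eapply Rle_trans; [|apply Rmult_le_compat_l; [lra|apply H2]].
  apply Rmult_le_reg_r with (lo * (hi * INR n)); [apply Rmult_lt_0_compat; nra|].
  replace (hi * INR (count n S) / (lo * INR n) * (lo * (hi * INR n)))
    with (hi * hi * INR (count n S)) by (field; lra).
  replace (INR G * (lo * INR (count n S) / (hi * INR n)) * (lo * (hi * INR n)))
    with (INR G * (lo * lo) * INR (count n S)) by (field; lra).
  now apply Rmult_le_compat_r.
Qed.

Lemma share_compl S w : (forall i, (i < n)%nat -> lo <= w i <= hi) ->
  1 - total n S w / sumR n w = total n (fun i => negb (S i)) w / sumR n w.
Proof.
  intros Hw. assert (Hp := sum_pos w Hw).
  replace 1 with (sumR n w / sumR n w) by (field; lra).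
  rewrite (total_split n S w) at 1. field. lra.
Qed.

Lemma ratios S :
  bfrac S <= INR G * mfrac S /\ mfrac S <= INR G * bfrac S /\
  1 - bfrac S <= INR G * (1 - mfrac S) /\ 1 - mfrac S <= INR G * (1 - bfrac S).
Proof.
  unfold bfrac, mfrac. rewrite !share_compl by auto.
  repeat split; apply share_ratio; auto.
Qed.

Lemma G_pos : (1 <= G)%nat.
Proof using Hlo Hlh HG.
  clear HD. destruct G; [exfalso|apply le_n_S, Nat.le_0_l]. simpl in HG. nra.
Qed.

Lemma k0_pos : (1 <= k0)%nat.
Proof using HC Hlo Hlh Hk0.
  clear HD. destruct k0; [exfalso|apply le_n_S, Nat.le_0_l]. simpl in Hk0. nra.
Qed.

Definition adm (S : nat -> bool) : Prop := admissible n C (mfrac S) (bfrac S).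
Definition val (S : nat -> bool) : R := d_gamma c (mfrac S) (bfrac S).

Lemma adm_range S : adm S -> 0 < mfrac S < 1 /\ 0 < bfrac S < 1.
Proof.
  unfold adm, admissible. assert (Hp := INR_n_pos).
  assert (0 < C / INR n) by (apply Rdiv_lt_0_compat; auto). lra.
Qed.

Lemma adm_nonempty S : adm S -> exists p, (p < n)%nat /\ S p = true.
Proof.
  intros H. apply adm_range in H.
  destruct (excluded_middle_informative (exists p, (p < n)%nat /\ S p = true)) as [He|He]; auto.
  exfalso. assert (E : total n S m = 0).
  { apply sumR_0. intros i Hi. destruct (S i) eqn:Ei; auto. exfalso. apply He. eauto. }
  unfold mfrac in H. rewrite E in H. unfold Rdiv in H. lra.
Qed.

Lemma attained_box q a b' l1 l2 : adm (box q a b' l1 l2) ->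
  attained (val (box q a b' l1 l2)).
Proof.
  intros H. destruct (box_region q a b' l1 l2 (adm_nonempty _ H)) as (Q & ts & HQ).
  exists Q, ts. unfold adm_prosp, val_prosp.
  rewrite !(frac_total _ _ _ HQ). split; [exact H|]. apply Rle_refl.
Qed.

Lemma attained_le v v' : v' <= v -> attained v -> attained v'.
Proof. intros H (Q & ts & HA & HV). exists Q, ts. split; auto. lra. Qed.

(** [k0] points carry a share of at least [k0 lo / (hi n) >= C / n]. Applied to [S] and to its
    complement, this yields both sides of admissibility. *)
Lemma adm_of_count S : (k0 <= count n S)%nat -> (count n S + k0 <= n)%nat -> adm S.
Proof.
  intros H1 H2. assert (Hp := INR_n_pos).
  assert (HL : forall S w, (forall i, (i < n)%nat -> lo <= w i <= hi) ->
    (k0 <= count n S)%nat -> C / INR n <= total n S w / sumR n w).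
  { clear S H1 H2. intros S w Hw HS. eapply Rle_trans; [|apply share_bounds; auto].
    apply le_INR in HS.
    replace (C / INR n) with (C * hi / (hi * INR n)) by (field; lra).
    unfold Rdiv. apply Rmult_le_compat_r; [left; apply Rinv_0_lt_compat; nra|]. nra. }
  assert (H3 := count_compl n S).
  unfold adm, admissible.
  assert (U1 := HL S m Hm H1). assert (U2 := HL S b Hb H1).
  assert (U3 := HL (fun i => negb (S i)) m Hm ltac:(lia)).
  assert (U4 := HL (fun i => negb (S i)) b Hb ltac:(lia)).
  rewrite <- share_compl in U3, U4 by auto.
  unfold mfrac, bfrac. lra.
Qed.

(** By [u ln (u / v) <= u (u - v) / v] and the bound [G] on the quotients, the statistic is at most
    [c G (bR + mR)], and both shares are at most [k0 hi / (lo n)]. *)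
Lemma val_small S : adm S -> (count n S < k0)%nat -> val S <= INR D / INR n.
Proof.
  intros HA HS. destruct (adm_range S HA) as [Rm Rb]. assert (Hp := INR_n_pos).
  destruct (ratios S) as (R1 & R2 & R3 & R4).
  assert (HW : forall w, (forall i, (i < n)%nat -> lo <= w i <= hi) ->
    total n S w / sumR n w <= INR k0 * hi / (lo * INR n)).
  { intros w Hw. eapply Rle_trans; [apply share_bounds; auto|].
    unfold Rdiv. apply Rmult_le_compat_r; [left; apply Rinv_0_lt_compat; nra|].
    assert (INR (count n S) <= INR k0) by (apply le_INR; lia). nra. }
  assert (W1 := HW m Hm). assert (W2 := HW b Hb). fold (mfrac S) in W1. fold (bfrac S) in W2.
  unfold val, d_gamma. set (mR := mfrac S) in *. set (bR := bfrac S) in *.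
  assert (L : forall u v, 0 < u -> 0 < v -> u * ln (u / v) <= u * ((u - v) / v)).
  { intros u v Hu Hv. apply Rmult_le_compat_l; [lra|].
    replace ((u - v) / v) with (u / v - 1) by (field; lra).
    apply ln_le_sub1. now apply Rdiv_lt_0_compat. }
  assert (HG0 := pos_INR G).
  assert (L1 := L bR mR ltac:(lra) ltac:(lra)).
  assert (L2 := L (1 - bR) (1 - mR) ltac:(lra) ltac:(lra)).
  assert (X1 : bR * ((bR - mR) / mR) <= INR G * bR).
  { assert ((bR - mR) / mR <= INR G).
    { apply Rmult_le_reg_r with mR; [lra|]. unfold Rdiv. rewrite Rmult_assoc, Rinv_l by lra. nra. }
    nra. }
  assert (X2 : (1 - bR) * ((1 - bR - (1 - mR)) / (1 - mR)) <= INR G * mR).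
  { destruct (Rle_dec bR mR).
    - replace ((1 - bR) * ((1 - bR - (1 - mR)) / (1 - mR)))
        with ((1 - bR) / (1 - mR) * (mR - bR)) by (field; lra).
      assert ((1 - bR) / (1 - mR) <= INR G).
      { apply Rmult_le_reg_r with (1 - mR); [lra|]. unfold Rdiv. rewrite Rmult_assoc, Rinv_l by lra. lra. }
      apply Rmult_le_compat; try lra. left. apply Rdiv_lt_0_compat; lra.
    - apply Rle_trans with 0; [|apply Rmult_le_pos; lra].
      assert ((1 - bR - (1 - mR)) / (1 - mR) <= 0); [|nra].
      apply Rmult_le_reg_r with (1 - mR); [lra|]. unfold Rdiv. rewrite Rmult_assoc, Rinv_l by lra. lra. }
  apply Rle_trans with (c * (INR G * (2 * (INR k0 * hi / (lo * INR n))))).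
  - apply Rmult_le_compat_l; [lra|]. nra.
  - apply Rmult_le_reg_r with (lo * INR n); [nra|].
    replace (c * (INR G * (2 * (INR k0 * hi / (lo * INR n)))) * (lo * INR n))
      with (2 * c * INR G * INR k0 * hi) by (field; lra).
    replace (INR D / INR n * (lo * INR n)) with (INR D * lo) by (field; lra). exact HD.
Qed.

(** [ratios] confines both optimal slopes to the interval from [/ G] to [G], where the grid of mesh
    [h = G / N] leaves the error [c h^2 G]. *)
Lemma val_plane S N : adm S -> (1 <= N)%nat ->
  exists u v, (u < N)%nat /\ (v < N)%nat /\
    val S <= plane c (slope_val G N u) (slope_val G N v) (mfrac S) (bfrac S)
             + c * INR G ^ 3 / INR N ^ 2.
Proof.
  intros HA HN. destruct (adm_range S HA) as [Rm Rb].
  destruct (ratios S) as (R1 & R2 & R3 & R4).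
  assert (HG1 := G_pos). assert (G0 : 0 < INR G) by (apply lt_0_INR; lia).
  assert (N0 : 0 < INR N) by (apply lt_0_INR; lia).
  assert (Q : forall u v, 0 < u -> 0 < v -> u <= INR G * v -> v <= INR G * u ->
     / INR G <= u / v <= INR G).
  { intros u v Hu Hv H1 H2. split.
    - apply Rmult_le_reg_r with (INR G * v); [nra|].
      replace (/ INR G * (INR G * v)) with v by (field; lra).
      replace (u / v * (INR G * v)) with (INR G * u) by (field; lra). auto.
    - apply Rmult_le_reg_r with v; auto.
      replace (u / v * v) with u by (field; lra). auto. }
  destruct (slope_val_close G N (bfrac S / mfrac S) HG1 HN) as (u & Hu & Cu).
  { apply Q; lra. }
  destruct (slope_val_close G N ((1 - bfrac S) / (1 - mfrac S)) HG1 HN) as (v & Hv & Cv).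
  { apply Q; lra. }
  exists u, v. split; auto. split; auto.
  replace (c * INR G ^ 3 / INR N ^ 2) with (c * ((INR G / INR N) ^ 2 * INR G)) by (field; lra).
  apply d_gamma_le_plane; auto; now apply slope_val_bounds.
Qed.

End Regions.

(** * Max-plus matrix products *)

(* States [0 .. k] count the points taken so far (saturating at [k]), state [k + 1]
   precedes the chosen interval of leaves and state [k + 2] follows it. *)
Definition leaf_entry (k : nat) (nb : R) (cnt : nat) (w : R) (p q : nat) : R :=
  if Nat.leb p k && Nat.eqb q (Nat.min (p + cnt) k) then w
  else if Nat.eqb p (k + 1) && (Nat.eqb q (k + 1) || Nat.eqb q 0) then 0
  else if (Nat.eqb p k || Nat.eqb p (k + 2)) && Nat.eqb q (k + 2) then 0
  else nb.

Section Automaton.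
Local Arguments Nat.leb : simpl never.
Local Arguments Nat.eqb : simpl never.
Local Arguments Nat.sub : simpl never.
Variables (k : nat) (nb : R) (cnt : nat -> nat) (w : nat -> R).
Hypothesis Hnb : nb <= 0.

Definition path_sum (s : nat -> nat) (L : nat) : R :=
  sumR L (fun i => leaf_entry k nb (cnt i) (w i) (s i) (s (S i))).

Lemma nsum_le l1 l2 f : (l1 <= l2)%nat -> (nsum l1 f <= nsum l2 f)%nat.
Proof. induction 1; simpl; lia. Qed.

(** The situations of a path that has not paid [nb]: still before the interval, inside an interval
    begun at [l1], or past an interval with enough points. *)
Definition legal (s : nat -> nat) (L : nat) : Prop :=
  (s L = (k + 1)%nat /\ path_sum s L = 0) \/
  (exists l1, (l1 <= L)%nat /\ s L = Nat.min (nsum L cnt - nsum l1 cnt) k /\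
     path_sum s L = sumR L w - sumR l1 w) \/
  (s L = (k + 2)%nat /\ exists l1 l2, (l1 <= l2 <= L)%nat /\ (k <= nsum l2 cnt - nsum l1 cnt)%nat /\
     path_sum s L = sumR l2 w - sumR l1 w).

(** Every entry is at most the modulus of its leaf weight, and one entry outside the automaton
    contributes [nb], so a single forbidden move already caps the whole sum. *)
Lemma path_legal s L : s 0%nat = (k + 1)%nat ->
  path_sum s L <= nb + sumR L (fun i => Rabs (w i)) \/ legal s L.
Proof.
  intros H0. induction L as [|L IH].
  - right. left. split; auto.
  - assert (Ep : path_sum s (S L) = path_sum s L + leaf_entry k nb (cnt L) (w L) (s L) (s (S L)))
      by reflexivity.
    assert (Ew : sumR (S L) w = sumR L w + w L) by reflexivity.
    assert (Ec : nsum (S L) cnt = (nsum L cnt + cnt L)%nat) by reflexivity.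
    assert (Ea : sumR (S L) (fun i => Rabs (w i)) = sumR L (fun i => Rabs (w i)) + Rabs (w L))
      by reflexivity.
    assert (Hw := Rle_abs (w L)). assert (Hw0 := Rabs_pos (w L)).
    assert (Hentry : leaf_entry k nb (cnt L) (w L) (s L) (s (S L)) <= Rabs (w L)).
    { unfold leaf_entry. destruct (_ && _); [auto|]. destruct (_ && _); [auto|].
      destruct (_ && _); lra. }
    destruct IH as [IH|IH]; [left; lra|].
    assert (Habs : forall l1 l2, (l1 <= l2)%nat ->
       sumR l2 w - sumR l1 w <= sumR l2 (fun i => Rabs (w i)) - sumR l1 (fun i => Rabs (w i))).
    { intros l1 l2 H. induction H; simpl; [lra|]. assert (Ha := Rle_abs (w m)). lra. }
    assert (Hpos : forall l1 l2, (l1 <= l2)%nat ->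
       sumR l1 (fun i => Rabs (w i)) <= sumR l2 (fun i => Rabs (w i))).
    { intros l1 l2 H. induction H; simpl; [lra|]. assert (Ha := Rabs_pos (w m)). lra. }
    assert (Hp0 : forall l, 0 <= sumR l (fun i => Rabs (w i))).
    { intros l. apply (Hpos 0%nat l). lia. }
    assert (Hle : path_sum s L <= sumR L (fun i => Rabs (w i))).
    { destruct IH as [[_ E]|[(l1 & Hl & _ & E)|(_ & l1 & l2 & Hl & _ & E)]]; rewrite E.
      - apply Hp0.
      - assert (U1 := Habs l1 L Hl). assert (U2 := Hp0 l1). lra.
      - assert (U1 := Habs l1 l2 ltac:(lia)). assert (U2 := Hp0 l1).
        assert (U3 := Hpos l2 L ltac:(lia)). lra. }
    rewrite Ep. unfold legal. rewrite Ep, Ew, Ec. clear Hentry.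
    unfold leaf_entry.
    destruct (Nat.leb_spec (s L) k) as [Hk|Hk]; simpl andb.
    + destruct (Nat.eqb_spec (s (S L)) (Nat.min (s L + cnt L) k)) as [E|E].
      * destruct IH as [[E1 _]|[(l1 & Hl & E1 & E2)|(E1 & _)]]; [lia| |lia].
        right. right. left. exists l1. split; [lia|]. split; [|lra].
        assert (Hc := nsum_le l1 L cnt Hl). lia.
      * destruct (Nat.eqb_spec (s L) (k + 1)); [lia|]. simpl andb.
        destruct (Nat.eqb_spec (s L) (k + 2)); [lia|]. rewrite orb_false_r.
        destruct (Nat.eqb_spec (s L) k) as [E1|E1]; [|left; simpl andb; lra].
        destruct (Nat.eqb_spec (s (S L)) (k + 2)) as [E2|E2]; [|left; simpl andb; lra].
        simpl andb. destruct IH as [[E3 _]|[(l1 & Hl & E3 & E4)|(E3 & _)]]; [lia| |lia].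
        right. right. right. split; auto. exists l1, L.
        split; [lia|]. split; [lia|]. lra.
    + destruct (Nat.eqb_spec (s L) (k + 1)) as [E1|E1]; simpl andb.
      * destruct IH as [[_ E2]|[(l1 & Hl & E3 & E4)|(E3 & _)]]; [|lia|lia].
        destruct (Nat.eqb_spec (s (S L)) (k + 1)) as [E3|E3]; simpl orb; cbv iota.
        { right. left. split; auto. rewrite E2. ring. }
        destruct (Nat.eqb_spec (s (S L)) 0) as [E4|E4]; cbv iota.
        { right. right. left. exists (S L). split; [auto|]. rewrite E4. rewrite Ec, Ew. split; [lia|lra]. }
        destruct (Nat.eqb_spec (s L) k); [lia|]. destruct (Nat.eqb_spec (s L) (k + 2)); [lia|].
        simpl andb. left. lra.
      * destruct (Nat.eqb_spec (s L) k); [lia|]. simpl orb.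
        destruct (Nat.eqb_spec (s L) (k + 2)) as [E2|E2]; simpl andb; [|left; lra].
        destruct (Nat.eqb_spec (s (S L)) (k + 2)) as [E3|E3]; [|left; lra].
        destruct IH as [[E4 _]|[(l1 & Hl & E4 & _)|(_ & l1 & l2 & Hl & Hcn & E5)]]; [lia|lia|].
        right. right. right. split; auto. exists l1, l2. split; [lia|]. split; auto. lra.
Qed.

(** Leaf [a1 - 1] is spent on the move into state 0 and leaf [a2] on the move into state [k + 2];
    the leaves taken are those in between. Hence the conditions [1 <= a1] here and [a2 < 2 ^ h] at
    the root. *)
Definition interval_path (a1 a2 : nat) (i : nat) : nat :=
  if Nat.ltb i a1 then k + 1
  else if Nat.leb i a2 then Nat.min (nsum i cnt - nsum a1 cnt) k else k + 2.

Lemma interval_path_sum a1 a2 L : (1 <= a1 <= a2)%nat ->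
  (k <= nsum a2 cnt - nsum a1 cnt)%nat ->
  path_sum (interval_path a1 a2) L =
    sumR (Nat.min L a2) w - sumR (Nat.min L a1) w.
Proof.
  intros Ha Hk. induction L as [|L IH]; [unfold path_sum; simpl; ring|].
  change (path_sum (interval_path a1 a2) (S L)) with
    (path_sum (interval_path a1 a2) L + leaf_entry k nb (cnt L) (w L)
       (interval_path a1 a2 L) (interval_path a1 a2 (S L))).
  rewrite IH. unfold interval_path, leaf_entry.
  assert (Em : forall a, (a <= L)%nat -> Nat.min L a = a /\ Nat.min (S L) a = a) by lia.
  assert (EM : forall a, (L < a)%nat -> Nat.min L a = L /\ Nat.min (S L) a = S L) by lia.
  destruct (Nat.ltb_spec L a1) as [L1|L1].
  - rewrite (proj1 (EM a1 L1)), (proj2 (EM a1 L1)), (proj1 (EM a2 ltac:(lia))), (proj2 (EM a2 ltac:(lia))).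
    destruct (Nat.leb_spec (k + 1) k); [lia|]. simpl andb. rewrite Nat.eqb_refl. simpl andb.
    destruct (Nat.ltb_spec (S L) a1).
    + rewrite Nat.eqb_refl. simpl orb. cbv iota. ring.
    + assert (a1 = S L) by lia. subst a1.
      destruct (Nat.leb_spec (S L) a2); [|lia]. rewrite Nat.sub_diag. change (Nat.min 0 k) with 0%nat.
      rewrite (Nat.eqb_refl 0), orb_true_r. simpl. ring.
  - rewrite (proj1 (Em a1 L1)), (proj2 (Em a1 L1)).
    destruct (Nat.ltb_spec (S L) a1); [lia|].
    destruct (Nat.leb_spec L a2) as [L2|L2].
    + assert (Hc := nsum_le a1 L cnt L1).
      destruct (Nat.leb_spec (S L) a2) as [L3|L3].
      * rewrite (proj1 (EM a2 L3)), (proj2 (EM a2 L3)).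
        destruct (Nat.leb_spec (Nat.min (nsum L cnt - nsum a1 cnt) k) k); [|lia].
        simpl nsum. match goal with |- context [Nat.eqb ?u ?v] =>
          destruct (Nat.eqb_spec u v); [|lia] end.
        simpl. ring.
      * assert (L = a2) by lia. subst L.
        rewrite (proj1 (Em a2 L2)), (proj2 (Em a2 L2)).
        replace (Nat.min (nsum a2 cnt - nsum a1 cnt) k) with k by lia.
        rewrite Nat.leb_refl. destruct (Nat.eqb_spec (k + 2) (Nat.min (k + cnt a2) k)); [lia|].
        simpl andb. destruct (Nat.eqb_spec k (k + 1)); [lia|]. simpl andb.
        rewrite !Nat.eqb_refl. simpl. ring.
    + rewrite (proj1 (Em a2 ltac:(lia))), (proj2 (Em a2 ltac:(lia))).
      destruct (Nat.leb_spec (S L) a2); [lia|].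
      destruct (Nat.leb_spec (k + 2) k); [lia|]. simpl andb.
      destruct (Nat.eqb_spec (k + 2) (k + 1)); [lia|]. simpl andb.
      rewrite Nat.eqb_refl, orb_true_r. simpl. ring.
Qed.

(** * Trees of max-plus matrices *)

Section Tree.
Variables (K h : nat) (M : nat -> nat -> nat -> R).

(** The max-plus product of the two children, given as an upper bound together with its
    attainment. *)
Definition consistent (j : nat) : Prop := forall p q, (p < K)%nat -> (q < K)%nat ->
  (forall r, (r < K)%nat -> M (2 * j) p r + M (2 * j + 1) r q <= M j p q) /\
  exists r, (r < K)%nat /\ M j p q = M (2 * j) p r + M (2 * j + 1) r q.

Definition walk_sum (s : nat -> nat) (u L : nat) : R :=
  sumR L (fun i => M (u + i)%nat (s i) (s (S i))).

Lemma walk_sum_app s u L L' :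
  walk_sum s u (L + L') = walk_sum s u L + walk_sum (fun i => s (L + i)%nat) (u + L) L'.
Proof.
  induction L' as [|L' IH]; [unfold walk_sum; rewrite Nat.add_0_r; simpl; ring|].
  rewrite Nat.add_succ_r. unfold walk_sum in *. simpl. rewrite IH.
  rewrite <- Nat.add_assoc, Nat.add_succ_r. ring.
Qed.

(** In heap numbering the leaves below a node [j] of height [d] are the nodes from [j * 2 ^ d] on.
    Walks over the two halves are glued or split at the middle state, so products of matrices become
    maxima over walks. *)
Lemma tree_walk d : forall j,
  (forall i, (1 <= i < 2 ^ h)%nat -> consistent i) -> (d <= h)%nat ->
  (2 ^ (h - d) <= j < 2 ^ (h - d + 1))%nat ->
  (forall p q, (p < K)%nat -> (q < K)%nat -> exists s, s 0%nat = p /\ s (2 ^ d)%nat = q /\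
     (forall i, (i <= 2 ^ d)%nat -> (s i < K)%nat) /\ M j p q = walk_sum s (j * 2 ^ d) (2 ^ d)) /\
  (forall s, (forall i, (i <= 2 ^ d)%nat -> (s i < K)%nat) ->
     walk_sum s (j * 2 ^ d) (2 ^ d) <= M j (s 0%nat) (s (2 ^ d)%nat)).
Proof.
  induction d as [|d IH]; intros j Hcons Hd Hj.
  - simpl. rewrite Nat.mul_1_r. split.
    + intros p q Hp Hq. exists (fun i => if Nat.eqb i 0 then p else q).
      split; auto. split; auto. split.
      * intros i _. destruct (Nat.eqb i 0); auto.
      * unfold walk_sum. simpl. rewrite Nat.add_0_r. ring.
    + intros s Hs. unfold walk_sum. simpl. rewrite Nat.add_0_r. lra.
  - assert (E1 : (2 ^ (h - d) = 2 * 2 ^ (h - S d))%nat).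
    { replace (h - d)%nat with (S (h - S d)) by lia. apply Nat.pow_succ_r'. }
    assert (E2 : (2 ^ (h - d + 1) = 2 * 2 ^ (h - S d + 1))%nat).
    { replace (h - d + 1)%nat with (S (h - S d + 1)) by lia. apply Nat.pow_succ_r'. }
    assert (Hlt : (j < 2 ^ h)%nat).
    { apply Nat.lt_le_trans with (2 ^ (h - S d + 1))%nat; [lia|]. apply Nat.pow_le_mono_r; lia. }
    assert (Hpos : (2 ^ (h - S d) <> 0)%nat) by (apply Nat.pow_nonzero; lia).
    assert (HC := Hcons j ltac:(lia)).
    destruct (IH (2 * j)%nat Hcons ltac:(lia) ltac:(lia)) as [L1 L2].
    destruct (IH (2 * j + 1)%nat Hcons ltac:(lia) ltac:(lia)) as [R1 R2].
    assert (Ed : (2 ^ S d = 2 ^ d + 2 ^ d)%nat) by (simpl; lia).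
    assert (Eu : (j * 2 ^ S d = 2 * j * 2 ^ d)%nat) by (simpl; lia).
    assert (Ev : (2 * j * 2 ^ d + 2 ^ d = (2 * j + 1) * 2 ^ d)%nat) by lia.
    rewrite Eu, Ed. split.
    + intros p q Hp Hq. destruct (HC p q Hp Hq) as [_ (r & Hr & E)].
      destruct (L1 p r Hp Hr) as (s1 & S10 & S11 & S1K & S1E).
      destruct (R1 r q Hr Hq) as (s2 & S20 & S21 & S2K & S2E).
      set (s := fun i => if Nat.leb i (2 ^ d) then s1 i else s2 (i - 2 ^ d)%nat).
      assert (Ss2 : forall i, s (2 ^ d + i)%nat = s2 i).
      { intros i. unfold s. destruct (Nat.leb_spec (2 ^ d + i) (2 ^ d)) as [H|H].
        - replace i with 0%nat by lia. rewrite Nat.add_0_r. congruence.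
        - f_equal. lia. }
      assert (Ss1 : forall i, (i <= 2 ^ d)%nat -> s i = s1 i).
      { intros i Hi. unfold s. destruct (Nat.leb_spec i (2 ^ d)); auto. lia. }
      exists s. split; [rewrite Ss1; auto; lia|]. split; [rewrite Ss2; auto|]. split.
      * intros i Hi. destruct (Nat.le_gt_cases i (2 ^ d)) as [H|H].
        -- rewrite Ss1; auto.
        -- replace i with (2 ^ d + (i - 2 ^ d))%nat by lia. rewrite Ss2. apply S2K. lia.
      * rewrite walk_sum_app, E, S1E, S2E, Ev. f_equal; apply sumR_ext; intros i Hi.
        -- rewrite !Ss1 by lia. reflexivity.
        -- rewrite !Ss2. reflexivity.
    + intros s Hs. rewrite walk_sum_app, Ev.
      assert (H1 := L2 s ltac:(intros; apply Hs; lia)).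
      assert (H2 := R2 (fun i => s (2 ^ d + i)%nat) ltac:(intros; apply Hs; lia)).
      cbv beta in H2. rewrite Nat.add_0_r in H2.
      destruct (HC (s 0%nat) (s (2 ^ d + 2 ^ d)%nat) ltac:(apply Hs; lia) ltac:(apply Hs; lia)) as [H3 _].
      specialize (H3 (s (2 ^ d)%nat) ltac:(apply Hs; lia)). lra.
Qed.

Hypothesis HK : K = (k + 3)%nat.
Hypothesis Hcons : forall i, (1 <= i < 2 ^ h)%nat -> consistent i.
Hypothesis Hleaf : forall l p q, (l < 2 ^ h)%nat -> (p < K)%nat -> (q < K)%nat ->
  M (2 ^ h + l) p q = leaf_entry k nb (cnt l) (w l) p q.

Lemma walk_path s : (forall i, (i <= 2 ^ h)%nat -> (s i < K)%nat) ->
  walk_sum s (1 * 2 ^ h) (2 ^ h) = path_sum s (2 ^ h).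
Proof.
  intros Hs. apply sumR_ext. intros i Hi. rewrite Nat.mul_1_l. apply Hleaf; auto; apply Hs; lia.
Qed.

(** A walk ending in state [k + 2] without a forbidden move has completed an interval; the left
    alternative absorbs all other walks. *)
Lemma root_sound :
  M 1%nat (k + 1)%nat (k + 2)%nat <= nb + sumR (2 ^ h) (fun i => Rabs (w i)) \/
  exists l1 l2, (l1 <= l2 <= 2 ^ h)%nat /\ (k <= nsum l2 cnt - nsum l1 cnt)%nat /\
    M 1%nat (k + 1)%nat (k + 2)%nat = sumR l2 w - sumR l1 w.
Proof.
  destruct (tree_walk h 1 Hcons (le_n h)) as [H _].
  { rewrite Nat.sub_diag. simpl. lia. }
  destruct (H (k + 1)%nat (k + 2)%nat) as (s & S0 & S1 & SK & E); [lia|lia|].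
  rewrite walk_path in E by auto. rewrite E.
  destruct (path_legal s (2 ^ h) S0) as [HB|[[HL _]|[(l1 & _ & HL & _)|(_ & HL)]]]; auto.
  - lia.
  - lia.
Qed.

Lemma root_complete a1 a2 : (1 <= a1 <= a2)%nat -> (a2 < 2 ^ h)%nat ->
  (k <= nsum a2 cnt - nsum a1 cnt)%nat ->
  sumR a2 w - sumR a1 w <= M 1%nat (k + 1)%nat (k + 2)%nat.
Proof.
  intros Ha H2 Hk. destruct (tree_walk h 1 Hcons (le_n h)) as [_ H].
  { rewrite Nat.sub_diag. simpl. lia. }
  specialize (H (interval_path a1 a2)).
  assert (HsK : forall i, (i <= 2 ^ h)%nat -> (interval_path a1 a2 i < K)%nat).
  { intros i _. unfold interval_path. destruct (Nat.ltb i a1); [lia|].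
    destruct (Nat.leb i a2); lia. }
  specialize (H HsK). rewrite walk_path, interval_path_sum in H by auto.
  rewrite !Nat.min_r in H by lia.
  replace (interval_path a1 a2 0) with (k + 1)%nat in H.
  2:{ unfold interval_path. destruct (Nat.ltb_spec 0 a1); lia. }
  replace (interval_path a1 a2 (2 ^ h)) with (k + 2)%nat in H; auto.
  unfold interval_path. destruct (Nat.ltb_spec (2 ^ h) a1); [lia|].
  destruct (Nat.leb_spec (2 ^ h) a2); lia.
Qed.

End Tree.
End Automaton.

(** * Reasoning about programs *)

(** The invariant is stated after the counter has been set, so it may mention the counter. A body
    that leaves the counter alone justifies the premise [na s' v 0 = k]. *)
Lemma for_ind (I : nat -> st -> Prop) v w c s : memb (nmods c) v = false ->
  I 0%nat (setn v 0 0 s) ->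
  (forall k s', (k < na s w 0)%nat -> na s' v 0%nat = k -> I k s' ->
     I (S k) (setn v 0 (S k) (run c s'))) ->
  I (na s w 0%nat) (run (For v w c) s).
Proof.
  intros Hv H0 HS. cbn [run].
  assert (G : forall r k s', (k + r = na s w 0)%nat -> na s' v 0%nat = k -> I k s' ->
    I (na s w 0%nat) (niter r (fun s => incr v (run c s)) s')).
  { induction r as [|r IH]; intros k s' Hk Hvk HI.
    - simpl. now replace (na s w 0%nat) with k by lia.
    - cbn [niter]. unfold incr at 2. rewrite run_na, Hvk by auto.
      apply (IH (S k)); [lia| |].
      + cbn. unfold upd2. now rewrite Nat.eqb_refl.
      + apply HS; auto. lia. }
  apply (G _ 0%nat); auto. cbn. unfold upd2. now rewrite Nat.eqb_refl.
Qed.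

Lemma upd2_same {A} (f : nat -> nat -> A) a i v : upd2 f a i v a i = v.
Proof. unfold upd2. now rewrite !Nat.eqb_refl. Qed.

Lemma upd2_row {A} (f : nat -> nat -> A) a i v i' :
  upd2 f a i v a i' = if Nat.eqb i' i then v else f a i'.
Proof. unfold upd2. now rewrite Nat.eqb_refl. Qed.

(* Arrays below 16 (naturals) and below 10 (reals) are only written by the preparation. *)
Definition low_free (c : cmd) : bool :=
  forallb (Nat.leb 16) (nmods c) && forallb (Nat.leb 10) (rmods c).

Definition agree (s0 s : st) : Prop :=
  (forall a, (a < 16)%nat -> na s a = na s0 a) /\
  (forall a, (a < 10)%nat -> ra s a = ra s0 a).

Lemma memb_forallb l k a : forallb (Nat.leb k) l = true -> (a < k)%nat -> memb l a = false.
Proof.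
  intros H Ha. unfold memb. induction l as [|z l IH]; simpl in *; auto.
  apply andb_true_iff in H. destruct H as [H1 H2]. apply Nat.leb_le in H1.
  rewrite IH by auto. destruct (Nat.eqb_spec a z); [lia|auto].
Qed.

Lemma agree_run s0 c s : low_free c = true -> agree s0 s -> agree s0 (run c s).
Proof.
  unfold low_free. intros H [H1 H2]. apply andb_true_iff in H. destruct H as [L1 L2].
  split; intros a Ha.
  - rewrite run_na; auto. now apply (memb_forallb _ 16).
  - rewrite run_ra; auto. now apply (memb_forallb _ 10).
Qed.

Lemma agree_setn s0 a i v s : (16 <= a)%nat -> agree s0 s -> agree s0 (setn a i v s).
Proof.
  intros Ha [H1 H2]. split; auto. intros a' Ha'. cbn [na setn].
  rewrite upd2_other_arr; auto. apply Nat.eqb_neq. lia.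
Qed.

(** Facts about scalars and whole arrays that a command may rely on. They are kept as data so that
    [stable] can check by computation that they survive a command. *)
Record env := mkEnv {
  nvals : list (nat * nat); rvals : list (nat * R);
  narrs : list (nat * (nat -> nat)); rarrs : list (nat * (nat -> R)) }.

Definition holds (e : env) (s : st) : Prop :=
  (forall z, In z (nvals e) -> na s (fst z) 0%nat = snd z) /\
  (forall z, In z (rvals e) -> ra s (fst z) 0%nat = snd z) /\
  (forall z, In z (narrs e) -> na s (fst z) = snd z) /\
  (forall z, In z (rarrs e) -> ra s (fst z) = snd z).

Definition stable (e : env) (ns rs : list nat) : bool :=
  forallb (fun a => negb (memb ns a)) (map fst (nvals e) ++ map fst (narrs e)) &&
  forallb (fun a => negb (memb rs a)) (map fst (rvals e) ++ map fst (rarrs e)).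

Lemma holds_frame e ns rs s s' : stable e ns rs = true ->
  (forall a, memb ns a = false -> na s' a = na s a) ->
  (forall a, memb rs a = false -> ra s' a = ra s a) -> holds e s -> holds e s'.
Proof.
  unfold stable. intros H HN HR (H1 & H2 & H3 & H4).
  rewrite !forallb_app, !andb_true_iff, !forallb_forall in H.
  destruct H as [[E1 E3] [E2 E4]].
  split; [|split; [|split]]; intros z Hz.
  - rewrite HN; auto. apply negb_true_iff, E1. now apply in_map.
  - rewrite HR; auto. apply negb_true_iff, E2. now apply in_map.
  - rewrite HN; auto. apply negb_true_iff, E3. now apply in_map.
  - rewrite HR; auto. apply negb_true_iff, E4. now apply in_map.
Qed.

Lemma holds_run e c s : stable e (nmods c) (rmods c) = true -> holds e s -> holds e (run c s).
Proof.
  intros H. apply (holds_frame e _ _ _ _ H); intros a Ha; [now apply run_na|now apply run_ra].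
Qed.

Lemma holds_setn e a i v s : stable e (a :: nil) nil = true -> holds e s -> holds e (setn a i v s).
Proof.
  intros H. apply (holds_frame e _ _ _ _ H); intros a' Ha'; auto.
  cbn. apply upd2_other_arr. cbn in Ha'. now rewrite orb_false_r in Ha'.
Qed.

Definition with_nval (a v : nat) (e : env) : env :=
  mkEnv ((a, v) :: nvals e) (rvals e) (narrs e) (rarrs e).
Definition with_rval (a : nat) (v : R) (e : env) : env :=
  mkEnv (nvals e) ((a, v) :: rvals e) (narrs e) (rarrs e).

(** * Commands that raise the best value found *)

Section Values.
Variables (s0 : st) (good : R -> Prop).

(* [ra 10 0] holds the best value found so far and [T] the values it has to reach. *)
Definition improves (e : env) (c : cmd) (T : R -> Prop) : Prop :=
  forall s, agree s0 s -> holds e s -> good (ra s 10 0%nat) ->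
    good (ra (run c s) 10 0%nat) /\ ra s 10 0%nat <= ra (run c s) 10 0%nat /\
    forall r, T r -> r <= ra (run c s) 10 0%nat.

Lemma improves_weaken e c (T T' : R -> Prop) : (forall r, T r -> T' r) ->
  improves e c T' -> improves e c T.
Proof.
  intros HT H s Ha He Hg. destruct (H s Ha He Hg) as (H1 & H2 & H3). auto.
Qed.

Lemma improves_skip e : improves e Skip (fun _ => False).
Proof. intros s Ha He Hg. cbn. split; auto. split; [lra|]. tauto. Qed.

Lemma improves_after e e' c1 c2 T :
  low_free c1 = true -> memb (rmods c1) 10 = false ->
  (forall s, agree s0 s -> holds e s -> holds e' (run c1 s)) ->
  improves e' c2 T -> improves e (Seq c1 c2) T.
Proof.
  intros L1 V1 HE H s Ha He Hg. cbn [run].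
  assert (EV : ra (run c1 s) 10 = ra s 10) by now apply run_ra.
  rewrite <- EV in *. apply H; auto. now apply agree_run.
Qed.

Lemma improves_seq e c1 c2 T1 T2 :
  low_free c1 = true -> stable e (nmods c1) (rmods c1) = true ->
  improves e c1 T1 -> improves e c2 T2 ->
  improves e (Seq c1 c2) (fun r => T1 r \/ T2 r).
Proof.
  intros L1 HS H1 H2 s Ha He Hg. cbn [run].
  destruct (H1 s Ha He Hg) as (A1 & A2 & A3).
  destruct (H2 (run c1 s)) as (B1 & B2 & B3); auto.
  { now apply agree_run. }
  { now apply holds_run. }
  split; auto. split; [lra|]. intros r [Hr|Hr]; auto. apply A3 in Hr. lra.
Qed.

(** Targets reached by one iteration stay reached, because the best value never decreases; so the
    targets of all iterations accumulate. *)
Lemma improves_for e v w c (T : nat -> R -> Prop) :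
  (w < 16)%nat -> (16 <= v)%nat -> low_free c = true -> memb (nmods c) v = false ->
  stable e (v :: nmods c) (rmods c) = true ->
  (forall k, (k < na s0 w 0)%nat -> improves (with_nval v k e) c (T k)) ->
  improves e (For v w c) (fun r => exists k, (k < na s0 w 0)%nat /\ T k r).
Proof.
  intros Hw Hv HL Hm HS H s Ha He Hg.
  rewrite <- (proj1 Ha w Hw) in *.
  set (I := fun k s' => agree s0 s' /\ holds e s' /\ good (ra s' 10 0%nat) /\
     ra s 10 0%nat <= ra s' 10 0%nat /\
     forall k' r, (k' < k)%nat -> T k' r -> r <= ra s' 10 0%nat).
  assert (HI : I (na s w 0%nat) (run (For v w c) s)).
  { assert (HS1 : stable e (v :: nil) nil = true /\ stable e (nmods c) (rmods c) = true).
    { unfold stable in *. rewrite !andb_true_iff, !forallb_forall in *.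
      destruct HS as [S1 S2]. repeat split; intros z Hz.
      - specialize (S1 z Hz). rewrite negb_true_iff in *. cbn in *.
        apply orb_false_iff in S1. now rewrite (proj1 S1).
      - specialize (S1 z Hz). rewrite negb_true_iff in *. cbn in *.
        apply orb_false_iff in S1. tauto.
      - auto. }
    destruct HS1 as [HS1 HS2].
    apply for_ind; auto.
    - split; [now apply agree_setn|]. split; [now apply holds_setn|].
      split; [exact Hg|]. split; [cbn; lra|]. intros k' r Hk'. lia.
    - intros k s' Hk Hvk (I1 & I2 & I3 & I4 & I5).
      destruct (H k Hk s') as (A1 & A2 & A3); auto.
      { destruct I2 as (J1 & J2 & J3 & J4). split; [|auto]. intros z [<-|Hz]; auto. }
      split; [apply agree_setn; auto; now apply agree_run|].
      split; [apply holds_setn; auto; now apply holds_run|].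
      split; [exact A1|]. cbn [ra setn]. split; [lra|].
      intros k' r Hk' HT. destruct (Nat.eq_dec k' k) as [->|N]; auto.
      apply Rle_trans with (ra s' 10 0%nat); auto. apply (I5 k'); auto. lia. }
  destruct HI as (_ & _ & I3 & I4 & I5). split; auto. split; auto.
  intros r (k & Hk & HT). now apply (I5 k).
Qed.

End Values.

Ltac sim := cbn [run evN evR evC setn setr na ra incr].
Ltac look := cbn [na ra setn setr]; unfold upd2; cbn [Nat.eqb andb].

(** * Scanning the regions of a strip *)

Section Buckets.
Variables (n : nat) (P : nat -> bool) (f : nat -> nat).

Definition bucket (w : nat -> R) (l : nat) : R := total n (fun p => P p && Nat.eqb (f p) l) w.
Definition bucket_count (l : nat) : nat := count n (fun p => P p && Nat.eqb (f p) l).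

Lemma bucket_prefix w l :
  sumR l (bucket w) = total n (fun p => P p && Nat.ltb (f p) l) w.
Proof.
  induction l as [|l IH].
  - symmetry. apply sumR_0. intros i _. now rewrite andb_false_r.
  - cbn [sumR]. rewrite IH. unfold bucket, total. rewrite <- sumR_plus.
    apply sumR_ext. intros i _. destruct (P i); simpl; [|ring].
    destruct (Nat.ltb_spec (f i) l), (Nat.eqb_spec (f i) l), (Nat.ltb_spec (f i) (S l));
      try lia; ring.
Qed.

Lemma bucket_interval w l1 l2 : (l1 <= l2)%nat ->
  sumR l2 (bucket w) - sumR l1 (bucket w) =
  total n (fun p => P p && Nat.leb l1 (f p) && Nat.ltb (f p) l2) w.
Proof.
  intros H. rewrite !bucket_prefix.
  assert (E : total n (fun p => P p && Nat.ltb (f p) l2) w =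
     total n (fun p => P p && Nat.leb l1 (f p) && Nat.ltb (f p) l2) w +
     total n (fun p => P p && Nat.ltb (f p) l1) w); [|rewrite E; ring].
  unfold total. rewrite <- sumR_plus. apply sumR_ext. intros i _. destruct (P i); simpl; [|ring].
  destruct (Nat.ltb_spec (f i) l1), (Nat.ltb_spec (f i) l2), (Nat.leb_spec l1 (f i)); simpl;
    try lia; ring.
Qed.

Lemma bucket_count_interval l1 l2 : (l1 <= l2)%nat ->
  nsum l2 bucket_count =
  (nsum l1 bucket_count + count n (fun p => P p && Nat.leb l1 (f p) && Nat.ltb (f p) l2))%nat.
Proof.
  intros H. apply INR_eq. rewrite plus_INR, !sumR_nsum, INR_count, <- bucket_interval by auto.
  assert (E : forall l, sumR l (fun i => INR (bucket_count i)) = sumR l (bucket (fun _ => 1))).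
  { intros l. apply sumR_ext. intros i _. apply INR_count. }
  rewrite !E. ring.
Qed.

End Buckets.

Record prepared (s0 : st) (n tn k0 h N : nat) : Prop := {
  p_n : na s0 0%nat 0%nat = n;
  p_tn : na s0 1%nat 0%nat = tn;
  p_k0 : na s0 2%nat 0%nat = k0;
  p_k1 : na s0 3%nat 0%nat = (k0 + 1)%nat;
  p_K : na s0 4%nat 0%nat = (k0 + 3)%nat;
  p_NN : na s0 5%nat 0%nat = (2 ^ h)%nat;
  p_h : na s0 6%nat 0%nat = h;
  p_Np : na s0 7%nat 0%nat = N;
  p_n1 : na s0 9%nat 0%nat = (n + 1)%nat;
  p_size : (n + 2 <= 2 ^ h)%nat;
  p_M : ra s0 8%nat 0%nat = sumR n (ra s0 2%nat);
  p_B : ra s0 9%nat 0%nat = sumR n (ra s0 3%nat);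
  p_rx : forall p, (p < n)%nat -> na s0 11%nat p = rank n (ra s0 0%nat) p;
  p_ry : forall p, (p < n)%nat -> na s0 12%nat p = rank n (ra s0 1%nat) p;
  p_ys : forall p, (p < n)%nat -> na s0 13%nat (sort_pos n (ra s0 1%nat) p) = p;
  p_vf : forall a, (a <= n)%nat -> ((0 < na s0 14%nat a)%nat <-> cut n (ra s0 1%nat) a);
  p_par : forall i, (i < 2 ^ h)%nat ->
    na s0 15%nat (2 * i)%nat = i /\ na s0 15%nat (2 * i + 1)%nat = i }.

Section Search.
Variables (s0 : st) (n tn k0 h N : nat).
Hypothesis Prep : prepared s0 n tn k0 h N.
Hypothesis Hn : (2 <= n)%nat.

Notation x := (ra s0 0%nat).
Notation y := (ra s0 1%nat).
Notation m := (ra s0 2%nat).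
Notation b := (ra s0 3%nat).
Notation t := (ra s0 4%nat).
Notation eps := (ra s0 5%nat 0%nat).
Notation c := (ra s0 6%nat 0%nat).
Notation C := (ra s0 7%nat 0%nat).
Notation rx := (rank n x).
Notation ry := (rank n y).
Notation box := (box n x y t).
Notation adm := (adm n C m b).
Notation val := (val n c m b).
Notation attained := (attained n c C x y t m b).

Hypothesis HC : 0 < C.

(** The disjunction admits the initial value 0, which lies below the optimum because the statistic
    is nonnegative. *)
Definition good (v : R) : Prop := 0 <= v /\ (v = 0 \/ attained v).

Definition strip (q a b' p : nat) : bool :=
  (Nat.leb a (ry p) && Nat.ltb (ry p) b' && negb (Rltb (t p) (t q)))%bool.

Lemma box_strip q a b' l1 l2 p :
  box q a b' l1 l2 p = (strip q a b' p && Nat.leb l1 (rx p) && Nat.ltb (rx p) l2)%bool.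
Proof. reflexivity. Qed.

Lemma good_max s v : good (ra s 10%nat 0%nat) -> attained v ->
  ra s 10%nat 0%nat < v -> good v.
Proof. intros [H _] Hv Hlt. split; [lra|auto]. Qed.

Lemma eval_ok s S : agree s0 s -> good (ra s 10%nat 0%nat) ->
  ra s 13%nat 0%nat = total n S m -> ra s 14%nat 0%nat = total n S b ->
  (adm S -> attained (val S)) ->
  good (ra (run eval_cmd s) 10%nat 0%nat) /\ ra s 10%nat 0%nat <= ra (run eval_cmd s) 10%nat 0%nat /\
  (adm S -> val S <= ra (run eval_cmd s) 10%nat 0%nat).
Proof.
  intros [An Ar] Hg H13 H14 HS. unfold eval_cmd. sim. look.
  rewrite H13, H14, (An 0%nat), (Ar 6%nat), (Ar 7%nat), (Ar 8%nat), (Ar 9%nat) by lia.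
  rewrite (p_n _ _ _ _ _ _ Prep), (p_M _ _ _ _ _ _ Prep), (p_B _ _ _ _ _ _ Prep).
  change (INR 1) with 1.
  assert (E : val S = c * (total n S b / sumR n b * ln (total n S b / sumR n b / (total n S m / sumR n m))
    + (1 - total n S b / sumR n b) * ln ((1 - total n S b / sumR n b) / (1 - total n S m / sumR n m))))
    by reflexivity.
  assert (EA : adm S <-> admissible n C (total n S m / sumR n m) (total n S b / sumR n b))
    by reflexivity.
  unfold admissible in EA.
  assert (Hrefl : ra s 10%nat 0%nat <= ra s 10%nat 0%nat) by apply Rle_refl.
  rcase H1.
  { cbn. split; auto. split; auto. intros HA. apply (proj1 EA) in HA; lra. }
  rcase H2.
  { cbn. split; auto. split; auto. intros HA. apply (proj1 EA) in HA; lra. }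
  rcase H3.
  { cbn. split; auto. split; auto. intros HA. apply (proj1 EA) in HA; lra. }
  rcase H4.
  { cbn. split; auto. split; auto. intros HA. apply (proj1 EA) in HA; lra. }
  assert (HA : adm S) by (apply (proj2 EA); lra).
  sim. look. rewrite <- E.
  rcase H5; sim; look.
  - split; [|split; lra]. apply (good_max s); auto.
  - split; [exact Hg|split; [lra|intros _; lra]].
Qed.

Lemma clear_ok s : agree s0 s ->
  forall l, (l < n)%nat -> ra (run clear_cmd s) 11%nat l = 0 /\
    ra (run clear_cmd s) 12%nat l = 0 /\ na (run clear_cmd s) 24%nat l = 0%nat.
Proof.
  intros [An Ar].
  set (I := fun k s => forall l, (l < k)%nat ->
    ra s 11%nat l = 0 /\ ra s 12%nat l = 0 /\ na s 24%nat l = 0%nat).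
  assert (HI : I (na s 0%nat 0%nat) (run clear_cmd s)).
  { apply (for_ind I); auto.
    - intros l Hl. lia.
    - intros k s' Hk Hv HI l Hl. sim. look. rewrite Hv.
      destruct (Nat.eqb_spec l k) as [->|Nl]; [auto|]. apply HI. lia. }
  rewrite (An 0%nat), (p_n _ _ _ _ _ _ Prep) in HI by lia. exact HI.
Qed.

Definition strip_env (q a b' : nat) : env :=
  mkEnv ((20%nat, a) :: (21%nat, b') :: nil) ((19%nat, t q) :: nil) nil nil.

Lemma strip_env_holds q a b' s : holds (strip_env q a b') s <->
  na s 20%nat 0%nat = a /\ na s 21%nat 0%nat = b' /\ ra s 19%nat 0%nat = t q.
Proof.
  split.
  - intros (H1 & H2 & _). split; [|split].
    + apply (H1 (20%nat, a)). now left.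
    + apply (H1 (21%nat, b')). right; now left.
    + apply (H2 (19%nat, t q)). now left.
  - intros (H1 & H2 & H3). split; [|split; [|split]]; cbn.
    + intros z [<-|[<-|[]]]; auto.
    + intros z [<-|[]]; auto.
    + tauto.
    + tauto.
Qed.

Definition bucketed (q a b' : nat) (s : st) : Prop := forall l, (l < n)%nat ->
  ra s 11%nat l = bucket n (strip q a b') rx m l /\
  ra s 12%nat l = bucket n (strip q a b') rx b l /\
  na s 24%nat l = bucket_count n (strip q a b') rx l.

Lemma total_S k S w : total (Datatypes.S k) S w = total k S w + (if S k then w k else 0).
Proof. reflexivity. Qed.

Lemma count_S k S : count (Datatypes.S k) S = (count k S + (if S k then 1 else 0))%nat.
Proof. reflexivity. Qed.

(** The program tests the inclusive range from [a] to [b'], while strips are half open: hence the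
    successor. *)
Lemma fill_ok q a b' s : agree s0 s -> holds (strip_env q a b') s ->
  bucketed q a (Datatypes.S b') (run (Seq clear_cmd fill_cmd) s).
Proof.
  intros Ha He. cbn [run].
  assert (Ha1 : agree s0 (run clear_cmd s)) by (apply agree_run; auto).
  assert (He1 : holds (strip_env q a b') (run clear_cmd s)) by (apply holds_run; auto).
  assert (H0 := clear_ok s Ha). revert Ha1 He1 H0. generalize (run clear_cmd s).
  clear s Ha He. intros s Ha He H0.
  set (P := strip q a (Datatypes.S b')).
  set (I := fun k s => agree s0 s /\ holds (strip_env q a b') s /\ forall l, (l < n)%nat ->
    ra s 11%nat l = total k (fun p => P p && Nat.eqb (rx p) l) m /\
    ra s 12%nat l = total k (fun p => P p && Nat.eqb (rx p) l) b /\
    na s 24%nat l = count k (fun p => P p && Nat.eqb (rx p) l)).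
  assert (HI : I (na s 0%nat 0%nat) (run fill_cmd s)).
  { apply (for_ind I); auto.
    - split; [apply agree_setn; auto; lia|]. split; [apply holds_setn; auto|].
      intros l Hl. cbn. destruct (H0 l Hl) as (A & B & D). auto.
    - intros k s' Hk Hv (Ha' & He' & HI).
      assert (Hkn : (k < n)%nat).
      { rewrite (proj1 Ha 0%nat), (p_n _ _ _ _ _ _ Prep) in Hk by lia. auto. }
      match goal with |- I _ (setn _ _ _ (run ?cc s')) => set (cb := cc) end.
      assert (HA1 : agree s0 (run cb s')) by (apply agree_run; auto).
      assert (HE1 : holds (strip_env q a b') (run cb s')) by (apply holds_run; auto).
      split; [apply agree_setn; auto; lia|]. split; [apply holds_setn; auto|].
      apply strip_env_holds in He'. destruct He' as (E20 & E21 & E19).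
      destruct Ha' as [An Ar].
      assert (R12 : na s' 12%nat k = ry k) by (rewrite An by lia; apply Prep; auto).
      assert (R11 : na s' 11%nat k = rx k) by (rewrite An by lia; apply Prep; auto).
      assert (EP : P k = negb (Nat.ltb (ry k) a) && negb (Nat.ltb b' (ry k)) && negb (Rltb (t k) (t q))).
      { unfold P, strip. f_equal. f_equal; [apply Nat.leb_antisym|].
        rewrite <- Nat.leb_antisym. apply eq_true_iff_eq. rewrite Nat.leb_le, Nat.ltb_lt. lia. }
      intros l Hl. destruct (HI l Hl) as (I1 & I2 & I3).
      rewrite !total_S, count_S, EP. unfold cb. sim. look.
      rewrite Hv, R12, E20, E21, E19, (Ar 4%nat) by lia.
      destruct (Nat.ltb (ry k) a); sim; [rewrite I1, I2, I3; cbn; repeat split; try ring; lia|].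
      destruct (Nat.ltb b' (ry k)); sim; [rewrite I1, I2, I3; cbn; repeat split; try ring; lia|].
      destruct (Rltb (t k) (t q)); sim; [rewrite I1, I2, I3; cbn; repeat split; try ring; lia|].
      look. rewrite ?Hv, ?R11, ?(Ar 2%nat), ?(Ar 3%nat) by lia. cbn [negb andb].
      rewrite (Nat.eqb_sym (rx k) l).
      destruct (Nat.eqb_spec l (rx k)) as [E|E].
      + rewrite <- E. rewrite I1, I2, I3. auto.
      + rewrite I1, I2, I3. repeat split; try ring; lia. }
  destruct HI as (_ & _ & HI). rewrite (proj1 Ha 0%nat), (p_n _ _ _ _ _ _ Prep) in HI by lia.
  exact HI.
Qed.

Definition next_of (cnt nx : nat -> nat) (l : nat) : Prop :=
  (l <= nx l <= n)%nat /\ (forall l', (l <= l' < nx l)%nat -> cnt l' = 0%nat) /\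
  ((nx l < n)%nat -> (0 < cnt (nx l))%nat).

Lemma next_ok s : agree s0 s ->
  forall l, (l <= n)%nat -> next_of (na s 24%nat) (na (run next_cmd s) 25%nat) l.
Proof.
  intros Ha. unfold next_cmd. cbn [run evN].
  set (s1 := setn 25 (na s 0%nat 0%nat) (na s 0%nat 0%nat) s).
  assert (Ha1 : agree s0 s1) by (apply agree_setn; auto; lia).
  assert (En : na s 0%nat 0%nat = n) by (rewrite (proj1 Ha) by lia; apply Prep).
  set (I := fun k s' => agree s0 s' /\ na s' 24%nat = na s 24%nat /\
    forall l, (n - k <= l <= n)%nat -> next_of (na s 24%nat) (na s' 25%nat) l).
  assert (HI : I (na s1 0%nat 0%nat) (run (For 22 0 (
    SetN 29 (NC 0) (NSub (NSub vn (NC 1)) (var 22)) ;;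
    If (CN (NC 0) (NG 24 (var 29)))
      (SetN 25 (var 29) (var 29))
      (SetN 25 (var 29) (NG 25 (NAdd (var 29) (NC 1)))))) s1)).
  { apply (for_ind I); auto.
    - split; [apply agree_setn; auto; lia|]. split; [reflexivity|].
      intros l Hl. assert (l = n) by lia. subst l. unfold s1. rewrite En. look.
      unfold next_of. rewrite Nat.eqb_refl. split; [lia|]. split; lia.
    - intros k s' Hk Hv (Ha' & E24 & HI).
      assert (Hkn : (k < n)%nat).
      { rewrite (proj1 Ha1 0%nat), (p_n _ _ _ _ _ _ Prep) in Hk by lia. auto. }
      assert (En' : na s' 0%nat 0%nat = n) by (rewrite (proj1 Ha') by lia; apply Prep).
      split; [apply agree_setn; [lia|]; apply agree_run; auto|].
      split; [etransitivity; [|exact E24]; apply run_na; reflexivity|].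
      intros l Hl. sim. look. rewrite Hv, En', E24.
      destruct (Nat.ltb_spec 0 (na s 24%nat (n - 1 - k))) as [Hp|Hp]; sim; look;
        rewrite ?Hv, ?En'; unfold next_of.
      + destruct (Nat.eqb_spec l (n - 1 - k)) as [->|Nl].
        * split; [lia|]. split; [lia|auto].
        * apply HI. lia.
      + destruct (Nat.eqb_spec l (n - 1 - k)) as [->|Nl]; [|apply HI; lia].
        replace (n - 1 - k + 1)%nat with (n - k)%nat by lia.
        destruct (HI (n - k)%nat ltac:(lia)) as (N1 & N2 & N3).
        split; [lia|]. split; [|auto].
        intros l' Hl'. destruct (Nat.eq_dec l' (n - 1 - k)) as [->|]; [lia|]. apply N2. lia. }
  destruct HI as (_ & _ & HI). rewrite (proj1 Ha1 0%nat), (p_n _ _ _ _ _ _ Prep) in HI by lia.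
  intros l Hl. apply HI. lia.
Qed.

Lemma eval_frame_na s a : na (run eval_cmd s) a = na s a.
Proof. apply run_na. reflexivity. Qed.

Lemma nsum_ext k f g : (forall i, (i < k)%nat -> f i = g i) -> nsum k f = nsum k g.
Proof. induction k as [|k IH]; intros H; simpl; auto. rewrite IH, H; auto. Qed.

Lemma box_count B q a b' l1 l2 :
  (forall l, (l < n)%nat -> B l = bucket_count n (strip q a b') rx l) ->
  (l1 <= l2 <= n)%nat -> nsum l2 B = (nsum l1 B + count n (box q a b' l1 l2))%nat.
Proof.
  intros HB Hl.
  rewrite (nsum_ext l2 _ (bucket_count n (strip q a b') rx)), (nsum_ext l1 _ (bucket_count n (strip q a b') rx))
    by (intros i Hi; apply HB; lia).
  apply bucket_count_interval. lia.
Qed.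

(** The last clause bounds the number of advances: a right end not yet covered by the best value
    lies at or beyond the cursor, and [d] advances have then collected at least [d] points. *)
Definition scanning (q a b' l1 d : nat) (v0 : R) (s : st) : Prop :=
  agree s0 s /\ good (ra s 10%nat 0%nat) /\ v0 <= ra s 10%nat 0%nat /\
  bucketed q a b' s /\ (forall l, (l <= n)%nat -> next_of (na s 24%nat) (na s 25%nat) l) /\
  (l1 <= na s 28%nat 0 <= n)%nat /\
  ra s 13%nat 0%nat = total n (box q a b' l1 (na s 28%nat 0%nat)) m /\
  ra s 14%nat 0%nat = total n (box q a b' l1 (na s 28%nat 0%nat)) b /\
  forall l2, (l1 <= l2 <= n)%nat -> adm (box q a b' l1 l2) ->
    val (box q a b' l1 l2) <= ra s 10%nat 0%nat \/
    ((na s 28%nat 0 <= l2)%nat /\ (d <= count n (box q a b' l1 (na s 28%nat 0)))%nat).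

Lemma attained_box' q a b' l1 l2 : adm (box q a b' l1 l2) -> attained (val (box q a b' l1 l2)).
Proof. apply attained_box; auto. Qed.

Lemma adm_val_ext S S' : (forall p, (p < n)%nat -> S p = S' p) ->
  (adm S <-> adm S') /\ val S = val S'.
Proof.
  intros H. unfold adm, val, mfrac, bfrac.
  rewrite (total_ext n S S' m H), (total_ext n S S' b H). tauto.
Qed.

Lemma count_0 S p : count n S = 0%nat -> (p < n)%nat -> S p = false.
Proof.
  intros H Hp. destruct (S p) eqn:E; auto. assert (H1 := count_pos n S p Hp E). lia.
Qed.

Lemma box_grow q a b' l1 l2 l3 p : count n (box q a b' l2 l3) = 0%nat -> (l1 <= l2 <= l3)%nat ->
  (p < n)%nat -> box q a b' l1 l3 p = box q a b' l1 l2 p.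
Proof.
  intros H Hl Hp. assert (E := count_0 _ p H Hp). rewrite !box_strip in *.
  destruct (strip q a b' p); cbn [andb] in *; auto.
  apply andb_false_iff in E. rewrite Nat.leb_gt, Nat.ltb_ge in E.
  apply eq_true_iff_eq. rewrite !andb_true_iff, !Nat.leb_le, !Nat.ltb_lt. lia.
Qed.

(** Evaluating at the cursor settles every right end up to the next nonempty rank [z], since those
    regions contain the same points. Moving on to [z + 1] adds at least one point. *)
Lemma advance_ok q a b' l1 d v0 s : scanning q a b' l1 d v0 s ->
  scanning q a b' l1 (Datatypes.S d) v0 (run advance_cmd s).
Proof.
  intros (Ha & Hg & Hv & HB & HN & Hcur & H13 & H14 & HT).
  set (cur := na s 28%nat 0%nat) in *.
  destruct (eval_ok s (box q a b' l1 cur) Ha Hg H13 H14 (attained_box' _ _ _ _ _)) as (G1 & G2 & G3).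
  assert (Ha' : agree s0 (run advance_cmd s)) by (apply agree_run; auto).
  destruct (HN cur ltac:(lia)) as (N1 & N2 & N3).
  set (z := na s 25%nat cur) in *.
  set (s1 := run eval_cmd s) in *.
  assert (F : forall a, na s1 a = na s a) by (intros; apply eval_frame_na).
  assert (E0 : na s 0%nat 0%nat = n) by (rewrite (proj1 Ha) by lia; apply Prep).
  assert (E11 : ra s1 11%nat = ra s 11%nat) by (apply run_ra; reflexivity).
  assert (E12 : ra s1 12%nat = ra s 12%nat) by (apply run_ra; reflexivity).
  assert (E13 : ra s1 13%nat = ra s 13%nat) by (apply run_ra; reflexivity).
  assert (E14 : ra s1 14%nat = ra s 14%nat) by (apply run_ra; reflexivity).
  assert (Erun : run advance_cmd s =
    if Nat.ltb z n then
      setn 28 0 (z + 1) (setr 14 0 (ra s 14%nat 0%nat + ra s 12%nat z)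
        (setr 13 0 (ra s 13%nat 0%nat + ra s 11%nat z) (setn 29 0 z s1)))
    else setn 29 0 z s1).
  { unfold advance_cmd.
    cbn [run evC evN evR]. fold s1. rewrite !F. fold cur z. look. rewrite !F, E0.
    destruct (Nat.ltb z n); auto. rewrite E11, E12, E13, E14. reflexivity. }
  assert (Hempty : forall l2, (cur <= l2 <= z)%nat -> count n (box q a b' cur l2) = 0%nat).
  { intros l2 Hl2.
    assert (E := box_count (na s 24%nat) q a b' cur l2 ltac:(intros; apply HB; auto) ltac:(lia)).
    assert (Ez : nsum l2 (na s 24%nat) = nsum cur (na s 24%nat)).
    { clear E. destruct Hl2 as [Hl Hz]. induction Hl as [|l2 Hl IH]; auto. cbn [nsum].
      rewrite IH, N2 by lia. lia. }
    lia. }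
  assert (Hsame : forall l2, (l1 <= l2 <= n)%nat -> (cur <= l2 <= z)%nat ->
     adm (box q a b' l1 l2) -> val (box q a b' l1 l2) <= ra s1 10%nat 0%nat).
  { intros l2 Hl2 Hz2 HA.
    destruct (adm_val_ext (box q a b' l1 l2) (box q a b' l1 cur)) as [HA' HV].
    { intros p Hp. apply box_grow; auto. lia. }
    rewrite HV. apply G3. now apply HA'. }
  rewrite Erun in Ha'. rewrite Erun.
  destruct (Nat.ltb_spec z n) as [Hzn|Hzn].
  - assert (Hgrow : forall p, (p < n)%nat ->
      box q a b' l1 (z + 1) p = (box q a b' l1 cur p || (strip q a b' p && Nat.eqb (rx p) z))%bool).
    { intros p Hp. assert (E := count_0 _ p (Hempty z ltac:(lia)) Hp). rewrite !box_strip in *.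
      destruct (strip q a b' p); cbn [andb orb] in *; auto.
      apply andb_false_iff in E. rewrite Nat.leb_gt, Nat.ltb_ge in E.
      apply eq_true_iff_eq.
      rewrite orb_true_iff, !andb_true_iff, !Nat.leb_le, !Nat.ltb_lt, Nat.eqb_eq. lia. }
    assert (Hsum : forall w, total n (box q a b' l1 (z + 1)) w =
      total n (box q a b' l1 cur) w + bucket n (strip q a b') rx w z).
    { intros w. unfold bucket, total. rewrite <- sumR_plus. apply sumR_ext. intros p Hp.
      rewrite Hgrow by auto. rewrite box_strip.
      destruct (strip q a b' p); simpl; [|ring].
      destruct (Nat.eqb_spec (rx p) z), (Nat.ltb_spec (rx p) cur), (Nat.leb_spec l1 (rx p));
        simpl; try lia; ring. }
    assert (Hcnt : (count n (box q a b' l1 cur) < count n (box q a b' l1 (z + 1)))%nat).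
    { apply INR_lt. rewrite !INR_count, Hsum. unfold bucket.
      assert (HP := N3 Hzn). destruct (HB z Hzn) as (_ & _ & E). rewrite E in HP.
      unfold bucket_count in HP. apply lt_0_INR in HP. rewrite INR_count in HP. lra. }
    split; [exact Ha'|]. unfold bucketed. look.
    split; [exact G1|]. split; [lra|]. rewrite E11, E12, !F.
    split; [exact HB|]. split; [exact HN|]. split; [lia|].
    destruct (HB z Hzn) as (B1 & B2 & _).
    split; [rewrite Hsum, H13, B1; reflexivity|].
    split; [rewrite Hsum, H14, B2; reflexivity|].
    intros l2 Hl2 HA. destruct (HT l2 Hl2 HA) as [HV|[HV1 HV2]]; [left; lra|].
    destruct (Nat.le_gt_cases l2 z) as [Hle|Hgt].
    + left. apply Hsame; auto.
    + right. split; [lia|]. lia.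
  - split; [exact Ha'|]. unfold bucketed. look.
    split; [exact G1|]. split; [lra|]. rewrite E11, E12, E13, E14, !F. fold cur.
    split; [exact HB|]. split; [exact HN|]. split; [lia|]. split; [exact H13|]. split; [exact H14|].
    intros l2 Hl2 HA. destruct (HT l2 Hl2 HA) as [HV|[HV1 HV2]]; [left; lra|].
    left. apply Hsame; auto. lia.
Qed.

Definition strip_targets (lim : nat) (q a b' : nat) (r : R) : Prop :=
  exists l1 l2, (l1 < l2 <= n)%nat /\ adm (box q a b' l1 l2) /\
    (count n (box q a b' l1 l2) < na s0 lim 0)%nat /\ r = val (box q a b' l1 l2).

Lemma box_empty q a b' l1 l2 w : (l2 <= l1)%nat -> total n (box q a b' l1 l2) w = 0.
Proof.
  intros H. apply sumR_0. intros p _. rewrite box_strip.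
  destruct (Nat.leb_spec l1 (rx p)), (Nat.ltb_spec (rx p) l2); try lia;
    now rewrite ?andb_false_r.
Qed.

Lemma scan_from_ok lim q a b' l1 e : (lim < 16)%nat -> (l1 < n)%nat ->
  (forall s, holds e s -> na s 26%nat 0%nat = l1 /\ bucketed q a b' s /\
     forall l, (l <= n)%nat -> next_of (na s 24%nat) (na s 25%nat) l) ->
  improves s0 good e (
    SetN 28 (NC 0) (var 26) ;;
    SetR 13 (NC 0) (RN (NC 0)) ;; SetR 14 (NC 0) (RN (NC 0)) ;;
    For 27 lim advance_cmd)
  (fun r => exists l2, (l1 < l2 <= n)%nat /\ adm (box q a b' l1 l2) /\
    (count n (box q a b' l1 l2) < na s0 lim 0)%nat /\ r = val (box q a b' l1 l2)).
Proof.
  intros Hlim Hl1 He s Ha Hh Hg.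
  destruct (He s Hh) as (E26 & HB & HN).
  set (s1 := setr 14 0 (INR 0) (setr 13 0 (INR 0) (setn 28 0 l1 s))).
  assert (Erun : run (SetN 28 (NC 0) (var 26) ;;
    SetR 13 (NC 0) (RN (NC 0)) ;; SetR 14 (NC 0) (RN (NC 0)) ;;
    For 27 lim advance_cmd) s = run (For 27 lim advance_cmd) s1).
  { cbn [run evN evR]. rewrite E26. reflexivity. }
  rewrite Erun.
  assert (Elim : na s1 lim 0%nat = na s0 lim 0%nat).
  { unfold s1. cbn [na setn setr]. rewrite upd2_other_arr by (apply Nat.eqb_neq; lia).
    now rewrite (proj1 Ha). }
  assert (Ha1 : agree s0 s1) by (apply (agree_run s0 (SetN 28 (NC 0) (NC l1) ;;
    SetR 13 (NC 0) (RN (NC 0)) ;; SetR 14 (NC 0) (RN (NC 0)))); auto).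
  assert (HI : scanning q a b' l1 (na s1 lim 0%nat) (ra s 10%nat 0%nat) (run (For 27 lim advance_cmd) s1)).
  { apply (for_ind (fun d => scanning q a b' l1 d (ra s 10%nat 0%nat))); [reflexivity| |].
    - assert (Ha2 : agree s0 (setn 27 0 0 s1)) by (apply agree_setn; auto; lia).
      split; [exact Ha2|]. unfold s1, bucketed. look.
      split; [exact Hg|]. split; [apply Rle_refl|]. split; [exact HB|]. split; [exact HN|].
      split; [lia|]. rewrite !box_empty by lia. split; [reflexivity|]. split; [reflexivity|].
      intros l2 Hl2 _. right. lia.
    - intros d s' _ _ HS. apply advance_ok in HS.
      destruct HS as (J1 & J). split; [apply agree_setn; auto; lia|].
      unfold bucketed in *. look. exact J. }
  destruct HI as (_ & J1 & J2 & _ & _ & Jc & _ & _ & J). split; auto. split; auto.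
  rewrite Elim in J.
  intros r (l2 & Hl2 & HA & Hcnt & ->). destruct (J l2 ltac:(lia) HA) as [HV|[HV1 HV2]]; auto.
  (* A target still ahead contains all points collected so far, at least as many as the loop limit,
     against its count. *)
  exfalso.
  set (cur := na (run (For 27 lim advance_cmd) s1) 28%nat 0%nat) in *.
  assert (Hle : (count n (box q a b' l1 cur) <= count n (box q a b' l1 l2))%nat); [|lia].
  apply count_le. intros p _. rewrite !box_strip, !andb_true_iff, !Nat.ltb_lt. intuition lia.
Qed.

Lemma walk_ok lim q a b' : (lim < 16)%nat ->
  improves s0 good (strip_env q a b') (walk_cmd lim) (strip_targets lim q a (Datatypes.S b')).
Proof.
  intros Hlim s Ha Hh Hg. unfold walk_cmd. cbn [run].
  assert (HB := fill_ok q a b' s Ha Hh). cbn [run] in HB.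
  set (s1 := run fill_cmd (run clear_cmd s)) in *.
  assert (Ha1 : agree s0 s1).
  { apply (agree_run s0 (clear_cmd ;; fill_cmd)); auto. }
  assert (HN := next_ok s1 Ha1).
  set (s2 := run next_cmd s1) in *.
  assert (Ha2 : agree s0 s2) by (apply agree_run; auto).
  assert (E24 : na s2 24%nat = na s1 24%nat) by (apply run_na; reflexivity).
  assert (E11 : ra s2 11%nat = ra s1 11%nat) by (apply run_ra; reflexivity).
  assert (E12 : ra s2 12%nat = ra s1 12%nat) by (apply run_ra; reflexivity).
  assert (E10 : ra s2 10%nat = ra s 10%nat).
  { transitivity (ra s1 10%nat); [apply run_ra; reflexivity|].
    apply (run_ra (clear_cmd ;; fill_cmd)). reflexivity. }
  (* The four arrays just filled become constants of the environment; the scan writes none of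
     them. *)
  set (e := mkEnv nil nil ((24%nat, na s2 24%nat) :: (25%nat, na s2 25%nat) :: nil)
                  ((11%nat, ra s2 11%nat) :: (12%nat, ra s2 12%nat) :: nil)).
  assert (Hscan : improves s0 good e (scan_cmd lim)
    (fun r => exists l1, (l1 < na s0 0 0)%nat /\ exists l2, (l1 < l2 <= n)%nat /\
      adm (box q a (Datatypes.S b') l1 l2) /\
      (count n (box q a (Datatypes.S b') l1 l2) < na s0 lim 0)%nat /\
      r = val (box q a (Datatypes.S b') l1 l2))).
  { apply (improves_for s0 good e 26 0 _ (fun l1 r => exists l2, (l1 < l2 <= n)%nat /\
      adm (box q a (Datatypes.S b') l1 l2) /\
      (count n (box q a (Datatypes.S b') l1 l2) < na s0 lim 0)%nat /\
      r = val (box q a (Datatypes.S b') l1 l2))); try lia; try reflexivity.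
    intros l1 Hl1. rewrite (p_n _ _ _ _ _ _ Prep) in Hl1. apply scan_from_ok; auto.
    intros s' (J1 & _ & J3 & J4).
    assert (K24 := J3 (24%nat, na s2 24%nat) ltac:(now left)).
    assert (K25 := J3 (25%nat, na s2 25%nat) ltac:(right; now left)).
    assert (K11 := J4 (11%nat, ra s2 11%nat) ltac:(now left)).
    assert (K12 := J4 (12%nat, ra s2 12%nat) ltac:(right; now left)).
    cbn [fst snd] in *. split; [apply (J1 (26%nat, l1)); now left|].
    rewrite K24, K25. split.
    - intros l Hl. rewrite K11, K12, K24, E11, E12, E24. apply HB; auto.
    - rewrite E24. exact HN. }
  destruct (Hscan s2 Ha2) as (G1 & G2 & G3).
  { split; [|split; [|split]]; cbn; intros z Hz; intuition (subst; auto). }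
  { now rewrite E10. }
  rewrite E10 in G2. split; auto. split; auto.
  intros r (l1 & l2 & Hl & HA & Hc & ->). apply G3. exists l1.
  rewrite (p_n _ _ _ _ _ _ Prep). split; [lia|]. exists l2. auto.
Qed.

Lemma set_time_ok q e' : stable e' nil (19%nat :: nil) = true ->
  forall s, agree s0 s -> holds (with_nval 19 q e') s ->
  holds (with_rval 19 (t q) (with_nval 19 q e')) (run (SetR 19 (NC 0) (RG 4 (var 19))) s).
Proof.
  intros Hs s Ha Hh.
  assert (E19 : na s 19%nat 0%nat = q) by (apply (proj1 Hh (19%nat, q)); now left).
  assert (H : holds (with_nval 19 q e') (run (SetR 19 (NC 0) (RG 4 (var 19))) s)).
  { apply holds_run; auto. }
  destruct H as (H1 & H2 & H3). split; [exact H1|]. split; [|exact H3].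
  intros z [<-|Hz]; [|now apply H2]. sim. look. rewrite E19, (proj2 Ha) by lia. reflexivity.
Qed.

Lemma small_ok : improves s0 good (mkEnv nil nil nil nil) small_cmd
  (fun r => exists q, (q < tn)%nat /\ exists a, (a < n)%nat /\ exists b', (b' < n)%nat /\
     strip_targets 2 q a (Datatypes.S b') r).
Proof.
  eapply improves_weaken; [|apply (improves_for s0 good _ 19 1 _ (fun q r =>
    exists a, (a < na s0 0 0)%nat /\ exists b', (b' < na s0 0 0)%nat /\
     strip_targets 2 q a (Datatypes.S b') r)); try lia; try reflexivity].
  - cbv beta. rewrite (p_tn _ _ _ _ _ _ Prep), (p_n _ _ _ _ _ _ Prep). auto.
  - intros q Hq. eapply improves_after; [reflexivity|reflexivity|apply set_time_ok; reflexivity|].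
    apply (improves_for s0 good _ 20 0 _ (fun a r => exists b', (b' < na s0 0 0)%nat /\
     strip_targets 2 q a (Datatypes.S b') r)); try lia; try reflexivity.
    intros a Ha. apply (improves_for s0 good _ 21 0 _ (fun b' r =>
     strip_targets 2 q a (Datatypes.S b') r)); try lia; try reflexivity.
    intros b' Hb. intros s Hag Hh. apply walk_ok; auto; [lia|].
    apply strip_env_holds. destruct Hh as (H1 & H2 & _).
    split; [apply (H1 (20%nat, a)); right; now left|].
    split; [apply (H1 (21%nat, b')); now left|].
    apply (H2 (19%nat, t q)). now left.
Qed.

Lemma improves_if e cd c1 c2 T1 T2 (B : bool) : (forall s, agree s0 s -> holds e s -> evC cd s = B) ->
  improves s0 good e c1 T1 -> improves s0 good e c2 T2 ->
  improves s0 good e (If cd c1 c2) (fun r => if B then T1 r else T2 r).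
Proof.
  intros HB H1 H2 s Ha Hh Hg. cbn [run]. rewrite (HB s Ha Hh). destruct B; auto.
Qed.

Lemma wide_ok : improves s0 good (mkEnv nil nil nil nil) wide_cmd
  (fun r => exists q, (q < tn)%nat /\ exists a, (a < k0)%nat /\ exists j, (j < k0)%nat /\
     (j < n)%nat /\ strip_targets 9 q a (n - j) r).
Proof.
  eapply improves_weaken; [|apply (improves_for s0 good _ 19 1 _ (fun q r =>
    exists a, (a < na s0 2 0)%nat /\ exists j, (j < na s0 2 0)%nat /\
     if Nat.ltb j n then strip_targets 9 q a (Datatypes.S (n - 1 - j)) r else False));
     try lia; try reflexivity].
  - cbv beta. rewrite (p_tn _ _ _ _ _ _ Prep), (p_k0 _ _ _ _ _ _ Prep).
    intros r (q & Hq & a & Ha & j & Hj & Hjn & HT).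
    exists q. split; auto. exists a. split; auto. exists j. split; auto.
    rewrite (proj2 (Nat.ltb_lt j n) Hjn). now replace (Datatypes.S (n - 1 - j)) with (n - j)%nat by lia.
  - intros q Hq. eapply improves_after; [reflexivity|reflexivity|apply set_time_ok; reflexivity|].
    apply (improves_for s0 good _ 20 2 _ (fun a r => exists j, (j < na s0 2 0)%nat /\
     if Nat.ltb j n then strip_targets 9 q a (Datatypes.S (n - 1 - j)) r else False));
      try lia; try reflexivity.
    intros a Ha. apply (improves_for s0 good _ 41 2 _ (fun j r =>
     if Nat.ltb j n then strip_targets 9 q a (Datatypes.S (n - 1 - j)) r else False));
      try lia; try reflexivity.
    intros j Hj.
    apply (improves_if _ _ _ _ _ (fun _ => False)).
    + intros s Hag Hh. cbn [evC evN].
      rewrite (proj1 Hag 0%nat), (p_n _ _ _ _ _ _ Prep) by lia.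
      f_equal. apply (proj1 Hh (41%nat, j)). now left.
    + apply (improves_after s0 good _ (strip_env q a (n - 1 - j))); try reflexivity.
      * intros s Hag Hh. apply strip_env_holds. destruct Hh as (H1 & H2 & _). sim. look.
        rewrite (proj1 Hag 0%nat), (p_n _ _ _ _ _ _ Prep) by lia.
        split; [apply (H1 (20%nat, a)); right; now left|].
        split; [f_equal; apply (H1 (41%nat, j)); now left|].
        apply (H2 (19%nat, t q)). now left.
      * apply walk_ok. lia.
    + apply improves_skip.
Qed.

End Search.

(** * The segment tree *)

Section TreePrograms.
Variables (s0 : st) (n tn k0 h N : nat).
Hypothesis Prep : prepared s0 n tn k0 h N.

Notation K := (k0 + 3)%nat.
Notation NN := (2 ^ h)%nat.

Definition mat (s : st) (j p q : nat) : R := ra s 21%nat ((j * K + p) * K + q)%nat.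

Lemma mat_index_inj j p q j' p' q' : (p < K)%nat -> (q < K)%nat -> (p' < K)%nat -> (q' < K)%nat ->
  ((j * K + p) * K + q = (j' * K + p') * K + q')%nat -> j = j' /\ p = p' /\ q = q'.
Proof.
  intros Hp Hq Hp' Hq' E.
  assert (W : forall u v z w, (v < K)%nat -> (w < K)%nat -> (u * K + v = z * K + w)%nat ->
    u = z /\ v = w).
  { intros u v z w Hv Hw Ew. assert (u = z); [|subst; lia].
    destruct (Nat.lt_trichotomy u z) as [L|[L|L]]; auto; exfalso; nia. }
  apply W in E; auto. destruct E as [E ->]. apply W in E; auto. tauto.
Qed.

Lemma mat_set s j p q v j' p' q' : (p < K)%nat -> (q < K)%nat -> (p' < K)%nat -> (q' < K)%nat ->
  mat (setr 21 ((j * K + p) * K + q) v s) j' p' q' =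
  if (Nat.eqb j' j && Nat.eqb p' p && Nat.eqb q' q)%bool then v else mat s j' p' q'.
Proof.
  intros Hp Hq Hp' Hq'. unfold mat. cbn [ra setr]. rewrite upd2_row.
  destruct (Nat.eqb_spec ((j' * K + p') * K + q') ((j * K + p) * K + q)) as [E|E].
  - apply mat_index_inj in E; auto. destruct E as (-> & -> & ->). now rewrite !Nat.eqb_refl.
  - destruct (Nat.eqb_spec j' j) as [->|]; auto. destruct (Nat.eqb_spec p' p) as [->|]; auto.
    destruct (Nat.eqb_spec q' q) as [->|]; auto. congruence.
Qed.

Lemma agree_K s : agree s0 s -> na s 4%nat 0%nat = K.
Proof. intros Ha. rewrite (proj1 Ha) by lia. apply Prep. Qed.

Lemma agree_k0 s : agree s0 s -> na s 2%nat 0%nat = k0.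
Proof. intros Ha. rewrite (proj1 Ha) by lia. apply Prep. Qed.

Lemma agree_k1 s : agree s0 s -> na s 3%nat 0%nat = (k0 + 1)%nat.
Proof. intros Ha. rewrite (proj1 Ha) by lia. apply Prep. Qed.

Lemma agree_NN s : agree s0 s -> na s 5%nat 0%nat = NN.
Proof. intros Ha. rewrite (proj1 Ha) by lia. apply Prep. Qed.

(** A matrix is written entry by entry. The last premise says that [R] depends only on the other
    nodes and on real 29, so entries of node [j] written earlier do not disturb later ones. *)
Lemma entries_ok (body : cmd) (R : st -> nat -> nat -> R -> Prop) j s :
  low_free body = true -> memb (nmods body) 31 = false -> memb (nmods body) 32 = false ->
  memb (nmods body) 30 = false -> memb (rmods body) 29 = false ->
  agree s0 s -> na s 30%nat 0%nat = j ->
  (forall s p q, agree s0 s -> na s 30%nat 0%nat = j -> (p < K)%nat -> (q < K)%nat ->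
     na s 31%nat 0%nat = p -> na s 32%nat 0%nat = q ->
     R s p q (mat (run body s) j p q) /\
     forall j' p' q', (p' < K)%nat -> (q' < K)%nat -> (j', p', q') <> (j, p, q) ->
       mat (run body s) j' p' q' = mat s j' p' q') ->
  (forall s s' p q v, (p < K)%nat -> (q < K)%nat ->
     (forall i p q, i <> j -> (p < K)%nat -> (q < K)%nat -> mat s' i p q = mat s i p q) ->
     ra s' 29%nat = ra s 29%nat -> R s' p q v -> R s p q v) ->
  let s' := run (For 31 4 (For 32 4 body)) s in
  (forall p q, (p < K)%nat -> (q < K)%nat -> R s p q (mat s' j p q)) /\
  (forall i p q, i <> j -> (p < K)%nat -> (q < K)%nat -> mat s' i p q = mat s i p q).
Proof.
  intros HL H31 H32 H30 H29 Ha Hj Hbody HR s'.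
  set (B := fun z => agree s0 z /\ na z 30%nat = na s 30%nat /\ ra z 29%nat = ra s 29%nat /\
    forall i p q, i <> j -> (p < K)%nat -> (q < K)%nat -> mat z i p q = mat s i p q).
  assert (HBset : forall z v i, (v = 31 \/ v = 32)%nat -> B z -> B (setn v 0 i z)).
  { intros z v i Hv (B1 & B2 & B3 & B4).
    assert (X : na (setn v 0 i z) 30%nat = na z 30%nat) by (destruct Hv as [-> | ->]; reflexivity).
    split; [apply agree_setn; auto; lia|]. rewrite X. auto. }
  set (I := fun k z => B z /\ forall p q, (p < k)%nat -> (q < K)%nat -> R s p q (mat z j p q)).
  assert (HI : I (na s 4%nat 0%nat) s').
  { apply (for_ind I).
    - cbn. exact H31.
    - split; [|intros; lia]. apply HBset; auto. unfold B; auto.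
    - intros k z Hk Hv [HB HI].
      rewrite (agree_K s Ha) in Hk.
      set (J := fun d z' => B z' /\ na z' 31%nat 0%nat = k /\ forall p q, (p < K)%nat -> (q < K)%nat ->
         (p < k \/ p = k /\ q < d)%nat -> R s p q (mat z' j p q)).
      assert (HJ : J (na z 4%nat 0%nat) (run (For 32 4 body) z)).
      { apply (for_ind J); auto.
        - split; [apply HBset; auto|]. split; [exact Hv|].
          intros p q Hp Hq Hpq. apply HI; auto. lia.
        - intros d z' Hd Hvd (HB' & Hv31 & HJ).
          rewrite (agree_K z) in Hd by apply HB.
          assert (HB1 := HB'). destruct HB1 as (B1 & B2 & B3 & B4).
          assert (Hj' : na z' 30%nat 0%nat = j) by (rewrite B2; exact Hj).
          destruct (Hbody z' k d B1 Hj' Hk Hd Hv31 Hvd) as [R1 R2].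
          assert (R3 : forall i p q, i <> j -> (p < K)%nat -> (q < K)%nat ->
            mat (run body z') i p q = mat z' i p q).
          { intros i p q Hi Hp Hq. apply R2; auto. congruence. }
          split; [apply HBset; auto; split; [apply agree_run; auto|]|].
          + rewrite run_na, run_ra by auto. split; auto. split; auto.
            intros i p q Hi Hp Hq. rewrite R3; auto.
          + split; [cbn; rewrite run_na; auto|].
            intros p q Hp Hq Hpq. change (R s p q (mat (run body z') j p q)).
            destruct (Nat.eq_dec p k) as [->|Np]; [destruct (Nat.eq_dec q d) as [->|Nq]|].
            * apply (HR s z'); auto.
            * rewrite R2; auto; [|congruence]. apply HJ; auto. lia.
            * rewrite R2; auto; [|congruence]. apply HJ; auto. lia. }
      rewrite (agree_K z) in HJ by apply HB.
      destruct HJ as (HB' & _ & HJ). split; [apply HBset; auto|].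
      intros p q Hp Hq. apply HJ; auto; lia. }
  rewrite (agree_K s Ha) in HI. destruct HI as [HB HI]. split; auto. apply HB.
Qed.

Lemma leaf_ok l s : agree s0 s -> na s 39%nat 0%nat = l ->
  let s' := run leaf_cmd s in
  (forall p q, (p < K)%nat -> (q < K)%nat ->
     mat s' (NN + l) p q = leaf_entry k0 (ra s 29%nat 0%nat) (na s 34%nat l) (ra s 20%nat l) p q) /\
  (forall i p q, i <> (NN + l)%nat -> (p < K)%nat -> (q < K)%nat -> mat s' i p q = mat s i p q).
Proof.
  intros Ha Hl s'. unfold s', leaf_cmd. clear s'.
  set (tail := For 31 3 _). set (fill := For 31 4 _).
  cbn [run]. set (s1 := setn 30 (evN (NC 0) s) (evN (NAdd vNN (var 39)) s) s).
  assert (Ha1 : agree s0 s1) by (apply agree_setn; auto; lia).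
  assert (E30 : na s1 30%nat 0%nat = (NN + l)%nat).
  { unfold s1. cbn [evN]. rewrite (agree_NN s Ha), Hl. reflexivity. }
  destruct (entries_ok (SetR 21 (tix (var 30) (var 31) (var 32)) (rvar 29))
    (fun z p q v => v = ra z 29%nat 0%nat) (NN + l) s1) as [F1 F2]; auto.
  { intros z p q Haz Hz Hp Hq Hvp Hvq.
    assert (E : run (SetR 21 (tix (var 30) (var 31) (var 32)) (rvar 29)) z =
      setr 21 (((NN + l) * K + p) * K + q) (ra z 29%nat 0%nat) z).
    { cbn [run evN evR tix]. rewrite Hz, Hvp, Hvq, (agree_K z Haz). reflexivity. }
    rewrite E. split.
    - rewrite mat_set by auto. now rewrite !Nat.eqb_refl.
    - intros j' p' q' Hp' Hq' Hne. rewrite mat_set by auto.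
      destruct (Nat.eqb_spec j' (NN + l)) as [->|]; auto. destruct (Nat.eqb_spec p' p) as [->|]; auto.
      destruct (Nat.eqb_spec q' q) as [->|]; auto. congruence. }
  { intros z z' p q v _ _ _ E ->. now rewrite E. }
  fold fill in F1, F2. set (s2 := run fill s1) in *.
  assert (Ha2 : agree s0 s2) by (apply agree_run; auto).
  assert (E30' : na s2 30%nat 0%nat = (NN + l)%nat) by (unfold s2; rewrite run_na; auto).
  set (s3 := setr 21 (((NN + l) * K + (k0 + 2)) * K + (k0 + 2)) (INR 0)
    (setr 21 (((NN + l) * K + k0) * K + (k0 + 2)) (INR 0)
    (setr 21 (((NN + l) * K + (k0 + 1)) * K + 0) (INR 0)
    (setr 21 (((NN + l) * K + (k0 + 1)) * K + (k0 + 1)) (INR 0) s2)))).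
  match goal with |- context [run tail ?z] => assert (E3 : z = s3) end.
  { unfold s3. cbn [evN evR tix na setr].
    rewrite E30', (agree_K s2 Ha2), (agree_k0 s2 Ha2), (agree_k1 s2 Ha2). reflexivity. }
  rewrite E3. clear E3.
  assert (Ha3 : agree s0 s3).
  { destruct Ha2 as [A1 A2]. split; [exact A1|]. intros a Hlt. unfold s3. cbn [ra setr].
    rewrite !upd2_other_arr by (apply Nat.eqb_neq; lia). auto. }
  assert (M3 : forall i p q, (p < K)%nat -> (q < K)%nat -> mat s3 i p q =
    if Nat.eqb i (NN + l) then
      if (Nat.eqb p (k0 + 1) && (Nat.eqb q (k0 + 1) || Nat.eqb q 0)
          || (Nat.eqb p k0 || Nat.eqb p (k0 + 2)) && Nat.eqb q (k0 + 2))%bool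
      then 0 else ra s 29%nat 0%nat
    else mat s i p q).
  { intros i p q Hp Hq. unfold s3. rewrite !mat_set by lia.
    destruct (Nat.eqb_spec i (NN + l)) as [->|Ni]; cbn [andb].
    - rewrite F1 by auto. change (ra s1 29%nat 0%nat) with (ra s 29%nat 0%nat).
      change (INR 0) with 0.
      destruct (Nat.eqb p (k0 + 1)), (Nat.eqb p (k0 + 2)), (Nat.eqb p k0),
        (Nat.eqb q (k0 + 1)), (Nat.eqb q (k0 + 2)), (Nat.eqb q 0); reflexivity.
    - rewrite F2 by auto. reflexivity. }
  assert (E30s : na s3 30%nat = na s2 30%nat) by reflexivity.
  assert (E34s : na s3 34%nat = na s 34%nat).
  { change (na s2 34%nat = na s 34%nat). unfold s2. rewrite run_na; auto. }
  assert (E39s : na s3 39%nat 0%nat = l).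
  { change (na s2 39%nat 0%nat = l). unfold s2. rewrite run_na; auto. }
  assert (E20s : ra s3 20%nat = ra s 20%nat).
  { change (ra s2 20%nat = ra s 20%nat). unfold s2. rewrite run_ra; auto. }
  set (I := fun k z => agree s0 z /\ na z 30%nat = na s3 30%nat /\ na z 34%nat = na s3 34%nat /\
    na z 39%nat = na s3 39%nat /\ ra z 20%nat = ra s3 20%nat /\
    forall i p q, (p < K)%nat -> (q < K)%nat -> mat z i p q =
      if (Nat.eqb i (NN + l) && Nat.ltb p k && Nat.eqb q (Nat.min (p + na s 34%nat l) k0))%bool
      then ra s 20%nat l else mat s3 i p q).
  assert (HI : I (na s3 3%nat 0%nat) (run tail s3)).
  { apply (for_ind I); auto.
    - split; [apply agree_setn; auto; lia|]. repeat (split; [reflexivity|]).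
      intros i p q _ _. rewrite andb_false_r. reflexivity.
    - intros k z Hk Hv (Az & Z1 & Z2 & Z3 & Z4 & Z5).
      rewrite (agree_k1 s3 Ha3) in Hk.
      set (q0 := Nat.min (k + na s 34%nat l) k0).
      match goal with |- I _ (setn _ _ _ (run ?bb z)) => set (body := bb) end.
      assert (Er : run body z = setr 21 (((NN + l) * K + k) * K + q0) (ra s 20%nat l)
        (if Nat.ltb k0 (k + na s 34%nat l) then setn 32 0 k0 (setn 32 0 (k + na s 34%nat l) z)
         else setn 32 0 (k + na s 34%nat l) z)).
      { unfold body. cbn [run evN evR evC tix].
        rewrite Hv, Z2, Z3, E39s, E34s. cbn [na setn]. rewrite upd2_same.
        change (upd2 (na z) 32 0 (k + na s 34%nat l)%nat 2%nat) with (na z 2%nat).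
        rewrite (agree_k0 z Az).
        unfold q0. destruct (Nat.ltb_spec k0 (k + na s 34%nat l)); cbn [na ra setn]; unfold upd2;
          cbn [Nat.eqb andb]; rewrite (agree_K z Az), Z1, Hv, Z3, E39s, Z4, E20s, E30s, E30';
          [rewrite (Nat.min_r (k + na s 34%nat l) k0) by lia|rewrite (Nat.min_l (k + na s 34%nat l) k0) by lia];
          reflexivity. }
      split; [apply agree_setn; [lia|]; apply agree_run; auto|].
      assert (X : na (run body z) 30%nat = na z 30%nat /\ na (run body z) 34%nat = na z 34%nat /\
        na (run body z) 39%nat = na z 39%nat /\ ra (run body z) 20%nat = ra z 20%nat).
      { rewrite !run_na, !run_ra by reflexivity. auto. }
      destruct X as (X1 & X2 & X3 & X4).
      split; [now rewrite <- Z1, <- X1|]. split; [now rewrite <- Z2, <- X2|].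
      split; [now rewrite <- Z3, <- X3|]. split; [now rewrite <- Z4, <- X4|].
      intros i p q Hp Hq. change (mat (setn 31 0 (S k) (run body z)) i p q) with (mat (run body z) i p q).
      rewrite Er, mat_set by (unfold q0; lia).
      replace (mat (if Nat.ltb k0 (k + na s 34%nat l) then _ else _) i p q) with (mat z i p q)
        by (destruct (Nat.ltb k0 (k + na s 34%nat l)); reflexivity).
      rewrite Z5 by auto. unfold q0.
      destruct (Nat.eqb_spec i (NN + l)); cbn [andb]; auto.
      destruct (Nat.eqb_spec p k) as [->|Np]; cbn [andb].
      + rewrite (proj2 (Nat.ltb_lt k (S k))), (Nat.ltb_irrefl k) by lia. cbn [andb]. reflexivity.
      + replace (Nat.ltb p (S k)) with (Nat.ltb p k); auto.
        apply eq_true_iff_eq. rewrite !Nat.ltb_lt. lia. }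
  rewrite (agree_k1 s3 Ha3) in HI. destruct HI as (_ & _ & _ & _ & _ & HI).
  split.
  - intros p q Hp Hq. rewrite HI, M3 by auto. rewrite Nat.eqb_refl. cbn [andb].
    unfold leaf_entry. replace (Nat.leb p k0) with (Nat.ltb p (k0 + 1))
      by (apply eq_true_iff_eq; rewrite Nat.ltb_lt, Nat.leb_le; lia).
    destruct (Nat.ltb p (k0 + 1) && Nat.eqb q (Nat.min (p + na s 34%nat l) k0))%bool; auto.
    destruct (Nat.eqb p (k0 + 1) && (Nat.eqb q (k0 + 1) || Nat.eqb q 0))%bool; cbn [orb]; auto.
  - intros i p q Hi Hp Hq. rewrite HI, M3 by auto.
    destruct (Nat.eqb_spec i (NN + l)); [congruence|]. reflexivity.
Qed.

Notation node_ok s := (consistent K (mat s)).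

(** As [1 <= j], the children [2 * j] and [2 * j + 1] differ from [j], and the operands of the
    product stay intact while the node is overwritten. *)
Lemma combine_ok j s : agree s0 s -> na s 30%nat 0%nat = j -> (1 <= j)%nat ->
  let s' := run combine_cmd s in
  node_ok s' j /\
  (forall i p q, i <> j -> (p < K)%nat -> (q < K)%nat -> mat s' i p q = mat s i p q).
Proof.
  intros Ha Hj Hj1.
  set (R := fun z p q v =>
    (forall r, (r < K)%nat -> mat z (2 * j) p r + mat z (2 * j + 1) r q <= v) /\
    exists r, (r < K)%nat /\ v = mat z (2 * j) p r + mat z (2 * j + 1) r q).
  unfold combine_cmd.
  match goal with |- context [For 31 4 (For 32 4 ?bb)] => set (body := bb) end.
  destruct (entries_ok body R j s) as [E1 E2]; auto.
  - intros z p q Haz Hz Hp Hq Hvp Hvq.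
    set (sum := fun r => mat z (2 * j) p r + mat z (2 * j + 1) r q).
    assert (Hchild : forall z' e, na z' 30%nat = na z 30%nat -> na z' 31%nat = na z 31%nat ->
      na z' 32%nat = na z 32%nat -> na z' 4%nat = na z 4%nat -> ra z' 21%nat = ra z 21%nat ->
      evR (child_sum e) z' = sum (evN e z')).
    { intros z' e X1 X2 X3 X4 X5. cbn [child_sum evR evN tix].
      rewrite X1, X2, X3, X4, X5, Hz, Hvp, Hvq, (agree_K z Haz). reflexivity. }
    unfold body.
    match goal with |- context [For 33 4 ?bb] => set (inner := bb) end.
    set (loop := For 33 4 inner).
    cbn [run]. rewrite (Hchild z (NC 0)) by reflexivity. cbn [evN].
    set (z1 := setr 22 0 (sum 0%nat) z).
    set (I := fun k z' => (forall a, a <> 33%nat -> na z' a = na z a) /\ ra z' 21%nat = ra z 21%nat /\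
      (forall r, (r < k)%nat -> sum r <= ra z' 22%nat 0%nat) /\
      exists r, (r < K)%nat /\ ra z' 22%nat 0%nat = sum r).
    assert (HI : I (na z1 4%nat 0%nat) (run (For 33 4 inner) z1)).
    { apply (for_ind I); auto.
      - split; [intros a Hna; cbn; apply upd2_other_arr; now apply Nat.eqb_neq|].
        split; [reflexivity|]. split; [intros r Hr; lia|]. exists 0%nat. split; [lia|reflexivity].
      - intros k z' Hk Hv (I1 & I2 & I3 & r0 & Hr0 & I4).
        assert (Hk' : (k < K)%nat).
        { change (na z1 4%nat 0%nat) with (na z 4%nat 0%nat) in Hk. now rewrite (agree_K z Haz) in Hk. }
        assert (Er : run inner z' =
          if Rltb (ra z' 22%nat 0%nat) (sum k) then setr 22 0 (sum k) (setr 23 0 (sum k) z')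
          else setr 23 0 (sum k) z').
        { unfold inner. cbn [run evC]. rewrite (Hchild z' (var 33)) by (auto; apply I1; lia).
          cbn [evN]. rewrite Hv. cbn [evR evN ra setr]. rewrite upd2_same.
          change (upd2 (ra z') 23 0 (sum k) 22%nat 0%nat) with (ra z' 22%nat 0%nat). reflexivity. }
        rewrite Er.
        split; [intros a Hna; destruct (Rltb _ _); cbn [na setn setr];
          rewrite upd2_other_arr by (now apply Nat.eqb_neq); auto|].
        split; [destruct (Rltb _ _); exact I2|].
        rcase HR.
        + replace (ra (setn 33 0 (S k) (setr 22 0 (sum k) (setr 23 0 (sum k) z'))) 22%nat 0%nat)
            with (sum k) by reflexivity.
          split; [|exists k; auto]. intros r Hr. destruct (Nat.eq_dec r k) as [->|Nr]; [lra|].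
          apply Rle_trans with (ra z' 22%nat 0%nat); [apply I3; lia|lra].
        + replace (ra (setn 33 0 (S k) (setr 23 0 (sum k) z')) 22%nat 0%nat)
            with (ra z' 22%nat 0%nat) by reflexivity.
          split; [|exists r0; auto]. intros r Hr. destruct (Nat.eq_dec r k) as [->|Nr]; [lra|].
          apply I3; lia. }
    change (na z1 4%nat 0%nat) with (na z 4%nat 0%nat) in HI. rewrite (agree_K z Haz) in HI.
    change (For 33 4 inner) with loop in HI.
    set (z2 := run loop z1) in *. destruct HI as (I1 & I2 & I3 & I4).
    assert (Ei : evN (tix (var 30) (var 31) (var 32)) z2 = ((j * K + p) * K + q)%nat).
    { cbn [evN tix]. rewrite !I1 by lia. rewrite Hz, Hvp, Hvq, (agree_K z Haz). reflexivity. }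
    assert (EM : forall i p' q', mat z2 i p' q' = mat z i p' q') by (intros; unfold mat; now rewrite I2).
    rewrite Ei. cbn [evR evN]. split.
    + rewrite mat_set by auto. rewrite !Nat.eqb_refl. cbn [andb]. unfold R.
      split; [exact I3|exact I4].
    + intros j' p' q' Hp' Hq' Hne. rewrite mat_set by auto. rewrite EM.
      destruct (Nat.eqb_spec j' j) as [->|]; auto. destruct (Nat.eqb_spec p' p) as [->|]; auto.
      destruct (Nat.eqb_spec q' q) as [->|]; auto. congruence.
  - intros z z' p q v Hp Hq HM _ [R1 (r & Hr & R2)]. split.
    + intros r' Hr'. rewrite <- !HM by lia. now apply R1.
    + exists r. split; auto. rewrite <- !HM by lia. exact R2.
  - split; [|exact E2]. intros p q Hp Hq. destruct (E1 p q Hp Hq) as [R1 (r & Hr & R2)]. split.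
    + intros r' Hr'. rewrite (E2 (2 * j)%nat), (E2 (2 * j + 1)%nat) by lia. now apply R1.
    + exists r. split; auto. rewrite (E2 (2 * j)%nat), (E2 (2 * j + 1)%nat) by lia. exact R2.
Qed.

Lemma node_ok_ext s s' i : (forall k p q, (k = i \/ k = 2 * i \/ k = 2 * i + 1)%nat ->
    (p < K)%nat -> (q < K)%nat -> mat s' k p q = mat s k p q) ->
  node_ok s i -> node_ok s' i.
Proof.
  intros HM H p q Hp Hq. destruct (H p q Hp Hq) as [H1 (r & Hr & H2)].
  rewrite HM by auto. split.
  - intros r' Hr'. rewrite !HM by auto. now apply H1.
  - exists r. split; auto. rewrite !HM by auto. exact H2.
Qed.

(** Only ancestors of [J] may be out of date. Recomputing one of them can invalidate only its
    parent, which is the next node on the path. *)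
Lemma climb_ok J s : agree s0 s -> na s 30%nat 0%nat = J -> (NN <= J < 2 * NN)%nat ->
  (forall i, (1 <= i < NN)%nat -> (forall e, (1 <= e <= h)%nat -> i <> (J / 2 ^ e)%nat) -> node_ok s i) ->
  let s' := run climb_cmd s in
  (forall i, (1 <= i < NN)%nat -> node_ok s' i) /\
  (forall i p q, (NN <= i)%nat -> (p < K)%nat -> (q < K)%nat -> mat s' i p q = mat s i p q).
Proof.
  intros Ha HJ HJr Hok s'.
  set (I := fun k z => agree s0 z /\ na z 30%nat 0%nat = (J / 2 ^ k)%nat /\
    (forall i, (1 <= i < NN)%nat -> (forall e, (k < e <= h)%nat -> i <> (J / 2 ^ e)%nat) -> node_ok z i) /\
    (forall i p q, (NN <= i)%nat -> (p < K)%nat -> (q < K)%nat -> mat z i p q = mat s i p q)).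
  assert (Eh : na s 6%nat 0%nat = h) by (rewrite (proj1 Ha) by lia; apply Prep).
  assert (HI : I (na s 6%nat 0%nat) s').
  { apply (for_ind I); auto.
    - split; [apply agree_setn; auto; lia|].
      split; [rewrite Nat.div_1_r; exact HJ|]. split; [|reflexivity].
      intros i Hi He. apply Hok; [exact Hi|]. intros e Hle. apply He. lia.
    - intros k z Hk Hv (Az & Z1 & Z2 & Z3). rewrite Eh in Hk.
      set (u := (J / 2 ^ k)%nat) in *.
      assert (Hpk : (2 ^ k <> 0)%nat) by (apply Nat.pow_nonzero; lia).
      assert (Epow : (2 ^ h = 2 ^ k * 2 ^ (h - k))%nat) by (rewrite <- Nat.pow_add_r; f_equal; lia).
      assert (Epow1 : (2 ^ (h - k) = 2 * 2 ^ (h - k - 1))%nat).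
      { rewrite <- Nat.pow_succ_r'. f_equal. lia. }
      assert (Hp1 : (2 ^ (h - k - 1) <> 0)%nat) by (apply Nat.pow_nonzero; lia).
      assert (Hu : (2 * 2 ^ (h - k - 1) <= u < 4 * 2 ^ (h - k - 1))%nat).
      { unfold u. split; [apply Nat.div_le_lower_bound; auto; nia|apply Nat.Div0.div_lt_upper_bound; nia]. }
      assert (Hu' : (u < 2 * NN)%nat).
      { unfold u. apply Nat.le_lt_trans with J; [|lia]. apply Nat.Div0.div_le_upper_bound; nia. }
      assert (Hhalf : (J / 2 ^ S k = u / 2)%nat).
      { unfold u. rewrite Nat.pow_succ_r', (Nat.mul_comm 2), Nat.Div0.div_div. reflexivity. }
      assert (Hdm := Nat.div_mod_eq u 2). assert (Hmd := Nat.mod_upper_bound u 2 ltac:(lia)).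
      set (v := (u / 2)%nat) in *.
      assert (Hv1 : (1 <= v < NN)%nat) by lia.
      assert (Hpar : na z 15%nat u = v).
      { rewrite (proj1 Az) by lia. destruct (p_par _ _ _ _ _ _ Prep v ltac:(lia)) as [P1 P2].
        destruct (Nat.eq_dec (u mod 2) 0) as [E0|E0].
        - rewrite E0, Nat.add_0_r in Hdm. rewrite Hdm. exact P1.
        - replace (u mod 2)%nat with 1%nat in Hdm by lia. rewrite Hdm. exact P2. }
      cbn [run evN]. rewrite Z1, Hpar.
      set (z1 := setn 30 0 v z).
      assert (Az1 : agree s0 z1) by (apply agree_setn; auto; lia).
      destruct (combine_ok v z1 Az1) as [C1 C2]; [unfold z1; cbn [na setn]; apply upd2_same|lia|].
      set (z2 := run combine_cmd z1) in *.
      assert (E30 : na z2 30%nat 0%nat = v).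
      { unfold z2. rewrite run_na by reflexivity. unfold z1. cbn [na setn]. apply upd2_same. }
      split; [apply agree_setn; [lia|]; apply agree_run; auto|].
      split; [rewrite Hhalf; exact E30|]. split.
      + intros i Hi He. apply (node_ok_ext z2); [reflexivity|].
        destruct (Nat.eq_dec i v) as [->|Niv]; [exact C1|].
        (* A node with child [v] is the next ancestor, excluded by [He]; when [v] is already the
           root, its parent would be 0, which is out of range. *)
        assert (Hnot : (2 * i <> v /\ 2 * i + 1 <> v)%nat).
        { destruct (Nat.le_gt_cases h (S k)) as [Hle|Hgt].
          - assert (Ehk : (2 ^ (h - k - 1) = 1)%nat) by (replace (h - k - 1)%nat with 0%nat by lia; auto).
            lia.
          - assert (E2 : (J / 2 ^ S (S k) = v / 2)%nat).
            { rewrite Nat.pow_succ_r', (Nat.mul_comm 2), <- Nat.Div0.div_div, Hhalf. reflexivity. }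
            assert (Hne := He (S (S k)) ltac:(lia)). rewrite E2 in Hne.
            assert (Hdm2 := Nat.div_mod_eq v 2). assert (Hmd2 := Nat.mod_upper_bound v 2 ltac:(lia)).
            lia. }
        apply (node_ok_ext z1).
        * intros k' p q Hk' Hp Hq. apply C2; auto. lia.
        * apply (node_ok_ext z); [reflexivity|]. apply Z2; auto.
          intros e Hle. destruct (Nat.eq_dec e (S k)) as [->|]; [rewrite Hhalf; auto|]. apply He. lia.
      + intros i p q Hi Hp Hq. change (mat (setn 35 0 (S k) z2) i p q) with (mat z2 i p q).
        rewrite C2 by (auto; lia). change (mat z1 i p q) with (mat z i p q). auto. }
  rewrite Eh in HI. destruct HI as (_ & _ & I2 & I3). split; auto.
  intros i Hi. apply I2; auto. intros e He. lia.
Qed.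

Definition tree_ok (s : st) : Prop :=
  (forall l p q, (l < NN)%nat -> (p < K)%nat -> (q < K)%nat ->
     mat s (NN + l) p q = leaf_entry k0 (ra s 29%nat 0%nat) (na s 34%nat l) (ra s 20%nat l) p q) /\
  (forall i, (1 <= i < NN)%nat -> node_ok s i).

(** Internal nodes are recomputed by decreasing number, hence after their children. Number 0 is not
    a node and is skipped. *)
Lemma reset_ok s : agree s0 s ->
  let s' := run reset_cmd s in
  tree_ok s' /\ forall l, (l < NN)%nat -> na s' 34%nat l = 0%nat /\ ra s' 20%nat l = 0.
Proof.
  intros Ha s'. unfold s', reset_cmd. clear s'.
  match goal with |- context [Seq (For 39 5 ?b1) (For 35 5 ?b2)] =>
    set (body1 := b1); set (body2 := b2) end.
  cbn [run]. change (niter _ _ (setn 39 0 0 s)) with (run (For 39 5 body1) s).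
  set (I := fun k z => agree s0 z /\ ra z 29%nat = ra s 29%nat /\ forall l, (l < k)%nat ->
    na z 34%nat l = 0%nat /\ ra z 20%nat l = 0 /\
    forall p q, (p < K)%nat -> (q < K)%nat ->
      mat z (NN + l) p q = leaf_entry k0 (ra s 29%nat 0%nat) 0 0 p q).
  assert (HI : I (na s 5%nat 0%nat) (run (For 39 5 body1) s)).
  { apply (for_ind I); auto.
    - split; [apply agree_setn; auto; lia|]. split; [reflexivity|]. intros l Hl. lia.
    - intros k z Hk Hv (Az & Z1 & Z2).
      unfold body1. cbn [run evN evR]. rewrite Hv. cbn [na setn]. change (INR 0) with 0.
      replace (upd2 (na z) 34 k 0%nat 39%nat 0%nat) with k by (symmetry; exact Hv).
      set (z1 := setr 20 k 0 (setn 34 k 0 z)).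
      assert (Az1 : agree s0 z1).
      { destruct Az as [A1 A2]. split; intros a Hlt; unfold z1; cbn [na ra setn setr].
        - rewrite upd2_other_arr by (apply Nat.eqb_neq; lia). auto.
        - rewrite upd2_other_arr by (apply Nat.eqb_neq; lia). auto. }
      destruct (leaf_ok k z1 Az1 Hv) as [L1 L2].
      assert (X34 : na (run leaf_cmd z1) 34%nat = na z1 34%nat) by (apply run_na; reflexivity).
      assert (X20 : ra (run leaf_cmd z1) 20%nat = ra z1 20%nat) by (apply run_ra; reflexivity).
      assert (X29 : ra (run leaf_cmd z1) 29%nat = ra z1 29%nat) by (apply run_ra; reflexivity).
      set (z2 := run leaf_cmd z1) in *.
      split; [apply agree_setn; [lia|]; apply agree_run; auto|].
      split; [exact (eq_trans X29 Z1)|].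
      intros l Hl. change (mat (setn 39 0 (S k) z2)) with (mat z2).
      change (na (setn 39 0 (S k) z2) 34%nat) with (na z2 34%nat).
      change (ra (setn 39 0 (S k) z2) 20%nat) with (ra z2 20%nat).
      rewrite X34, X20.
      change (ra z1 29%nat) with (ra z 29%nat) in L1. rewrite Z1 in L1.
      unfold z1 in L1, L2 |- *. cbn [na ra setn setr] in *. rewrite !upd2_same in L1.
      rewrite !upd2_row.
      destruct (Nat.eqb_spec l k) as [->|Nl]; [auto|].
      destruct (Z2 l ltac:(lia)) as (W1 & W2 & W3). split; auto. split; auto.
      intros p q Hp Hq. rewrite L2 by (auto; lia). rewrite <- W3 by auto. reflexivity. }
  rewrite (agree_NN s Ha) in HI. destruct HI as (Ha1 & E29 & HI).
  set (s1 := run (For 39 5 body1) s) in *.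
  match goal with |- tree_ok ?z /\ _ => change z with (run (For 35 5 body2) s1) end.
  set (J := fun k z => agree s0 z /\
    (forall i p q, (NN <= i)%nat -> (p < K)%nat -> (q < K)%nat -> mat z i p q = mat s1 i p q) /\
    forall i, (1 <= i < NN)%nat -> (NN - k <= i)%nat -> node_ok z i).
  assert (HJ : J (na s1 5%nat 0%nat) (run (For 35 5 body2) s1)).
  { apply (for_ind J); auto.
    - split; [apply agree_setn; auto; lia|]. split; [reflexivity|]. intros i Hi Hi'. lia.
    - intros k z Hk Hv (Az & Z1 & Z2). rewrite (agree_NN s1 Ha1) in Hk.
      set (j := (NN - 1 - k)%nat). set (z1 := setn 30 0 j z).
      assert (Er : run body2 z = if Nat.ltb 0 j then run combine_cmd z1 else z1).
      { unfold body2. cbn [run evN evC]. rewrite (agree_NN z Az), Hv. fold j z1.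
        replace (na z1 30%nat 0%nat) with j by (symmetry; apply upd2_same). reflexivity. }
      split; [apply agree_setn; [lia|]; apply agree_run; auto|].
      change (mat (setn 35 0 (S k) (run body2 z))) with (mat (run body2 z)).
      rewrite Er.
      assert (Az1 : agree s0 z1) by (apply (agree_setn s0 30 0 j z); auto; lia).
      destruct (Nat.ltb_spec 0 j) as [Hj|Hj].
      + destruct (combine_ok j z1 Az1 ltac:(apply upd2_same) ltac:(lia)) as [C1 C2].
        split.
        * intros i p q Hi Hp Hq. rewrite C2 by (auto; unfold j; lia). apply (Z1 i p q); auto.
        * intros i Hi Hi'. destruct (Nat.eq_dec i j) as [->|Nij]; [exact C1|].
          apply (node_ok_ext z1); [intros k' p q Hk' Hp Hq; apply C2; auto; unfold j in *; lia|].
          apply (Z2 i); auto. unfold j in *. lia.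
      + split; [exact Z1|]. intros i Hi Hi'. apply (Z2 i); auto. unfold j in *. lia. }
  rewrite (agree_NN s1 Ha1) in HJ. destruct HJ as (_ & J1 & J2).
  assert (X34 : na (run (For 35 5 body2) s1) 34%nat = na s1 34%nat) by (apply run_na; reflexivity).
  assert (X20 : ra (run (For 35 5 body2) s1) 20%nat = ra s1 20%nat) by (apply run_ra; reflexivity).
  assert (X29 : ra (run (For 35 5 body2) s1) 29%nat = ra s1 29%nat) by (apply run_ra; reflexivity).
  unfold tree_ok. rewrite X34, X20, X29, E29. split; [split|].
  - intros l p q Hl Hp Hq. rewrite J1 by (auto; lia).
    destruct (HI l Hl) as (W1 & W2 & W3). rewrite W1, W2. auto.
  - intros i Hi. apply J2; auto. lia.
  - intros l Hl. destruct (HI l Hl) as (W1 & W2 & _). auto.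
Qed.

(** Changing a leaf invalidates only its parent, its first ancestor, so the precondition of
    [climb_ok] holds. The shift by one in [l0] keeps leaf 0 idle. *)
Lemma insert_ok p s : agree s0 s -> tree_ok s -> (p < n)%nat -> na s 40%nat 0%nat = p ->
  let s' := run insert_cmd s in
  let l0 := (rank n (ra s0 0%nat) p + 1)%nat in
  tree_ok s' /\
  forall l, na s' 34%nat l = (na s 34%nat l + if Nat.eqb l l0 then 1 else 0)%nat /\
    ra s' 20%nat l = ra s 20%nat l + if Nat.eqb l l0 then
      ra s 26%nat 0%nat * ra s0 3%nat p - ra s 27%nat 0%nat * ra s0 2%nat p else 0.
Proof.
  intros Ha [T1 T2] Hp Hvp s' l0. unfold s', insert_cmd. clear s'.
  assert (Hl0 : (l0 < NN)%nat).
  { assert (H1 := rank_bound n (ra s0 0%nat) p Hp). assert (H2 := p_size _ _ _ _ _ _ Prep).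
    unfold l0. lia. }
  assert (Erx : na s 11%nat p = rank n (ra s0 0%nat) p).
  { rewrite (proj1 Ha) by lia. apply Prep; auto. }
  cbn [run].
  set (v := ra s 20%nat l0 + (ra s 26%nat 0%nat * ra s0 3%nat p - ra s 27%nat 0%nat * ra s0 2%nat p)).
  set (s1 := setr 20 l0 v (setn 34 l0 (na s 34%nat l0 + 1) (setn 39 0 l0 s))).
  match goal with |- context [run leaf_cmd ?z] => assert (E1 : z = s1) end.
  { unfold s1, v. cbn [evN evR]. rewrite Hvp, Erx. fold l0.
    assert (U : forall f : nat -> nat -> nat, upd2 f 39 0 l0 39%nat 0%nat = l0) by (intros; apply upd2_same).
    cbn [na ra setn setr]. unfold upd2 at 2 3 4 5 6 7. cbn [Nat.eqb andb].
    unfold upd2. cbn [Nat.eqb andb].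
    rewrite Hvp, (proj2 Ha 2%nat), (proj2 Ha 3%nat) by lia. reflexivity. }
  rewrite E1. clear E1.
  assert (Ha1 : agree s0 s1).
  { destruct Ha as [A1 A2]. split; intros a Hlt; unfold s1; cbn [na ra setn setr];
      rewrite ?upd2_other_arr by (apply Nat.eqb_neq; lia); auto. }
  destruct (leaf_ok l0 s1 Ha1 ltac:(reflexivity)) as [L1 L2].
  assert (Y34 : na (run leaf_cmd s1) 34%nat = na s1 34%nat) by (apply run_na; reflexivity).
  assert (Y20 : ra (run leaf_cmd s1) 20%nat = ra s1 20%nat) by (apply run_ra; reflexivity).
  assert (Y29 : ra (run leaf_cmd s1) 29%nat = ra s1 29%nat) by (apply run_ra; reflexivity).
  assert (Y30 : na (run leaf_cmd s1) 30%nat 0%nat = (NN + l0)%nat).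
  { unfold leaf_cmd. match goal with |- context [Seq (SetN 30 _ _) ?r] => set (rest := r) end.
    cbn [run]. rewrite (run_na rest) by reflexivity. cbn [na setn evN]. rewrite upd2_same.
    rewrite (agree_NN s1 Ha1). reflexivity. }
  assert (Ha2 : agree s0 (run leaf_cmd s1)) by (apply agree_run; auto).
  set (s2 := run leaf_cmd s1) in *.
  destruct (climb_ok (NN + l0) s2 Ha2 Y30 ltac:(lia)) as [C1 C2].
  { intros i Hi He. apply (node_ok_ext s1).
    - intros k' p' q' Hk' Hp' Hq'. apply L2; auto. intros E.
      assert (Hpos : (0 < h)%nat) by (destruct h; simpl in *; lia).
      apply (He 1%nat); [lia|]. change (2 ^ 1)%nat with 2%nat.
      rewrite <- E. destruct Hk' as [-> | [-> | ->]].
      + lia.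
      + rewrite Nat.mul_comm, Nat.div_mul by lia. reflexivity.
      + rewrite Nat.add_comm, Nat.mul_comm, Nat.div_add by lia. reflexivity.
    - apply (node_ok_ext s); [reflexivity|]. auto. }
  set (s3 := run climb_cmd s2) in *.
  assert (Z34 : na s3 34%nat = na s1 34%nat) by (transitivity (na s2 34%nat); [apply run_na; reflexivity|auto]).
  assert (Z20 : ra s3 20%nat = ra s1 20%nat) by (transitivity (ra s2 20%nat); [apply run_ra; reflexivity|auto]).
  assert (Z29 : ra s3 29%nat = ra s1 29%nat) by (transitivity (ra s2 29%nat); [apply run_ra; reflexivity|auto]).
  unfold tree_ok. rewrite Z34, Z20, Z29. split; [split; [|exact C1]|].
  - intros l p' q' Hl Hp' Hq'. rewrite C2 by (auto; lia).
    destruct (Nat.eq_dec l l0) as [->|Nl]; [apply L1; auto|].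
    rewrite L2 by (auto; lia). change (mat s1) with (mat s). rewrite T1 by auto.
    unfold s1. cbn [na ra setn setr]. rewrite !upd2_row.
    destruct (Nat.eqb_spec l l0); [congruence|]. reflexivity.
  - intros l. unfold s1. cbn [na ra setn setr]. rewrite !upd2_row.
    destruct (Nat.eqb_spec l l0) as [->|]; [split; [reflexivity|unfold v; ring]|].
    split; [|ring]. rewrite Nat.add_0_r. unfold upd2. reflexivity.
Qed.

End TreePrograms.

(** * Sweeping with a fixed plane *)

Section Sweep.
Variables (s0 : st) (n tn k0 h N : nat).
Hypothesis Prep : prepared s0 n tn k0 h N.
Hypotheses (Hn : (2 <= n)%nat) (Hk0 : (1 <= k0)%nat).

Notation x := (ra s0 0%nat).
Notation y := (ra s0 1%nat).
Notation m := (ra s0 2%nat).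
Notation b := (ra s0 3%nat).
Notation t := (ra s0 4%nat).
Notation c := (ra s0 6%nat 0%nat).
Notation C := (ra s0 7%nat 0%nat).
Notation rx := (rank n x).
Notation ry := (rank n y).
Notation K := (k0 + 3)%nat.
Notation NN := (2 ^ h)%nat.
Notation box := (box n x y t).
Notation adm := (adm n C m b).
Notation val := (val n c m b).
Notation stripe := (strip s0 n).
Notation good := (good s0 n).

Hypothesis HC : 0 < C.
Hypothesis Hadm : forall S, (k0 <= count n S)%nat -> (count n S + k0 <= n)%nat -> adm S.

Variables (la mu kap nb : R).
Definition weight (p : nat) : R := la * b p - mu * m p.
Definition plane_val (S : nat -> bool) : R := total n S weight + kap.
Hypotheses (Hkap : kap <= 0) (Hnb : sumR n (fun p => Rabs (weight p)) <= - nb).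
Hypothesis Hplane : forall S, adm S -> plane_val S <= val S.

Lemma nb_nonpos : nb <= 0.
Proof.
  assert (H : 0 <= sumR n (fun p => Rabs (weight p))).
  { rewrite <- (sumR_0 n (fun _ => 0)) by auto. apply sumR_le. intros; apply Rabs_pos. }
  lra.
Qed.

Variables (q a : nat).
Hypothesis Ha : (a < n)%nat.

(** Phrased by positions because points are inserted in that order, also in the middle of a y-class,
    where no strip corresponds to it. *)
Definition seen (k p : nat) : bool :=
  (Nat.leb a (sort_pos n y p) && Nat.ltb (sort_pos n y p) k && negb (Rltb (t p) (t q)))%bool.

Definition leaf_of (p : nat) : nat := (rx p + 1)%nat.

Definition sweep_env : env :=
  mkEnv ((20%nat, a) :: nil)
    ((19%nat, t q) :: (26%nat, la) :: (27%nat, mu) :: (28%nat, kap) :: (29%nat, nb) :: nil) nil nil.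

Definition sweeping (k : nat) (s : st) : Prop :=
  agree s0 s /\ holds sweep_env s /\ tree_ok k0 h s /\
  na s 38%nat 0%nat = count n (seen k) /\
  forall l, (l < NN)%nat -> na s 34%nat l = bucket_count n (seen k) leaf_of l /\
    ra s 20%nat l = bucket n (seen k) leaf_of weight l.

Lemma sweeping_frame k s s' : agree s0 s' -> na s' 20%nat = na s 20%nat ->
  na s' 34%nat = na s 34%nat -> na s' 38%nat = na s 38%nat ->
  (forall i, In i (19 :: 20 :: 21 :: 26 :: 27 :: 28 :: 29 :: nil)%nat -> ra s' i = ra s i) ->
  sweeping k s -> sweeping k s'.
Proof.
  intros A E20 E34 E38 ER (_ & (H1 & H2 & _) & [T1 T2] & H38 & HB).
  assert (EM : mat k0 s' = mat k0 s).
  { unfold mat. rewrite ER by (cbn; auto). reflexivity. }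
  split; [exact A|]. split; [|split; [|split]].
  - split; [|split; [|split; intros z []]].
    + intros z [<-|[]]. cbn [fst snd]. rewrite E20. apply (H1 (20%nat, a)). now left.
    + intros z Hz. rewrite ER; [now apply H2|].
      cbn in Hz. destruct Hz as [<-|[<-|[<-|[<-|[<-|[]]]]]]; cbn; auto 10.
  - unfold tree_ok. rewrite EM, E34, (ER 20%nat), (ER 29%nat) by (cbn; auto 10). split; auto.
  - now rewrite E38.
  - intros l Hl. rewrite E34, (ER 20%nat) by (cbn; auto). auto.
Qed.

Lemma seen_ext k S' w l : (forall p, (p < n)%nat -> seen k p = S' p) ->
  bucket n (seen k) leaf_of w l = bucket n S' leaf_of w l /\
  bucket_count n (seen k) leaf_of l = bucket_count n S' leaf_of l /\
  count n (seen k) = count n S'.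
Proof.
  intros H. split; [|split]; [apply total_ext|apply count_ext|now apply count_ext];
    intros p Hp; now rewrite H.
Qed.

Lemma seen_strip b' p : cut n y a -> cut n y b' -> (b' <= n)%nat -> (p < n)%nat ->
  seen b' p = stripe q a b' p.
Proof.
  intros Ca Cb Hb Hp. unfold seen, strip. f_equal. apply eq_true_iff_eq.
  rewrite !andb_true_iff, !Nat.leb_le, !Nat.ltb_lt.
  assert (H1 := cut_pos n y a p Ca ltac:(lia) Hp). assert (H2 := cut_pos n y b' p Cb Hb Hp). lia.
Qed.

Lemma query_ok k s : (k < n)%nat -> cut n y a -> sweeping (Datatypes.S k) s -> na s 21%nat 0%nat = k ->
  good (ra s 10%nat 0%nat) ->
  let s' := run query_cmd s in
  sweeping (Datatypes.S k) s' /\ good (ra s' 10%nat 0%nat) /\ ra s 10%nat 0%nat <= ra s' 10%nat 0%nat /\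
  (cut n y (Datatypes.S k) -> (count n (stripe q a (Datatypes.S k)) + k0 <= n)%nat ->
   forall l1 l2, (l1 < l2 <= n)%nat -> (k0 <= count n (box q a (Datatypes.S k) l1 l2))%nat ->
     plane_val (box q a (Datatypes.S k) l1 l2) <= ra s' 10%nat 0%nat).
Proof.
  intros Hk Ca HS Hvk Hg s'.
  split.
  { apply (sweeping_frame _ s); auto.
    - apply agree_run; [reflexivity|apply HS].
    - apply run_na; reflexivity.
    - apply run_na; reflexivity.
    - apply run_na; reflexivity.
    - intros i Hi. apply run_ra. cbn in Hi.
      destruct Hi as [<-|[<-|[<-|[<-|[<-|[<-|[<-|[]]]]]]]]; reflexivity. }
  destruct HS as (Ag & He & [T1 T2] & H38 & HB).
  set (k' := Datatypes.S k) in *.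
  set (root := mat k0 s 1 (k0 + 1) (k0 + 2)).
  set (v := root + kap).
  assert (Er : s' = if Nat.ltb 0 (na s 14%nat k') then
      if Nat.ltb n (count n (seen k') + k0) then s
      else if Rltb (ra s 10%nat 0%nat) v then setr 10 0 v (setr 23 0 v s) else setr 23 0 v s
    else s).
  { unfold s', query_cmd. cbn [run evC evN]. rewrite Hvk, Nat.add_1_r. fold k'.
    destruct (Nat.ltb 0 (na s 14%nat k')); auto.
    rewrite (proj1 Ag 0%nat), (p_n _ _ _ _ _ _ Prep), H38, (agree_k0 s0 n tn k0 h N Prep s Ag) by lia.
    destruct (Nat.ltb n (count n (seen k') + k0)); auto.
    cbn [run evN evR tix].
    rewrite (agree_K s0 n tn k0 h N Prep s Ag), (agree_k1 s0 n tn k0 h N Prep s Ag),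
      (agree_k0 s0 n tn k0 h N Prep s Ag).
    assert (E28 : ra s 28%nat 0%nat = kap).
    { apply (proj1 (proj2 He) (28%nat, kap)). cbn; auto. }
    rewrite E28.
    change (ra s 21%nat ((1 * K + (k0 + 1)) * K + (k0 + 2))%nat) with root. fold v.
    cbn [ra setr]. rewrite upd2_same.
    change (upd2 (ra s) 23 0 v 10%nat 0%nat) with (ra s 10%nat 0%nat). reflexivity. }
  assert (Hvf : (0 < na s 14%nat k')%nat <-> cut n y k').
  { rewrite (proj1 Ag) by lia. apply Prep. unfold k'; lia. }
  rewrite Er. clear Er s'.
  destruct (Nat.ltb_spec 0 (na s 14%nat k')) as [Hf|Hf].
  2:{ split; auto. split; [lra|]. intros Hcut. apply Hvf in Hcut. lia. }
  apply Hvf in Hf.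
  assert (Hseen : forall p, (p < n)%nat -> seen k' p = stripe q a k' p).
  { intros p Hp. apply seen_strip; auto. }
  destruct (seen_ext k' (stripe q a k') weight 0%nat Hseen) as (_ & _ & Ecount).
  rewrite Ecount.
  destruct (Nat.ltb_spec n (count n (stripe q a k') + k0)) as [Hc|Hc].
  { split; auto. split; [lra|]. intros _ Hc'. lia. }
  assert (E29 : ra s 29%nat 0%nat = nb).
  { apply (proj1 (proj2 He) (29%nat, nb)). cbn; auto 10. }
  rewrite E29 in T1.
  assert (HBW : forall l, (l < NN)%nat ->
    na s 34%nat l = bucket_count n (stripe q a k') leaf_of l /\
    ra s 20%nat l = bucket n (stripe q a k') leaf_of weight l).
  { intros l Hl. destruct (HB l Hl) as [-> ->].
    destruct (seen_ext k' (stripe q a k') weight l Hseen) as (-> & -> & _). auto. }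
  (* Leaf [l + 1] carries rank [l]. Truncation at [l1 = 0] is harmless because leaf 0 holds no
     point. *)
  assert (Hseg : forall l1 l2, (l1 <= l2 <= NN)%nat ->
    sumR l2 (ra s 20%nat) - sumR l1 (ra s 20%nat) =
      total n (box q a k' (l1 - 1) (l2 - 1)) weight /\
    nsum l2 (na s 34%nat) = (nsum l1 (na s 34%nat) + count n (box q a k' (l1 - 1) (l2 - 1)))%nat).
  { intros l1 l2 Hl.
    assert (EB : forall p, (stripe q a k' p && Nat.leb l1 (leaf_of p) && Nat.ltb (leaf_of p) l2)%bool
       = box q a k' (l1 - 1) (l2 - 1) p).
    { intros p. rewrite box_strip. unfold leaf_of. destruct (stripe q a k' p); cbn [andb]; auto.
      apply eq_true_iff_eq. rewrite !andb_true_iff, !Nat.leb_le, !Nat.ltb_lt. lia. }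
    rewrite (sumR_ext l2 _ (bucket n (stripe q a k') leaf_of weight)),
      (sumR_ext l1 _ (bucket n (stripe q a k') leaf_of weight)) by (intros i Hi; apply HBW; lia).
    rewrite (nsum_ext l2 _ (bucket_count n (stripe q a k') leaf_of)),
      (nsum_ext l1 _ (bucket_count n (stripe q a k') leaf_of)) by (intros i Hi; apply HBW; lia).
    rewrite bucket_interval, (bucket_count_interval n _ _ l1 l2) by lia.
    split; [apply total_ext; intros; apply EB|]. f_equal. apply count_ext; intros; apply EB. }
  assert (Hsound : 0 < v -> attained n c C x y t m b v).
  { intros Hv.
    destruct (root_sound k0 nb (na s 34%nat) (ra s 20%nat) nb_nonpos K h (mat k0 s) eq_refl T2 T1)
      as [HB1|(l1 & l2 & Hl & Hcn & E)].
    (* A forbidden move leaves at most [nb] plus the moduli of the leaf weights, which is at most 0,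
       and [kap <= 0] cannot make it positive. *)
    - exfalso. fold root in HB1.
      assert (Habs : sumR NN (fun i => Rabs (ra s 20%nat i)) <= sumR n (fun p => Rabs (weight p))).
      { apply Rle_trans with (sumR NN (bucket n (stripe q a k') leaf_of (fun p => Rabs (weight p)))).
        - apply sumR_le. intros l Hl. destruct (HBW l Hl) as [_ ->].
          unfold bucket, total. generalize n at 1 3. intros k1.
          induction k1 as [|k1 IH]; cbn [sumR]; [rewrite Rabs_R0; lra|].
          eapply Rle_trans; [apply Rabs_triang|]. apply Rplus_le_compat; auto.
          destruct (_ && _); [lra|rewrite Rabs_R0; lra].
        - rewrite bucket_prefix. apply sumR_le. intros p Hp.
          assert (Hp0 := Rabs_pos (weight p)). destruct (_ && _); lra. }
      unfold v in Hv. lra.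
    - fold root in E. destruct (Hseg l1 l2 Hl) as [E1 E2]. rewrite E1 in E.
      set (S := box q a k' (l1 - 1) (l2 - 1)) in *.
      assert (HcS : (k0 <= count n S)%nat) by lia.
      assert (HcS' : (count n S <= count n (stripe q a k'))%nat).
      { apply count_le. intros p _. unfold S. rewrite box_strip, !andb_true_iff. tauto. }
      (* The lower count comes from the automaton, the upper one from the guard on the strip that
         contains [S]. *)
      assert (HA : adm S) by (apply Hadm; lia).
      assert (Ev : v = plane_val S) by (unfold v, plane_val; lra).
      apply (attained_le n c C x y t m b (val S)); [rewrite Ev; now apply Hplane|].
      apply attained_box; auto. }
  assert (Hcomplete : forall l1 l2, (l1 < l2 <= n)%nat -> (k0 <= count n (box q a k' l1 l2))%nat ->
     plane_val (box q a k' l1 l2) <= v).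
  { intros l1 l2 Hl Hcn. assert (Hsz := p_size _ _ _ _ _ _ Prep).
    destruct (Hseg (l1 + 1)%nat (l2 + 1)%nat ltac:(lia)) as [E1 E2].
    rewrite !Nat.add_sub in E1, E2. unfold plane_val, v. rewrite <- E1.
    apply Rplus_le_compat_r.
    apply (root_complete k0 nb (na s 34%nat) (ra s 20%nat) K h (mat k0 s) eq_refl T2 T1); lia. }
  rcase HV.
  - look. split; [|split; [lra|auto]].
    (* Soundness requires a positive value; exceeding a best value that is at least 0 provides
       it. *)
    apply (good_max s0 n s); auto. apply Hsound. destruct Hg; lra.
  - look. split; auto. split; [lra|]. intros _ _ l1 l2 Hl Hcn.
    apply Rle_trans with v; auto.
Qed.

Lemma visit_insert_ok k s : (k < n)%nat -> (a <= k)%nat -> sweeping k s -> na s 21%nat 0%nat = k ->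
  let s' := run (
     SetN 40 (NC 0) (YS (var 21)) ;;
     If (CR (RG 4 (var 40)) (rvar 19)) Skip
       (insert_cmd ;; SetN 38 (NC 0) (NAdd (var 38) (NC 1)))) s in
  sweeping (Datatypes.S k) s' /\ na s' 21%nat 0%nat = k /\ ra s' 10%nat = ra s 10%nat.
Proof.
  intros Hk Hak (Ag & He & HT & H38 & HB) Hvk s'.
  assert (Ag' : agree s0 s') by (apply agree_run; auto).
  assert (He' : holds sweep_env s') by (apply holds_run; auto).
  assert (E21 : na s' 21%nat = na s 21%nat) by (apply run_na; reflexivity).
  assert (E10 : ra s' 10%nat = ra s 10%nat) by (apply run_ra; reflexivity).
  rewrite E21. split; [|auto].
  destruct (pos_surj n y k Hk) as (p & Hp & Ep).
  assert (Eys : na s 13%nat k = p).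
  { rewrite (proj1 Ag), <- Ep by lia. apply Prep; auto. }
  set (s1 := setn 40 0 p s).
  assert (Er : s' = if Rltb (t p) (t q) then s1
     else setn 38 0 (na (run insert_cmd s1) 38%nat 0%nat + 1) (run insert_cmd s1)).
  { unfold s'. cbn [run evN evC evR]. rewrite Hvk, Eys. fold s1.
    replace (na s1 40%nat 0%nat) with p by (symmetry; apply upd2_same).
    replace (ra s1 19%nat 0%nat) with (t q)
      by (symmetry; apply (proj1 (proj2 He) (19%nat, t q)); now left).
    change (ra s1 4%nat) with (ra s 4%nat). rewrite (proj2 Ag 4%nat) by lia.
    destruct (Rltb (t p) (t q)); reflexivity. }
  (* Positions are distinct, so the point at position [k] is the only candidate to be added. *)
  assert (Hstep : forall p', (p' < n)%nat -> seen (Datatypes.S k) p' =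
     (seen k p' || (Nat.eqb p' p && negb (Rltb (t p) (t q))))%bool).
  { intros p' Hp'. unfold seen.
    destruct (Nat.eqb_spec p' p) as [->|Np].
    - rewrite Ep. rewrite Nat.ltb_irrefl, andb_false_r. cbn [andb orb].
      rewrite (proj2 (Nat.leb_le a k) Hak), (proj2 (Nat.ltb_lt k (Datatypes.S k))) by lia. reflexivity.
    - cbn [andb]. rewrite orb_false_r. f_equal. f_equal.
      assert (Hne : sort_pos n y p' <> k).
      { intros E. apply Np. apply (pos_inj n y); auto. congruence. }
      apply eq_true_iff_eq. rewrite !Nat.ltb_lt. lia. }
  assert (Hseenp : seen k p = false).
  { unfold seen. rewrite Ep, Nat.ltb_irrefl, andb_false_r. reflexivity. }
  split; [exact Ag'|]. split; [exact He'|]. rewrite Er. clear Er.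
  destruct (Rltb (t p) (t q)) eqn:Et.
  - split; [exact HT|].
    assert (Hsame : forall p', (p' < n)%nat -> seen (Datatypes.S k) p' = seen k p').
    { intros p' Hp'. rewrite Hstep by auto. now rewrite andb_false_r, orb_false_r. }
    destruct (seen_ext _ _ weight 0%nat Hsame) as (_ & _ & Ec).
    rewrite Ec. split; [exact H38|]. intros l Hl.
    destruct (seen_ext _ _ weight l Hsame) as (-> & -> & _). apply HB; auto.
  - assert (Ag1 : agree s0 s1) by (apply agree_setn; auto; lia).
    destruct (insert_ok s0 n tn k0 h N Prep p s1 Ag1 HT Hp ltac:(apply upd2_same)) as [I1 I2].
    assert (E38 : na (run insert_cmd s1) 38%nat = na s1 38%nat) by (apply run_na; reflexivity).
    set (s2 := run insert_cmd s1) in *.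
    assert (Hbk : forall w l, bucket n (seen (Datatypes.S k)) leaf_of w l =
      bucket n (seen k) leaf_of w l + if Nat.eqb l (leaf_of p) then w p else 0).
    { intros w l. unfold bucket, total.
      rewrite (sumR_ext n _ (fun p' => (if (seen k p' && Nat.eqb (leaf_of p') l)%bool then w p' else 0)
        + (if (Nat.eqb p' p && Nat.eqb (leaf_of p') l)%bool then w p' else 0))).
      - rewrite sumR_plus. f_equal. rewrite (sumR_single n p _ Hp) by
          (intros i Hi Hne; destruct (Nat.eqb_spec i p); [congruence|reflexivity]).
        rewrite Nat.eqb_refl. cbn [andb]. rewrite Nat.eqb_sym. reflexivity.
      - intros p' Hp'. rewrite Hstep by auto. cbn [negb]. rewrite andb_true_r.
        destruct (Nat.eqb_spec p' p) as [->|Np].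
        + rewrite Hseenp. cbn [orb andb]. destruct (Nat.eqb (leaf_of p) l); ring.
        + cbn [andb]. rewrite orb_false_r. destruct (_ && _)%bool; ring. }
    split; [exact I1|].
    assert (Hbc : forall l, bucket_count n (seen (Datatypes.S k)) leaf_of l =
      (bucket_count n (seen k) leaf_of l + if Nat.eqb l (leaf_of p) then 1 else 0)%nat).
    { intros l. apply INR_eq. rewrite plus_INR. unfold bucket_count. rewrite !INR_count.
      assert (E := Hbk (fun _ => 1) l). unfold bucket in E. rewrite E. f_equal.
      destruct (Nat.eqb l (leaf_of p)); reflexivity. }
    split.
    + cbn [na setn]. rewrite upd2_same, E38.
      change (na s1 38%nat 0%nat) with (na s 38%nat 0%nat). rewrite H38.
      apply INR_eq. rewrite plus_INR, !INR_count. unfold total.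
      rewrite (sumR_ext n (fun i => if seen (Datatypes.S k) i then 1 else 0)
        (fun i => (if seen k i then 1 else 0) + (if Nat.eqb i p then 1 else 0))).
      * rewrite sumR_plus. f_equal. rewrite (sumR_single n p _ Hp) by
          (intros i Hi Hne; destruct (Nat.eqb_spec i p); [congruence|reflexivity]).
        rewrite Nat.eqb_refl. reflexivity.
      * intros p' Hp'. rewrite Hstep by auto. cbn [negb]. rewrite andb_true_r.
        destruct (Nat.eqb_spec p' p) as [->|Np]; [rewrite Hseenp; cbn [orb]; ring|].
        rewrite orb_false_r. ring.
    + intros l Hl. rewrite Hbc, Hbk. destruct (I2 l) as [J1 J2]. destruct (HB l Hl) as [B1 B2].
      change (na (setn 38 0 (na s2 38%nat 0%nat + 1) s2) 34%nat) with (na s2 34%nat).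
      change (ra (setn 38 0 (na s2 38%nat 0%nat + 1) s2) 20%nat) with (ra s2 20%nat).
      rewrite J1, J2. change (na s1 34%nat) with (na s 34%nat). change (ra s1 20%nat) with (ra s 20%nat).
      rewrite B1, B2. unfold leaf_of, weight.
      assert (E26 : ra s1 26%nat 0%nat = la).
      { apply (proj1 (proj2 He) (26%nat, la)). cbn; auto. }
      assert (E27 : ra s1 27%nat 0%nat = mu).
      { apply (proj1 (proj2 He) (27%nat, mu)). cbn; auto. }
      rewrite E26, E27. auto.
Qed.

Definition sweep_targets (r : R) : Prop :=
  exists b' l1 l2, (a < b' <= n)%nat /\ cut n y b' /\ (l1 < l2 <= n)%nat /\
    (count n (stripe q a b') + k0 <= n)%nat /\ (k0 <= count n (box q a b' l1 l2))%nat /\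
    r = plane_val (box q a b' l1 l2).

Lemma sweep_ok : cut n y a -> improves s0 good sweep_env sweep_cmd sweep_targets.
Proof.
  intros Ca s Ag He Hg. unfold sweep_cmd. cbn [run].
  set (loop := For 21 0 visit_cmd).
  change (niter (na (run reset_cmd (setn 38 (evN (NC 0) s) (evN (NC 0) s) s)) 0%nat 0%nat) _ _)
    with (run loop (run reset_cmd (setn 38 0 0 s))).
  set (s1 := setn 38 0 0 s).
  assert (Ag1 : agree s0 s1) by (apply agree_setn; auto; lia).
  destruct (reset_ok s0 n tn k0 h N Prep s1 Ag1) as [R1 R2].
  assert (Ag2 : agree s0 (run reset_cmd s1)) by (apply agree_run; auto).
  assert (He2 : holds sweep_env (run reset_cmd s1)).
  { apply holds_run; [reflexivity|]. apply holds_setn; auto. }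
  assert (E38 : na (run reset_cmd s1) 38%nat = na s1 38%nat) by (apply run_na; reflexivity).
  assert (E10 : ra (run reset_cmd s1) 10%nat = ra s 10%nat).
  { transitivity (ra s1 10%nat); [apply run_ra; reflexivity|reflexivity]. }
  set (s2 := run reset_cmd s1) in *.
  set (I := fun k z => sweeping k z /\ good (ra z 10%nat 0%nat) /\
    ra s 10%nat 0%nat <= ra z 10%nat 0%nat /\
    forall b' l1 l2, (b' <= k)%nat -> (a < b' <= n)%nat -> cut n y b' -> (l1 < l2 <= n)%nat ->
      (count n (stripe q a b') + k0 <= n)%nat -> (k0 <= count n (box q a b' l1 l2))%nat ->
      plane_val (box q a b' l1 l2) <= ra z 10%nat 0%nat).
  assert (HI : I (na s2 0%nat 0%nat) (run loop s2)).
  { apply (for_ind I); [reflexivity| |].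
    - assert (Hs0 : forall p, seen 0 p = false).
      { intros p. unfold seen. now rewrite andb_false_r. }
      split; [|split; [|split]].
      + split; [apply agree_setn; auto; lia|]. split; [apply holds_setn; auto|].
        split; [exact R1|]. change (na (setn 21 0 0 s2) 38%nat) with (na s2 38%nat).
        split.
        * rewrite E38. change (na s1 38%nat 0%nat) with 0%nat. symmetry.
          rewrite (count_ext n _ (fun _ => false)) by auto.
          apply INR_eq. rewrite INR_count. now apply sumR_0.
        * intros l Hl. destruct (R2 l Hl) as [W1 W2].
          change (na (setn 21 0 0 s2) 34%nat) with (na s2 34%nat).
          change (ra (setn 21 0 0 s2) 20%nat) with (ra s2 20%nat).
          rewrite W1, W2. split; symmetry.
          -- apply INR_eq. unfold bucket_count. rewrite INR_count. apply sumR_0.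
             intros i _. now rewrite Hs0.
          -- apply sumR_0. intros i _. now rewrite Hs0.
      + cbn [ra setn]. now rewrite E10.
      + cbn [ra setn]. rewrite E10. lra.
      + intros b' l1 l2 Hb' Hab. lia.
    - intros k z Hk Hv (I1 & I2 & I3 & I4).
      assert (Hkn : (k < n)%nat).
      { rewrite (proj1 Ag2 0%nat), (p_n _ _ _ _ _ _ Prep) in Hk by lia. auto. }
      assert (Hset : forall z' v, sweeping (Datatypes.S k) z' -> sweeping (Datatypes.S k) (setn 21 0 v z')).
      { intros z' v Hz'. apply (sweeping_frame _ z'); auto.
        apply agree_setn; [lia|apply Hz']. }
      unfold visit_cmd.
      match goal with |- context [If _ Skip (?c1 ;; ?c2 ;; ?c3)] =>
        assert (Erun : forall u, run (c1 ;; c2 ;; c3) u = run c3 (run (c1 ;; c2) u)) by reflexivity;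
        set (both := c1 ;; c2 ;; c3) in * end.
      cbn [run evC evN]. rewrite Hv.
      replace (na z 20%nat 0%nat) with a
        by (symmetry; apply (proj1 (proj1 (proj2 I1)) (20%nat, a)); now left).
      destruct (Nat.ltb_spec k a) as [Hka|Hka].
      + split; [|split; [exact I2|split; [exact I3|]]].
        * apply Hset. destruct I1 as (A1 & A2 & A3 & A4 & A5).
          assert (Hsame : forall p, (p < n)%nat -> seen (Datatypes.S k) p = seen k p).
          { intros p Hp. unfold seen. f_equal. apply eq_true_iff_eq.
            rewrite !andb_true_iff, !Nat.leb_le, !Nat.ltb_lt. lia. }
          destruct (seen_ext _ _ weight 0%nat Hsame) as (_ & _ & Ec).
          split; [exact A1|]. split; [exact A2|]. split; [exact A3|]. rewrite Ec.
          split; [exact A4|]. intros l Hl.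
          destruct (seen_ext _ _ weight l Hsame) as (-> & -> & _). apply A5; auto.
        * intros b' l1 l2 Hb' Hab. exfalso. lia.
      + rewrite Erun.
        destruct (visit_insert_ok k z Hkn Hka I1 Hv) as (V1 & V2 & V3).
        match goal with |- context [run query_cmd ?u] => set (z1 := u) in * end.
        destruct (query_ok k z1 Hkn Ca V1 V2) as (Q1 & Q2 & Q3 & Q4).
        { rewrite V3. exact I2. }
        rewrite V3 in Q3. set (z2 := run query_cmd z1) in *.
        split; [now apply Hset|]. cbn [ra setn]. split; [exact Q2|]. split; [lra|].
        intros b' l1 l2 Hb' Hab Hcut Hl Hc1 Hc2.
        destruct (Nat.eq_dec b' (Datatypes.S k)) as [->|Nb]; [apply Q4; auto|].
        apply Rle_trans with (ra z 10%nat 0%nat); auto. apply I4; auto. lia. }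
  rewrite (proj1 Ag2 0%nat), (p_n _ _ _ _ _ _ Prep) in HI by lia.
  destruct HI as (_ & G1 & G2 & G3). split; auto. split; auto.
  intros r (b' & l1 & l2 & Hb' & Hcut & Hl & Hc1 & Hc2 & ->). apply G3; auto. lia.
Qed.

End Sweep.

(** * The search *)

Section SearchCorrect.
Variables (s0 : st) (n tn k0 h N G D : nat) (lo hi : R).
Hypothesis Prep : prepared s0 n tn k0 h N.
Hypotheses (Hn : (2 <= n)%nat) (HN : (1 <= N)%nat).

Notation x := (ra s0 0%nat).
Notation y := (ra s0 1%nat).
Notation m := (ra s0 2%nat).
Notation b := (ra s0 3%nat).
Notation t := (ra s0 4%nat).
Notation eps := (ra s0 5%nat 0%nat).
Notation c := (ra s0 6%nat 0%nat).
Notation C := (ra s0 7%nat 0%nat).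
Notation box := (box n x y t).
Notation adm := (adm n C m b).
Notation val := (val n c m b).
Notation stripe := (strip s0 n).
Notation good := (good s0 n).
Notation empty_env := (mkEnv nil nil nil nil).

Hypotheses (Heps : 0 < eps) (Hc : 0 < c) (HC : 0 < C) (Hlo : 0 < lo) (Hlh : lo <= hi).
Hypothesis Hm : forall i, (i < n)%nat -> lo <= m i <= hi.
Hypothesis Hb : forall i, (i < n)%nat -> lo <= b i <= hi.
Hypothesis Htn : forall p, (p < n)%nat -> exists q, (q < tn)%nat /\ t q = t p.
Hypothesis Hk0 : C * hi <= INR k0 * lo.
Hypothesis HG : hi * hi <= INR G * (lo * lo).
Hypothesis HD : 2 * c * INR G * INR k0 * hi <= INR D * lo.

Notation rho u := (slope_val G N u).
Notation la u v := (c * (ln (rho u) - ln (rho v)) / sumR n b).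
Notation mu u v := (c * (rho u - rho v) / sumR n m).
Notation kap v := (c * (1 + ln (rho v) - rho v)).

Lemma G_ge1 : (1 <= G)%nat.
Proof. apply (G_pos G lo hi); auto. Qed.

Lemma sums_pos : 0 < sumR n m /\ 0 < sumR n b.
Proof. split; apply (sum_pos n lo hi); auto. Qed.

Lemma plane_val_eq u v S : plane_val s0 n (la u v) (mu u v) (kap v) S =
  plane c (rho u) (rho v) (mfrac n m S) (bfrac n b S).
Proof.
  destruct sums_pos as [P1 P2]. unfold plane_val, weight, plane, mfrac, bfrac.
  assert (E : total n S (fun p => la u v * b p - mu u v * m p) =
     la u v * total n S b - mu u v * total n S m).
  { rewrite <- !total_scal. unfold total.
    assert (E1 : forall f g, sumR n f - sumR n g = sumR n (fun i => f i - g i)).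
    { intros f g. generalize n. induction n0 as [|k IH]; simpl; lra. }
    rewrite E1. apply sumR_ext. intros i _. destruct (S i); ring. }
  rewrite E. field. lra.
Qed.

(** [ln z <= z - 1] at the slope and at its inverse; the slope is at most [1 + G] and its inverse at
    most [G]. *)
Lemma rho_bounds u : (u < N)%nat -> 0 < rho u /\ Rabs (ln (rho u)) <= INR G.
Proof.
  intros Hu. assert (HG1 := G_ge1).
  assert (G0 : 1 <= INR G) by (change 1 with (INR 1); apply le_INR; auto).
  assert (GI : 0 < / INR G) by (apply Rinv_0_lt_compat; lra).
  assert (GI1 : / INR G <= 1) by (rewrite <- Rinv_1; apply Rinv_le_contravar; lra).
  assert (H := slope_val_bounds G N u HG1 Hu). assert (Hr : 0 < rho u) by lra. split; auto.
  assert (H1 := ln_le_sub1 (rho u) Hr).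
  assert (H2 := ln_le_sub1 (/ rho u) ltac:(now apply Rinv_0_lt_compat)).
  rewrite ln_Rinv in H2 by auto.
  assert (/ rho u <= INR G).
  { rewrite <- (Rinv_inv (INR G)). apply Rinv_le_contravar; lra. }
  apply Rabs_le. lra.
Qed.

(** The logarithms account for [2 G c] and the slopes themselves for [G c]. This is the origin of
    the factor 3 in the substitute for minus infinity. *)
Lemma weights_bound u v : (u < N)%nat -> (v < N)%nat ->
  sumR n (fun p => Rabs (weight s0 (la u v) (mu u v) p)) <= - (0 - c * INR (3 * G)).
Proof.
  intros Hu Hv. destruct sums_pos as [P1 P2].
  destruct (rho_bounds u Hu) as [U1 U2]. destruct (rho_bounds v Hv) as [V1 V2].
  assert (Bu := slope_val_bounds G N u G_ge1 Hu). assert (Bv := slope_val_bounds G N v G_ge1 Hv).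
  assert (HR : Rabs (rho u - rho v) <= INR G) by (apply Rabs_le; lra).
  assert (HL : Rabs (ln (rho u) - ln (rho v)) <= 2 * INR G).
  { eapply Rle_trans; [apply Rabs_triang|]. rewrite Rabs_Ropp. lra. }
  apply Rle_trans with (Rabs (la u v) * sumR n b + Rabs (mu u v) * sumR n m).
  - rewrite <- !sumR_scal, <- sumR_plus. apply sumR_le. intros p Hp. unfold weight.
    eapply Rle_trans; [apply Rabs_triang|]. rewrite Rabs_Ropp, !Rabs_mult.
    rewrite (Rabs_right (b p)), (Rabs_right (m p)); [lra| |].
    + specialize (Hm p Hp). lra.
    + specialize (Hb p Hp). lra.
  - unfold Rdiv. rewrite !Rabs_mult, !Rabs_inv.
    rewrite (Rabs_right (sumR n b)), (Rabs_right (sumR n m)), (Rabs_right c) by lra.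
    rewrite !Rmult_assoc, !Rinv_l, !Rmult_1_r by lra.
    rewrite mult_INR. change (INR 3) with (2 + 1).
    assert (c * Rabs (ln (rho u) - ln (rho v)) <= c * (2 * INR G)) by (apply Rmult_le_compat_l; lra).
    assert (c * Rabs (rho u - rho v) <= c * INR G) by (apply Rmult_le_compat_l; lra).
    replace (2 + 1) with 3 by ring. lra.
Qed.

Definition plane_targets (r : R) : Prop := exists u v q a b' l1 l2,
  (u < N)%nat /\ (v < N)%nat /\ (q < tn)%nat /\ cut n y a /\ cut n y b' /\
  (a < b' <= n)%nat /\ (l1 < l2 <= n)%nat /\
  (count n (stripe q a b') + k0 <= n)%nat /\ (k0 <= count n (box q a b' l1 l2))%nat /\
  r = plane c (rho u) (rho v) (mfrac n m (box q a b' l1 l2)) (bfrac n b (box q a b' l1 l2)).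

Definition plane_env (u v : nat) : env :=
  mkEnv nil ((26%nat, la u v) :: (27%nat, mu u v) :: (28%nat, kap v) ::
             (29%nat, 0 - c * INR (3 * G)) :: nil) nil nil.

Lemma k0_ge1 : (1 <= k0)%nat.
Proof. apply (k0_pos k0 C lo hi); auto. Qed.

Lemma plane_sweeps_ok u v : (u < N)%nat -> (v < N)%nat ->
  improves s0 good (plane_env u v)
    (For 19 1 (SetR 19 (NC 0) (RG 4 (var 19)) ;;
      For 20 0 (If (CN (NC 0) (VF (var 20))) sweep_cmd Skip)))
    (fun r => exists q, (q < tn)%nat /\ exists a, (a < n)%nat /\
      cut n y a /\ sweep_targets s0 n k0 (la u v) (mu u v) (kap v) q a r).
Proof.
  intros Hu Hv.
  set (T := fun q a r => if Nat.ltb 0 (na s0 14%nat a) then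
     sweep_targets s0 n k0 (la u v) (mu u v) (kap v) q a r else False).
  eapply improves_weaken; [|apply (improves_for s0 good _ 19 1 _ (fun q r =>
    exists a, (a < na s0 0 0)%nat /\ T q a r)); try lia; try reflexivity].
  - cbv beta. rewrite (p_tn _ _ _ _ _ _ Prep), (p_n _ _ _ _ _ _ Prep).
    intros r (q & Hq & a & Ha & Hcut & HT). exists q. split; auto. exists a. split; auto.
    unfold T. rewrite (proj2 (Nat.ltb_lt 0 _)); auto. apply Prep; auto. lia.
  - intros q Hq. eapply improves_after; [reflexivity|reflexivity|apply (set_time_ok s0 n Hn); reflexivity|].
    apply (improves_for s0 good _ 20 0 _ (T q)); try lia; try reflexivity.
    intros a Ha. rewrite (p_n _ _ _ _ _ _ Prep) in Ha. unfold T.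
    destruct (Nat.ltb_spec 0 (na s0 14%nat a)) as [Hf|Hf].
    + assert (Hcut : cut n y a) by (apply Prep; auto; lia).
      apply (improves_if s0 n _ _ _ _ _ (fun _ => False) true).
      * intros s Hag Hh. cbn [evC evN].
        replace (na s 20%nat 0%nat) with a by (symmetry; apply (proj1 Hh (20%nat, a)); now left).
        rewrite (proj1 Hag) by lia. now apply Nat.ltb_lt.
      * assert (HS : improves s0 good (sweep_env s0 (la u v) (mu u v) (kap v) (0 - c * INR (3 * G)) q a)
          sweep_cmd (sweep_targets s0 n k0 (la u v) (mu u v) (kap v) q a)).
        { apply (sweep_ok s0 n tn k0 h N Prep); auto.
          - apply k0_ge1.
          - intros S H1 H2. apply (adm_of_count n k0 C lo hi); auto.
          - destruct (rho_bounds v Hv) as [V1 _]. assert (L := ln_le_sub1 _ V1).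
            assert (0 <= c * (rho v - (1 + ln (rho v)))) by (apply Rmult_le_pos; lra). lra.
          - apply weights_bound; auto.
          - intros S HA. rewrite plane_val_eq. destruct (adm_range n C m b Hn HC S HA).
            apply plane_le; auto; now apply rho_bounds. }
        intros s Hag Hh. apply HS; auto.
        destruct Hh as (H1 & H2 & _).
        assert (K26 := H2 (26%nat, la u v) ltac:(cbn; auto 10)).
        assert (K27 := H2 (27%nat, mu u v) ltac:(cbn; auto 10)).
        assert (K28 := H2 (28%nat, kap v) ltac:(cbn; auto 10)).
        assert (K29 := H2 (29%nat, 0 - c * INR (3 * G)) ltac:(cbn; auto 10)).
        assert (K19 := H2 (19%nat, t q) ltac:(cbn; auto 10)).
        assert (K20 := H1 (20%nat, a) ltac:(cbn; auto 10)).
        split; [intros z [<-|[]]; exact K20|].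
        split; [|split; intros z []].
        intros z [<-|[<-|[<-|[<-|[<-|[]]]]]]; assumption.
      * apply improves_skip.
    + intros s Hag Hh Hg. cbn [run evC evN].
      replace (na s 20%nat 0%nat) with a by (symmetry; apply (proj1 Hh (20%nat, a)); now left).
      rewrite (proj1 Hag), (proj2 (Nat.ltb_ge 0 _) Hf) by lia.
      split; [exact Hg|split; [lra|tauto]].
Qed.

Lemma planes_ok : improves s0 good empty_env (planes_cmd G) plane_targets.
Proof.
  set (T := fun u v r => exists q, (q < tn)%nat /\ exists a, (a < n)%nat /\
      cut n y a /\ sweep_targets s0 n k0 (la u v) (mu u v) (kap v) q a r).
  eapply improves_weaken; [|apply (improves_for s0 good _ 36 7 _ (fun u r =>
    exists v, (v < na s0 7 0)%nat /\ T u v r)); try lia; try reflexivity].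
  - cbv beta. rewrite (p_Np _ _ _ _ _ _ Prep).
    intros r (u & v & q & a & b' & l1 & l2 & Hu & Hv & Hq & Ca & Cb & Hab & Hl & H1 & H2 & ->).
    exists u. split; auto. exists v. split; auto. exists q. split; auto. exists a.
    split; [lia|]. split; auto. exists b', l1, l2. rewrite plane_val_eq. auto 10.
  - intros u Hu. rewrite (p_Np _ _ _ _ _ _ Prep) in Hu.
    apply (improves_for s0 good _ 37 7 _ (T u)); try lia; try reflexivity.
    intros v Hv. rewrite (p_Np _ _ _ _ _ _ Prep) in Hv.
    match goal with |- improves _ _ _ (?c1 ;; ?c2 ;; ?c3 ;; ?c4 ;; ?c5 ;; ?c6 ;; ?c7) _ =>
      change (improves s0 good (with_nval 37 v (with_nval 36 u empty_env))
        ((c1 ;; c2 ;; c3 ;; c4 ;; c5 ;; c6) ;; c7) (T u v)) end.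
    apply (improves_after s0 good _ (plane_env u v)); try reflexivity;
      [|apply plane_sweeps_ok; auto].
    intros s Hag (H1 & _).
    assert (K36 := H1 (36%nat, u) ltac:(cbn; auto)).
    assert (K37 := H1 (37%nat, v) ltac:(cbn; auto)). cbn [fst snd] in K36, K37.
    assert (E7 : na s 7%nat 0%nat = N) by (rewrite (proj1 Hag) by lia; apply Prep).
    split; [intros z []|]. split; [|split; intros z []].
    intros z [<-|[<-|[<-|[<-|[]]]]]; cbn [fst snd slope run evR evN]; look;
      rewrite ?K36, ?K37, ?E7, ?(proj2 Hag 6%nat), ?(proj2 Hag 8%nat), ?(proj2 Hag 9%nat) by lia;
      rewrite ?(p_M _ _ _ _ _ _ Prep), ?(p_B _ _ _ _ _ _ Prep); reflexivity.
Qed.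

Lemma count_pos_below a : (a <= n)%nat -> count n (fun p => Nat.ltb (sort_pos n y p) a) = a.
Proof.
  induction a as [|a IH]; intros Ha.
  - apply INR_eq. rewrite INR_count. now apply sumR_0.
  - destruct (pos_surj n y a Ha) as (p & Hp & Ep).
    apply INR_eq. rewrite INR_count, S_INR, <- IH at 1 by lia. rewrite INR_count. unfold total.
    rewrite (sumR_ext n _ (fun i => (if Nat.ltb (sort_pos n y i) a then 1 else 0) +
       (if Nat.eqb i p then 1 else 0))).
    + rewrite sumR_plus. f_equal. rewrite (sumR_single n p _ Hp).
      * now rewrite Nat.eqb_refl.
      * intros i Hi Hne. destruct (Nat.eqb_spec i p); [congruence|reflexivity].
    + intros i Hi. destruct (Nat.eqb_spec i p) as [->|Ni].
      * rewrite Ep, Nat.ltb_irrefl, (proj2 (Nat.ltb_lt a (Datatypes.S a))) by lia. ring.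
      * assert (Hne : sort_pos n y i <> a).
        { intros E. apply Ni. apply (pos_inj n y); auto. congruence. }
        destruct (Nat.ltb_spec (sort_pos n y i) (Datatypes.S a)), (Nat.ltb_spec (sort_pos n y i) a);
          try lia; ring.
Qed.

(** The [a] positions below the cut at [a] are disjoint from the strip, and together they stay below
    position [b']. *)
Lemma strip_count q a b' : cut n y a -> cut n y b' -> (a <= b' <= n)%nat ->
  (count n (stripe q a b') + a <= b')%nat.
Proof.
  intros Ca Cb Hab.
  rewrite <- (count_pos_below b') at 2 by lia. rewrite <- (count_pos_below a) at 2 by lia.
  apply INR_le. rewrite plus_INR, !INR_count. unfold total. rewrite <- sumR_plus.
  apply sumR_le. intros p Hp. unfold strip.
  assert (H1 := cut_pos n y a p Ca ltac:(lia) Hp). assert (H2 := cut_pos n y b' p Cb ltac:(lia) Hp).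
  destruct (Nat.leb_spec a (rank n y p)), (Nat.ltb_spec (rank n y p) b'),
    (Nat.ltb_spec (sort_pos n y p) a), (Nat.ltb_spec (sort_pos n y p) b');
    destruct (Rltb (t p) (t q)); cbn [andb negb]; try lra; exfalso; lia.
Qed.

Theorem search_ok : ra s0 10%nat 0%nat = 0 -> c * INR G ^ 3 <= eps * INR N ^ 2 ->
  let v := ra (run (search_cmd G D) s0) 10%nat 0%nat in
  good v /\ forall Q ts, adm_prosp n C x y t m b Q ts -> val_prosp n c x y t m b Q ts <= v + eps.
Proof.
  intros H10 Hgrid v.
  assert (Hp : 0 < INR n) by (apply lt_0_INR; lia).
  assert (A0 : agree s0 s0) by (split; auto).
  assert (E0 : holds empty_env s0) by (repeat split; intros z []).
  assert (G0 : good (ra s0 10%nat 0%nat)) by (rewrite H10; split; [lra|auto]).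
  set (cd := CR (RMul (rvar 5) (RN vn)) (RN (NC D))).
  assert (Ecd : forall s, agree s0 s -> holds empty_env s -> evC cd s = Rltb (eps * INR n) (INR D)).
  { intros s [A1 A2] _. unfold cd. cbn [evC evR evN].
    rewrite A1, A2 by lia. now rewrite (p_n _ _ _ _ _ _ Prep). }
  assert (HI := improves_seq s0 good empty_env (If cd small_cmd Skip) (wide_cmd ;; planes_cmd G) _ _ eq_refl eq_refl
    (improves_if s0 n _ _ _ _ _ _ _ Ecd (small_ok s0 n tn k0 h N Prep Hn HC)
       (improves_skip s0 good empty_env))
    (improves_seq s0 good empty_env wide_cmd (planes_cmd G) _ _ eq_refl eq_refl
       (wide_ok s0 n tn k0 h N Prep Hn HC) planes_ok)).
  destruct (HI s0 A0 E0 G0) as (V1 & _ & V3).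
  change (good v) in V1. change (ra (run (If cd small_cmd Skip ;; wide_cmd ;; planes_cmd G) s0) 10%nat 0%nat) with v in V3.
  clear HI.
  split; auto. intros Q ts HA. unfold adm_prosp in HA. unfold val_prosp.
  assert (Hne : exists p, (p < n)%nat /\ in_prosp x y t Q ts p).
  { destruct (excluded_middle_informative (exists p, (p < n)%nat /\ in_prosp x y t Q ts p)) as [He|He]; auto.
    exfalso. rewrite !(frac_total n _ _ (fun _ => false)) in HA
      by (intros p Hpn; split; intros Hx; [exfalso; apply He; eauto|discriminate]).
    unfold total in HA. rewrite !sumR_0 in HA by auto. unfold admissible, Rdiv in HA.
    assert (0 < C * / INR n) by (apply Rmult_lt_0_compat; [auto|now apply Rinv_0_lt_compat]). lra. }
  destruct (region_box n tn x y t Hn Htn Q ts Hne)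
    as (q & a & b' & l1 & l2 & Hq & Hab & Hb' & Hl & Hl2 & Ca & Cb & Hbox).
  rewrite !(frac_total n _ _ _ Hbox) in HA |- *.
  set (S := box q a b' l1 l2) in *.
  change (adm S) in HA. change (val S <= v + eps).
  destruct (Nat.lt_ge_cases (count n S) k0) as [Hsmall|Hbig].
  - destruct (Rlt_le_dec (eps * INR n) (INR D)) as [He|He].
    + rewrite (proj2 (Rltb_true _ _) He) in V3. apply Rle_trans with v; [|lra]. apply V3. left. exists q. split; auto.
      exists a. split; [lia|]. exists (b' - 1)%nat. split; [lia|].
      replace (Datatypes.S (b' - 1)) with b' by lia.
      exists l1, l2. split; [lia|]. split; [exact HA|]. split; [|reflexivity].
      rewrite (p_k0 _ _ _ _ _ _ Prep). exact Hsmall.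
    (* With [D <= eps n] the value is at most [D / n <= eps], so [v >= 0] is already close
       enough. *)
    + assert (HV := val_small n k0 G D c C lo hi m b Hn Hc HC Hlo Hlh Hm Hb HG HD S HA Hsmall).
      assert (INR D / INR n <= eps).
      { apply Rmult_le_reg_r with (INR n); auto. unfold Rdiv. rewrite Rmult_assoc, Rinv_l by lra. lra. }
      destruct V1 as [V0 _]. fold v in V0. lra.
  - destruct (Nat.le_gt_cases (count n (stripe q a b') + k0) n) as [Hc1|Hc1].
    + destruct (val_plane n G c C lo hi m b Hn Hc HC Hlo Hlh Hm Hb HG S N HA HN)
        as (u & w & Hu & Hw & HV).
      eapply Rle_trans; [exact HV|]. apply Rplus_le_compat.
      * apply V3. right. right. exists u, w, q, a, b', l1, l2. auto 15.
      * assert (0 < INR N ^ 2) by (apply pow_lt, lt_0_INR; lia).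
        apply Rmult_le_reg_r with (INR N ^ 2); auto.
        unfold Rdiv. rewrite (Rmult_assoc (c * INR G ^ 3)), Rinv_l by lra. lra.
    + apply Rle_trans with v; [|lra]. apply V3. right. left.
      (* From [count + a <= b'] and [n < count + k0] follows [a + (n - b') < k0], so both margins
         are in the range of the exact enumeration. *)
      assert (Hsc := strip_count q a b' Ca Cb ltac:(lia)).
      exists q. split; auto. exists a. split; [lia|]. exists (n - b')%nat.
      split; [lia|]. split; [lia|]. replace (n - (n - b'))%nat with b' by lia.
      exists l1, l2. split; [lia|]. split; [exact HA|]. split; [|reflexivity].
      rewrite (p_n1 _ _ _ _ _ _ Prep). assert (Hcb := count_bound n S). fold S. lia.
Qed.

End SearchCorrect.

(** * Preparation *)

Lemma totals_ok s n : na s 0%nat 0%nat = n ->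
  ra (run totals_cmd s) 8%nat 0%nat = sumR n (ra s 2%nat) /\
  ra (run totals_cmd s) 9%nat 0%nat = sumR n (ra s 3%nat).
Proof.
  intros Hn. unfold totals_cmd.
  match goal with |- context [For 16 0 ?bb] => set (loop := For 16 0 bb) end.
  cbn [run evR evN]. set (s1 := setr 9 0 _ _).
  set (I := fun k z => ra z 2%nat = ra s 2%nat /\ ra z 3%nat = ra s 3%nat /\
    ra z 8%nat 0%nat = sumR k (ra s 2%nat) /\ ra z 9%nat 0%nat = sumR k (ra s 3%nat)).
  assert (HI : I (na s1 0%nat 0%nat) (run loop s1)).
  { apply (for_ind I); [reflexivity|repeat split|].
    intros k z _ Hv (I1 & I2 & I3 & I4). unfold I. sim. look. rewrite Hv, I1, I2, I3, I4.
    repeat split. }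
  change (na s1 0%nat 0%nat) with (na s 0%nat 0%nat) in HI. rewrite Hn in HI.
  destruct HI as (_ & _ & HI). exact HI.
Qed.

Lemma rank_ok key dst s n : na s 0%nat 0%nat = n -> (dst < 16)%nat -> dst <> 0%nat ->
  forall p, (p < n)%nat -> na (run (rank_cmd key dst) s) dst p = rank n (ra s key) p.
Proof.
  intros Hn Hd Hd0. unfold rank_cmd.
  match goal with |- context [Seq _ (Seq (For 17 0 ?bb) _)] => set (inner := For 17 0 bb); set (body := bb) end.
  set (I := fun k z => ra z key = ra s key /\ na z 0%nat = na s 0%nat /\
    forall p, (p < k)%nat -> na z dst p = rank n (ra s key) p).
  match goal with |- context [run ?l s] => assert (HI : I (na s 0%nat 0%nat) (run l s)) end.
  { apply (for_ind I).
    - cbn -[Nat.eqb]. rewrite (proj2 (Nat.eqb_neq 16 dst)) by lia. reflexivity.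
    - split; [reflexivity|]. split; [reflexivity|]. intros p Hp. lia.
    - intros k z Hk Hv (I1 & I2 & I3). cbn [run evN]. set (z1 := setn 18 0 0 z).
      set (J := fun j z' => ra z' key = ra s key /\ na z' 0%nat = na s 0%nat /\ na z' 16%nat = na z 16%nat /\
        na z' dst = na z dst /\
        na z' 18%nat 0%nat = count j (fun q => Rltb (ra s key q) (ra s key k))).
      assert (HJ : J (na z1 0%nat 0%nat) (run inner z1)).
      { apply (for_ind J); [reflexivity| |].
        - unfold J, z1. cbn [na ra setn]. split; [exact I1|]. split; [exact I2|]. split; [reflexivity|].
          split; [|reflexivity]. rewrite !upd2_other_arr; auto; apply Nat.eqb_neq; lia.
        - intros j z' _ Hv' (J1 & J2 & J3 & J4 & J5).
          unfold body. cbn [run evC evR evN]. rewrite Hv', J3, Hv, J1. unfold J. rewrite count_S.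
          destruct (Rltb (ra s key j) (ra s key k)); cbn [run evN setn na ra];
            (split; [exact J1|]; split; [exact J2|]; split; [exact J3|]; split;
             [rewrite !upd2_other_arr; auto; apply Nat.eqb_neq; lia|]).
          + unfold upd2. cbn [Nat.eqb andb]. lia.
          + unfold upd2. cbn [Nat.eqb andb]. lia. }
      change (na z1 0%nat 0%nat) with (na z 0%nat 0%nat) in HJ. rewrite I2, Hn in HJ.
      set (z2 := run inner z1) in *. destruct HJ as (J1 & J2 & J3 & J4 & J5).
      unfold I. cbn [na ra setn].
      assert (E16 : na z2 16%nat 0%nat = k) by (rewrite J3; exact Hv).
      split; [exact J1|]. split.
      + rewrite !upd2_other_arr; auto; apply Nat.eqb_neq; lia.
      + intros p Hp. rewrite (upd2_other_arr _ 16) by (apply Nat.eqb_neq; lia).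
        rewrite upd2_row, E16, J5. destruct (Nat.eqb_spec p k) as [->|Np]; [reflexivity|].
        rewrite J4. apply I3. lia. }
  rewrite Hn in HI. apply HI.
Qed.

Lemma sort_ok s n y : na s 0%nat 0%nat = n ->
  (forall p, (p < n)%nat -> na s 12%nat p = rank n y p) ->
  forall p, (p < n)%nat -> na (run sort_cmd s) 13%nat (sort_pos n y p) = p.
Proof.
  intros Hn Hry. unfold sort_cmd.
  match goal with |- context [Seq _ (Seq (For 17 0 ?bb) _)] => set (inner := For 17 0 bb); set (body := bb) end.
  set (I := fun k z => na z 12%nat = na s 12%nat /\ na z 0%nat = na s 0%nat /\
    forall p, (p < k)%nat -> na z 13%nat (sort_pos n y p) = p).
  match goal with |- context [run ?l s] => assert (HI : I (na s 0%nat 0%nat) (run l s)) end.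
  { apply (for_ind I); [reflexivity| |].
    - split; [reflexivity|]. split; [reflexivity|]. intros p Hp. lia.
    - intros k z Hk Hv (I1 & I2 & I3). rewrite Hn in Hk.
      cbn [run evN]. rewrite Hv. set (z1 := setn 18 0 (na z 12%nat k) z).
      (* The inner loop runs up to [n], but only indices below [k] break ties: hence the minimum. *)
      set (J := fun j z' => na z' 12%nat = na s 12%nat /\ na z' 0%nat = na s 0%nat /\
        na z' 16%nat = na z 16%nat /\ na z' 13%nat = na z 13%nat /\
        na z' 18%nat 0%nat = (rank n y k + count (Nat.min j k) (fun q =>
          negb (Nat.ltb (rank n y q) (rank n y k)) && negb (Nat.ltb (rank n y k) (rank n y q))))%nat).
      assert (HJ : J (na z1 0%nat 0%nat) (run inner z1)).
      { apply (for_ind J); [reflexivity| |].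
        - unfold J, z1. cbn [na setn].
          split; [exact I1|]. split; [exact I2|]. split; [reflexivity|]. split; [reflexivity|].
          unfold upd2. cbn [Nat.eqb andb]. rewrite I1, Hry by auto. unfold count. simpl. lia.
        - intros j z' Hj Hv' (J1 & J2 & J3 & J4 & J5).
          change (na z1 0%nat 0%nat) with (na z 0%nat 0%nat) in Hj. rewrite I2, Hn in Hj.
          unfold body. cbn [run evC evN]. rewrite Hv', J3, Hv.
          destruct (Nat.ltb_spec j k) as [Hjk|Hjk].
          + rewrite J1, !Hry by lia. unfold J.
            replace (Nat.min (S j) k) with (S j) by lia. replace (Nat.min j k) with j in J5 by lia.
            rewrite count_S.
            destruct (Nat.ltb (rank n y j) (rank n y k)); cbn [run negb andb].
            { rewrite Nat.add_0_r. cbn [na setn]. split; [exact J1|]. auto. }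
            destruct (Nat.ltb (rank n y k) (rank n y j)); cbn [run negb andb evN].
            { rewrite Nat.add_0_r. cbn [na setn]. split; [exact J1|]. auto. }
            split; [exact J1|]. split; [exact J2|]. split; [exact J3|]. split; [exact J4|].
            look. lia.
          + unfold J. cbn [run na setn]. replace (Nat.min (S j) k) with k by lia.
            replace (Nat.min j k) with k in J5 by lia.
            split; [exact J1|]. auto. }
      change (na z1 0%nat 0%nat) with (na z 0%nat 0%nat) in HJ. rewrite I2, Hn in HJ.
      set (z2 := run inner z1) in *. destruct HJ as (J1 & J2 & J3 & J4 & J5).
      replace (Nat.min n k) with k in J5 by lia.
      change (na z2 18%nat 0%nat = sort_pos n y k) in J5.
      assert (E16 : na z2 16%nat 0%nat = k) by (rewrite J3; exact Hv).
      split; [exact J1|]. split; [exact J2|].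
      intros p Hp. look. rewrite J5, E16.
      destruct (Nat.eqb_spec (sort_pos n y p) (sort_pos n y k)) as [E|E].
      + symmetry. apply (pos_inj n y); auto. lia.
      + rewrite J4. apply I3. destruct (Nat.eq_dec p k); [congruence|lia]. }
  rewrite Hn in HI. apply HI.
Qed.

(** Exactly one point sits at each position, so comparing its rank with the position decides [cut].
    The end [n] is always a cut, no position being equal to it. *)
Lemma flags_ok s n y : na s 0%nat 0%nat = n ->
  (forall p, (p < n)%nat -> na s 12%nat p = rank n y p) ->
  (forall p, (p < n)%nat -> na s 13%nat (sort_pos n y p) = p) ->
  forall a, (a <= n)%nat -> ((0 < na (run flags_cmd s) 14%nat a)%nat <-> cut n y a).
Proof.
  intros Hn Hry Hys. unfold flags_cmd.
  match goal with |- context [For 16 0 ?bb] => set (loop := For 16 0 bb) end.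
  set (I := fun k z => na z 0%nat = na s 0%nat /\ na z 12%nat = na s 12%nat /\ na z 13%nat = na s 13%nat /\
    forall a, (a < k)%nat -> (a < n)%nat -> ((0 < na z 14%nat a)%nat <-> cut n y a)).
  assert (HI : I (na s 0%nat 0%nat) (run loop s)).
  { apply (for_ind I); [reflexivity| |].
    - repeat (split; [reflexivity|]). intros a Ha. lia.
    - intros k z Hk Hv (I1 & I2 & I3 & I4). rewrite Hn in Hk.
      destruct (pos_surj n y k Hk) as (p & Hp & Ep).
      assert (Hcut : cut n y k <-> (k <= rank n y p)%nat).
      { split; [intros H; now apply H|]. intros H p' Hp' Ep'.
        replace p' with p; auto. apply (pos_inj n y); auto. congruence. }
      cbn [run evC evN]. rewrite Hv, I2, I3, <- Ep, Hys, Hry, Ep by auto.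
      destruct (Nat.ltb_spec (rank n y p) k) as [Hlt|Hge]; unfold I; cbn [run evN]; look;
        (split; [exact I1|]; split; [exact I2|]; split; [exact I3|]); intros a Ha Han;
        rewrite ?Hv; (destruct (Nat.eqb_spec a k) as [->|Na]; [rewrite Hcut; lia|]);
        apply I4; auto; lia. }
  rewrite Hn in HI. destruct HI as (I1 & _ & _ & I4). cbn [run evN].
  intros a Ha. look. rewrite I1, Hn.
  destruct (Nat.eqb_spec a n) as [->|Na]; [|apply I4; lia].
  split; [|lia]. intros _ p Hp Ep. assert (H := pos_bound n y p Hp). lia.
Qed.

(** A doubling adds at least one leaf, so [n + 2] rounds are enough when array 10 holds [n + 2]. The
    last doubling starts below that bound, which gives the factor 2 in the upper estimate. *)
Lemma shape_ok s : let s' := run shape_cmd s in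
  na s' 5%nat 0%nat = (2 ^ na s' 6%nat 0%nat)%nat /\
  (na s 10%nat 0 <= na s' 5%nat 0)%nat /\ (na s' 5%nat 0 <= 2 * na s 10%nat 0 + 1)%nat /\
  forall i, (i < na s' 5%nat 0)%nat -> na s' 15%nat (2 * i)%nat = i /\ na s' 15%nat (2 * i + 1)%nat = i.
Proof.
  intros s'. unfold s', shape_cmd. clear s'.
  match goal with |- context [Seq _ (Seq _ (Seq (For 16 10 ?b1) (For 16 5 ?b2)))] =>
    set (grow := For 16 10 b1); set (par := For 16 5 b2) end.
  cbn [run evN]. set (s1 := setn 6 0 0 (setn 5 0 1 s)).
  set (I := fun k z => na z 10%nat = na s 10%nat /\ na z 5%nat 0%nat = (2 ^ na z 6%nat 0%nat)%nat /\
    (1 <= na z 5%nat 0)%nat /\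
    (Nat.min (na s 10%nat 0%nat) (k + 1) <= na z 5%nat 0)%nat /\
    (na z 5%nat 0 <= 2 * na s 10%nat 0 + 1)%nat).
  assert (HI : I (na s1 10%nat 0%nat) (run grow s1)).
  { apply (for_ind I); [reflexivity| |].
    - unfold I, s1. look. split; [reflexivity|]. simpl. lia.
    - intros k z Hk Hv (I1 & I2 & I3 & I4 & I5). cbn [run evC evN]. rewrite I1.
      destruct (Nat.ltb_spec (na z 5%nat 0%nat) (na s 10%nat 0%nat)) as [Hlt|Hge];
        unfold I; cbn [run evN]; look.
      + split; [exact I1|]. replace (na z 6%nat 0 + 1)%nat with (S (na z 6%nat 0%nat)) by lia.
        rewrite Nat.pow_succ_r'. lia.
      + split; [exact I1|]. lia. }
  change (na s1 10%nat 0%nat) with (na s 10%nat 0%nat) in HI.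
  set (s2 := run grow s1) in *. destruct HI as (I1 & I2 & I3 & I4 & I5).
  assert (E5 : na (run par s2) 5%nat = na s2 5%nat) by (apply run_na; reflexivity).
  assert (E6 : na (run par s2) 6%nat = na s2 6%nat) by (apply run_na; reflexivity).
  rewrite E5, E6. split; [exact I2|]. split; [lia|]. split; [exact I5|].
  set (J := fun k z => forall i, (i < k)%nat -> na z 15%nat (2 * i)%nat = i /\ na z 15%nat (2 * i + 1)%nat = i).
  assert (HJ : J (na s2 5%nat 0%nat) (run par s2)).
  { apply (for_ind J); [reflexivity| |].
    - intros i Hi. lia.
    - intros k z Hk Hv HJ i Hi. cbn [run evN]. rewrite Hv. look. rewrite Hv.
      destruct (Nat.eq_dec i k) as [->|Ni].
      + rewrite Nat.eqb_refl. destruct (Nat.eqb_spec (2 * k) (2 * k + 1)); [lia|].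
        rewrite Nat.eqb_refl. auto.
      + destruct (Nat.eqb_spec (2 * i) (2 * k + 1)); [lia|].
        destruct (Nat.eqb_spec (2 * i) (2 * k)); [lia|].
        destruct (Nat.eqb_spec (2 * i + 1) (2 * k + 1)); [lia|].
        destruct (Nat.eqb_spec (2 * i + 1) (2 * k)); [lia|]. apply HJ. lia. }
  exact HJ.
Qed.

(** Unless the result [N] is 1, [(N - 1)^2] is still below the target, and [N <= 2 (N - 1)]. So
    [N^2] overshoots by at most a factor 4, and the slope pairs remain [O(1 / eps)] in number. *)
Lemma slopes_ok s : let s' := run slopes_cmd s in
  (1 <= na s' 7%nat 0)%nat /\ (na s 8%nat 0 <= na s' 7%nat 0 * na s' 7%nat 0)%nat /\
  (na s' 7%nat 0 * na s' 7%nat 0 <= 4 * na s 8%nat 0 + 1)%nat.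
Proof.
  intros s'. unfold s', slopes_cmd. clear s'.
  match goal with |- context [For 16 8 ?bb] => set (loop := For 16 8 bb) end.
  cbn [run evN]. set (s1 := setn 7 0 1 s).
  set (I := fun k z => na z 8%nat = na s 8%nat /\ (1 <= na z 7%nat 0)%nat /\
    (na s 8%nat 0 <= na z 7%nat 0 * na z 7%nat 0 \/ k + 1 <= na z 7%nat 0)%nat /\
    (na z 7%nat 0 = 1 \/ (na z 7%nat 0 - 1) * (na z 7%nat 0 - 1) < na s 8%nat 0)%nat).
  assert (HI : I (na s1 8%nat 0%nat) (run loop s1)).
  { apply (for_ind I); [reflexivity| |].
    - unfold I, s1. look. split; [reflexivity|]. lia.
    - intros k z Hk Hv (I1 & I2 & I3 & I4). cbn [run evC evN]. rewrite I1.
      destruct (Nat.ltb_spec (na z 7%nat 0%nat * na z 7%nat 0%nat) (na s 8%nat 0%nat)) as [Hlt|Hge];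
        unfold I; cbn [run evN]; look.
      + split; [exact I1|]. split; [lia|]. split; [lia|].
        right. rewrite Nat.add_sub. exact Hlt.
      + split; [exact I1|]. split; [lia|]. split; [lia|]. exact I4. }
  change (na s1 8%nat 0%nat) with (na s 8%nat 0%nat) in HI. destruct HI as (_ & I2 & I3 & I4).
  split; [exact I2|]. split; [destruct I3 as [I3|I3]; [exact I3|nia]|].
  destruct I4 as [->|I4]; [lia|]. nia.
Qed.

Lemma run_seq c1 c2 s : run (c1 ;; c2) s = run c2 (run c1 s).
Proof. reflexivity. Qed.

Lemma sizes_ok static k0 s n : na s 0%nat 0%nat = n ->
  let s1 := run (sizes_cmd static k0) s in
  na s1 1%nat 0%nat = (if static then 1 else n)%nat /\ na s1 2%nat 0%nat = k0 /\
  na s1 3%nat 0%nat = (k0 + 1)%nat /\ na s1 4%nat 0%nat = (k0 + 3)%nat /\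
  na s1 9%nat 0%nat = (n + 1)%nat /\ na s1 10%nat 0%nat = (n + 2)%nat /\ ra s1 10%nat 0%nat = 0.
Proof.
  intros Hn s1. unfold s1, sizes_cmd.
  destruct static; cbn [run evN evR]; look; rewrite Hn; repeat split.
Qed.

Lemma prep_ok static k0 s n : na s 0%nat 0%nat = n ->
  let s' := run (prep_cmd static k0) s in
  prepared s' n (if static then 1 else n) k0 (na s' 6%nat 0%nat) (na s' 7%nat 0%nat) /\
  (forall a, (a < 8)%nat -> ra s' a = ra s a) /\ ra s' 10%nat 0%nat = 0 /\
  (na s' 5%nat 0 <= 2 * n + 5)%nat.
Proof.
  intros Hn. cbv zeta. unfold prep_cmd. rewrite !run_seq.
  remember (run (sizes_cmd static k0) s) as s1 eqn:Q1.
  remember (run totals_cmd s1) as s2 eqn:Q2. remember (run (rank_cmd 0 11) s2) as s3 eqn:Q3.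
  remember (run (rank_cmd 1 12) s3) as s4 eqn:Q4. remember (run sort_cmd s4) as s5 eqn:Q5.
  remember (run flags_cmd s5) as s6 eqn:Q6. remember (run shape_cmd s6) as s7 eqn:Q7.
  assert (R1 : forall a, a <> 10%nat -> ra s1 a = ra s a).
  { intros a Ha. rewrite Q1. apply run_ra. cbn. destruct (Nat.eqb_spec a 10); [congruence|reflexivity]. }
  assert (N1 : na s1 0%nat = na s 0%nat) by (rewrite Q1; apply run_na; destruct static; reflexivity).
  assert (V1 := sizes_ok static k0 s n Hn). rewrite <- Q1 in V1.
  assert (F : forall a, memb (11 :: 12 :: 13 :: 14 :: 5 :: 6 :: 15 :: 16 :: 17 :: 18 :: nil)%nat a = false ->
    na s7 a = na s1 a /\ na s2 a = na s1 a /\ na s3 a = na s1 a /\ na s4 a = na s1 a /\ na s5 a = na s1 a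
    /\ na s6 a = na s1 a).
  { intros a Ha.
    assert (W : forall cmd z, (forall u, In u (nmods cmd) ->
        In u (11 :: 12 :: 13 :: 14 :: 5 :: 6 :: 15 :: 16 :: 17 :: 18 :: nil)%nat) ->
        na (run cmd z) a = na z a).
    { intros cmd z Hin. apply run_na. apply not_true_is_false. intros Ht.
      unfold memb in Ht. apply existsb_exists in Ht. destruct Ht as (u & Hu & Eu).
      apply Nat.eqb_eq in Eu. subst u. apply Hin in Hu.
      assert (Hm : memb (11 :: 12 :: 13 :: 14 :: 5 :: 6 :: 15 :: 16 :: 17 :: 18 :: nil)%nat a = true).
      { unfold memb. apply existsb_exists. exists a. now rewrite Nat.eqb_refl. }
      congruence. }
    assert (E2 : na s2 a = na s1 a) by (rewrite Q2; apply W; cbn; tauto).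
    assert (E3 : na s3 a = na s1 a) by (rewrite <- E2, Q3; apply W; cbn; tauto).
    assert (E4 : na s4 a = na s1 a) by (rewrite <- E3, Q4; apply W; cbn; tauto).
    assert (E5 : na s5 a = na s1 a) by (rewrite <- E4, Q5; apply W; cbn; tauto).
    assert (E6 : na s6 a = na s1 a) by (rewrite <- E5, Q6; apply W; cbn; tauto).
    assert (E7 : na s7 a = na s1 a) by (rewrite <- E6, Q7; apply W; cbn; tauto).
    auto 10. }
  assert (RF : forall a, a <> 8%nat -> a <> 9%nat -> ra s7 a = ra s1 a /\ ra s2 a = ra s1 a /\ ra s3 a = ra s1 a).
  { intros a H8 H9.
    assert (E2 : ra s2 a = ra s1 a).
    { rewrite Q2. apply run_ra. cbn. destruct (Nat.eqb_spec a 8); [congruence|].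
      destruct (Nat.eqb_spec a 9); [congruence|reflexivity]. }
    assert (E3 : ra s3 a = ra s2 a) by (rewrite Q3; apply run_ra; reflexivity).
    assert (E7 : ra s7 a = ra s3 a).
    { rewrite Q7, run_ra, Q6, run_ra, Q5, run_ra, Q4, run_ra by reflexivity. reflexivity. }
    split; [congruence|]. split; congruence. }
  assert (RM : ra s7 8%nat = ra s2 8%nat /\ ra s7 9%nat = ra s2 9%nat).
  { rewrite Q7, !run_ra, Q6, !run_ra, Q5, !run_ra, Q4, !run_ra, Q3, !run_ra by reflexivity. auto. }
  destruct RM as [RM8 RM9].
  destruct (F 0%nat eq_refl) as (F7 & F2 & F3 & F4 & F5 & F6).
  assert (n1 : na s1 0%nat 0%nat = n) by (now rewrite N1).
  destruct (totals_ok s1 n n1) as [T8 T9]. rewrite <- Q2 in T8, T9.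
  assert (K3 := rank_ok 0 11 s2 n ltac:(now rewrite F2) ltac:(lia) ltac:(lia)). rewrite <- Q3 in K3.
  assert (K4 := rank_ok 1 12 s3 n ltac:(now rewrite F3) ltac:(lia) ltac:(lia)). rewrite <- Q4 in K4.
  assert (K5 := sort_ok s4 n _ ltac:(now rewrite F4) K4). rewrite <- Q5 in K5.
  assert (G12 : na s5 12%nat = na s4 12%nat) by (rewrite Q5; apply run_na; reflexivity).
  assert (K6 := flags_ok s5 n (ra s3 1%nat) ltac:(now rewrite F5)
                 ltac:(intros; rewrite G12; auto) K5). rewrite <- Q6 in K6.
  destruct (shape_ok s6) as (S1 & S2 & S3 & S4). rewrite <- Q7 in S1, S2, S3, S4.
  destruct (F 10%nat eq_refl) as (_ & _ & _ & _ & _ & F10). rewrite F10 in S2, S3.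
  cbv zeta in V1. destruct V1 as (V1 & V2 & V3 & V4 & V9 & V10 & VR). rewrite V10 in S2, S3.
  assert (ER : forall a, (a < 8)%nat -> ra s7 a = ra s a).
  { intros a Ha. rewrite <- R1 by lia. apply RF; lia. }
  destruct (RF 0%nat ltac:(lia) ltac:(lia)) as (X07 & X02 & _).
  destruct (RF 1%nat ltac:(lia) ltac:(lia)) as (X17 & _ & X13).
  destruct (RF 2%nat ltac:(lia) ltac:(lia)) as (X27 & _ & _).
  destruct (RF 3%nat ltac:(lia) ltac:(lia)) as (X37 & _ & _).
  split; [constructor|split; [exact ER|split]].
  - now rewrite F7.
  - rewrite (proj1 (F 1%nat eq_refl)). exact V1.
  - rewrite (proj1 (F 2%nat eq_refl)). exact V2.
  - rewrite (proj1 (F 3%nat eq_refl)). exact V3.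
  - rewrite (proj1 (F 4%nat eq_refl)). exact V4.
  - exact S1.
  - reflexivity.
  - reflexivity.
  - rewrite (proj1 (F 9%nat eq_refl)). exact V9.
  - rewrite <- S1. exact S2.
  - rewrite RM8, X27. exact T8.
  - rewrite RM9, X37. exact T9.
  - intros p Hp. rewrite X07, <- X02, <- K3 by auto.
    rewrite Q7, run_na, Q6, run_na, Q5, run_na, Q4, run_na by reflexivity. reflexivity.
  - intros p Hp. rewrite X17, <- X13, <- K4 by auto.
    rewrite Q7, run_na, Q6, run_na, Q5, run_na by reflexivity. reflexivity.
  - intros p Hp. rewrite X17, <- X13. rewrite <- (K5 p Hp) at 2.
    rewrite Q7, run_na, Q6, run_na by reflexivity. reflexivity.
  - intros a Ha. rewrite X17, <- X13, <- K6 by auto.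
    rewrite Q7, run_na by reflexivity. reflexivity.
  - rewrite <- S1. exact S4.
  - rewrite (proj1 (RF 10%nat ltac:(lia) ltac:(lia))). exact VR.
  - lia.
Qed.

Lemma prepared_frame s s' n tn k0 h N : prepared s n tn k0 h N ->
  (forall a, (a < 16)%nat -> a <> 7%nat -> a <> 8%nat -> na s' a = na s a) ->
  (forall a, (a < 10)%nat -> ra s' a = ra s a) ->
  prepared s' n tn k0 h (na s' 7%nat 0%nat).
Proof.
  intros [] HN HR. constructor; rewrite ?HR by lia; try (rewrite ?HN by lia); auto.
Qed.

Lemma setup_ok static k0 G s n : na s 0%nat 0%nat = n ->
  let s1 := run (prep_cmd static k0) s in
  let s0 := run slopes_cmd (run (Ceil 8 30) (run (target_cmd G) s1)) in
  let N1 := Z.to_nat (up (ra s 6%nat 0%nat * INR (G * G * G) / ra s 5%nat 0%nat)) in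
  prepared s0 n (if static then 1 else n) k0 (na s0 6%nat 0%nat) (na s0 7%nat 0%nat) /\
  (forall a, (a < 8)%nat -> ra s0 a = ra s a) /\ ra s0 10%nat 0%nat = 0 /\
  (na s0 5%nat 0 <= 2 * n + 5)%nat /\ (1 <= na s0 7%nat 0)%nat /\
  (N1 <= na s0 7%nat 0 * na s0 7%nat 0 <= 4 * N1 + 1)%nat /\
  ra (run (target_cmd G) s1) 30%nat 0%nat = ra s 6%nat 0%nat * INR (G * G * G) / ra s 5%nat 0%nat /\
  na (run (Ceil 8 30) (run (target_cmd G) s1)) 8%nat 0%nat = N1.
Proof.
  intros Hn s1 s0 N1.
  destruct (prep_ok static k0 s n Hn) as (P1 & P2 & P3 & P4). fold s1 in P1, P2, P3, P4.
  set (s2 := run (target_cmd G) s1) in *.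
  assert (E30 : ra s2 30%nat 0%nat = ra s 6%nat 0%nat * INR (G * G * G) / ra s 5%nat 0%nat).
  { unfold s2, target_cmd. cbn [run evR evN]. look. rewrite !P2 by lia. reflexivity. }
  set (s3 := run (Ceil 8 30) s2) in *.
  assert (E8 : na s3 8%nat 0%nat = N1).
  { unfold s3. cbn [run]. look. rewrite E30. reflexivity. }
  destruct (slopes_ok s3) as (S1 & S2 & S3). fold s0 in S1, S2, S3. rewrite E8 in S2, S3.
  assert (FN : forall a, (a < 16)%nat -> a <> 7%nat -> a <> 8%nat -> na s0 a = na s1 a).
  { intros a Ha H7 H8. transitivity (na s3 a); [|transitivity (na s2 a)].
    - apply run_na. cbn. destruct (Nat.eqb_spec a 7); [congruence|].
      destruct (Nat.eqb_spec a 16); [lia|reflexivity].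
    - apply run_na. cbn. destruct (Nat.eqb_spec a 8); [congruence|reflexivity].
    - apply run_na. reflexivity. }
  assert (FR : forall a, (a < 30)%nat -> ra s0 a = ra s1 a).
  { intros a Ha. transitivity (ra s3 a); [|transitivity (ra s2 a)].
    - apply run_ra. reflexivity.
    - apply run_ra. reflexivity.
    - apply run_ra. cbn. destruct (Nat.eqb_spec a 30); [lia|reflexivity]. }
  split; [|split; [|split; [|split; [|split; [|split; [|split]]]]]]; auto.
  - rewrite (FN 6%nat) by lia. apply (prepared_frame s1 s0 n _ k0 _ (na s1 7%nat 0%nat)); auto.
    intros a Ha. apply FR. lia.
  - intros a Ha. rewrite FR by lia. auto.
  - rewrite FR by lia. exact P3.
  - rewrite FN by lia. exact P4.
Qed.

(** * Running time *)

(** Each list names the limits of the loops around one unit charge, and [cost_factor] is the number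
    of lists. The cost is thus at most that number times the largest product of limits. *)
Fixpoint paths (c : cmd) : list (list nat) :=
  match c with
  | Skip => nil
  | SetN _ _ _ | SetR _ _ _ | Ceil _ _ => nil :: nil
  | Seq c1 c2 => paths c1 ++ paths c2
  | If _ c1 c2 => nil :: paths c1 ++ paths c2
  | For _ w c => nil :: (w :: nil) :: map (cons w) (paths c)
  end.

Fixpoint cost_factor (c : cmd) : nat :=
  match c with
  | Skip => 0
  | SetN _ _ _ | SetR _ _ _ | Ceil _ _ => 1
  | Seq c1 c2 => cost_factor c1 + cost_factor c2
  | If _ c1 c2 => 1 + cost_factor c1 + cost_factor c2
  | For _ _ c => 2 + cost_factor c
  end.

Definition prodl (L : nat -> nat) (l : list nat) : nat := fold_right (fun w p => L w * p)%nat 1%nat l.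

Lemma cost_bound_paths c L B P :
  (forall l, In l (paths c) -> (P * prodl L l <= B)%nat) ->
  (P * cost_bound c L <= cost_factor c * B)%nat.
Proof.
  revert P. induction c; intros P H; cbn [cost_bound cost_factor paths] in *; try lia.
  - assert (H0 := H nil (or_introl eq_refl)). cbn in H0. lia.
  - assert (H0 := H nil (or_introl eq_refl)). cbn in H0. lia.
  - specialize (IHc1 P). specialize (IHc2 P).
    assert (P * cost_bound c1 L <= cost_factor c1 * B)%nat by (apply IHc1; intros; apply H, in_or_app; auto).
    assert (P * cost_bound c2 L <= cost_factor c2 * B)%nat by (apply IHc2; intros; apply H, in_or_app; auto).
    lia.
  - assert (H0 := H nil (or_introl eq_refl)). cbn in H0.
    assert (P * cost_bound c1 L <= cost_factor c1 * B)%nat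
      by (apply IHc1; intros; apply H; right; apply in_or_app; auto).
    assert (P * cost_bound c2 L <= cost_factor c2 * B)%nat
      by (apply IHc2; intros; apply H; right; apply in_or_app; auto).
    lia.
  - assert (H0 := H nil (or_introl eq_refl)). assert (H1 := H (w :: nil) (or_intror (or_introl eq_refl))).
    cbn in H0, H1.
    assert (P * L w * cost_bound c L <= cost_factor c * B)%nat.
    { apply IHc. intros l Hl. specialize (H (w :: l)). cbn in H. rewrite <- Nat.mul_assoc.
      apply H. right. right. now apply in_map. }
    lia.
Qed.

(** A greedy test for an order-preserving embedding of [l] into [m] in which every limit is bounded
    by its image. *)
Fixpoint dominated (r : nat -> nat -> bool) (l m : list nat) : bool :=
  match m with
  | nil => match l with nil => true | _ => false end
  | b :: m' => match l with
               | nil => true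
               | a :: l' => if r a b then dominated r l' m' else dominated r l m'
               end
  end.

Lemma prodl_pos L m : (forall a, In a m -> (1 <= L a)%nat) -> (1 <= prodl L m)%nat.
Proof.
  induction m as [|b m IH]; intros H; cbn; [lia|].
  assert (1 <= L b)%nat by (apply H; now left). assert (1 <= prodl L m)%nat by (apply IH; intros; apply H; now right).
  unfold prodl in *. nia.
Qed.

Lemma dominated_le L r l m : (forall a b, r a b = true -> (L a <= L b)%nat) ->
  (forall a, In a m -> (1 <= L a)%nat) -> dominated r l m = true -> (prodl L l <= prodl L m)%nat.
Proof.
  intros Hr. revert l. induction m as [|b m IH]; intros l Hm Hd.
  - destruct l; [cbn; lia|discriminate].
  - destruct l as [|a l].
    + apply (prodl_pos L (b :: m)); auto.
    + assert (Hm' : forall a, In a m -> (1 <= L a)%nat) by (intros; apply Hm; now right).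
      assert (1 <= L b)%nat by (apply Hm; now left).
      cbn [dominated] in Hd. destruct (r a b) eqn:E.
      * cbn. apply Nat.mul_le_mono; auto. apply IH; auto.
      * specialize (IH _ Hm' Hd). cbn [prodl fold_right] in *. unfold prodl in *. cbn [fold_right] in *. nia.
Qed.

Lemma cost_dominated c (L : nat -> nat) r m s :
  no_ceil c && fixed_limits c && forallb (fun l => dominated r l m) (paths c) = true ->
  (forall a b, r a b = true -> (L a <= L b)%nat) -> (forall a, In a m -> (1 <= L a)%nat) ->
  (forall w, In w (limits c) -> (na s w 0 <= L w)%nat) ->
  (cost c s <= cost_factor c * prodl L m)%nat.
Proof.
  intros H Hr Hm HL. apply andb_true_iff in H. destruct H as [H Hd].
  apply andb_true_iff in H. destruct H as [Hc Hf].
  eapply Nat.le_trans; [apply (cost_le c L s Hc Hf HL)|].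
  rewrite <- (Nat.mul_1_l (cost_bound c L)). apply cost_bound_paths.
  intros l Hl. rewrite Nat.mul_1_l. apply (dominated_le L r); auto.
  rewrite forallb_forall in Hd. auto.
Qed.

(** Besides equality two comparisons are enough: [n] against the bound for the leaves, and [k0 + 1]
    against [k0 + 3]. *)
Definition limit_le (a b : nat) : bool :=
  Nat.eqb a b || Nat.eqb a 0 && Nat.eqb b 5 || Nat.eqb a 3 && Nat.eqb b 4.

(** Entry 5 is [5 n] because there are at most [2 n + 5] leaves and [n >= 2]. The depth enters as
    [h + 1] since dominating factors have to be at least 1. *)
Definition limit_bound (n tn k0 h N w : nat) : nat :=
  nth w (n :: tn :: k0 :: k0 + 1 :: k0 + 3 :: 5 * n :: h + 1 :: N :: 0 :: n + 1 :: nil)%nat 0%nat.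

Section Costs.
Variables (s0 : st) (n tn k0 h N : nat).
Hypothesis Prep : prepared s0 n tn k0 h N.
Hypothesis Hn : (2 <= n)%nat.
Hypothesis Htn : (1 <= tn)%nat.
Hypothesis Hk : (1 <= k0)%nat.
Hypothesis HN : (1 <= N)%nat.
Hypothesis HNN : (na s0 5 0 <= 2 * n + 5)%nat.

Lemma limit_bound_ok c s m :
  no_ceil c && fixed_limits c && forallb (fun l => dominated limit_le l m) (paths c) = true ->
  agree s0 s ->
  forallb (fun a => existsb (Nat.eqb a) (0 :: 1 :: 2 :: 3 :: 4 :: 5 :: 6 :: 7 :: 9 :: nil)%nat)
    (m ++ limits c) = true ->
  (cost c s <= cost_factor c * prodl (limit_bound n tn k0 h N) m)%nat.
Proof.
  intros Hc [Hag _] Hm.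
  assert (Hin : forall a, In a (m ++ limits c) ->
    In a (0 :: 1 :: 2 :: 3 :: 4 :: 5 :: 6 :: 7 :: 9 :: nil)%nat).
  { intros a Ha. rewrite forallb_forall in Hm. specialize (Hm a Ha). apply existsb_exists in Hm.
    destruct Hm as (u & Hu & E). apply Nat.eqb_eq in E. now subst. }
  apply (cost_dominated c _ limit_le); auto.
  - intros a b' E. unfold limit_le in E. rewrite !orb_true_iff, !andb_true_iff, !Nat.eqb_eq in E.
    destruct E as [[->|[-> ->]]|[-> ->]]; cbn; lia.
  - intros a Ha. assert (Ha' := Hin a ltac:(apply in_or_app; auto)). cbn [In] in Ha'.
    destruct Ha' as [<-|[<-|[<-|[<-|[<-|[<-|[<-|[<-|[<-|[]]]]]]]]]]; cbn; lia.
  - intros w Hw. assert (Hw' := Hin w ltac:(apply in_or_app; auto)). cbn [In] in Hw'.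
    rewrite Hag by lia. destruct Prep.
    destruct Hw' as [<-|[<-|[<-|[<-|[<-|[<-|[<-|[<-|[<-|[]]]]]]]]]]; unfold limit_bound; cbn [nth]; lia.
Qed.

Lemma small_cost s : agree s0 s ->
  (cost small_cmd s <= cost_factor small_cmd * k0 * (tn * n ^ 3))%nat.
Proof.
  intros Hs. eapply Nat.le_trans; [apply (limit_bound_ok _ _ (1 :: 0 :: 0 :: 0 :: 2 :: nil)%nat); auto|].
  unfold prodl, limit_bound. cbn [fold_right nth]. apply Nat.eq_le_incl. cbn [Nat.pow]. ring.
Qed.

Lemma wide_cost s : agree s0 s ->
  (cost wide_cmd s <= 2 * cost_factor wide_cmd * k0 ^ 2 * (tn * n ^ 2))%nat.
Proof.
  intros Hs. eapply Nat.le_trans; [apply (limit_bound_ok _ _ (1 :: 2 :: 2 :: 0 :: 9 :: nil)%nat); auto|].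
  unfold prodl, limit_bound. cbn [fold_right nth]. generalize (cost_factor wide_cmd). intros W.
  replace (2 * W * k0 ^ 2 * (tn * n ^ 2))%nat with (W * (tn * (k0 * (k0 * (n * ((n + n) * 1))))))%nat
    by (cbn [Nat.pow]; ring).
  repeat apply Nat.mul_le_mono; lia.
Qed.

(** The dominating nest reads: two slopes, threshold, lower side, leaf or inserted point, level, and
    three state indices for a product. It covers both the reset over all leaves and the insertions
    with their climbs. *)
Lemma planes_cost G s : agree s0 s ->
  (cost (planes_cmd G) s <= 5 * cost_factor (planes_cmd G) * (k0 + 3) ^ 3 * (N * N * (h + 1) * (tn * n ^ 2)))%nat.
Proof.
  intros Hs.
  eapply Nat.le_trans; [apply (limit_bound_ok _ _ (7 :: 7 :: 1 :: 0 :: 5 :: 6 :: 4 :: 4 :: 4 :: nil)%nat); auto|].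
  unfold prodl, limit_bound. cbn [fold_right nth]. generalize (cost_factor (planes_cmd G)). intros W.
  apply Nat.eq_le_incl. cbn [Nat.pow]. ring.
Qed.

End Costs.

Lemma cost_seq c1 c2 s : cost (c1 ;; c2) s = (cost c1 s + cost c2 (run c1 s))%nat.
Proof. reflexivity. Qed.

Lemma square_cost c s n : no_ceil c && fixed_limits c &&
    forallb (fun l => dominated Nat.eqb l (0 :: 0 :: nil)%nat) (paths c) = true ->
  forallb (Nat.eqb 0) (limits c) = true -> na s 0%nat 0%nat = n -> (1 <= n)%nat ->
  (cost c s <= cost_factor c * n ^ 2)%nat.
Proof.
  intros H1 H2 Hs Hn.
  eapply Nat.le_trans; [apply (cost_dominated c (fun _ => n) Nat.eqb (0 :: 0 :: nil)%nat); auto|].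
  - intros w Hw. rewrite forallb_forall in H2. apply H2, Nat.eqb_eq in Hw. subst. auto.
  - cbn. apply Nat.eq_le_incl. ring.
Qed.

Lemma shape_cost s n : na s 10%nat 0%nat = (n + 2)%nat -> (2 <= n)%nat ->
  (cost shape_cmd s <= 40 * n ^ 2)%nat.
Proof.
  intros H10 Hn. destruct (shape_ok s) as (_ & _ & H5 & _). revert H5. unfold shape_cmd.
  match goal with |- context [Seq _ (Seq _ (Seq (For 16 10 ?b1) (For 16 5 ?b2)))] =>
    set (grow := For 16 10 b1); set (par := For 16 5 b2) end.
  rewrite !run_seq, !cost_seq. cbn [run evN cost].
  set (s1 := setn 6 0 0 (setn 5 0 1 s)). set (s2 := run grow s1).
  rewrite (run_na par s2 5) by reflexivity. rewrite H10. intros H5.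
  assert (C1 : (cost grow s1 <= cost_factor grow * prodl (fun _ => n + 2)%nat (10 :: nil)%nat)%nat).
  { apply (cost_dominated grow _ Nat.eqb); auto; [intros; lia|].
    intros w Hw. cbn in Hw. destruct Hw as [<-|[]]. change (na s1 10%nat 0%nat) with (na s 10%nat 0%nat). lia. }
  assert (C2 : (cost par s2 <= cost_factor par * prodl (fun _ => 2 * n + 5)%nat (5 :: nil)%nat)%nat).
  { apply (cost_dominated par _ Nat.eqb); auto; [intros; lia|].
    intros w Hw. cbn in Hw. destruct Hw as [<-|[]]. lia. }
  cbn [cost_factor grow par prodl fold_right] in C1, C2. cbn [Nat.pow]. nia.
Qed.

Lemma prep_cost (static : bool) k0 s n : na s 0%nat 0%nat = n -> (2 <= n)%nat ->
  (cost (prep_cmd static k0) s <= 200 * n ^ 2)%nat.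
Proof.
  intros Hs Hn. unfold prep_cmd. rewrite !cost_seq.
  remember (run (sizes_cmd static k0) s) as s1 eqn:Q1.
  remember (run totals_cmd s1) as s2 eqn:Q2. remember (run (rank_cmd 0 11) s2) as s3 eqn:Q3.
  remember (run (rank_cmd 1 12) s3) as s4 eqn:Q4. remember (run sort_cmd s4) as s5 eqn:Q5.
  remember (run flags_cmd s5) as s6 eqn:Q6.
  assert (V := sizes_ok static k0 s n Hs). rewrite <- Q1 in V. destruct V as (_ & _ & _ & _ & _ & V10 & _).
  assert (E1 : na s1 0%nat 0%nat = n) by (rewrite Q1, run_na; auto; destruct static; reflexivity).
  assert (E2 : na s2 0%nat 0%nat = n) by (rewrite Q2, run_na; auto).
  assert (E3 : na s3 0%nat 0%nat = n) by (rewrite Q3, run_na; auto).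
  assert (E4 : na s4 0%nat 0%nat = n) by (rewrite Q4, run_na; auto).
  assert (E5 : na s5 0%nat 0%nat = n) by (rewrite Q5, run_na; auto).
  assert (E10 : na s6 10%nat 0%nat = (n + 2)%nat).
  { rewrite Q6, run_na, Q5, run_na, Q4, run_na, Q3, run_na, Q2, run_na by reflexivity. exact V10. }
  assert (C1 : cost (sizes_cmd static k0) s = 7%nat) by reflexivity.
  assert (C2 := square_cost totals_cmd s1 n eq_refl eq_refl E1 ltac:(lia)).
  assert (C3 := square_cost (rank_cmd 0 11) s2 n eq_refl eq_refl E2 ltac:(lia)).
  assert (C4 := square_cost (rank_cmd 1 12) s3 n eq_refl eq_refl E3 ltac:(lia)).
  assert (C5 := square_cost sort_cmd s4 n eq_refl eq_refl E4 ltac:(lia)).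
  assert (C6 := square_cost flags_cmd s5 n eq_refl eq_refl E5 ltac:(lia)).
  assert (C7 := shape_cost s6 n E10 Hn).
  cbn [cost_factor totals_cmd rank_cmd sort_cmd flags_cmd] in C2, C3, C4, C5, C6. assert (4 <= n ^ 2)%nat by (cbn [Nat.pow]; nia).
  cbn [Nat.pow] in *. lia.
Qed.

Lemma agree_refl s : agree s s.
Proof. split; auto. Qed.

Definition time_factor (G k0 : nat) : nat :=
  (220 + cost_factor small_cmd * k0 + 2 * cost_factor wide_cmd * k0 ^ 2 + 5 * cost_factor (planes_cmd G) * (k0 + 3) ^ 3)%nat.

Lemma main_cost (static : bool) k0 G D s n : na s 0%nat 0%nat = n -> (2 <= n)%nat -> (1 <= k0)%nat ->
  let tn := (if static then 1 else n)%nat in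
  let N1 := Z.to_nat (up (ra s 6%nat 0%nat * INR (G * G * G) / ra s 5%nat 0%nat)) in
  exists h, (2 ^ h <= 2 * n + 5)%nat /\
  (cost (main_cmd static k0 G D) s <= time_factor G k0 *
     (N1 + (if Rltb (ra s 5%nat 0%nat * INR n) (INR D) then tn * n ^ 3 else 0) +
      (4 * N1 + 1) * (h + 1) * (tn * n ^ 2)))%nat.
Proof.
  intros Hs Hn Hk tn N1.
  assert (ST := setup_ok static k0 G s n Hs). cbv zeta in ST. fold tn N1 in ST.
  unfold main_cmd. rewrite !cost_seq.
  assert (CP := prep_cost static k0 s n Hs Hn).
  remember (run (prep_cmd static k0) s) as s1 eqn:Q1.
  remember (run (target_cmd G) s1) as s2 eqn:Q2.
  assert (CC : cost (Ceil 8 30) s2 = (1 + Z.to_nat (up (ra s2 30%nat 0%nat)))%nat) by reflexivity.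
  remember (run (Ceil 8 30) s2) as s3 eqn:Q3. remember (run slopes_cmd s3) as s0 eqn:Q0.
  destruct ST as (Prep & HR & _ & H5 & HN & HN1 & E30 & E8).
  rewrite E30 in CC. fold N1 in CC.
  assert (CT : cost (target_cmd G) s1 = 1%nat) by reflexivity.
  assert (CS : (cost slopes_cmd s3 <= cost_factor slopes_cmd * prodl (fun _ => N1 + 1)%nat (8 :: nil)%nat)%nat).
  { apply (cost_dominated slopes_cmd _ Nat.eqb); auto; [intros; lia|].
    intros w Hw. cbn in Hw. destruct Hw as [<-|[]]. lia. }
  cbn [cost_factor slopes_cmd prodl fold_right] in CS.
  exists (na s0 6%nat 0%nat).
  assert (H2h := p_NN _ _ _ _ _ _ Prep). split; [lia|].
  set (h := na s0 6%nat 0%nat) in *. set (N := na s0 7%nat 0%nat) in *.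
  assert (Ht : (1 <= tn)%nat) by (unfold tn; destruct static; lia).
  unfold search_cmd. rewrite !cost_seq.
  set (cd := CR (RMul (rvar 5) (RN vn)) (RN (NC D))).
  assert (Ec : cost (If cd small_cmd Skip) s0 =
     Datatypes.S (if evC cd s0 then cost small_cmd s0 else 0)%nat) by reflexivity.
  assert (Ecd : evC cd s0 = Rltb (ra s 5%nat 0%nat * INR n) (INR D)).
  { unfold cd. cbn [evC evR evN]. rewrite HR by lia. now rewrite (p_n _ _ _ _ _ _ Prep). }
  rewrite Ecd in Ec.
  assert (A1 : agree s0 (run (If cd small_cmd Skip) s0)) by (apply agree_run; [reflexivity|apply agree_refl]).
  assert (A2 : agree s0 (run wide_cmd (run (If cd small_cmd Skip) s0))) by (apply agree_run; auto).
  assert (B1 := small_cost s0 n tn k0 h N Prep Hn Ht Hk HN H5 s0 (agree_refl s0)).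
  assert (B2 := wide_cost s0 n tn k0 h N Prep Hn Ht Hk HN H5 _ A1).
  assert (B3 := planes_cost s0 n tn k0 h N Prep Hn Ht Hk HN H5 G _ A2).
  rewrite CC, CT, Ec. unfold time_factor. clear Q1 Q2 Q3 Q0 Ec Ecd E30 E8 HR CC CT A1 A2 Prep.
  set (X1 := cost wide_cmd _) in *. set (X2 := cost (planes_cmd G) _) in *.
  set (X3 := cost slopes_cmd s3) in *. set (X4 := cost (prep_cmd static k0) s) in *.
  set (X5 := cost small_cmd s0) in *.
  set (w1 := (cost_factor small_cmd * k0)%nat) in *. set (w2 := (2 * cost_factor wide_cmd * k0 ^ 2)%nat) in *.
  set (w3 := (5 * cost_factor (planes_cmd G) * (k0 + 3) ^ 3)%nat) in *.
  set (b := Rltb _ _). set (T3 := (tn * n ^ 3)%nat) in *. set (T2 := (tn * n ^ 2)%nat) in *.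
  assert (HT : (n ^ 2 <= T2)%nat) by (unfold T2; nia).
  assert (HT4 : (4 <= n ^ 2)%nat) by (cbn [Nat.pow]; nia).
  set (U := ((4 * N1 + 1) * (h + 1) * T2)%nat).
  assert (HU1 : (T2 <= U)%nat) by (unfold U; nia).
  assert (HU2 : (N * N * (h + 1) * T2 <= U)%nat).
  { unfold U. apply Nat.mul_le_mono_r, Nat.mul_le_mono_r. lia. }
  set (U3 := (N * N * (h + 1) * T2)%nat) in *.
  set (Y := if b then T3 else 0%nat).
  assert (HY : ((if b then X5 else 0) <= w1 * Y)%nat) by (unfold Y; destruct b; lia).
  set (Z0 := if b then X5 else 0%nat) in *.
  assert (w2 * T2 <= w2 * U)%nat by (apply Nat.mul_le_mono_l; lia).
  assert (w3 * U3 <= w3 * U)%nat by (apply Nat.mul_le_mono_l; lia).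
  clearbody X1 X2 X3 X4 X5 w1 w2 w3 U U3 Y Z0 T2 T3.
  ring_simplify in CS.
  nia.
Qed.

(** * The algorithm *)

Lemma frac_ext n w w' (I I' : nat -> Prop) : (forall i, (i < n)%nat -> w i = w' i) ->
  (forall i, (i < n)%nat -> I i <-> I' i) -> frac n w I = frac n w' I'.
Proof.
  intros Hw HI. unfold frac. f_equal; apply sumR_ext; auto.
  intros i Hi. specialize (HI i Hi). destruct (excluded_middle_informative (I i)) as [H|H],
    (excluded_middle_informative (I' i)) as [H'|H']; auto; tauto.
Qed.

Lemma input_mem_point n eps c C x y m b t i a : (i < n)%nat -> (a < 5)%nat ->
  input_mem n eps c C x y m b t (4 + 5 * i + a)%nat =
  nth a (x i :: y i :: m i :: b i :: t i :: nil) 0.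
Proof.
  intros Hi Ha. replace (4 + 5 * i + a)%nat with (S (S (S (S (5 * i + a))))) by lia.
  cbn [input_mem]. rewrite (proj2 (Nat.ltb_lt _ _)) by lia.
  rewrite <- (Nat.div_unique (5 * i + a) 5 i a), <- (Nat.mod_unique (5 * i + a) 5 i a) by lia.
  do 5 (destruct a as [|a]; [reflexivity|]). lia.
Qed.

Lemma input_mem_outside n eps c C x y m b t j : (5 * n + 4 <= j)%nat ->
  input_mem n eps c C x y m b t j = 0.
Proof.
  intros Hj. do 4 (destruct j as [|j]; [lia|]). cbn [input_mem].
  now rewrite (proj2 (Nat.ltb_ge _ _)) by lia.
Qed.

Lemma ln_ge_half n : (2 <= n)%nat -> / 2 <= ln (INR n).
Proof.
  intros Hn. apply Rle_trans with (ln 2); [left; apply ln_lt_2|].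
  assert (2 <= INR n) by (change 2 with (INR 2); now apply le_INR).
  destruct (Req_dec (INR n) 2) as [->|Hne]; [lra|]. left. apply ln_increasing; lra.
Qed.

(** For [n >= 2] one has [2 n + 5 <= n^4], hence [h ln 2 <= 4 ln n] and, as [ln 2 > 1/2],
    [h <= 8 ln n]. The summand 1 is at most [2 ln n]. *)
Lemma depth_ln h n : (2 <= n)%nat -> (2 ^ h <= 2 * n + 5)%nat -> INR (h + 1) <= 10 * ln (INR n).
Proof.
  intros Hn Hh. assert (Hl := ln_ge_half n Hn).
  assert (H2 : 2 <= INR n) by (change 2 with (INR 2); now apply le_INR).
  assert (Hp : (2 ^ h <= n ^ 4)%nat) by (eapply Nat.le_trans; [exact Hh|]; change (n ^ 4)%nat with (n * (n * (n * (n * 1))))%nat;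
    assert (2 * n <= n * n)%nat by nia; assert (4 * n <= n * (n * n))%nat by nia; nia).
  apply le_INR in Hp. rewrite !pow_INR in Hp. change (INR 2) with 2 in Hp.
  assert (INR h * ln 2 <= 4 * ln (INR n)).
  { rewrite <- ln_pow by lra. replace (4 * ln (INR n)) with (ln (INR n ^ 4)) by (rewrite ln_pow by lra; simpl INR; ring).
    assert (0 < 2 ^ h) by (apply pow_lt; lra).
    destruct Hp as [Hp| ->]; [left; apply ln_increasing; auto|lra]. }
  assert (Hln := ln_lt_2). rewrite plus_INR. simpl (INR 1).
  assert (0 <= INR h) by apply pos_INR. nra.
Qed.

Lemma up_le r : 0 <= r -> INR (Z.to_nat (up r)) <= r + 1.
Proof.
  intros Hr. destruct (archimed r) as [H1 H2].
  rewrite INR_IZR_INZ, Z2Nat.id; [lra|]. apply le_IZR. lra.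
Qed.

Lemma up_ge r : 0 <= r -> r <= INR (Z.to_nat (up r)).
Proof.
  intros Hr. destruct (archimed r) as [H1 H2].
  rewrite INR_IZR_INZ, Z2Nat.id; [lra|]. apply le_IZR. lra.
Qed.

(** The depth brings in one logarithm; [L <= 2 L^2], valid because [L >= 1/2], converts it into the
    square. In the factor [1 + / eps] the 1 covers large [eps], where at least one slope pair is
    still processed. *)
Lemma total_time (W A n tn N1 D h k S : nat) (g eps : R) :
  (2 <= n)%nat -> (1 <= tn)%nat -> 0 < eps -> 0 <= g -> (2 ^ h <= 2 * n + 5)%nat ->
  INR N1 <= g * / eps + 1 ->
  (S <= A * (N1 + (if Rltb (eps * INR n) (INR D) then tn * n ^ 3 else 0) + (4 * N1 + 1) * (h + 1) * (tn * n ^ 2)))%nat ->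
  (k <= W * (n + S + 1))%nat ->
  INR k <= INR W * (4 + INR A * (4 * (g + 1) + 4 * INR D + 20 * (4 * g + 5))) * (1 + / eps) *
    INR (tn * n ^ 2) * ln (INR n) ^ 2.
Proof.
  intros Hn Ht He Hg Hh HN HS Hk.
  assert (Hl := ln_ge_half n Hn). assert (Hd := depth_ln h n Hn Hh).
  assert (Hi : 0 < / eps) by now apply Rinv_0_lt_compat.
  assert (HT : (n + 1 <= tn * n ^ 2)%nat) by (cbn [Nat.pow]; nia).
  (* The guard [eps n < D] trades the extra factor [n] of the enumeration for [D / eps]. *)
  assert (HST : (if Rltb (eps * INR n) (INR D) then INR (tn * n ^ 3) else 0) <= INR D * / eps * INR (tn * n ^ 2)).
  { destruct (Rltb_spec (eps * INR n) (INR D)) as [Hs|Hs].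
    - replace (tn * n ^ 3)%nat with (n * (tn * n ^ 2))%nat by (cbn [Nat.pow]; ring).
      rewrite mult_INR. apply Rmult_le_compat_r; [apply pos_INR|].
      apply Rmult_le_reg_l with eps; auto. replace (eps * (INR D * / eps)) with (INR D) by (field; lra). lra.
    - apply Rmult_le_pos; [|apply pos_INR]. apply Rmult_le_pos; [apply pos_INR|lra]. }
  assert (HA := pos_INR A). assert (HW := pos_INR W). assert (HD := pos_INR D). assert (Hh0 := pos_INR (h + 1)).
  apply le_INR in HT, HS, Hk. rewrite plus_INR in HT. change (INR 1) with 1 in HT.
  assert (Hn0 := pos_INR n).
  set (T := INR (tn * n ^ 2)) in *. set (L := ln (INR n)) in *. set (E := 1 + / eps).
  set (Z0 := if Rltb _ _ then INR _ else 0) in *.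
  assert (HS' : INR S <= INR A * (INR N1 + Z0 + (4 * INR N1 + 1) * INR (h + 1) * T)).
  { eapply Rle_trans; [exact HS|]. rewrite mult_INR. apply Rmult_le_compat_l; auto.
    rewrite (plus_INR (N1 + _)), (plus_INR N1), (mult_INR ((4 * N1 + 1) * (h + 1))), (mult_INR (4 * N1 + 1)), (plus_INR (4 * N1)), (mult_INR 4).
    fold T. replace (INR 4) with 4 by (simpl; ring). change (INR 1) with 1.
    apply Req_le. unfold Z0. destruct (Rltb _ _); reflexivity. }
  clear HS. set (H := INR (h + 1)) in *. clearbody Z0.
  rewrite mult_INR, !plus_INR in Hk. change (INR 1) with 1 in *.
  assert (HE : 1 <= E) by (unfold E; lra).
  assert (HT1 : 1 <= T) by lra.
  assert (HN' : INR N1 <= (g + 1) * E) by (unfold E; nra).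
  assert (HP : 1 <= 4 * L ^ 2) by nra.
  assert (HL : L <= 2 * L ^ 2) by nra.
  assert (HET : E <= E * T) by nra. assert (HTT : T <= E * T) by nra.
  assert (Q0 : 0 <= E * T) by nra.
  assert (B1 : (4 * INR N1 + 1) * H * T <= (4 * g + 5) * (20 * (E * T * L ^ 2))).
  { apply Rle_trans with ((4 * ((g + 1) * E) + 1) * (10 * L) * T).
    - apply Rmult_le_compat_r; [lra|]. apply Rmult_le_compat; auto; [assert (X := pos_INR N1); lra|lra].
    - replace ((4 * ((g + 1) * E) + 1) * (10 * L) * T) with ((4 * ((g + 1) * E) + 1) * T * (10 * L)) by ring.
      apply Rle_trans with ((4 * g + 5) * (E * T) * (10 * L)).
      + apply Rmult_le_compat_r; [lra|]. nra.
      + replace ((4 * g + 5) * (20 * (E * T * L ^ 2))) with ((4 * g + 5) * (E * T) * (10 * (2 * L ^ 2))) by ring.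
        apply Rmult_le_compat_l; [|lra]. apply Rmult_le_pos; lra. }
  assert (B2 : INR N1 <= 4 * (g + 1) * (E * T * L ^ 2)).
  { apply Rle_trans with ((g + 1) * (E * T)); [apply Rle_trans with ((g + 1) * E); auto; apply Rmult_le_compat_l; lra|].
    replace (4 * (g + 1) * (E * T * L ^ 2)) with ((g + 1) * (E * T) * (4 * L ^ 2)) by ring.
    rewrite <- (Rmult_1_r ((g + 1) * (E * T))) at 1. apply Rmult_le_compat_l; auto. apply Rmult_le_pos; lra. }
  assert (B3 : Z0 <= 4 * INR D * (E * T * L ^ 2)).
  { apply Rle_trans with (INR D * (E * T)).
    - eapply Rle_trans; [exact HST|]. rewrite Rmult_assoc. apply Rmult_le_compat_l; auto. unfold E. nra.
    - replace (4 * INR D * (E * T * L ^ 2)) with (INR D * (E * T) * (4 * L ^ 2)) by ring.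
      rewrite <- (Rmult_1_r (INR D * (E * T))) at 1. apply Rmult_le_compat_l; auto. apply Rmult_le_pos; lra. }
  assert (B4 : T <= 4 * (E * T * L ^ 2)).
  { apply Rle_trans with (E * T * 1); [lra|].
    replace (4 * (E * T * L ^ 2)) with (E * T * (4 * L ^ 2)) by ring. apply Rmult_le_compat_l; lra. }
  set (X := E * T * L ^ 2) in *.
  replace (INR W * (4 + INR A * (4 * (g + 1) + 4 * INR D + 20 * (4 * g + 5))) * E * T * L ^ 2) with
    (INR W * (4 * X + INR A * (4 * (g + 1) * X + 4 * INR D * X + (4 * g + 5) * (20 * X)))) by (unfold X; ring).
  eapply Rle_trans; [exact Hk|]. apply Rmult_le_compat_l; auto.
  eapply Rle_trans with (T + INR S); [lra|]. apply Rplus_le_compat; [lra|].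
  eapply Rle_trans; [exact HS'|]. apply Rmult_le_compat_l; auto. lra.
Qed.

Lemma nat_above r : exists k, (1 <= k)%nat /\ r <= INR k.
Proof.
  destruct (INR_unbounded r) as [k Hk]. exists (S k). rewrite S_INR. split; [lia|lra].
Qed.

Lemma adm_prosp_nonneg n c C x y t m b Q ts : (2 <= n)%nat -> 0 < c -> 0 < C ->
  adm_prosp n C x y t m b Q ts -> 0 <= val_prosp n c x y t m b Q ts.
Proof.
  intros Hn Hc HC [H1 H2]. assert (0 < C / INR n) by (apply Rdiv_lt_0_compat; auto; apply lt_0_INR; lia).
  apply d_gamma_nonneg; auto; lra.
Qed.

Lemma prosp_ext n x y t m b x' y' t' m' b' Q ts :
  (forall i, (i < n)%nat -> x i = x' i /\ y i = y' i /\ t i = t' i /\ m i = m' i /\ b i = b' i) ->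
  frac n m (in_prosp x y t Q ts) = frac n m' (in_prosp x' y' t' Q ts) /\
  frac n b (in_prosp x y t Q ts) = frac n b' (in_prosp x' y' t' Q ts).
Proof.
  intros H. split; apply frac_ext; intros i Hi; destruct (H i Hi) as (E1 & E2 & E3 & E4 & E5); auto;
    unfold in_prosp; rewrite E1, E2, E3; tauto.
Qed.

Lemma algorithm (static : bool) c C lo hi : 0 < c -> 0 < C -> 0 < lo -> lo <= hi ->
  exists (P : program) (K : R), forall n eps x y t m b,
    (2 <= n)%nat -> 0 < eps -> valid_input n lo hi x y m b ->
    (static = true -> forall i, t i = 0) ->
    exists (k : nat) (V : R),
      exec P (init_state n eps c C x y m b t) k V /\
      INR k <= K * (1 + / eps) * INR n ^ (if static then 2 else 3) * (ln (INR n)) ^ 2 /\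
      (forall OPT, is_opt_prosp n c C x y t m b OPT -> V <= OPT <= V + eps).
Proof.
  intros Hc HC Hlo Hlh.
  (* [k0], [G] and [D] are literals of the program, so they are fixed before [n] and [eps] are
     known. *)
  destruct (nat_above (C * hi / lo)) as (k0 & Hk1 & Hk0).
  destruct (nat_above (hi * hi / (lo * lo))) as (G & _ & HG).
  destruct (nat_above (2 * c * INR G * INR k0 * hi / lo)) as (D & _ & HD).
  apply Rmult_le_compat_r with (r := lo) in Hk0; [|lra].
  apply Rmult_le_compat_r with (r := lo * lo) in HG; [|nra].
  apply Rmult_le_compat_r with (r := lo) in HD; [|lra].
  unfold Rdiv in Hk0, HG, HD.
  rewrite Rmult_assoc, Rinv_l, Rmult_1_r in Hk0, HD by lra.
  rewrite Rmult_assoc, Rinv_l, Rmult_1_r in HG by nra.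
  destruct (ram_of_cmd (main_cmd static k0 G D) 10 (main_ok static k0 G D) ltac:(unfold AW; lia))
    as (P & W & HP).
  set (g := c * INR (G * G * G)).
  assert (Hg : 0 <= g) by (apply Rmult_le_pos; [lra|apply pos_INR]).
  exists P, (INR W * (4 + INR (time_factor G k0) * (4 * (g + 1) + 4 * INR D + 20 * (4 * g + 5)))).
  intros n eps x y t m b Hn Heps [_ Hmb] Ht0.
  set (inp := input_mem n eps c C x y m b t).
  destruct (HP n inp Hn eq_refl (input_mem_outside n eps c C x y m b t)) as (k & Hex & Hk).
  remember (relocated n inp) as s eqn:Es.
  assert (R5 : ra s 5%nat 0%nat = eps) by (rewrite Es; reflexivity).
  assert (R6 : ra s 6%nat 0%nat = c) by (rewrite Es; reflexivity).
  assert (R7 : ra s 7%nat 0%nat = C) by (rewrite Es; reflexivity).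
  assert (Hns : na s 0%nat 0%nat = n) by (rewrite Es; reflexivity).
  assert (Rp : forall i a, (i < n)%nat -> (a < 5)%nat ->
    ra s a i = nth a (x i :: y i :: m i :: b i :: t i :: nil) 0).
  { intros i a Hi Ha. rewrite Es. cbn [relocated ra]. rewrite (proj2 (Nat.ltb_lt a 5) Ha).
    now apply input_mem_point. }
  clear Es.
  exists k, (ra (run (main_cmd static k0 G D) s) 10%nat 0%nat). split; [exact Hex|].
  set (tn := (if static then 1 else n)%nat).
  assert (Hg0 : 0 <= g * / eps) by (apply Rmult_le_pos; auto; left; now apply Rinv_0_lt_compat).
  split.
  - destruct (main_cost static k0 G D s n Hns Hn Hk1) as (h & Hh & Hcost). cbv zeta in Hcost.
    rewrite R5, R6 in Hcost. fold tn g in Hcost.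
    assert (Hfin := total_time W (time_factor G k0) n tn (Z.to_nat (up (g / eps))) D h k _ g eps
      Hn ltac:(unfold tn; destruct static; lia) Heps Hg Hh (up_le _ Hg0) Hcost Hk).
    eapply Rle_trans; [exact Hfin|]. apply Req_le. f_equal. f_equal. unfold tn.
    destruct static; rewrite mult_INR, pow_INR; simpl; ring.
  - unfold main_cmd. rewrite !run_seq.
    destruct (setup_ok static k0 G s n Hns) as (Prep & HR & H10 & _ & HN & HN1 & _ & _).
    rewrite R5, R6 in HN1. fold g in HN1.
    change (if static then 1 else n)%nat with tn in Prep.
    set (s0 := run slopes_cmd (run (Ceil 8 30) (run (target_cmd G) (run (prep_cmd static k0) s)))) in *.
    clearbody s0. set (N := na s0 7%nat 0%nat) in *.
    assert (E5 : ra s0 5%nat 0%nat = eps) by (rewrite HR by lia; auto).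
    assert (E6 : ra s0 6%nat 0%nat = c) by (rewrite HR by lia; auto).
    assert (E7 : ra s0 7%nat 0%nat = C) by (rewrite HR by lia; auto).
    assert (Hgrid : ra s0 6%nat 0%nat * INR G ^ 3 <= ra s0 5%nat 0%nat * INR N ^ 2).
    { rewrite E5, E6. apply Rle_trans with (eps * (g / eps)).
      - apply Req_le. unfold g. rewrite !mult_INR. field. lra.
      - apply Rmult_le_compat_l; [lra|]. eapply Rle_trans; [apply (up_ge _ Hg0)|].
        rewrite <- pow_INR. apply le_INR. cbn [Nat.pow]. rewrite Nat.mul_1_r. apply HN1. }
    assert (Hext : forall i, (i < n)%nat -> ra s0 0%nat i = x i /\ ra s0 1%nat i = y i /\
       ra s0 4%nat i = t i /\ ra s0 2%nat i = m i /\ ra s0 3%nat i = b i).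
    { intros i Hi. rewrite !HR by lia. rewrite !Rp by lia. repeat split. }
    destruct (search_ok s0 n tn k0 (na s0 6%nat 0%nat) N G D lo hi Prep Hn HN) as [[HV0 HV] HU];
      rewrite ?E5, ?E6, ?E7; auto.
    + intros i Hi. destruct (Hext i Hi) as (_ & _ & _ & -> & _). now apply Hmb.
    + intros i Hi. destruct (Hext i Hi) as (_ & _ & _ & _ & ->). now apply Hmb.
    + intros p Hp. destruct (Hext p Hp) as (_ & _ & E & _). unfold tn. destruct static.
      * exists 0%nat. split; [lia|]. destruct (Hext 0%nat ltac:(lia)) as (_ & _ & E0 & _).
        rewrite E, E0, !Ht0; auto.
      * exists p. auto.
    + rewrite <- E5, <- E6. exact Hgrid.
    + set (v := ra (run (search_cmd G D) s0) 10%nat 0%nat) in *. rewrite E5, E6, E7 in HU.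
      unfold attained in HV. rewrite E6, E7 in HV.
      unfold adm_prosp, val_prosp in HU, HV.
      assert (Hfr := fun Q ts => prosp_ext n _ _ _ _ _ x y t m b Q ts Hext).
      intros OPT [(Q & ts & HA & <-) Hopt]. split.
      (* If nothing beat the initial 0, nonnegativity of the statistic gives [V <= OPT]. *)
      * destruct HV as [->|(Q' & ts' & HA' & HV')]; [now apply (adm_prosp_nonneg n c C)|].
        destruct (Hfr Q' ts') as [F1 F2]. rewrite F1, F2 in HA', HV'.
        eapply Rle_trans; [exact HV'|]. now apply Hopt.
      * destruct (Hfr Q ts) as [F1 F2]. specialize (HU Q ts). rewrite F1, F2 in HU. now apply HU.
Qed.

(** With all timestamps 0, a threshold either admits every point or, when positive, leaves an empty
    and hence inadmissible region. *)
Lemma opt_rect_prosp n c C x y m b OPT : (2 <= n)%nat -> 0 < C ->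
  is_opt_rect n c C x y m b OPT -> is_opt_prosp n c C x y (fun _ => 0) m b OPT.
Proof.
  intros Hn HC [(Q & HA & HV) Hopt].
  assert (Hfr : forall w Q ts, ts <= 0 ->
    frac n w (in_prosp x y (fun _ => 0) Q ts) = frac n w (in_static x y Q)).
  { intros w Q' ts Hts. apply frac_ext; auto. intros i _. unfold in_prosp, in_static. tauto. }
  split.
  - exists Q, 0. unfold adm_prosp, val_prosp. rewrite !Hfr by lra. auto.
  - intros Q' ts HA'. destruct (Rle_lt_dec ts 0) as [Hts|Hts].
    + unfold adm_prosp, val_prosp in *. rewrite !Hfr in * by auto. now apply Hopt.
    + exfalso. destruct HA' as [[HA' _] _]. unfold frac in HA'.
      rewrite (sumR_0 n) in HA'.
      * assert (0 < C / INR n) by (apply Rdiv_lt_0_compat; auto; apply lt_0_INR; lia).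
        unfold Rdiv in *. lra.
      * intros i _. destruct (excluded_middle_informative _) as [[_ H]|]; [lra|reflexivity].
Qed.

Theorem theorem7p5 :
  forall (c C lo hi : R), 0 < c -> 0 < C -> 0 < lo -> lo <= hi ->
  (* static version: O((1/eps) n^2 log^2 n) *)
  (exists (P : program) (K : R),
     forall (n : nat) (eps : R) (x y m b : nat -> R),
       (2 <= n)%nat -> 0 < eps ->
       valid_input n lo hi x y m b ->
       (exists Q, adm_rect n C x y m b Q) ->
       exists (k : nat) (V : R),
         exec P (init_state n eps c C x y m b (fun _ => 0)) k V /\
         INR k <= K * (1 + / eps) * INR n ^ 2 * (ln (INR n)) ^ 2 /\
         (forall OPT, is_opt_rect n c C x y m b OPT -> V <= OPT <= V + eps)) /\
  (* prospective version: O((1/eps) n^3 log^2 n) *)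
  (exists (P : program) (K : R),
     forall (n : nat) (eps : R) (x y t m b : nat -> R),
       (2 <= n)%nat -> 0 < eps ->
       valid_input n lo hi x y m b ->
       (exists Q ts, adm_prosp n C x y t m b Q ts) ->
       exists (k : nat) (V : R),
         exec P (init_state n eps c C x y m b t) k V /\
         INR k <= K * (1 + / eps) * INR n ^ 3 * (ln (INR n)) ^ 2 /\
         (forall OPT, is_opt_prosp n c C x y t m b OPT -> V <= OPT <= V + eps)).
Proof.
  intros c C lo hi Hc HC Hlo Hlh. split.
  - destruct (algorithm true c C lo hi Hc HC Hlo Hlh) as (P & K & HP). exists P, K.
    intros n eps x y m b Hn He Hv _.
    destruct (HP n eps x y (fun _ => 0) m b Hn He Hv (fun _ _ => eq_refl)) as (k & V & H1 & H2 & H3).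
    exists k, V. split; [exact H1|]. split; [exact H2|].
    intros OPT HO. apply H3. now apply opt_rect_prosp.
  - destruct (algorithm false c C lo hi Hc HC Hlo Hlh) as (P & K & HP). exists P, K.
    intros n eps x y t m b Hn He Hv _. now apply (HP n eps x y t m b Hn He Hv).
Qed.
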